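(* Let $(F,f)\colon(L'\rightrightarrows L'_N;H\rightrightarrows N)\to(L\rightrightarrows L_M;G\rightrightarrows M)$ be a VB Morita map between line bundle groupoids, let $\theta\in\Omega^1(G,L)$ be a multiplicative $L$-valued $1$-form and let $\kappa\in\Omega^2(M,L_M)$. Then the pair $(F^*\theta,F^*\kappa)$ is a $+1$-shifted contact structure on $L'$ if and only if $(\theta,\kappa)$ is a $+1$-shifted contact structure on $L$.
   Context: A VB groupoid (VBG) $(V\rightrightarrows V_M;G\rightrightarrows M)$ consists of Lie groupoids $V\rightrightarrows V_M$, $G\rightrightarrows M$ (Hausdorff) and vector bundles $V\to G$, $V_M\to M$ such that all structure maps $s,t,m,i,u$ of $V$ are vector bundle (VB) morphisms covering those of $G$. Products $gg'$ are defined when $s(g)=t(g')$; units are regarded as submanifolds. The core is $C=\ker(s\colon V\to V_M)|_M$. A VBG morphism $(F,f)$ is a VB morphism $F$ covering $f$ with $F,f$ Lie groupoid morphisms; it is a VB Morita map if $F$ is a Morita map of Lie groupoids. A line bundle groupoid is a VBG $(L\rightrightarrows L_M;G\rightrightarrows M)$ with $L\to G$, $L_M\to M$ line bundles; its structure maps, and VB Morita maps between line bundle groupoids, are isomorphisms on fibers, so line bundle valued forms and connections can be pulled back along them ($F^*\theta=F^{-1}\circ\theta\circ df$). $s_g:=s|_{L_g}$; $G$ acts on $L_M$ by $g.v=t(s_g^{-1}(v))$. $\partial=s^*-t^*$ on $\Omega^\bullet(M,L_M)$, $\partial=\mathrm{pr}_2^*-m^*+\mathrm{pr}_1^*$ on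 $\Omega^\bullet(G,L)$; $\theta\in\Omega^1(G,L)$ is multiplicative if $\partial\theta=0$. $A=\ker(ds)|_M$ is the Lie algebroid of $G$. Morita kernel: for $\theta\in\Omega^1(G,L)$ multiplicative, $\mathsf MK_\theta$ is the VBG $TG\oplus L\rightrightarrows TM\oplus L_M$ over $G$ with $s(v,\lambda)=(ds(v),s(\lambda))$, $t(v,\lambda)=(dt(v),t(\lambda+\theta(v)))$, $u(v,\lambda)=(du(v),u(\lambda))$, $(v,\lambda)(v',\lambda')=(vv',s_{gg'}^{-1}(s(\lambda')))$ for composable elements over $g,g'$; its core is $A$. Twisted dual: for a VBG $V$ over $G$ with core $C$, $V^\dagger=\operatorname{Hom}(V,L)\rightrightarrows C^\dagger=\operatorname{Hom}(C,L_M)$ is the VBG over $G$ with, for $\psi\in V^\dagger_g$, $\langle s(\psi),c\rangle=-s\langle\psi,0_g\cdot c^{-1}\rangle$, $\langle t(\psi),c'\rangle=t\langle\psi,c'\cdot0_g\rangle$, $\langle\psi\psi',vv'\rangle=s_{gg'}^{-1}(g'^{-1}.s\langle\psi,v\rangle+s\langle\psi',v'\rangle)$, unit $\psi\mapsto\psi\circ\mathrm{pr}_C$ ($\mathrm{pr}_C\colon V|_M\to C$ with kernel $V_M$). So $\mathsf MK_\theta^\dagger=T^\dagger G\oplus\mathbb R_G\rightrightarrows A^\dagger$, $T^\dagger G=\operatorname{Hom}(TG,L)$, $\mathbb R_G=G\times\mathbb R$. Morita curvature: for a connection $\nabla$ on $L_M$ let $\eta_\nabla=s^*\nabla-t^*\nabla\in\Omega^1(G)$.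 For $\kappa\in\Omega^2(M,L_M)$ the Morita curvature of $(\theta,\kappa)$ is the VBG morphism $\mathsf MR_{(\theta,\kappa)}\colon\mathsf MK_\theta\to\mathsf MK_\theta^\dagger$, $(v,\lambda)\mapsto(\iota_v(d^{t^*\nabla}\theta+\partial\kappa)+\lambda\otimes\eta_\nabla,-\eta_\nabla(v))$. A $+1$-shifted contact structure on $L$ is a pair $(\theta,\kappa)$, $\theta\in\Omega^1(G,L)$ multiplicative, $\kappa\in\Omega^2(M,L_M)$, such that $\mathsf MR_{(\theta,\kappa)}$ is a VB Morita map (this does not depend on the choice of $\nabla$). *)

(* Defs.v *)
From HB Require Import structures.
From mathcomp Require Import all_boot all_order all_algebra.
From mathcomp Require Import all_classical all_reals all_analysis.

Set Implicit Arguments.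
Unset Strict Implicit.
Unset Printing Implicit Defensive.

Import Order.TTheory GRing.Theory Num.Theory.
Import numFieldNormedType.Exports.
Local Open Scope classical_set_scope.
Local Open Scope ring_scope.

(* Smooth manifolds are presented through their algebra of smooth real-valued
   functions (differential spaces in the sense of Sikorski): a space is a type
   with a family of real functions generating the smooth structure, and a
   manifold is a Hausdorff second countable space locally diffeomorphic to open
   subsets of R^n.  Fibre products, tangent bundles and Hom bundles then have
   total spaces given directly by generators, the generators being local
   coordinates of the usual manifold structure whenever the latter exists. *)

Record subl (K : pzRingType) (W : lmodType K) (S : submodClosed W) :=
  Subl { sublv : W; _ : sublv \in S }.

HB.instance Definition _ (K : pzRingType) (W : lmodType K) (S : submodClosed W)
  := [isSub for @sublv K W S].
HB.instance Definition _ (K : pzRingType) (W : lmodType K) (S : submodClosed W)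
  := [Choice of subl S by <:].
HB.instance Definition _ (K : pzRingType) (W : lmodType K) (S : submodClosed W)
  := [SubChoice_isSubLmodule of subl S by <:].

Section Span.
Context (K : pzRingType) (W : lmodType K) (P : set W).

Definition lin_closed (S : set W) : Prop :=
  S 0 /\ forall (a : K) (x y : W), S x -> S y -> S (a *: x + y).

(* Used below for sets [P] that are subspaces as soon as the structure maps
   involved are linear, in which case the span is [P] itself. *)
Definition span_pred : {pred W} :=
  fun w => `[< forall S : set W, lin_closed S -> P `<=` S -> S w >].

Fact span_closed : submod_closed span_pred.
Proof.
split=> [|a x y /asboolP Hx /asboolP Hy]; apply/asboolP => S SL PS.
  by case: SL.
by have [_] := SL; apply; [apply: Hx | apply: Hy].
Qed.

HB.instance Definition _ := GRing.isSubmodClosed.Build K W span_pred span_closed.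

Definition span_of : lmodType K := subl span_pred.
End Span.

Section LinearMaps.
Context (K : comPzRingType) (U W : lmodType K).

Definition lin_pred : {pred (U -> W)} := fun f => `[< linear f >].

Fact lin_pred_closed : submod_closed lin_pred.
Proof.
split=> [|a f g /asboolP Hf /asboolP Hg]; apply/asboolP => b x y.
  by rewrite /= scaler0 addr0.
change (a *: f (b *: x + y) + g (b *: x + y)
  = b *: (a *: f x + g x) + (a *: f y + g y)).
by rewrite Hf Hg !scalerDr !scalerA (mulrC a b) -!addrA; congr (_ + _);
   rewrite addrCA.
Qed.

HB.instance Definition _ :=
  GRing.isSubmodClosed.Build K (U -> W) lin_pred lin_pred_closed.

Definition hom : lmodType K := subl lin_pred.

(* The junk value 0 is taken when [f] is not linear. *)
Definition mkhom (f : U -> W) : hom := insubd 0 f.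
End LinearMaps.

(* Meant for bijective [f]. *)
Definition finv (K : pzRingType) (U W : lmodType K) (f : U -> W) (y : W) : U :=
  xget 0 [set x | f x = y].

Section Spaces.
Context (R : realType).

Fixpoint Ck (k n : nat) (f : 'rV[R]_n -> R^o) : Prop :=
  if k is k'.+1 then
    (forall x, differentiable f x) /\
    (forall i : 'I_n, Ck k' (fun x => 'D_(delta_mx 0 i) f x))
  else continuous f.

Definition Cinf (n : nat) (f : 'rV[R]_n -> R) : Prop := forall k, Ck k f.

Record space := Space { pt :> Type; gen : set (pt -> R) }.

HB.instance Definition _ (X : space) := gen_eqMixin (pt X).
HB.instance Definition _ (X : space) := gen_choiceMixin (pt X).
HB.instance Definition _ (X : space) :=
  @isSubBaseTopological.Build (pt X) (set (pt X))
    [set U | exists2 f : X -> R, gen f & exists2 A : set R, open A & U = f @^-1` A]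
    id.

(* A smooth function is locally a smooth function of finitely many generators. *)
Definition smoothf (X : space) (f : X -> R) : Prop :=
  forall p : X, exists (n : nat) (s : 'I_n -> X -> R) (w : 'rV[R]_n -> R),
    [/\ forall i, gen (s i), Cinf w
      & \forall q \near nbhs p, f q = w (\row_i s i q)].

Definition smooth (X Y : space) (phi : X -> Y) : Prop :=
  forall f : Y -> R, smoothf f -> smoothf (f \o phi).

Definition initial_space (T : Type) (Y : space) (phi : T -> Y) : space :=
  Space [set h \o phi | h in @gen Y].

Definition sub (X : space) (P : set X) : space :=
  initial_space (fun q : {x : X | P x} => sval q).

Definition prod_space (X Y : space) : space :=
  @Space (X * Y) ([set h \o fst | h in @gen X] `|` [set h \o snd | h in @gen Y]).

Definition euclid (n : nat) : space :=
  @Space 'rV[R]_n [set h | exists i : 'I_n, h = fun x : 'rV[R]_n => x 0 i].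

Definition diffeo_onto (X Y : space) (phi : X -> Y) (P : set Y) : Prop :=
  smooth phi /\ (forall x, P (phi x)) /\
  exists psi : sub P -> X, smooth psi /\
    (forall y, phi (psi y) = sval y) /\
    (forall (x : X) (y : sub P), sval y = phi x -> psi y = x).

Definition is_manifold (X : space) : Prop :=
  hausdorff_space X /\ @second_countable (pt X) /\
  exists n : nat, forall p : X,
    exists (U : set X) (V : set (euclid n)) (phi : sub U -> euclid n),
      [/\ open U, U p, open V & diffeo_onto phi V].

(* Tangent vectors at [p] are the derivations at [p] of the algebra of smooth
   functions, extended by 0 to non-smooth functions so that equality of tangent
   vectors is equality of derivations. *)
Definition der_pred (X : space) (p : X) : {pred ((X -> R) -> R^o)} :=
  fun v => `[< (forall f, ~ smoothf f -> v f = 0) /\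
    (forall (a : R) (f g : X -> R), smoothf f -> smoothf g ->
       v (fun x => a * f x + g x) = a * v f + v g) /\
    (forall f g : X -> R, smoothf f -> smoothf g ->
       v (fun x => f x * g x) = f p * v g + g p * v f) >].

Fact der_closed (X : space) (p : X) : submod_closed (der_pred p).
Proof.
split=> [|c u v /asboolP [u0 [uD uM]] /asboolP [v0 [vD vM]]]; apply/asboolP.
  by split=> //; split=> *; rewrite /= !(mulr0, addr0).
split=> [f nf|].
  change (c * u f + v f = 0 :> R).
  by rewrite u0 // v0 // mulr0 addr0.
split=> [a f g sf sg|f g sf sg].
  change (c * u (fun x => a * f x + g x) + v (fun x => a * f x + g x)
    = a * (c * u f + v f) + (c * u g + v g) :> R).
  by rewrite uD // vD // !mulrDr !mulrA (mulrC c a) -!addrA; congr (_ + _);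
     rewrite addrCA.
change (c * u (fun x => f x * g x) + v (fun x => f x * g x)
  = f p * (c * u g + v g) + g p * (c * u f + v f) :> R).
rewrite uM // vM // !mulrDr !mulrA (mulrC c (f p)) (mulrC c (g p)) -!addrA.
by congr (_ + _); rewrite addrCA.
Qed.

HB.instance Definition _ (X : space) (p : X) :=
  GRing.isSubmodClosed.Build R ((X -> R) -> R^o) (der_pred p) (der_closed p).

Definition tangent (X : space) (p : X) : lmodType R := subl (der_pred p).

Definition dmap (X Y : space) (phi : X -> Y) (p : X) (v : tangent p) :
    tangent (phi p) :=
  insubd 0 (fun h : Y -> R => if `[< smoothf h >] then sublv v (h \o phi) else 0).

Definition submersion (X Y : space) (phi : X -> Y) : Prop :=
  smooth phi /\
  forall (p : X) (w : tangent (phi p)), exists v : tangent p, dmap phi v = w.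

Record bundle (B : space) :=
  Bundle { fib :> B -> lmodType R; tgen : set ({x : B & fib x} -> R) }.

Definition tot (B : space) (E : bundle B) : space :=
  @Space {x : B & E x} (@tgen B E).

Definition Tot (B : space) (E : bundle B) (x : B) (e : E x) : tot E :=
  existT (fun x => E x : Type) x e.

(* [fibat x q] is the point [q] of the total space seen as an element of the
   fibre over [x]; it is meant for [q] over a point propositionally equal
   to [x]. *)
Definition fibat (B : space) (E : bundle B) (x : B) (q : tot E) : E x :=
  xget 0 [set e | Tot e = q].

Definition is_vector_bundle (k : nat) (B : space) (E : bundle B) : Prop :=
  smooth (fun q : tot E => tag q : B) /\
  forall x0 : B, exists (U : set B) (phi : forall x, E x -> 'rV[R]_k),
    [/\ open U, U x0, forall x, U x -> linear (phi x)
      & diffeo_onto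
          (fun q : sub [set q : tot E | U (tag q)] =>
             (tag (sval q), phi _ (tagged (sval q))) : prod_space B (euclid k))
          [set y | U y.1]].

Definition section (B : space) (E : bundle B) := forall x : B, E x.

Definition smooth_section (B : space) (E : bundle B) (e : section E) : Prop :=
  smooth (fun x => Tot (e x)).

Definition TB (X : space) : bundle X :=
  @Bundle X (@tangent X)
    ([set h | exists2 f : X -> R, smoothf f &
        h = fun q : {x : X & tangent x} => f (tag q)] `|`
     [set h | exists2 f : X -> R, smoothf f &
        h = fun q : {x : X & tangent x} => sublv (tagged q) f]).

Definition sum_bundle (B : space) (E E' : bundle B) : bundle B :=
  @Bundle B (fun x => (E x * E' x)%type : lmodType R)
    ([set h | exists2 f : tot E -> R, tgen f &
        h = fun q : {x : B & (E x * E' x)%type} => f (Tot (tagged q).1)] `|`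
     [set h | exists2 f : tot E' -> R, tgen f &
        h = fun q : {x : B & (E x * E' x)%type} => f (Tot (tagged q).2)]).

(* A smooth frame of [E] and a smooth coframe of [E'], cut off by bump
   functions, give local coordinates of the second kind of generators. *)
Definition hom_bundle (B : space) (E E' : bundle B) : bundle B :=
  @Bundle B (fun x => hom (E x) (E' x))
    ([set h | exists2 f : B -> R, smoothf f &
        h = fun q : {x : B & hom (E x) (E' x)} => f (tag q)] `|`
     [set h | exists (X : section E) (l : tot E' -> R),
        [/\ smooth_section X, smoothf l
          & h = fun q : {x : B & hom (E x) (E' x)} =>
                  l (Tot (sublv (tagged q) (X (tag q))))]]).

Definition form1 (B : space) (E : bundle B) := forall x : B, tangent x -> E x.

Definition form2 (B : space) (E : bundle B) :=
  forall x : B, tangent x -> tangent x -> E x.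

Definition is_form1 (B : space) (E : bundle B) (th : form1 E) : Prop :=
  (forall x, linear (th x)) /\
  smooth (fun q : tot (TB B) => Tot (th _ (tagged q))).

Definition is_form2 (B : space) (E : bundle B) (ka : form2 E) : Prop :=
  [/\ forall x v, linear (ka x v), forall x v, ka x v v = 0,
      forall x v w, ka x v w = - ka x w v
    & smooth (fun q : tot (sum_bundle (TB B) (TB B)) =>
                Tot (ka _ (tagged q).1 (tagged q).2))].

Section Pullback.
Context (B B' : space) (E : bundle B) (E' : bundle B') (f : B -> B').
(* [F] is meant to be an isomorphism on each fibre. *)
Context (F : forall x, E x -> E' (f x)).

Definition pull1 (th : form1 E') : form1 E :=
  fun x v => finv (@F x) (th (f x) (dmap f v)).

Definition pull2 (ka : form2 E') : form2 E :=
  fun x v w => finv (@F x) (ka (f x) (dmap f v) (dmap f w)).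

Definition pull_section (e : section E') : section E :=
  fun x => finv (@F x) (e (f x)).
End Pullback.

Definition conn (B : space) (E : bundle B) :=
  forall x : B, tangent x -> section E -> E x.

Definition is_connection (B : space) (E : bundle B) (D : conn E) : Prop :=
  [/\ forall x e, smooth_section e -> linear (fun v => D x v e),
      forall x v (e e' : section E), smooth_section e -> smooth_section e' ->
        D x v (fun y => e y + e' y) = D x v e + D x v e',
      forall x v (f : B -> R) (e : section E), smoothf f -> smooth_section e ->
        D x v (fun y => f y *: e y) = f x *: D x v e + sublv v f *: e x
    & forall (X : section (TB B)) (e : section E),
        smooth_section X -> smooth_section e ->
        smooth_section (fun x => D x (X x) e)].

(* The unique connection for which [F^* e] has derivative
   [F^-1 (nabla_(df v) e)] along [v]. *)
Definition pull_conn (B B' : space) (E : bundle B) (E' : bundle B')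
    (f : B -> B') (F : forall x, E x -> E' (f x)) (nabla : conn E') : conn E :=
  fun x v e => xget 0 [set l | exists D : conn E,
    [/\ is_connection D,
        forall (e' : section E') y (w : tangent y), smooth_section e' ->
          D y w (pull_section F e') = finv (@F y) (nabla (f y) (dmap f w) e')
      & l = D x v e]].

Definition bracket (X : space) (V W : section (TB X)) : section (TB X) :=
  fun p => insubd 0 (fun h : X -> R =>
    sublv (V p) (fun q => sublv (W q) h) - sublv (W p) (fun q => sublv (V q) h)).

(* [d^nabla theta (V, W)
     = nabla_V (theta W) - nabla_W (theta V) - theta [V, W]],
   for any vector fields [V], [W] extending the given vectors. *)
Definition dconn (B : space) (E : bundle B) (nabla : conn E) (th : form1 E) :
    form2 E :=
  fun x v w => xget 0 [set l | exists V W : section (TB B),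
    [/\ smooth_section V, smooth_section W, V x = v, W x = w
      & l = nabla x v (fun y => th y (W y)) - nabla x w (fun y => th y (V y))
            - th x (bracket V W x)]].

(* [mul g h] is only meaningful when [src g = tgt h]. *)
Record groupoid := Groupoid {
  ob : space; ar : space;
  src : ar -> ob; tgt : ar -> ob; unt : ob -> ar; inv : ar -> ar;
  mul : ar -> ar -> ar }.

Definition comp (G : groupoid) : space :=
  sub [set p : prod_space (ar G) (ar G) | src p.1 = tgt p.2].

Definition comp1 (G : groupoid) (p : comp G) : ar G := (sval p).1.
Definition comp2 (G : groupoid) (p : comp G) : ar G := (sval p).2.
Definition compm (G : groupoid) (p : comp G) : ar G :=
  mul (sval p).1 (sval p).2.

Definition is_groupoid (G : groupoid) : Prop :=
  (forall x : ob G, src (unt x) = x /\ tgt (unt x) = x) /\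
  (forall g h : ar G, src g = tgt h ->
     src (mul g h) = src h /\ tgt (mul g h) = tgt g) /\
  (forall g h k : ar G, src g = tgt h -> src h = tgt k ->
     mul (mul g h) k = mul g (mul h k)) /\
  (forall g : ar G, mul g (unt (src g)) = g /\ mul (unt (tgt g)) g = g) /\
  (forall g : ar G, src (inv g) = tgt g /\ tgt (inv g) = src g) /\
  (forall g : ar G, mul g (inv g) = unt (tgt g) /\ mul (inv g) g = unt (src g)).

Definition is_lie_groupoid (G : groupoid) : Prop :=
  [/\ is_groupoid G, is_manifold (ob G) /\ is_manifold (ar G),
      submersion (@src G) /\ submersion (@tgt G),
      smooth (@unt G) /\ smooth (@inv G)
    & smooth (@compm G)].

Record gmap (H G : groupoid) :=
  GMap { ar_map : ar H -> ar G; ob_map : ob H -> ob G }.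

Definition is_lie_morphism (H G : groupoid) (phi : gmap H G) : Prop :=
  [/\ smooth (ar_map phi) /\ smooth (ob_map phi),
      forall h, src (ar_map phi h) = ob_map phi (src h) /\
                tgt (ar_map phi h) = ob_map phi (tgt h),
      forall x, ar_map phi (unt x) = unt (ob_map phi x)
    & forall h k, src h = tgt k ->
        ar_map phi (mul h k) = mul (ar_map phi h) (ar_map phi k)].

Definition fully_faithful (H G : groupoid) (phi : gmap H G) : Prop :=
  diffeo_onto
    (fun h : ar H => (ar_map phi h, (src h, tgt h))
       : prod_space (ar G) (prod_space (ob H) (ob H)))
    [set q | src q.1 = ob_map phi q.2.1 /\ tgt q.1 = ob_map phi q.2.2].

Definition essentially_surjective (H G : groupoid) (phi : gmap H G) : Prop :=
  let T := fun q : sub [set q : prod_space (ar G) (ob H) |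
                          src q.1 = ob_map phi q.2] => tgt (sval q).1 in
  (forall x, exists q, T q = x) /\ submersion T.

Definition is_morita (H G : groupoid) (phi : gmap H G) : Prop :=
  [/\ is_lie_morphism phi, fully_faithful phi & essentially_surjective phi].

Record vbg (G : groupoid) := VBG {
  vb :> bundle (ar G); vb0 : bundle (ob G);
  vsrc : forall g, vb g -> vb0 (src g);
  vtgt : forall g, vb g -> vb0 (tgt g);
  vunt : forall x, vb0 x -> vb (unt x);
  vinv : forall g, vb g -> vb (inv g);
  vmul : forall g h, vb g -> vb h -> vb (mul g h) }.

Arguments vsrc {G} _ {g} _.
Arguments vtgt {G} _ {g} _.
Arguments vunt {G} _ {x} _.
Arguments vinv {G} _ {g} _.
Arguments vmul {G} _ {g h} _ _.

Definition vcomposable (G : groupoid) (V : vbg G) (g h : ar G)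
    (v : V g) (w : V h) : Prop :=
  Tot (vsrc V v) = Tot (vtgt V w).

Definition tot_groupoid (G : groupoid) (V : vbg G) : groupoid :=
  @Groupoid (tot (vb0 V)) (tot V)
    (fun q => Tot (vsrc V (tagged q))) (fun q => Tot (vtgt V (tagged q)))
    (fun q => Tot (vunt V (tagged q))) (fun q => Tot (vinv V (tagged q)))
    (fun q r => Tot (vmul V (tagged q) (tagged r))).

Definition is_vbg_rank (k k0 : nat) (G : groupoid) (V : vbg G) : Prop :=
  [/\ is_lie_groupoid G, is_lie_groupoid (tot_groupoid V),
      is_vector_bundle k V /\ is_vector_bundle k0 (vb0 V),
      [/\ forall g, linear (@vsrc G V g), forall g, linear (@vtgt G V g),
          forall x, linear (@vunt G V x) & forall g, linear (@vinv G V g)]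
    & forall (g h : ar G) (a : R) (v v' : V g) (w w' : V h),
        src g = tgt h -> vcomposable v w -> vcomposable v' w' ->
        vmul V (a *: v + v') (a *: w + w') = a *: vmul V v w + vmul V v' w'].

Definition is_line_groupoid (G : groupoid) (L : vbg G) : Prop :=
  is_vbg_rank 1 1 L.

Record vbmap (H G : groupoid) (W : vbg H) (V : vbg G) := VBMap {
  base : gmap H G;
  vmap : forall h, W h -> V (ar_map base h);
  vmap0 : forall x, vb0 W x -> vb0 V (ob_map base x) }.

Definition tot_gmap (H G : groupoid) (W : vbg H) (V : vbg G)
    (F : vbmap W V) : gmap (tot_groupoid W) (tot_groupoid V) :=
  @GMap (tot_groupoid W) (tot_groupoid V)
    (fun q => Tot (vmap F (tagged q))) (fun q => Tot (vmap0 F (tagged q))).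

Definition is_vbg_morphism (H G : groupoid) (W : vbg H) (V : vbg G)
    (F : vbmap W V) : Prop :=
  [/\ is_lie_morphism (base F), is_lie_morphism (tot_gmap F),
      forall h, linear (@vmap _ _ _ _ F h)
    & forall x, linear (@vmap0 _ _ _ _ F x)].

Definition is_vb_morita (H G : groupoid) (W : vbg H) (V : vbg G)
    (F : vbmap W V) : Prop :=
  is_vbg_morphism F /\ is_morita (tot_gmap F).

Definition core (G : groupoid) (V : vbg G) : bundle (ob G) :=
  @Bundle (ob G) (fun x => span_of [set v : V (unt x) | vsrc V v = 0])
    [set h | exists2 f, tgen f & h = fun q => f (Tot (sublv (tagged q)))].

Section LineGroupoid.
Context (G : groupoid) (L : vbg G).

(* [s_g^-1], for a point of [L_M] over [src g] *)
Definition sinv (g : ar G) (l : tot (vb0 L)) : L g :=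
  xget 0 [set x : L g | Tot (vsrc L x) = l].

(* [g.l], for a point [l] of [L_M] over [src g] *)
Definition act (g : ar G) (l : tot (vb0 L)) : vb0 L (tgt g) :=
  vtgt L (sinv g l).

Definition comp_bundle : bundle (comp G) :=
  @Bundle (comp G)
    (fun p => span_of [set l : (L (comp1 p) * L (comp2 p))%type |
                         vcomposable l.1 l.2])
    ([set h | exists2 f, tgen f & h = fun q => f (Tot (sublv (tagged q)).1)] `|`
     [set h | exists2 f, tgen f & h = fun q => f (Tot (sublv (tagged q)).2)]).

Definition lpr1 (p : comp G) (l : comp_bundle p) : L (comp1 p) := (sublv l).1.
Definition lpr2 (p : comp G) (l : comp_bundle p) : L (comp2 p) := (sublv l).2.
Definition lmul (p : comp G) (l : comp_bundle p) : L (compm p) :=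
  vmul L (sublv l).1 (sublv l).2.

Definition multiplicative (th : form1 L) : Prop :=
  forall (p : comp G) (z : tangent p),
    pull1 lpr2 th z - pull1 lmul th z + pull1 lpr1 th z = 0.

Definition partial2 (ka : form2 (vb0 L)) : form2 L :=
  fun g v w => pull2 (@vsrc G L) ka v w - pull2 (@vtgt G L) ka v w.

(* The difference of the two connections [s^* nabla] and [t^* nabla] on the line
   bundle [L] is a scalar valued 1-form. *)
Definition eta (nabla : conn (vb0 L)) (g : ar G) (v : tangent g) : R :=
  xget 0 [set r | forall e : section L, smooth_section e ->
    pull_conn (@vsrc G L) nabla v e - pull_conn (@vtgt G L) nabla v e
    = r *: e g].

(* The multiplication of the tangent groupoid: [dm] on T(G x_M G), whose
   elements are identified with pairs of composable tangent vectors. *)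
Definition tmul (g h : ar G) (v : tangent g) (w : tangent h) :
    tangent (mul g h) :=
  xget 0 [set u : tangent (mul g h) | exists (e : src g = tgt h),
    let p : comp G := exist _ (g, h) e in
    exists z : tangent p,
      [/\ dmap (@comp1 G) z = v, dmap (@comp2 G) z = w
        & dmap (@compm G) z = u]].

(* The inverse is forced by the remaining structure maps. *)
Definition MK (th : form1 L) : vbg G :=
  @VBG G (sum_bundle (TB (ar G)) L) (sum_bundle (TB (ob G)) (vb0 L))
    (fun g a => (dmap (@src G) a.1, vsrc L a.2))
    (fun g a => (dmap (@tgt G) a.1, vtgt L (a.2 + th g a.1)))
    (fun x a => (dmap (@unt G) a.1, vunt L a.2))
    (fun g a => (dmap (@inv G) a.1,
                 sinv (inv g) (Tot (vtgt L (a.2 + th g a.1)))))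
    (fun g h a b => (tmul a.1 b.1, sinv (mul g h) (Tot (vsrc L b.2)))).

Section Dual.
Context (V : vbg G).

Definition dual_bundle : bundle (ar G) := hom_bundle V L.
Definition dual_bundle0 : bundle (ob G) := hom_bundle (core V) (vb0 L).

Definition dual_src (g : ar G) (psi : dual_bundle g) : dual_bundle0 (src g) :=
  mkhom (fun c : core V (src g) =>
    - vsrc L (sublv psi
        (fibat g (Tot (vmul V (0 : V g) (vinv V (sublv c))))))).

Definition dual_tgt (g : ar G) (psi : dual_bundle g) : dual_bundle0 (tgt g) :=
  mkhom (fun c : core V (tgt g) =>
    vtgt L (sublv psi (fibat g (Tot (vmul V (sublv c) (0 : V g)))))).

(* The projection V|_M -> C with kernel V_M *)
Definition pr_core (x : ob G) (v : V (unt x)) : core V x :=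
  insubd 0 (v - fibat (unt x) (Tot (vunt V (vsrc V v)))).

Definition dual_unt (x : ob G) (psi : dual_bundle0 x) : dual_bundle (unt x) :=
  mkhom (fun v : V (unt x) => vunt L (sublv psi (pr_core v))).

(* The inverse is forced by the remaining structure maps. *)
Definition dual_inv (g : ar G) (psi : dual_bundle g) : dual_bundle (inv g) :=
  mkhom (fun v : V (inv g) =>
    - vinv L (sublv psi (fibat g (Tot (vinv V v))))).

Definition dual_mul (g h : ar G) (psi : dual_bundle g) (psi' : dual_bundle h) :
    dual_bundle (mul g h) :=
  mkhom (fun u : V (mul g h) => xget 0 [set l : L (mul g h) |
    exists (v : V g) (w : V h), [/\ vcomposable v w, vmul V v w = u
      & l = sinv (mul g h)
              (Tot (fibat (src h) (Tot (act (inv h) (Tot (vsrc L (sublv psi v)))))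
                    + vsrc L (sublv psi' w)))]]).

Definition dual : vbg G :=
  @VBG G dual_bundle dual_bundle0 dual_src dual_tgt dual_unt dual_inv dual_mul.
End Dual.

Section Curvature.
Context (nabla : conn (vb0 L)) (th : form1 L) (ka : form2 (vb0 L)).

(* [(psi, r)] in [T^dagger G + R_G] is the element
   [(w, m) |-> psi w + r m] of [Hom (TG + L, L)]. *)
Definition MR_ar (g : ar G) (a : MK th g) : dual (MK th) g :=
  mkhom (fun b : MK th g =>
    dconn (pull_conn (@vtgt G L) nabla) th a.1 b.1 + partial2 ka a.1 b.1
    + eta nabla b.1 *: a.2 - eta nabla a.1 *: b.2).

(* The map on units is determined as [s \o MR \o u]. *)
Definition MR_ob (x : ob G) (a : vb0 (MK th) x) : vb0 (dual (MK th)) x :=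
  fibat x (Tot (vsrc (dual (MK th)) (MR_ar (vunt (MK th) a)))).

Definition MR : vbmap (MK th) (dual (MK th)) :=
  @VBMap G G (MK th) (dual (MK th)) (@GMap G G id id) MR_ar MR_ob.
End Curvature.

(* Connections on [L_M] exist, and the Morita condition on [MR] does not depend
   on the one chosen. *)
Definition is_shifted_contact (th : form1 L) (ka : form2 (vb0 L)) : Prop :=
  [/\ is_form1 th, multiplicative th, is_form2 ka
    & exists nabla : conn (vb0 L),
        is_connection nabla /\ is_vb_morita (MR nabla th ka)].

End LineGroupoid.
End Spaces.

(* Main.v *)
(* Let K_s and K_t be the kernels of source and target on the fibre of the Morita kernel
   over an arrow g, I their intersection, and Omega_g the bilinear form defining the Morita
   curvature.  Since Omega_g pairs K_s trivially with K_t, it induces a pairing between I and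
   the quotient by K_s + K_t, and Omega is multiplicative in g.  The curvature is always a
   VBG morphism, and it is a VB Morita map if and only if for every g the induced pairing is
   nondegenerate on both sides: full faithfulness at g is this condition read as linear
   algebra, and it also gives the solvability behind essential surjectivity.

   An element of I is a tangent vector killed by ds, dt and theta, and pairing it with
   anything involves only the differential of theta and the logarithmic derivative of the
   ratio of two frames, hence neither the connection nor kappa.  A Morita map (F, f) induces
   isomorphisms on I and on the quotients, compatible with these pairings, so the condition
   at h for the pulled back data is the condition at f h.  It is moreover invariant under
   left and right translations, and every arrow of G is of the form
   k_1 (f h) k_0^-1. *)
From HB Require Import structures.
Require Import Defs.
From mathcomp Require Import all_boot all_order all_algebra.
From mathcomp Require Import all_classical all_reals all_analysis.
From mathcomp Require Import ring lra.
Set Implicit Arguments.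
Unset Strict Implicit.
Unset Printing Implicit Defensive.
Import Order.TTheory GRing.Theory Num.Theory.
Import numFieldNormedType.Exports.
Import Defs.
Local Open Scope classical_set_scope.
Local Open Scope ring_scope.

(** * Smooth functions on R^n *)

(** Tangent vectors are derivations, and the spaces of composable pairs or of graphs of a Morita map
    are mere equalizers inside products, not given as manifolds. The analytic part shows that the
    derivations of such an equalizer are the pairs of vectors with equal images. Hadamard's lemma
    turns derivations into directional derivatives in a chart, and a contraction argument shows that
    a function vanishing on the zero set of a submersion has zero derivative along its kernel. Bump
    functions make derivations local. A second obstacle is choice: pulled back connections, [eta]
    and [dconn] are picked by [xget], so each needs an existence proof and a formula in frames
    before it can be used; a locally finite partition supplies the connections. Passing through a
    pointwise pairing avoids comparing the two curvature maps through the twisted duals, and lets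
    each side use a connection of its own. Vectors over base points that are only propositionally
    equal are compared in total spaces, by means of [Tot]. Everything needed about the base of [F]
    is extracted from its total groupoids along zero sections. *)

Section Calculus.
Context (R : realType).

Definition pd n (i : 'I_n) (f : 'rV[R]_n -> R^o) : 'rV[R]_n -> R^o :=
  fun x => 'D_(delta_mx 0 i) f x.

Lemma CkSE k n (f : 'rV[R]_n -> R^o) :
  Ck k.+1 f = ((forall x, differentiable f x) /\ forall i, Ck k (pd i f)).
Proof. by []. Qed.

Lemma Ck_continuous k n (f : 'rV[R]_n -> R^o) : Ck k f -> continuous f.
Proof.
by case: k => // k [df _] x; apply: differentiable_continuous.
Qed.

Lemma CkS k n (f : 'rV[R]_n -> R^o) : Ck k.+1 f -> Ck k f.
Proof.
elim: k f => [|k IH] f; first exact: Ck_continuous.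
by rewrite CkSE => -[df pf]; split => // i; apply: IH; apply: pf.
Qed.

Lemma Cinf_diff n (f : 'rV[R]_n -> R^o) x : Cinf f -> differentiable f x.
Proof. by move=> /(_ 1%N) []. Qed.

Lemma Cinf_pd n (f : 'rV[R]_n -> R^o) i : Cinf f -> Cinf (pd i f).
Proof. by move=> cf k; have [_] := cf k.+1; apply. Qed.

Lemma Cinf_continuous n (f : 'rV[R]_n -> R^o) : Cinf f -> continuous f.
Proof. by move=> /(_ 0%N). Qed.

Lemma Ck_cst k n (c : R) : Ck k (fun _ : 'rV[R]_n => c : R^o).
Proof.
elim: k c => [|k IH] c; first by move=> x; exact: cst_continuous.
split=> [x|i]; first exact: (differentiable_cst (c : R^o)).
rewrite [X in Ck _ X](_ : _ = fun _ => 0); first exact: IH.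
by apply/funext => x; rewrite derive_cst.
Qed.

Lemma CkD k n (f g : 'rV[R]_n -> R^o) :
  Ck k f -> Ck k g -> Ck k (fun x => f x + g x).
Proof.
elim: k f g => [|k IH] f g.
  by move=> cf cg x; apply: continuousD; [apply: cf|apply: cg].
move=> [df pf] [dg pg]; split=> [x|i]; first exact: differentiableD.
rewrite [X in Ck _ X](_ : _ = fun x => pd i f x + pd i g x).
  by apply: IH; [apply: pf|apply: pg].
by apply/funext => x; rewrite deriveD //; apply: diff_derivable.
Qed.

Lemma CkM k n (f g : 'rV[R]_n -> R^o) :
  Ck k f -> Ck k g -> Ck k (fun x => f x * g x).
Proof.
elim: k f g => [|k IH] f g.
  by move=> cf cg x; apply: continuousM; [apply: cf|apply: cg].
move=> cf cg; have [df pf] := cf; have [dg pg] := cg.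
split=> [x|i]; first exact: differentiableM.
rewrite [X in Ck _ X](_ : _ = fun x => f x * pd i g x + g x * pd i f x).
  exact: CkD (IH _ _ (CkS cf) (pg i)) (IH _ _ (CkS cg) (pf i)).
by apply/funext => x; rewrite deriveM //; apply: diff_derivable.
Qed.

Lemma Ck_sum k n m (f : 'I_m -> 'rV[R]_n -> R^o) :
  (forall i, Ck k (f i)) -> Ck k (fun x => \sum_i f i x).
Proof.
move=> cf; elim: m f cf => [|m IH] f cf.
  rewrite [X in Ck _ X](_ : _ = fun _ => 0); first exact: Ck_cst.
  by apply/funext => x; rewrite big_ord0.
rewrite [X in Ck _ X](_ : _ =
  fun x => f ord0 x + \sum_i f (lift ord0 i) x).
  by apply: CkD => //; apply: IH => i.
by apply/funext => x; rewrite big_ord_recl.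
Qed.

Lemma coord_linear n (i : 'I_n) : linear (fun x : 'rV[R]_n => x 0 i : R^o).
Proof. by move=> a x y; rewrite !mxE. Qed.

Lemma derive_coord n (i : 'I_n) (x v : 'rV[R]_n) :
  'D_v (fun x : 'rV[R]_n => x 0 i : R^o) x = v 0 i.
Proof.
pose L := GRing.isLinear.Build _ _ _ _ _ (@coord_linear n i).
pose f : {linear 'rV[R]_n -> R^o} := HB.pack (fun x : 'rV[R]_n => x 0 i : R^o) L.
have df : differentiable f x by exact: differentiable_coord.
rewrite -[fun _ => _]/(f : _ -> _) deriveE // diff_lin //.
move=> y; have : differentiable f y by exact: differentiable_coord.
exact: differentiable_continuous.
Qed.

Lemma Ck_coord k n (i : 'I_n) : Ck k (fun x : 'rV[R]_n => x 0 i : R^o).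
Proof.
case: k => [|k].
  move=> x; apply: (@differentiable_continuous _ _ _ x).
  exact: differentiable_coord.
split=> [x|j]; first exact: differentiable_coord.
rewrite [X in Ck _ X](_ : _ = fun _ => (delta_mx 0 j : 'rV[R]_n) 0 i).
  exact: Ck_cst.
by apply/funext => x; rewrite derive_coord.
Qed.

Section Chain.
Context (n m : nat) (u : 'I_m -> 'rV[R]_n -> R^o).

Let U (x : 'rV[R]_n) : 'rV[R]_m := \row_i u i x.

Let UE : U = fun x => \sum_i u i x *: (delta_mx 0 i : 'rV[R]_m).
Proof.
apply/funext => x; rewrite [LHS]row_sum_delta.
by apply: eq_bigr => i _; rewrite mxE.
Qed.

Lemma row_differentiable x :
  (forall i, differentiable (u i) x) -> differentiable U x.
Proof.
move=> du; rewrite UE.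
have -> : (fun x => \sum_i u i x *: (delta_mx 0 i : 'rV[R]_m)) =
  \sum_i (fun y => u i y *: (delta_mx 0 i : 'rV[R]_m)).
  by apply/funext => y; rewrite fct_sumE.
by apply: differentiable_sum => i; apply: differentiableZl.
Qed.

Lemma row_diff x v : (forall i, differentiable (u i) x) ->
  'd U x v = \row_i 'D_v (u i) x.
Proof.
move=> du; apply/rowP => i; rewrite mxE.
have dU := row_differentiable du.
have -> : u i = (fun y : 'rV[R]_m => y 0 i : R^o) \o U.
  by apply/funext => y; rewrite /= mxE.
have dc : differentiable (fun y : 'rV[R]_m => y 0 i : R^o) (U x).
  exact: differentiable_coord.
rewrite deriveE; last exact: differentiable_comp.
by rewrite diff_comp //= -[LHS](derive_coord i (U x)) deriveE.
Qed.

End Chain.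

Lemma deriveD_dir n (w : 'rV[R]_n -> R^o) x v : differentiable w x ->
  'D_v w x = \sum_i v 0 i * pd i w x.
Proof.
move=> dw; rewrite deriveE // [in LHS](row_sum_delta v) linear_sum /=.
apply: eq_bigr => i _; rewrite linearZ /=; congr (_ * _).
by rewrite -deriveE.
Qed.

Lemma chain_rule n m (u : 'I_m -> 'rV[R]_n -> R^o) (w : 'rV[R]_m -> R^o) x v :
  (forall i, differentiable (u i) x) -> differentiable w (\row_i u i x) ->
  'D_v (fun y => w (\row_i u i y)) x
  = \sum_i pd i w (\row_i u i x) * 'D_v (u i) x.
Proof.
move=> du dw; rewrite deriveE; last first.
  by apply: (differentiable_comp (row_differentiable du)).
rewrite (diff_comp (row_differentiable du) dw) /= row_diff //.
rewrite -deriveE // deriveD_dir //.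
by apply: eq_bigr => i _; rewrite mxE mulrC.
Qed.

(** By induction on [k]: the chain rule writes each partial derivative as a sum of products of a
    composite of the same shape, one order lower, with a partial derivative of [u]. *)
Lemma Ck_comp k n m (u : 'I_m -> 'rV[R]_n -> R^o) (w : 'rV[R]_m -> R^o) :
  (forall i, Ck k (u i)) -> Ck k w -> Ck k (fun x => w (\row_i u i x)).
Proof.
elim: k u w => [|k IH] u w cu cw.
  move=> x; apply: (@continuous_comp _ _ _ (fun x => \row_i u i x) w); last exact: cw.
  have -> : (fun x => \row_i u i x) =
     \sum_i (fun y => u i y *: (delta_mx 0 i : 'rV[R]_m)).
    apply/funext => y; rewrite fct_sumE [LHS]row_sum_delta.
    by apply: eq_bigr => i _; rewrite mxE.
  elim/big_ind: _ => [|f g cf cg|i _]; first exact: (@cst_continuous _ _ (0 : 'rV[R]_m)).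
    exact: continuousD.
  by apply: continuousZr_tmp; exact: (cu i).
have du i x : differentiable (u i) x by case: (cu i).
have dw x : differentiable w x by case: cw.
split=> [x|j].
  exact: (differentiable_comp (row_differentiable (fun i => du i x))).
rewrite [X in Ck _ X](_ : _ = fun x =>
    \sum_i pd i w (\row_i u i x) * pd j (u i) x); last first.
  by apply/funext => x; rewrite chain_rule.
apply: Ck_sum => i; apply: CkM; last exact: (proj2 (cu i) j).
exact: IH (fun l => CkS (cu l)) (proj2 cw i).
Qed.

Lemma Ck_inv k n (f : 'rV[R]_n -> R^o) : (forall x, f x != 0) ->
  Ck k f -> Ck k (fun x => (f x)^-1).
Proof.
move=> f0; elim: k => [|k IH] cf.
  by move=> x; apply: continuousV => //; apply: cf.
have [df pf] := cf; split=> [x|i].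
  by apply: differentiableV.
rewrite [X in Ck _ X](_ : _ = fun x => - 1 * ((f x)^-1 * (f x)^-1 * pd i f x)).
  apply: CkM; first exact: Ck_cst.
  have cV := IH (CkS cf); exact: CkM (CkM cV cV) (pf i).
apply/funext => x; rewrite deriveV //; last exact: diff_derivable.
by rewrite /pd mulN1r -expr2 exprVn -mulNr.
Qed.

Lemma Cinf_cst n (c : R) : Cinf (fun _ : 'rV[R]_n => c).
Proof. by move=> k; apply: Ck_cst. Qed.
Lemma Cinf_coord n (i : 'I_n) : Cinf (fun x : 'rV[R]_n => x 0 i).
Proof. by move=> k; apply: Ck_coord. Qed.
Lemma CinfD n (f g : 'rV[R]_n -> R) :
  Cinf f -> Cinf g -> Cinf (fun x => f x + g x).
Proof. by move=> cf cg k; apply: CkD. Qed.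
Lemma CinfM n (f g : 'rV[R]_n -> R) :
  Cinf f -> Cinf g -> Cinf (fun x => f x * g x).
Proof. by move=> cf cg k; apply: CkM. Qed.
Lemma Cinf_comp n m (u : 'I_m -> 'rV[R]_n -> R) (w : 'rV[R]_m -> R) :
  (forall i, Cinf (u i)) -> Cinf w -> Cinf (fun x => w (\row_i u i x)).
Proof. by move=> cu cw k; apply: Ck_comp => // i; apply: cu. Qed.
Lemma Cinf_inv n (f : 'rV[R]_n -> R) : (forall x, f x != 0) ->
  Cinf f -> Cinf (fun x => (f x)^-1).
Proof. by move=> f0 cf k; apply: Ck_inv. Qed.

Lemma Cinf_shift n (f : 'rV[R]_n -> R) (a : 'rV[R]_n) : Cinf f -> Cinf (fun x => f (a + x)).
Proof.
move=> cf; have -> : (fun x => f (a + x)) = fun x : 'rV[R]_n => f (\row_i (a 0 i + x 0 i)).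
  by apply/funext => x; congr f; apply/rowP => i; rewrite !mxE.
apply: Cinf_comp => // i; apply: CinfD; [apply: Cinf_cst | apply: Cinf_coord].
Qed.

End Calculus.

(** * Averages along rays and Hadamard's lemma *)

Section Hadamard.
Context (R : realType).

(** The little-o condition in epsilon form; uniqueness of the differential then yields its existence
    and its value together. *)
Lemma diff_intro (V W : normedModType R) (f : V -> W) (df : {linear V -> W}) x :
  continuous df ->
  (forall e, 0 < e -> \forall h \near 0, `|f (h + x) - f x - df h| <= e * `|h|) ->
  differentiable f x /\ 'd f x = df :> (V -> W).
Proof.
move=> cdf H.
have E : f \o shift x = cst (f x) + df +o_ 0 id.
  apply/eqaddoP => e e0; have := H e e0.
  by apply: filterS => h; rewrite /= !fctE opprD addrA.
have D := diff_unique cdf E; split => //.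
by apply/diff_locallyP; rewrite D.
Qed.

Lemma is_derive_line n (f : 'rV[R]_n -> R^o) (x h : 'rV[R]_n) t :
  differentiable f (x + t *: h) ->
  is_derive t (1 : R) (fun t => f (x + t *: h)) ('D_h f (x + t *: h)).
Proof.
move=> df; pose l := fun t : R => x + t *: h.
have linS : linear (fun s : R^o => s *: h) by move=> a u v; rewrite scalerDl scalerA.
pose S : {linear R^o -> 'rV[R]_n} := HB.pack (fun s : R^o => s *: h) (GRing.isLinear.Build _ _ _ _ _ linS).
have [|e e0|dl dlE] := @diff_intro R^o 'rV[R]_n l S t.
- by move=> s; apply: continuousZr_tmp => ?; apply: cvg_id.
- apply/nbhs_normP; exists 1 => //= s _.
  have -> : l (s + t) - l t - s *: h = 0.
    by apply/rowP => i; rewrite /l !mxE; ring.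
  by rewrite normr0 mulr_ge0 // ltW.
have dfl : differentiable (f \o l) t by exact: differentiable_comp.
have -> : 'D_h f (x + t *: h) = 'D_1 (f \o l) t.
  rewrite [RHS]deriveE // diff_comp //= deriveE //.
  by rewrite dlE /= scale1r.
by apply: derivableP; apply: diff_derivable.
Qed.

Lemma line_continuous n (f : 'rV[R]_n -> R^o) (x h : 'rV[R]_n) :
  continuous f -> continuous (fun t : R => f (x + t *: h)).
Proof.
move=> cf t; apply: (@continuous_comp _ _ _ (fun t : R => x + t *: h) f); last exact: cf.
apply: continuousD; first exact: (@cst_continuous _ _ x).
by apply: continuousZr_tmp => ?; apply: cvg_id.
Qed.

Lemma MVT_line n (f : 'rV[R]_n -> R^o) (x h : 'rV[R]_n) :
  (forall y, differentiable f y) ->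
  exists2 t : R, 0 <= t <= 1 & f (x + h) - f x = 'D_h f (x + t *: h).
Proof.
move=> df.
have [t _||t t01 E] := @MVT_segment R (fun t => f (x + t *: h))
  (fun t => 'D_h f (x + t *: h)) 0 1 ler01.
- exact: is_derive_line.
- apply: continuous_subspaceT; apply: line_continuous => y.
  exact: differentiable_continuous.
exists t; first by move: t01; rewrite in_itv.
by move: E; rewrite scale1r scale0r addr0 subr0 mulr1.
Qed.

Lemma continuous_mul (f g : R -> R) : continuous f -> continuous g ->
  continuous (fun t : R => f t * g t).
Proof. by move=> cf cg t; apply: cvgM; [exact: cf|exact: cg]. Qed.

Lemma continuous_sub (f g : R -> R) : continuous f -> continuous g ->
  continuous (fun t : R => f t - g t).
Proof. by move=> cf cg t; apply: (@cvgB R R^o); [exact: cf|exact: cg]. Qed.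

Lemma continuous_cst (c : R) : continuous (fun _ : R => c).
Proof. by move=> t; apply: cvg_cst. Qed.

Definition avg (h : R -> R) : R := Rintegral (@lebesgue_measure R) `[0, 1] h.

Lemma avg_integrable (h : R -> R) : continuous h ->
  (@lebesgue_measure R).-integrable `[0, 1] (EFin \o h).
Proof.
move=> ch; apply: (@continuous_compact_integrable R h `[0, 1]).
  exact: segment_compact.
exact: continuous_subspaceT.
Qed.

Lemma avgD (f g : R -> R) : continuous f -> continuous g ->
  avg (fun t => f t + g t) = avg f + avg g.
Proof. by move=> cf cg; apply: RintegralD => //; apply: avg_integrable. Qed.

Lemma avgB (f g : R -> R) : continuous f -> continuous g ->
  avg (fun t => f t - g t) = avg f - avg g.
Proof. by move=> cf cg; apply: RintegralB => //; apply: avg_integrable. Qed.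

Lemma avgZ (c : R) (f : R -> R) : continuous f ->
  avg (fun t => c * f t) = c * avg f.
Proof. by move=> cf; apply: RintegralZl => //; apply: avg_integrable. Qed.

Lemma sum_continuous m (f : 'I_m -> R -> R) :
  (forall i, continuous (f i)) -> continuous (fun t => \sum_i f i t).
Proof.
move=> cf t.
have -> : (fun t => \sum_i f i t) = \sum_i f i.
  by apply/funext => y; rewrite fct_sumE.
elim/big_ind: _ => [|g h cg ch|i _]; first exact: (@cst_continuous _ _ (0 : R)).
  exact: (@continuousD R R^o).
exact: cf.
Qed.

Lemma avg_sum m (f : 'I_m -> R -> R) :
  (forall i, continuous (f i)) ->
  avg (fun t => \sum_i f i t) = \sum_i avg (f i).
Proof.
elim: m f => [|m IH] f cf.
  rewrite big_ord0 -[RHS](mul0r (avg (fun _ => 0))) -avgZ.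
    by congr (avg _); apply/funext => t; rewrite big_ord0 mul0r.
  exact: (@cst_continuous _ _ (0 : R)).
rewrite big_ord_recl -IH // -avgD //.
  by congr (avg _); apply/funext => t; rewrite big_ord_recl.
exact: sum_continuous.
Qed.

Lemma avg_bound (c : R) (f : R -> R) : continuous f ->
  (forall t, 0 <= t <= 1 -> `|f t| <= c) -> `|avg f| <= c.
Proof.
move=> cf fc; apply: le_trans (le_normr_Rintegral _ (avg_integrable cf)) _ => //.
have -> : c = Rintegral (@lebesgue_measure R) `[0, 1] (cst c).
  rewrite Rintegral_cst //= lebesgue_measure_itv /= lte_fin ltr01.
  by rewrite oppr0 adde0 mulr1.
apply: le_Rintegral => //.
- apply: (@avg_integrable (fun t => `|f t|)) => t.
  by apply: (@continuous_comp _ _ _ f Num.norm); [exact: cf | exact: norm_continuous].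
- by apply: (@avg_integrable (cst c)) => t; apply: cvg_cst.
Qed.

(** The power of [t] records the number of differentiations: each derivative in [x] of [f (t *: x)]
    contributes one more factor [t]. *)
Definition ray k n (f : 'rV[R]_n -> R) (x : 'rV[R]_n) : R :=
  avg (fun t => t ^+ k * f (t *: x)).

Lemma ray_integrand k n (f : 'rV[R]_n -> R) (x : 'rV[R]_n) :
  continuous f -> continuous (fun t : R => t ^+ k * f (t *: x)).
Proof.
move=> cf; apply: continuous_mul; first exact: exprn_continuous.
have := @line_continuous n f 0 x cf.
by under eq_fun do rewrite add0r.
Qed.

Lemma row_cvgP n (f : 'rV[R]_n -> R) (x : 'rV[R]_n) (l : R) : f y @[y --> x] --> l <->
  forall e, 0 < e -> exists2 d, 0 < d & forall y, `|y - x| < d -> `|f y - l| <= e.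
Proof.
split=> [/(@cvgrPdist_le _ R^o) H e /H /nbhs_normP [d d0 dP]|H].
  by exists d => // y yx; rewrite distrC; apply: dP; rewrite /= distrC.
apply/(cvgrPdist_le (FF := nbhs_filter x) (f : _ -> R^o)) => e /H [d d0 dP].
have : \forall y \near x, `|l - f y| <= e; last by [].
apply/nbhs_normP; exists d => // y /=; rewrite distrC => /dP.
by rewrite distrC.
Qed.

(** Compactness of the unit interval makes the continuity of [f] at the points [t *: x] uniform in
    [t]. *)
Lemma ray_uniform n (f : 'rV[R]_n -> R) (x : 'rV[R]_n) (e : R) :
  continuous f -> 0 < e ->
  exists2 d : R, 0 < d & forall h, `|h| < d ->
    forall t, 0 <= t <= 1 -> `|f (t *: (h + x)) - f (t *: x)| <= e.
Proof.
move=> cf e0.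
have /compact_near_coveringP cov : compact `[0 : R, 1] by exact: segment_compact.
have := cov 'rV[R]_n (nbhs (0 : 'rV[R]_n))
  (fun h t => `|f (t *: (h + x)) - f (t *: x)| <= e) _.
move=> H; have : \forall h \near (0 : 'rV[R]_n), `[0, 1] `<=`
    (fun t => `|f (t *: (h + x)) - f (t *: x)| <= e); last first.
  move/nbhs_normP => [d d0 dP]; exists d => // h hd t t01.
  by apply: dP; rewrite /= ?sub0r ?normrN // in_itv.
apply: H => t _.
  pose e2 := e / 2; have e20 : 0 < e2 by rewrite divr_gt0.
  have c1 : (fun z : R * 'rV[R]_n => f (z.1 *: (z.2 + x))) z
    @[z --> (t, 0 : 'rV[R]_n)] --> f (t *: (0 + x)).
    apply: continuous_cvg; first exact: cf.
    apply: cvgZ; first exact: cvg_fst.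
    by apply: cvgD; [exact: cvg_snd | exact: cvg_cst].
  have c2 : (fun z : R * 'rV[R]_n => f (z.1 *: x)) z
    @[z --> (t, 0 : 'rV[R]_n)] --> f (t *: x).
    apply: continuous_cvg; first exact: cf.
    by apply: cvgZr_tmp; exact: cvg_fst.
  move/(@cvgrPdist_lt _ R^o): c1 => /(_ _ e20) c1; move/(@cvgrPdist_lt _ R^o): c2 => /(_ _ e20) c2.
  near=> z.
  have z1 : `|f (t *: (0 + x)) - f (z.1 *: (z.2 + x))| < e2 by near: z.
  have z2 : `|f (t *: x) - f (z.1 *: x)| < e2 by near: z.
  rewrite add0r in z1.
  have -> : f (z.1 *: (z.2 + x)) - f (z.1 *: x) =
    (f (t *: x) - f (z.1 *: x)) - (f (t *: x) - f (z.1 *: (z.2 + x))) by ring.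
  apply: le_trans (ler_normB _ _) _; rewrite /e2 in z1 z2; lra.
Unshelve. all: by end_near. Qed.

Lemma ray_continuous k n (f : 'rV[R]_n -> R) : continuous f -> continuous (ray k f).
Proof.
move=> cf x; apply/row_cvgP => e e0.
have [d d0 dP] := ray_uniform x cf e0; exists d => // y xy.
rewrite /ray -avgB; try exact: ray_integrand.
apply: avg_bound => [|t t01]; first by apply: continuous_sub; exact: ray_integrand.
rewrite -mulrBr normrM.
have tk : `|t ^+ k| <= 1.
  by case/andP: t01 => t0 t1; rewrite ger0_norm ?exprn_ge0 // exprn_ile1.
have := dP (y - x) xy t t01; rewrite subrK => H.
by rewrite -[leRHS]mul1r; apply: ler_pM.
Qed.

Lemma norm_row n (x : 'rV[R]_n) i : `|x 0 i| <= `|x|.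
Proof.
rewrite [leRHS]mx_normrE; apply: (@le_bigmax _ _ _ _ (fun j => `|x j.1 j.2|) (0, i)).
Qed.

(** Differentiation under the integral sign. The mean value theorem on the segment from [t *: x] to
    [t *: (h + x)] replaces the increment by derivatives at an intermediate point, and [ray_uniform]
    compares these with the derivatives at [t *: x]. *)
Lemma ray_diff k n (f : 'rV[R]_n -> R^o) (x : 'rV[R]_n) : Cinf f ->
  differentiable (ray k f : _ -> R^o) x /\
  forall i, pd i (ray k f : _ -> R^o) x = ray k.+1 (pd i f) x.
Proof.
move=> cf; have cpd i := Cinf_continuous (Cinf_pd i cf).
have cc := Cinf_continuous cf.
pose L (h : 'rV[R]_n) : R^o := \sum_i h 0 i * ray k.+1 (pd i f) x.
have linL : linear L.
  move=> a u v; rewrite /L scaler_sumr -big_split /=; apply: eq_bigr => i _.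
  by rewrite !mxE mulrDl -mulrA.
pose Lm := GRing.isLinear.Build _ _ _ _ _ linL.
pose l : {linear 'rV[R]_n -> R^o} := HB.pack L Lm.
have cl : continuous l.
  apply: (@Ck_continuous _ 0%N n L); apply: Ck_sum => i; apply: CkM; first exact: Ck_coord.
  exact: Ck_cst.
have [|df dE] := @diff_intro _ _ (ray k f : _ -> R^o) l x cl; last first.
  split => // i; rewrite /pd deriveE // dE /= /L (bigD1 i) //= mxE !eqxx mul1r.
  by rewrite big1 ?addr0 // => j ji; rewrite mxE (negbTE ji) andbF mul0r.
(* The error is shared among the [n] coordinates; dividing by [n.+1] keeps the quotient positive
   when [n] is 0. *)
move=> e e0; pose e' := e / n.+1%:R.
have e'0 : 0 < e' by rewrite divr_gt0.
have /choice[d dP] : forall i : 'I_n, exists d : R, 0 < d /\ forall h, `|h| < d ->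
    forall t, 0 <= t <= 1 -> `|pd i f (t *: (h + x)) - pd i f (t *: x)| <= e'.
  by move=> i; have [d ? ?] := ray_uniform x (cpd i) e'0; exists d.
pose dm := \big[Num.min/1]_i d i.
have dm0 : 0 < dm by rewrite /dm; elim/big_ind: _ => // [a b a0 b0|i _]; [rewrite lt_min a0|case: (dP i)].
apply/nbhs_normP; exists dm => // h; rewrite /= sub0r normrN => hd.
have hdi i : `|h| < d i.
  by apply: lt_le_trans hd _; apply: bigmin_le_cond.
have cint i : continuous (fun t : R => t ^+ k.+1 * pd i f (t *: x)) by exact: ray_integrand.
have cint' i : continuous (fun t : R => h 0 i * (t ^+ k.+1 * pd i f (t *: x))).
  apply: continuous_mul; [exact: continuous_cst|exact: cint].
have -> : L h = avg (fun t => \sum_i h 0 i * (t ^+ k.+1 * pd i f (t *: x))).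
  by rewrite avg_sum // /L; apply: eq_bigr => i _; rewrite avgZ.
have cr y : continuous (fun t : R => t ^+ k * f (t *: y)) by exact: ray_integrand.
rewrite /ray -avgB // -avgB //; last 2 first.
- by apply: continuous_sub; exact: cr.
- exact: sum_continuous.
apply: avg_bound => [|t t01].
  apply: continuous_sub; last exact: sum_continuous.
  by apply: continuous_sub; exact: cr.
case/andP: (t01) => t0 t1.
have [s /andP[s0 s1] sE] := @MVT_line n f (t *: x) (t *: h) (fun y => Cinf_diff y cf).
rewrite -mulrBr (addrC h) scalerDr sE.
have -> : t *: x + s *: (t *: h) = t *: (s *: h + x).
  by rewrite scalerDr addrC !scalerA mulrC.
rewrite deriveD_dir; last exact: Cinf_diff.
rewrite mulr_sumr -sumrB.
have tk : `|t ^+ k.+1| <= 1 by rewrite ger0_norm ?exprn_ge0 // exprn_ile1.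
apply: le_trans (ler_norm_sum _ _ _) _.
have -> : e * `|h| = \sum_(i < n.+1) (e' * `|h|).
  by rewrite sumr_const card_ord -mulr_natr /e' mulrAC divfK.
rewrite big_ord_recl /=; apply: le_trans (_ : \sum_(i < n) (e' * `|h|) <= _); last first.
  by rewrite lerDr mulr_ge0 // ltW.
apply: ler_sum => i _; rewrite mxE.
have -> : t ^+ k * (t * h 0 i * pd i f (t *: (s *: h + x)))
   - h 0 i * (t ^+ k.+1 * pd i f (t *: x))
   = t ^+ k.+1 * (h 0 i * (pd i f (t *: (s *: h + x)) - pd i f (t *: x))).
  by rewrite exprS; ring.
rewrite normrM -[leRHS]mul1r; apply: ler_pM => //.
rewrite normrM mulrC; apply: ler_pM => //; last exact: norm_row.
apply: (proj2 (dP i)) => //; apply: le_lt_trans (hdi i).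
by rewrite normrZ ger0_norm // ler_piMl.
Qed.

Lemma ray_Ck j k n (f : 'rV[R]_n -> R^o) : Cinf f -> Ck j (ray k f : _ -> R^o).
Proof.
elim: j k f => [|j IH] k f cf; first exact/ray_continuous/Cinf_continuous.
split=> [x|i]; first by case: (ray_diff k x cf).
rewrite [X in Ck _ X](_ : _ = ray k.+1 (pd i f)); first exact: IH (Cinf_pd i cf).
by apply/funext => x; case: (ray_diff k x cf) => _; apply.
Qed.

(** The fundamental theorem of calculus along the segment from the origin to [x]. *)
Lemma ray_FTC n (f : 'rV[R]_n -> R^o) (x : 'rV[R]_n) : Cinf f ->
  f x - f 0 = \sum_i x 0 i * ray 0 (pd i f) x.
Proof.
move=> cf; pose F t : R^o := f (0 + t *: x).
have cF : continuous F by apply: line_continuous; exact: Cinf_continuous.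
have dF t : is_derive t (1 : R) F ('D_x f (0 + t *: x)).
  by apply: is_derive_line; exact: Cinf_diff.
pose g t := \sum_i x 0 i * (t ^+ 0 * pd i f (t *: x)).
have cpd i := Cinf_continuous (Cinf_pd i cf).
have cg' i : continuous (fun t : R => x 0 i * (t ^+ 0 * pd i f (t *: x))).
  apply: continuous_mul; [exact: continuous_cst|exact: ray_integrand].
have cg : continuous g by exact: sum_continuous.
have -> : \sum_i x 0 i * ray 0 (pd i f) x = avg g.
  rewrite avg_sum //; apply: eq_bigr => i _; rewrite avgZ //; exact: ray_integrand.
rewrite /avg /Rintegral (@continuous_FTC2 R g F 0 1) //.
- by rewrite /= /F scale1r scale0r !add0r.
- exact: continuous_subspaceT.
- split=> [t _||].
  + by case: (dF t).
  + by apply: cvg_at_right_filter; exact: cF.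
  + by apply: cvg_at_left_filter; exact: cF.
move=> t _; rewrite derive1E; case: (dF t) => _ ->.
rewrite deriveD_dir ?add0r; last exact: Cinf_diff.
by apply: eq_bigr => i _; rewrite expr0 mul1r.
Qed.

(** The coefficients are the averages of the partial derivatives over the segment from [a] to [x].
    Their values at [a] are read off by differentiating the resulting expansion. *)
Lemma hadamard n (w : 'rV[R]_n -> R) (a : 'rV[R]_n) : Cinf w ->
  exists g : 'I_n -> 'rV[R]_n -> R, [/\ forall i, Cinf (g i),
    forall x, w x = w a + \sum_i (x 0 i - a 0 i) * g i x
    & forall i, g i a = pd i (w : _ -> R^o) a].
Proof.
move=> cw; pose w' x := w (a + x); have cw' : Cinf w' by exact: Cinf_shift.
pose g i x := ray 0 (pd i w') (- a + x).
have cg i : Cinf (g i) by apply: Cinf_shift => k; apply/ray_Ck/Cinf_pd.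
have E x : w x = w a + \sum_i (x 0 i - a 0 i) * g i x.
  have := ray_FTC (- a + x) cw'; rewrite /w' addr0 addNKr => /eqP.
  rewrite subr_eq addrC => /eqP ->; congr (_ + _); apply: eq_bigr => i _.
  by rewrite !mxE [in RHS]addrC.
exists g; split => // i.
have -> : (w : _ -> R^o) = fun x : 'rV[R]_n => w a + \sum_i (x 0 i - a 0 i) * g i x.
  by apply/funext => x; rewrite -E.
have dc (j : 'I_n) : is_derive a (delta_mx 0 i) (fun x : 'rV[R]_n => x 0 j - a 0 j : R^o)
    (((delta_mx 0 i : 'rV[R]_n) 0 j : R^o) - 0).
  apply: is_deriveB; apply: DeriveDef; last exact: derive_coord.
  by apply: diff_derivable; exact: differentiable_coord.
have dg j : is_derive a (delta_mx 0 i) (g j : _ -> R^o) (pd i (g j : _ -> R^o) a).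
  by apply: derivableP; apply: diff_derivable; exact: Cinf_diff.
rewrite /pd.
have -> : (fun x : 'rV[R]_n => w a + \sum_j (x 0 j - a 0 j) * g j x) =
  cst (w a : R^o) + \sum_j ((fun x : 'rV[R]_n => x 0 j - a 0 j : R^o) * g j).
  by apply/funext => x; rewrite !fctE fct_sumE.
have H := is_deriveD (is_derive_cst (w a : R^o) a (delta_mx 0 i))
  (is_derive_sum (fun j => is_deriveM (dc j) (dg j))).
rewrite (@derive_val _ _ _ _ _ _ _ H) add0r (bigD1 i) //= big1 ?addr0.
  by rewrite subrr scale0r add0r mxE !eqxx subr0 scaler1.
by move=> j ji; rewrite subrr scale0r add0r mxE (negbTE ji) andbF subr0 scaler0.
Qed.

End Hadamard.

(** * Flat functions, cutoffs and smooth reciprocals *)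

Section Bump.
Context (R : realType).

(** Smoothness in one variable is phrased through composition, because [Cinf] speaks of functions of
    row vectors. *)
Definition smooth1 (phi : R -> R) : Prop :=
  forall n (u : 'rV[R]_n -> R), Cinf u -> Cinf (phi \o u).

Lemma derive_comp1 (phi : R -> R) (dphi : R) n (u : 'rV[R]_n -> R) x v :
  is_derive (u x) (1 : R) phi dphi -> differentiable (u : _ -> R^o) x ->
  differentiable (phi \o u : _ -> R^o) x /\
  'D_v (phi \o u : _ -> R^o) x = dphi * 'D_v (u : _ -> R^o) x.
Proof.
move=> [dp dpE] du.
have dp' : differentiable (phi : R -> R^o) (u x) by exact/derivable1_diffP.
have dc : differentiable (phi \o u : _ -> R^o) x by exact: (differentiable_comp du dp').
split=> //; rewrite deriveE // (diff_comp du dp') /= deriv1E //= derive1E dpE.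
by rewrite mulrC -deriveE.
Qed.

(** The whole tower of derivatives is given at once, so that the induction on the order of
    differentiability can treat all its members simultaneously. *)
Lemma smooth1P (d : nat -> R -> R) :
  (forall k x, is_derive x (1 : R) (d k) (d k.+1 x)) -> smooth1 (d 0%N).
Proof.
move=> dd n u cu j.
suff : forall k, Ck j (d k \o u : _ -> R^o) by apply.
elim: j => [|j IH] k.
  move=> x; apply: (@differentiable_continuous _ _ _ x).
  exact: (proj1 (derive_comp1 0 (dd k (u x)) (Cinf_diff x cu))).
split=> [x|i].
  exact: (proj1 (derive_comp1 0 (dd k (u x)) (Cinf_diff x cu))).
rewrite [X in Ck _ X](_ : _ = fun x => (d k.+1 \o u) x * pd i (u : _ -> R^o) x).
  by apply: CkM; [exact: IH | exact: Cinf_pd].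
apply/funext => x.
exact: (proj2 (derive_comp1 (delta_mx 0 i) (dd k (u x)) (Cinf_diff x cu))).
Qed.

(** The polynomial factor makes the family of classical flat functions closed under
    differentiation. *)
Definition flat (p : {poly R}) (x : R) : R :=
  if 0 < x then p.[x^-1] * expR (- x^-1) else 0.

(** With [y] the inverse of [x], the derivative of [p(y) exp(-y)] in [x] is
    [y^2 (p(y) - p'(y)) exp(-y)]. *)
Definition flat_der (p : {poly R}) : {poly R} := 'X^2 * (p - p^`()).

(** A monomial is at most a factorial times the exponential, by comparison with a single term of the
    series. *)
Lemma poly_expR_bound (p : {poly R}) : exists2 C : R, 0 <= C &
  forall y, 0 <= y -> `|p.[y]| <= C * expR y.
Proof.
have pow k : exists2 D : R, 0 <= D & forall y, 0 <= y -> y ^+ k <= D * expR y.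
  case: k => [|k]; first by exists 1 => // y y0; rewrite expr0 mul1r -expR0 ler_expR.
  exists (k.+1)`!%:R => // y y0; rewrite mulrC -ler_pdivrMr ?ltr0n ?fact_gt0 //.
  by apply: le_trans (expR_ge1Dxn k y0); rewrite lerDr.
rewrite -(coefK p) poly_def.
elim: (size p) => [|m [C' C'0 IH]].
  by exists 0 => // y _; rewrite big_ord0 horner0 normr0 mul0r.
have [D D0 DP] := pow m.
exists (C' + `|p`_m| * D) => [|y y0]; first by rewrite addr_ge0 // mulr_ge0.
rewrite big_ord_recr /= hornerD; apply: le_trans (ler_normD _ _) _.
rewrite mulrDl lerD ?IH // hornerZ hornerXn normrM -mulrA.
by rewrite ler_wpM2l // ger0_norm ?exprn_ge0 // DP.
Qed.

(** The exponential bound, applied to ['X^2 * p] at the inverse of [x], leaves a factor [x ^+ 2];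
    this quadratic decay is what gives the derivative zero at the origin. *)
Lemma flat_bound (p : {poly R}) : exists2 C : R, 0 <= C &
  forall x, `|flat p x| <= C * x ^+ 2.
Proof.
have [C C0 CP] := poly_expR_bound ('X^2 * p); exists C => // x.
rewrite /flat; case: ifP => x0; last by rewrite normr0 mulr_ge0 // sqr_ge0.
have y0 : 0 <= x^-1 by rewrite invr_ge0 ltW.
have := CP _ y0; rewrite hornerM hornerXn !normrM expRN -expr2 (ger0_norm y0).
rewrite [X in _ -> _ * X <= _]ger0_norm ?invr_ge0 ?expR_ge0 // => H.
rewrite ler_pdivrMr ?expR_gt0 //.
rewrite -(@ler_pM2l _ (x^-1 ^+ 2)) ?exprn_gt0 ?invr_gt0 //.
apply: le_trans H _.
have x2 : x ^+ 2 != 0 by rewrite expf_neq0 // gt_eqF.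
by rewrite exprVn -mulrA mulrCA (mulrA (x ^- 2)) mulVf // mul1r.
Qed.

Lemma flat_derive (p : {poly R}) x : is_derive x (1 : R) (flat p) (flat (flat_der p) x).
Proof.
have [x0|x0|x0] := ltrgt0P x.
- have E : \forall y \near x, p.[y^-1] * expR (- y^-1) = flat p y.
    by apply: filterS (lt_nbhsr x0) => y y0; rewrite /flat y0.
  apply: near_eq_is_derive E _.
  have x0' : x != 0 by rewrite gt_eqF.
  have dV : is_derive x (1 : R) (fun y : R => y^-1) (- x ^- 2).
    apply: DeriveDef; first exact: derivableV.
    by rewrite deriveV // derive_id [LHS]mulr1.
  have dp := is_derive1_comp (is_derive_poly p x^-1) dV.
  have dN : is_derive x (1 : R) (fun y : R => - y^-1) (- - x ^- 2) by exact: is_deriveN dV.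
  have de := @is_derive1_comp R expR (fun y : R => - y^-1) x _ _ (is_derive_expR (- x^-1)) dN.
  apply: is_derive_eq (is_deriveM dp de) _; rewrite /flat x0 /flat_der hornerM hornerXn hornerD hornerN /=.
  rewrite -exprVn; set e := expR _.
  change (p.[x^-1] * (e * - - (x^-1) ^+ 2) + e * (p^`().[x^-1] * - (x^-1) ^+ 2) =
    (x^-1) ^+ 2 * (p.[x^-1] - p^`().[x^-1]) * e); ring.
- have E : \forall y \near x, 0 = flat p y.
    by apply: filterS (lt_nbhsl x0) => y y0; rewrite /flat ltNge ltW.
  apply: (near_eq_is_derive (f := fun=> 0) E).
  by rewrite /flat ltNge ltW //=; exact: is_derive_cst.
- rewrite x0 {2}/flat ltxx.
  have [C C0 CP] := flat_bound p.
  have [|e e0|dl dlE] := @diff_intro _ R^o R^o (flat p) \0 0.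
  + exact: cst_continuous.
  + apply/nbhs_normP; exists (e / (C + 1)).
      by rewrite /= divr_gt0 // ltr_wpDl.
    move=> h; rewrite /= sub0r normrN => hd.
    rewrite addr0 subr0 {2}/flat ltxx subr0; apply: le_trans (CP h) _.
    rewrite -real_normK ?num_real // expr2 mulrA ler_wpM2r //.
    move: hd; rewrite ltr_pdivlMr ?ltr_wpDl // => /ltW; apply: le_trans.
    by rewrite mulrDr mulr1 mulrC lerDl.
  apply: DeriveDef; first exact/derivable1_diffP.
  by rewrite deriveE // dlE.
Qed.

Lemma flat_smooth (p : {poly R}) : smooth1 (flat p).
Proof.
by apply: (@smooth1P (fun k => flat (iter k flat_der p))) => k x; exact: flat_derive.
Qed.

Lemma flat1_gt0 x : 0 < x -> 0 < flat 1 x.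
Proof. by move=> x0; rewrite /flat x0 hornerC mul1r expR_gt0. Qed.

Lemma flat_ge0 x : 0 <= flat 1 x.
Proof. by rewrite /flat; case: ifP => // _; rewrite hornerC mul1r expR_ge0. Qed.

Lemma flat_le0 p x : x <= 0 -> flat p x = 0.
Proof. by move=> x0; rewrite /flat ltNge x0. Qed.

(** The quotient [a / (a + b)], where [a] is positive exactly for [|y| < r] and [b] exactly for
    [|y| > r / 2]. These two regions cover the line, hence the denominator never vanishes. *)
Lemma cutoff_exists (r : R) : 0 < r -> exists c : R -> R,
  [/\ smooth1 c, forall y, `|y| <= r / 2 -> c y = 1, forall y, r <= `|y| -> c y = 0
    & forall y, 0 <= c y <= 1].
Proof.
move=> r0; pose a y := flat 1 (r ^+ 2 - y * y).
pose b y := flat 1 (y * y - (r / 2) ^+ 2).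
have ge0 y : 0 <= a y /\ 0 <= b y by split; exact: flat_ge0.
have rr : (r / 2) ^+ 2 < r ^+ 2 by rewrite ltr_sqr ?nnegrE ?divr_ge0 ?ltW // ltr_pdivrMr // ltr_pMr // ltr1n.
have ab y : 0 < a y + b y.
  have [a0 b0] := ge0 y.
  have [H|H] := ltP (y * y) (r ^+ 2).
    by rewrite ltr_pwDl // flat1_gt0 // subr_gt0.
  by rewrite ltr_wpDl // flat1_gt0 // subr_gt0; apply: lt_le_trans H.
exists (fun y => a y / (a y + b y)); split => [n u cu|y yr|y yr|y].
- have ca : Cinf (a \o u).
    apply: flat_smooth; apply: CinfD; first exact: Cinf_cst.
    have -> : (fun x => - (u x * u x)) = fun x => (-1) * (u x * u x).
      by apply/funext => x; rewrite mulN1r.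
    by apply: CinfM; [exact: Cinf_cst|exact: CinfM].
  have cb : Cinf (b \o u).
    by apply: flat_smooth; apply: CinfD; [exact: CinfM|exact: Cinf_cst].
  apply: CinfM => //; apply: Cinf_inv; last exact: CinfD.
  by move=> x; rewrite gt_eqF // ab.
- rewrite (_ : b y = 0) ?addr0; last first.
    apply: flat_le0; rewrite subr_le0 -expr2 -real_normK ?num_real //.
    by rewrite ler_sqr // ?nnegrE // divr_ge0 // ltW.
  by rewrite divff // gt_eqF //; have := ab y; rewrite (_ : b y = 0) ?addr0 //;
   apply: flat_le0; rewrite subr_le0 -expr2 -real_normK ?num_real // ler_sqr // ?nnegrE // divr_ge0 // ltW.
- rewrite (_ : a y = 0) ?mul0r //; apply: flat_le0.
  by rewrite subr_le0 -expr2 -[leRHS]real_normK ?num_real // ler_sqr // nnegrE ltW.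
have [a0 b0] := ge0 y.
by rewrite divr_ge0 ?(ltW (ab y)) //= ler_pdivrMr // mul1r lerDl.
Qed.

(** A local model must be smooth on the whole of R^n. The argument is therefore first pushed by a
    cutoff into the ball of radius [|y0| / 2] about [y0], which avoids zero, and only then
    inverted. *)
Lemma recip_exists (y0 : R) : y0 != 0 -> exists c : R -> R,
  smooth1 c /\ \forall y \near y0, c y = y^-1.
Proof.
move=> y00; pose r := `|y0| / 2.
have r0 : 0 < r by rewrite divr_gt0 // normr_gt0.
have [c [cs c1 c0 c01]] := cutoff_exists r0.
pose d y := y0 + c (y - y0) * (y - y0).
have dn y : d y != 0.
  have [H|H] := leP r `|y - y0|; first by rewrite /d c0 // mul0r addr0.
  apply/eqP => d0; have : `|y0| <= `|y - y0|.
    have -> : `|y0| = `|- (c (y - y0) * (y - y0))|.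
      by congr `|_|; apply/eqP; rewrite -subr_eq0 opprK -/(d y) d0.
    rewrite normrN normrM; have /andP[c0' c1'] := c01 (y - y0).
    by rewrite ger0_norm // ler_piMl.
  move: H; rewrite /r => H H2; have := lt_le_trans H (le_refl _).
  by move: (normr_gt0 y0); rewrite y00 => y0p; lra.
exists (fun y => (d y)^-1); split.
  move=> n u cu; apply: (@Cinf_inv _ _ (d \o u)) => [x|]; first exact: dn.
  have cu' : Cinf (fun x => u x - y0) by apply: CinfD => //; exact: Cinf_cst.
  apply: CinfD; first exact: Cinf_cst.
  by apply: CinfM => //; exact: (cs _ _ cu').
apply/nbhs_normP; exists (r / 2); first by rewrite /= divr_gt0.
move=> y /=; rewrite distrC => /ltW H; rewrite /d c1 // mul1r addrC subrK //.
Qed.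

End Bump.

(** * A tangential form of the implicit function theorem *)

Section Implicit.
Context (R : realType).

Lemma derive_lin n (g : 'rV[R]_n -> R^o) x : differentiable g x ->
  forall a u v, 'D_(a *: u + v) g x = a * 'D_u g x + 'D_v g x.
Proof.
move=> dg a u v; rewrite !deriveD_dir // mulr_sumr -big_split /=.
by apply: eq_bigr => i _; rewrite !mxE mulrDl mulrA.
Qed.

(** The mean value theorem together with continuity of the partial derivatives at 0. Unlike plain
    differentiability this compares two nearby points, which is what a contraction estimate
    needs. *)
Lemma strict_diff n (g : 'rV[R]_n -> R) (e : R) : Cinf g -> 0 < e ->
  exists2 r, 0 < r & forall x y : 'rV[R]_n, `|x| < r -> `|y| < r ->
    `|g x - g y - 'D_(x - y) (g : _ -> R^o) 0| <= e * `|x - y|.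
Proof.
move=> cg e0; pose e' := e / n.+1%:R.
have e'0 : 0 < e' by rewrite divr_gt0.
have /choice[d dP] : forall i : 'I_n, exists d : R, 0 < d /\ forall y, `|y| < d ->
    `|pd i (g : _ -> R^o) y - pd i (g : _ -> R^o) 0| <= e'.
  move=> i; have /row_cvgP/(_ _ e'0)[d d0 dP] := Cinf_continuous (Cinf_pd i cg) (x := 0).
  by exists d; split => // y yd; apply: dP; rewrite subr0.
pose r := \big[Num.min/1]_i d i.
have r0 : 0 < r.
  by rewrite /r; elim/big_ind: _ => // [a b a0 b0|i _]; [rewrite lt_min a0|case: (dP i)].
exists r => // x y xr yr.
have [t /andP[t0 t1] tE] := MVT_line y (x - y) (fun z => Cinf_diff z cg).
rewrite (addrC y (x - y)) subrK in tE; rewrite tE !deriveD_dir; try exact: Cinf_diff.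
rewrite -sumrB; apply: le_trans (ler_norm_sum _ _ _) _.
have -> : e * `|x - y| = \sum_(i < n.+1) (e' * `|x - y|).
  by rewrite sumr_const card_ord -mulr_natr /e' mulrAC divfK.
rewrite big_ord_recl /=; apply: le_trans (_ : \sum_(i < n) (e' * `|x - y|) <= _); last first.
  by rewrite lerDr mulr_ge0 // ltW.
apply: ler_sum => i _; rewrite -mulrBr normrM mulrC; apply: ler_pM => //; last exact: norm_row.
apply: (proj2 (dP i)); apply: lt_le_trans (_ : r <= _); last exact: bigmin_le_cond.
have -> : y + t *: (x - y) = (1 - t) *: y + t *: x.
  by apply/rowP => j; rewrite !mxE; ring.
apply: le_lt_trans (ler_normD _ _) _; rewrite !normrZ !ger0_norm ?subr_ge0 //.
have [->|tn0] := eqVneq t 0; first by rewrite mul0r addr0 subr0 mul1r.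
have -> : r = (1 - t) * r + t * r by ring.
by rewrite ler_ltD // ?ler_wpM2l ?subr_ge0 ?(ltW yr) // ltr_pM2l // lt_def tn0.
Qed.

(* For small [e] the Newton map [r |-> r - g (e u + B r)] is a contraction of a
   ball of radius [o(e)], so the zero set of [g] contains points [e u + o(e)]. *)
Lemma implicit_zero n m (g : 'I_m -> 'rV[R]_n -> R) (b : 'I_m -> 'rV[R]_n)
    (u : 'rV[R]_n) (f : 'rV[R]_n -> R) :
  (forall j, Cinf (g j)) -> (forall j, g j 0 = 0) ->
  (forall i j, 'D_(b i) (g j : _ -> R^o) 0 = (i == j)%:R) ->
  (forall j, 'D_u (g j : _ -> R^o) 0 = 0) ->
  Cinf f -> (\forall x \near (0 : 'rV[R]_n), (forall j, g j x = 0) -> f x = 0) ->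
  'D_u (f : _ -> R^o) 0 = 0.
Proof.
move=> cg g0 gb gu cf /nbhs_normP[rf rf0 fP].
(* The vectors [b] are dual to the differentials of the [g j] at 0, so [B] is a right inverse of the
   derivative of [g]. *)
pose B (r : 'rV[R]_m) := \sum_i r 0 i *: b i.
have BB r r' : B r - B r' = B (r - r').
  by rewrite /B -sumrB; apply: eq_bigr => i _; rewrite !mxE scalerBl.
pose K := 1 + \sum_i `|b i|.
have K1 : 1 <= K by rewrite lerDl sumr_ge0.
have K0 : 0 < K by rewrite (lt_le_trans ltr01).
have BK r : `|B r| <= K * `|r|.
  apply: le_trans (ler_norm_sum _ _ _) _; rewrite /K mulrDl mulr_suml.
  rewrite -[leLHS]add0r lerD ?mul1r //; apply: ler_sum => i _.
  by rewrite normrZ mulrC ler_wpM2l // norm_row.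
have gB j r : 'D_(B r) (g j : _ -> R^o) 0 = r 0 j.
  have -> : B r = \sum_i r 0 i *: b i by [].
  have H (s : seq 'I_m) : 'D_(\sum_(i <- s) r 0 i *: b i) (g j : _ -> R^o) 0 =
      \sum_(i <- s) r 0 i * (i == j)%:R.
    elim: s => [|i s IH]; first by rewrite !big_nil derive0.
    by rewrite !big_cons derive_lin ?IH ?gb //; exact: Cinf_diff.
  rewrite H (bigD1 j) //= eqxx mulr1 big1 ?addr0 // => i ij.
  by rewrite (negbTE ij) mulr0.
have f00 : f 0 = 0 by apply: fP => //=; rewrite subrr normr0.
have [Cf Cf0 CfP] : exists2 C : R, 0 <= C & forall v, `|'D_v (f : _ -> R^o) 0| <= C * `|v|.
  exists (\sum_i `|pd i (f : _ -> R^o) 0|); first exact: sumr_ge0.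
  move=> v; rewrite deriveD_dir; last exact: Cinf_diff.
  apply: le_trans (ler_norm_sum _ _ _) _; rewrite mulr_suml; apply: ler_sum => i _.
  by rewrite normrM mulrC ler_wpM2l // norm_row.
pose U := `|u| + 1; have U0 : 0 < U by rewrite ltr_wpDl.
(* Here [eta] is the relative error allowed in strict differentiability. The bound holds for every
   small [eta], which forces the derivative of [f] along [u] to vanish. *)
have key eta : 0 < eta -> eta * K <= 2^-1 ->
    `|'D_u (f : _ -> R^o) 0| <= eta * (2 * U + Cf * K * 2 * U).
  move=> eta0 etaK.
  have /choice[d dP] : forall j : 'I_m, exists d, 0 < d /\ forall x y : 'rV[R]_n,
      `|x| < d -> `|y| < d ->
      `|g j x - g j y - 'D_(x - y) (g j : _ -> R^o) 0| <= eta * `|x - y|.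
    by move=> j; have [d ? ?] := strict_diff (cg j) eta0; exists d.
  have [df df0 dfP] := strict_diff cf eta0.
  pose rho := Num.min (Num.min rf df) (\big[Num.min/1]_j d j).
  have rho0 : 0 < rho.
    rewrite /rho !lt_min df0 /= rf0 /=.
    by elim/big_ind: _ => // [x y x0 y0|i _]; [rewrite lt_min x0|case: (dP i)].
  have rhod j : rho <= d j by rewrite /rho ge_min; apply/orP; right; exact: bigmin_le_cond.
  have rhof : rho <= rf by rewrite /rho !ge_min lexx.
  have rhodf : rho <= df by rewrite /rho !ge_min lexx orbT.
  have [ep ep0 epU] : exists2 ep, 0 < ep & ep * U * 2 < rho.
    exists (rho / (2 * U) / 2); first by rewrite !divr_gt0 // mulr_gt0.
    have -> : rho / (2 * U) / 2 * U * 2 = rho / 2 by field; rewrite gt_eqF.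
    by rewrite ltr_pdivrMr // mulr_natr mulr2n ltrDl.
  (* Twice the bound for [T 0]: a map with Lipschitz constant 1/2 that moves 0 by at most [s / 2]
     preserves the ball of radius [s]. *)
  pose s := 2 * eta * ep * U.
  have s0 : 0 < s by rewrite /s; apply: mulr_gt0 => //; apply: mulr_gt0 => //; rewrite mulr_gt0.
  have inrho (r : 'rV[R]_m) : `|r| <= s -> `|ep *: u + B r| <= ep * U * 2.
    move=> rs; apply: le_trans (ler_normD _ _) _; rewrite normrZ gtr0_norm //.
    rewrite mulr_natr mulr2n lerD //; first by rewrite ler_wpM2l ?(ltW ep0) // lerDl.
    apply: le_trans (BK r) _; apply: le_trans (_ : K * s <= _); first by rewrite ler_wpM2l ?(ltW K0).
    have -> : K * s = (eta * K) * (2 * (ep * U)) by rewrite /s; ring.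
    apply: le_trans (_ : 2^-1 * (2 * (ep * U)) <= _).
      by rewrite ler_wpM2r // !mulr_ge0 ?(ltW ep0) ?(ltW U0).
    by rewrite mulKf.
  pose T (r : 'rV[R]_m) : 'rV[R]_m := \row_j (r 0 j - g j (ep *: u + B r)).
  have Tlip r r' : `|r| <= s -> `|r'| <= s -> `|T r - T r'| <= 2^-1 * `|r - r'|.
    move=> rs r's; rewrite [leLHS]mx_normrE; apply: bigmax_le => [|[i j] _ /=].
      by rewrite mulr_ge0.
    rewrite !mxE.
    have := proj2 (dP j) (ep *: u + B r) (ep *: u + B r')
      (le_lt_trans (inrho _ rs) (lt_le_trans epU (rhod j)))
      (le_lt_trans (inrho _ r's) (lt_le_trans epU (rhod j))).
    rewrite opprD addrACA subrr add0r BB gB !mxE => H.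
    have -> : r 0 j - g j (ep *: u + B r) - (r' 0 j - g j (ep *: u + B r')) =
      - (g j (ep *: u + B r) - g j (ep *: u + B r') - (r 0 j - r' 0 j)) by ring.
    rewrite normrN; apply: le_trans H _.
    apply: le_trans (_ : eta * (K * `|r - r'|) <= _); first by rewrite ler_wpM2l ?(ltW eta0).
    by rewrite mulrA ler_wpM2r.
  have B0 : B 0 = 0 by rewrite /B big1 // => i _; rewrite mxE scale0r.
  have T0 : `|T 0| <= 2^-1 * s.
    rewrite [leLHS]mx_normrE; apply: bigmax_le => [|[i j] _ /=].
      by rewrite mulr_ge0 // ltW.
    rewrite !mxE sub0r normrN B0 addr0.
    have epu : `|ep *: u| <= ep * U.
      by rewrite normrZ gtr0_norm // ler_wpM2l ?(ltW ep0) // lerDl.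
    have := proj2 (dP j) (ep *: u) 0; rewrite normr0 subr0 g0 subr0.
    have -> : 'D_(ep *: u) (g j : _ -> R^o) 0 = 0.
      by rewrite -[ep *: u]addr0 derive_lin ?gu ?derive0 ?mulr0 ?addr0 //; exact: Cinf_diff.
    rewrite subr0 => H; apply: le_trans (H _ _) _.
    - apply: le_lt_trans epu _; apply: lt_le_trans (rhod j); apply: le_lt_trans epU.
      by rewrite ler_peMr ?mulr_ge0 ?(ltW ep0) ?(ltW U0) // ler1n.
    - by case: (dP j).
    apply: le_trans (_ : eta * (ep * U) <= _); first by rewrite ler_wpM2l ?(ltW eta0).
    by rewrite /s -!mulrA mulKf.
  have Ts r : `|r| <= s -> `|T r| <= s.
    move=> rs; have -> : T r = (T r - T 0) + T 0 by rewrite subrK.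
    apply: le_trans (ler_normD _ _) _.
    have -> : s = 2^-1 * s + 2^-1 * s by field.
    rewrite lerD // (le_trans (Tlip r 0 rs _)) ?normr0 ?(ltW s0) //.
    by rewrite subr0 ler_wpM2l.
  pose Q := [set r : 'rV[R]_m | `|r| <= s].
  have TQ : set_fun Q Q T by move=> r; exact: Ts.
  pose X : completeNormedModType R := HB.pack_for (completeNormedModType R) 'rV[R]_m
    (Uniform_isComplete.Build 'rV[R]_m (@cauchy_cvg _)).
  pose T' : {fun Q >-> Q} := HB.pack T (isFun.Build _ _ Q Q T TQ).
  have [r rQ rE] : exists2 p : X, Q p & p = T' p.
    apply: (@banach_fixed_point R X Q T').
    - have h0 : (0 : R) <= 2^-1 by rewrite invr_ge0.
      exists (NngNum h0); split; first by rewrite /= invf_lt1 // ltr1n.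
      by move=> [x y] [/= xQ yQ]; exact: Tlip.
    - have -> : Q = (fun r : 'rV[R]_m => `|r|) @^-1` [set y | y <= s] by [].
      apply: closed_comp; last exact: closed_le.
      by move=> x _; exact: norm_continuous.
    - by exists 0; rewrite /Q /= normr0 ltW.
  have gz j : g j (ep *: u + B r) = 0.
    by move/rowP: rE => /(_ j); rewrite mxE => /eqP; rewrite eq_sym subr_eq -subr_eq0 opprD addNKr oppr_eq0 => /eqP.
  have xr := inrho r rQ; set x := ep *: u + B r in gz xr.
  have fx : f x = 0.
    apply: fP => //=; rewrite sub0r normrN.
    by apply: le_lt_trans xr (lt_le_trans epU rhof).
  have := dfP x 0 (le_lt_trans xr (lt_le_trans epU rhodf)).
  rewrite normr0 fx f00 !subr0 sub0r normrN => /(_ df0) H.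
  rewrite -(@ler_pM2l _ ep) //.
  have -> : ep * `|'D_u (f : _ -> R^o) 0| =
      `|'D_x (f : _ -> R^o) 0 - 'D_(B r) (f : _ -> R^o) 0|.
    rewrite /x derive_lin ?addrK; last exact: Cinf_diff.
    by rewrite normrM gtr0_norm.
  apply: le_trans (ler_normB _ _) _.
  apply: le_trans (_ : eta * (ep * U * 2) + Cf * (K * s) <= _).
    apply: lerD; first by apply: le_trans H _; rewrite ler_wpM2l ?(ltW eta0).
    apply: le_trans (CfP _) _; rewrite ler_wpM2l //; apply: le_trans (BK r) _.
    by rewrite ler_wpM2l ?(ltW K0).
  by rewrite le_eqVlt; apply/orP; left; apply/eqP; rewrite /s; ring.
set D := 'D_u _ _ in key *.
apply/eqP; rewrite -normr_le0 leNgt; apply/negP => D0.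
pose W := 2 * U + Cf * K * 2 * U.
have W0 : 0 < W by rewrite ltr_pwDl ?mulr_gt0 // !mulr_ge0 ?(ltW K0) ?(ltW U0).
(* The first bound makes the Newton map a contraction, the second makes the estimate of [key] at
   most half of [|D|]. *)
pose eta := Num.min (2^-1 / K) (`|D| / (2 * W)).
have eta0 : 0 < eta by rewrite lt_min !divr_gt0 ?mulr_gt0.
have := key eta eta0 _; rewrite -/W => /(_ _).
have etaK : eta * K <= 2^-1 by rewrite -ler_pdivlMr // ge_min lexx.
move=> /(_ etaK); apply/negP; rewrite -ltNge.
apply: le_lt_trans (_ : `|D| / (2 * W) * W < _).
  by rewrite ler_wpM2r ?(ltW W0) // ge_min lexx orbT.
have -> : `|D| / (2 * W) * W = `|D| / 2 by field; rewrite gt_eqF.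
by rewrite ltr_pdivrMr // mulr_natr mulr2n ltrDl.
Qed.

End Implicit.

(** * Differential spaces *)

Section SmoothFunctions.
Context (R : realType).
Implicit Types X Y Z : space R.

Lemma near_all X (p : X) (P : X -> Prop) : (forall q, P q) -> \forall q \near (p : X), P q.
Proof. by move=> H; apply: (@filterS _ _ (nbhs_filter p)) (@filterT _ _ (nbhs_filter p)) => q _. Qed.

(** The preimages of open sets under generators form a subbase, so a property of neighbourhoods
    stable under enlargement and intersection can be checked on those preimages alone. *)
Lemma nbhs_gen_ind X (p : X) (P : set X -> Prop) :
  (forall U V : set X, U `<=` V -> P U -> P V) -> P setT ->
  (forall U V : set X, P U -> P V -> P (U `&` V)) ->
  (forall (f : X -> R) (A : set R), gen f -> open A -> A (f p) -> P (f @^-1` A)) ->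
  forall U : set X, nbhs p U -> P U.
Proof.
move=> Psub PT PI Pg U; rewrite nbhsE => -[V [oV Vp] VU].
apply: (Psub _ _ VU); case: oV => D Dfin VE; move: Vp; rewrite -VE => -[A DA Ap].
have [F Fsub FE] := Dfin A DA.
apply: (Psub A _); first by move=> q Aq; exists A.
rewrite -FE in Ap *.
have H (s : seq (set X)) : {subset s <= finmap.enum_fset F} -> P [set q | forall B, B \in s -> B q].
  elim: s => [|B s IH] sF; first by apply: Psub PT => q _ B; rewrite in_nil.
  have BF : B \in finmap.enum_fset F by apply: sF; rewrite mem_head.
  have PB : P B.
    have /set_mem [f gf [W oW BE]] := Fsub _ BF.
    have Bp : B p by exact: (Ap B BF).
    by rewrite BE; apply: Pg => //; rewrite BE in Bp.
  have sF' : {subset s <= finmap.enum_fset F} by move=> C Cs; apply: sF; rewrite inE Cs orbT.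
  apply: Psub (PI _ _ PB (IH sF')) => q [Bq sq] C; rewrite inE => /orP[/eqP->//|].
  exact: sq.
have := H (finmap.enum_fset F) (fun B => id); apply: Psub => q qF B /= BF; exact: qF.
Qed.

Lemma gen_continuous X (f : X -> R) : gen f -> continuous f.
Proof.
move=> gf; apply/continuousP => A oA; exists [set f @^-1` A]; last first.
  by rewrite bigcup_set1.
move=> _ ->; apply: finI_from1; exists f => //; exists A => //.
Qed.

(** [smoothf f] is by definition [forall p, smooth_at p f], so a proof of the former is applied
    directly to a point. *)
Definition smooth_at X (p : X) (f : X -> R) : Prop :=
  exists (n : nat) (s : 'I_n -> X -> R) (w : 'rV[R]_n -> R),
    [/\ forall i, gen (s i), Cinf w
      & \forall q \near (p : X), f q = w (\row_i s i q)].

Lemma smooth_at_ext X (p : X) f g : (\forall q \near (p : X), f q = g q) ->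
  smooth_at p f -> smooth_at p g.
Proof.
move=> fg [n [s [w [gs cw E]]]]; exists n, s, w; split => //.
by apply: filterS2 fg E => q -> ->.
Qed.

Lemma smoothf_gen X (f : X -> R) : gen f -> smoothf f.
Proof.
move=> gf p; exists 1%N, (fun _ => f), (fun x => x 0 0); split => //.
  exact: Cinf_coord.
by apply: near_all => q; rewrite mxE.
Qed.

(** Concatenating the lists of generators gives finitely many functions local models over one common
    list, which is what composition with a function of several variables requires. *)
Lemma smooth_at_joint X (p : X) m (u : 'I_m -> X -> R) :
  (forall i, smooth_at p (u i)) -> exists n (s : 'I_n -> X -> R) (w : 'I_m -> 'rV[R]_n -> R),
   [/\ forall i, gen (s i), forall i, Cinf (w i)
     & \forall q \near (p : X), forall i, u i q = w i (\row_j s j q)].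
Proof.
elim: m u => [|m IH] u su.
  exists 0%N, (fun i => u (widen_ord (leqnn 0) i)), (fun i _ => u i p); split; try by case.
  by apply: near_all => q; case.
have [n1 [s1 [w1 [g1 c1 E1]]]] := su ord0.
have [n2 [s2 [w2 [g2 c2 E2]]]] := IH (fun i => u (lift ord0 i)) (fun i => su _).
pose s k := match fintype.split k with inl i => s1 i | inr j => s2 j end.
pose l1 (x : 'rV[R]_(n1 + n2)) : 'rV[R]_n1 := \row_i x 0 (lshift n2 i).
pose l2 (x : 'rV[R]_(n1 + n2)) : 'rV[R]_n2 := \row_i x 0 (rshift n1 i).
have E q : l1 (\row_j s j q) = \row_i s1 i q.
  apply/rowP => i; rewrite !mxE /s.
  by rewrite -[lshift n2 i]/(unsplit (inl i)) unsplitK.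
have E' q : l2 (\row_j s j q) = \row_i s2 i q.
  apply/rowP => i; rewrite !mxE /s.
  by rewrite -[rshift n1 i]/(unsplit (inr i)) unsplitK.
exists (n1 + n2)%N, s, (fun i => if unlift ord0 i is Some j then w2 j \o l2 else w1 \o l1).
split.
- by move=> k; rewrite /s; case: fintype.split.
- move=> i; case: unliftP => [j|] _.
  + by apply: Cinf_comp => // k; exact: Cinf_coord.
  + by apply: Cinf_comp => // k; exact: Cinf_coord.
apply: filterS2 E1 E2 => q E1 E2 i; case: unliftP => [j ->|->] /=.
  by rewrite E' E2.
by rewrite E E1.
Qed.

Lemma smooth_at_comp X (p : X) m (u : 'I_m -> X -> R) (w : 'rV[R]_m -> R) :
  (forall i, smooth_at p (u i)) -> Cinf w ->
  smooth_at p (fun q => w (\row_i u i q)).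
Proof.
move=> /smooth_at_joint[n [s [v [gs cv E]]]] cw.
exists n, s, (fun x => w (\row_i v i x)); split => //; first exact: Cinf_comp.
by apply: filterS E => q E; congr w; apply/rowP => i; rewrite !mxE E.
Qed.

Lemma smoothf_comp X m (u : 'I_m -> X -> R) (w : 'rV[R]_m -> R) :
  (forall i, smoothf (u i)) -> Cinf w -> smoothf (fun q => w (\row_i u i q)).
Proof. by move=> su cw p; apply: smooth_at_comp => // i; exact: su. Qed.

Lemma smooth_at_cst X (p : X) c : smooth_at p (fun _ => c).
Proof.
exists 0%N, (fun i => match i with Ordinal _ h => fun _ => c end), (fun _ => c).
split; [by case|exact: Cinf_cst|exact: near_all].
Qed.

Lemma smooth_at1 X (p : X) (phi : R -> R) f : smooth1 phi -> smooth_at p f ->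
  smooth_at p (phi \o f).
Proof.
move=> sphi sf.
have := @smooth_at_comp X p 1 (fun _ => f) (fun x => phi (x 0 0)) (fun _ => sf)
  (sphi _ _ (@Cinf_coord R 1 0)).
by apply: smooth_at_ext; apply: near_all => q /=; rewrite mxE.
Qed.

Lemma smooth_at2 X (p : X) (op : R -> R -> R) f g :
  Cinf (fun x : 'rV[R]_2 => op (x 0 0) (x 0 1)) -> smooth_at p f -> smooth_at p g ->
  smooth_at p (fun q => op (f q) (g q)).
Proof.
move=> sop sf sg.
have := @smooth_at_comp X p 2 (fun i => if i == 0 then f else g) _ _ sop.
move=> /(_ _)/= H.
have {}H : smooth_at p (fun q => op ((\row_i (if i == 0 then f else g) q : 'rV[R]_2) 0 0)
   ((\row_i (if i == 0 then f else g) q : 'rV[R]_2) 0 1)).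
  by apply: H => i; case: eqP.
by apply: smooth_at_ext H; apply: near_all => q; rewrite !mxE.
Qed.

Lemma smooth_atD X (p : X) f g : smooth_at p f -> smooth_at p g ->
  smooth_at p (fun q => f q + g q).
Proof. by apply: smooth_at2; apply: CinfD; exact: Cinf_coord. Qed.

Lemma smooth_atM X (p : X) f g : smooth_at p f -> smooth_at p g ->
  smooth_at p (fun q => f q * g q).
Proof. by apply: smooth_at2; apply: CinfM; exact: Cinf_coord. Qed.

Lemma smooth_atZ X (p : X) c f : smooth_at p f -> smooth_at p (fun q => c * f q).
Proof. by apply: smooth_atM; exact: smooth_at_cst. Qed.

Lemma smooth_atN X (p : X) f : smooth_at p f -> smooth_at p (fun q => - f q).
Proof.
by move=> /(smooth_atZ (-1)); apply: smooth_at_ext; apply: near_all => q; rewrite mulN1r.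
Qed.

Lemma smooth_atB X (p : X) f g : smooth_at p f -> smooth_at p g ->
  smooth_at p (fun q => f q - g q).
Proof. by move=> sf /smooth_atN sg; exact: smooth_atD. Qed.

Lemma smooth_at_sum X (p : X) (I : Type) (r : seq I) (P : pred I) (f : I -> X -> R) :
  (forall i, P i -> smooth_at p (f i)) -> smooth_at p (fun q => \sum_(i <- r | P i) f i q).
Proof.
move=> sf; elim: r => [|i r IH].
  by apply: smooth_at_ext (smooth_at_cst p 0); apply: near_all => q; rewrite big_nil.
have [Pi|nPi] := boolP (P i).
  apply: smooth_at_ext (smooth_atD (sf i Pi) IH).
  by apply: near_all => q; rewrite big_cons Pi.
by apply: smooth_at_ext IH; apply: near_all => q; rewrite big_cons (negbTE nPi).
Qed.

Lemma smooth_at_prod X (p : X) (I : Type) (r : seq I) (P : pred I) (f : I -> X -> R) :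
  (forall i, P i -> smooth_at p (f i)) -> smooth_at p (fun q => \prod_(i <- r | P i) f i q).
Proof.
move=> sf; elim: r => [|i r IH].
  by apply: smooth_at_ext (smooth_at_cst p 1); apply: near_all => q; rewrite big_nil.
have [Pi|nPi] := boolP (P i).
  apply: smooth_at_ext (smooth_atM (sf i Pi) IH).
  by apply: near_all => q; rewrite big_cons Pi.
by apply: smooth_at_ext IH; apply: near_all => q; rewrite big_cons (negbTE nPi).
Qed.

Lemma smooth_at_continuous X (p : X) f : smooth_at p f -> f q @[q --> p] --> f p.
Proof.
move=> [n [s [w [gs cw E]]]].
have Ep := nbhs_singleton E.
have H : w (\row_i s i q) @[q --> p] --> f p; last first.
  by move=> U /H HU; apply: filterS2 E HU => q /= ->.
rewrite Ep; apply: (@cvg_comp _ _ _ (fun q => \row_i s i q) w _ (nbhs (\row_i s i p)));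
  last exact: Cinf_continuous.
apply/(cvgrPdist_lt (FF := nbhs_filter p)) => e e0.
have : \forall q \near p, forall i, `|s i p - s i q| < e.
  apply: (@filter_forall _ _ _ _ (nbhs_filter p)) => i.
  have : \forall y \near s i p, `|s i p - y| < e by apply/nbhs_normP; exists e.
  exact: (gen_continuous (gs i) (x := p)).
apply: filterS => q H; rewrite [ltLHS]mx_normrE; apply: bigmax_lt => // -[a i] _ /=.
by rewrite !mxE.
Qed.

Lemma smooth_atV X (p : X) f : smooth_at p f -> f p != 0 ->
  smooth_at p (fun q => (f q)^-1).
Proof.
move=> sf f0; have [c [sc cE]] := recip_exists f0.
apply: smooth_at_ext (smooth_at1 sc sf).
exact: (smooth_at_continuous sf) cE.
Qed.

Lemma smooth_at_neq0 X (p : X) f : smooth_at p f -> f p != 0 ->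
  \forall q \near (p : X), f q != 0.
Proof.
move=> sf f0.
have : \forall y \near f p, y != 0.
  apply: open_nbhs_nbhs; split; last exact: f0.
  by have := @open_neq R (0 : R).
exact: (smooth_at_continuous sf).
Qed.

(* A germ at [p] is always the germ of a global smooth function, because the
   local model [w] is defined on the whole of R^n. *)
Lemma smooth_at_global X (p : X) f : smooth_at p f ->
  exists2 g, smoothf g & \forall q \near (p : X), f q = g q.
Proof.
move=> [n [s [w [gs cw E]]]]; exists (fun q => w (\row_i s i q)) => //.
by apply: smoothf_comp => // i; exact: smoothf_gen.
Qed.

(** Vanishing is required on a neighbourhood of every point outside [U], boundary points included,
    so that a function smooth only on [U] becomes globally smooth after multiplication. In the
    induction on neighbourhoods, products handle intersections and a cutoff of a generator handles
    its preimages. *)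
Lemma smooth_bump X (p : X) (U : set X) : nbhs p U ->
  exists b : X -> R, [/\ smoothf b, \forall q \near (p : X), b q = 1
    & forall q, ~ U q -> \forall q' \near (q : X), b q' = 0].
Proof.
move: U; apply: nbhs_gen_ind.
- move=> U V UV [b [sb b1 b0]]; exists b; split => // q nVq.
  by apply: b0 => /UV.
- exists (fun _ => 1); split; [by move=> q; exact: smooth_at_cst|exact: near_all|].
  by move=> q [].
- move=> U V [b [sb b1 b0]] [c [sc c1 c0]]; exists (fun q => b q * c q); split.
  + by move=> q; apply: smooth_atM; [exact: sb|exact: sc].
  + by apply: filterS2 b1 c1 => q -> ->; rewrite mulr1.
  + move=> q /not_andP[/b0|/c0]; apply: filterS => q' ->; by rewrite ?mul0r ?mulr0.
- move=> f A gf oA Afp.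
  have /nbhs_normP[r r0 rA] : nbhs (f p) A by exact: open_nbhs_nbhs.
  (* The cutoff is supported in half the radius, so that it still vanishes near a point whose value
     is at distance exactly [r]. *)
  have r20 : 0 < r / 2 by rewrite divr_gt0.
  have [c [sc c1 c0 _]] := cutoff_exists r20.
  have sd : smoothf (fun q => f q - f p).
    by move=> q; apply: smooth_atB; [exact: smoothf_gen|exact: smooth_at_cst].
  exists (fun q => c (f q - f p)); split.
  + by move=> q; apply: smooth_at1 => //; exact: sd.
  + have : \forall y \near f p, `|f p - y| < r / 2 / 2.
      by apply/nbhs_normP; exists (r / 2 / 2) => //=; rewrite divr_gt0.
    move/(gen_continuous gf); apply: (@filterS _ _ (nbhs_filter p)) => q /ltW H.
    by apply: c1; rewrite distrC.
  + move=> q nq.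
    have rq : r <= `|f q - f p|.
      by rewrite leNgt; apply/negP => H; apply: nq; apply: rA; rewrite /= distrC.
    have : \forall y \near f q, `|f q - y| < r / 2.
      by apply/nbhs_normP; exists (r / 2).
    move/(gen_continuous gf); apply: (@filterS _ _ (nbhs_filter q)) => q' /= H; apply: c0.
    have := ler_normD (f q - f q') (f q' - f p); rewrite addrA subrK; lra.
Qed.

End SmoothFunctions.

(** * Smooth maps, products, subspaces and Euclidean space *)

Section SmoothMaps.
Context (R : realType).
Implicit Types X Y Z : space R.

Definition smooth_map_at X Y (p : X) (phi : X -> Y) : Prop :=
  forall f : Y -> R, smooth_at (phi p) f -> smooth_at p (f \o phi).

Lemma gen_cvg X Y (p : X) (phi : X -> Y) :
  (forall f : Y -> R, gen f -> smooth_at p (f \o phi)) -> phi q @[q --> p] --> phi p.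
Proof.
move=> H U; move: U; apply: nbhs_gen_ind.
- by move=> U V UV; apply: (@filterS _ _ (nbhs_filter p)) => q /UV.
- exact: (@filterT _ _ (nbhs_filter p)).
- by move=> U V PU PV; exact: (@filterI _ _ (nbhs_filter p)).
- move=> f A gf oA Af; have := smooth_at_continuous (H f gf); apply.
  exact: open_nbhs_nbhs.
Qed.

(** Any smooth function is locally a smooth expression in generators, so testing generators
    suffices; continuity, needed to pull the local model back, also follows from generators
    alone. *)
Lemma smooth_map_atP X Y (p : X) (phi : X -> Y) :
  (forall f : Y -> R, gen f -> smooth_at p (f \o phi)) <-> smooth_map_at p phi.
Proof.
split=> [H f [n [s [w [gs cw E]]]]|H f gf]; last first.
  by apply: H; exact: smoothf_gen.
have := smooth_at_comp (fun i => H (s i) (gs i)) cw; apply: smooth_at_ext.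
by apply: (@filterS _ _ (nbhs_filter p) _ _ _ (gen_cvg H E)) => q /= ->.
Qed.

Lemma smooth_map_at_cvg X Y (p : X) (phi : X -> Y) : smooth_map_at p phi ->
  phi q @[q --> p] --> phi p.
Proof. by move/smooth_map_atP; exact: gen_cvg. Qed.

Lemma smoothP X Y (phi : X -> Y) : smooth phi <-> forall p, smooth_map_at p phi.
Proof.
split=> [H p|H f sf p]; last by apply: H; exact: sf.
by apply/smooth_map_atP => f /smoothf_gen/H; apply.
Qed.

Lemma smooth_continuous X Y (phi : X -> Y) p : smooth phi -> phi q @[q --> p] --> phi p.
Proof. by move=> /smoothP/(_ p)/smooth_map_at_cvg. Qed.

Lemma smooth_map_at_ext X Y (p : X) (phi psi : X -> Y) :
  (\forall q \near (p : X), phi q = psi q) -> smooth_map_at p phi -> smooth_map_at p psi.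
Proof.
move=> E H f; rewrite -(nbhs_singleton E) => /H; apply: smooth_at_ext.
by apply: filterS E => q /= ->.
Qed.

Lemma smooth_map_at_comp X Y Z (p : X) (phi : X -> Y) (psi : Y -> Z) :
  smooth_map_at p phi -> smooth_map_at (phi p) psi -> smooth_map_at p (psi \o phi).
Proof. by move=> H1 H2 f sf; apply: (H1 (f \o psi)); apply: H2. Qed.

Lemma smooth_comp X Y Z (phi : X -> Y) (psi : Y -> Z) :
  smooth phi -> smooth psi -> smooth (psi \o phi).
Proof. by move=> H1 H2 f sf; apply: (H1 (f \o psi)); apply: H2. Qed.

Lemma smooth_id X : smooth (@id X).
Proof. by []. Qed.

Lemma smooth_cst X Y (y : Y) : smooth (fun _ : X => y).
Proof. by move=> f _ p; exact: smooth_at_cst. Qed.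

Lemma smooth_fst X Y : smooth (fst : prod_space X Y -> X).
Proof.
apply/smoothP => p; apply/smooth_map_atP => f gf; apply: (@smoothf_gen R (prod_space X Y)).
by left; exists f.
Qed.

Lemma smooth_snd X Y : smooth (snd : prod_space X Y -> Y).
Proof.
apply/smoothP => p; apply/smooth_map_atP => f gf; apply: (@smoothf_gen R (prod_space X Y)).
by right; exists f.
Qed.

Lemma smooth_map_at_pair X Y Z (p : X) (phi : X -> Y) (psi : X -> Z) :
  smooth_map_at p phi -> smooth_map_at p psi ->
  @smooth_map_at X (prod_space Y Z) p (fun q => (phi q, psi q)).
Proof.
move=> /smooth_map_atP H1 /smooth_map_atP H2; apply/smooth_map_atP => f.
by case=> -[g gg <-]; [exact: H1|exact: H2].
Qed.

Lemma smooth_pair X Y Z (phi : X -> Y) (psi : X -> Z) :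
  smooth phi -> smooth psi -> @smooth R X (prod_space Y Z) (fun q => (phi q, psi q)).
Proof.
by move=> /smoothP H1 /smoothP H2; apply/smoothP => p; exact: smooth_map_at_pair.
Qed.

Lemma smooth_map_at_initial (T : Type) X Y (i : T -> Y) (p : X) (phi : X -> initial_space i) :
  @smooth_map_at X Y p (i \o phi) <-> smooth_map_at p phi.
Proof.
split=> [/smooth_map_atP H|/smooth_map_atP H]; apply/smooth_map_atP => f.
  by case=> g gg <-; exact: H.
by move=> gf; apply: (H (f \o i)); exists f.
Qed.

Lemma smooth_initial (T : Type) X Y (i : T -> Y) (phi : X -> initial_space i) :
  @smooth R X Y (i \o phi) <-> smooth phi.
Proof.
split=> /smoothP H; apply/smoothP => p.
  exact: (proj1 (smooth_map_at_initial p phi) (H p)).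
exact: (proj2 (smooth_map_at_initial p phi) (H p)).
Qed.

Lemma smooth_initial_map (T : Type) Y (i : T -> Y) : smooth (i : initial_space i -> Y).
Proof. exact: (proj2 (smooth_initial (@id (initial_space i))) (@smooth_id _)). Qed.

Lemma smooth_sval X (P : set X) : smooth (fun q : sub P => sval q).
Proof. exact: smooth_initial_map. Qed.

(** The local model of [f] is an expression in generators pulled back from [Y]; the same expression,
    read on [Y], is the extension. *)
Lemma initial_extend (T : Type) Y (i : T -> Y) (p : initial_space i) (f : T -> R) :
  @smooth_at R (initial_space i) p f ->
  exists2 g : Y -> R, smoothf g & \forall q \near (p : initial_space i), f q = g (i q).
Proof.
move=> [n [s [w [gs cw E]]]].
have /choice[h hP] : forall k, exists h : Y -> R, gen h /\ h \o i = s k.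
  by move=> k; case: (gs k) => h gh <-; exists h.
exists (fun y => w (\row_k h k y)).
  by apply: smoothf_comp => // k; apply: smoothf_gen; case: (hP k).
apply: filterS E => q ->; congr w; apply/rowP => k; rewrite !mxE.
by case: (hP k) => _ <-.
Qed.

(** This links the topology induced by the coordinate functions with the norm topology, in which the
    calculus takes place. *)
Lemma euclid_nbhs n (x : 'rV[R]_n) (U : set 'rV[R]_n) :
  @nbhs _ (pt (euclid R n)) (x : euclid R n) U <-> nbhs x U.
Proof.
split.
  move: U; apply: (@nbhs_gen_ind R (euclid R n)).
  - by move=> U V UV; apply: filterS.
  - exact: (@filterT _ _ (nbhs_filter x)).
  - by move=> U V PU PV; exact: (@filterI _ _ (nbhs_filter x)).
  - move=> f A [i ->] oA Ax; have := @Cinf_continuous _ n _ (@Cinf_coord R n i) x A.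
    by apply; exact: open_nbhs_nbhs.
move=> /nbhs_normP[r r0 rU].
have : \forall y \near (x : euclid R n), forall i : 'I_n, `|(x : 'rV[R]_n) 0 i - (y : 'rV[R]_n) 0 i| < r.
  apply: (@filter_forall _ _ _ _ (nbhs_filter (x : euclid R n))) => i.
  have gi : gen ((fun y : 'rV[R]_n => y 0 i) : euclid R n -> R) by exists i.
  have : \forall z \near (x 0 i), `|x 0 i - z| < r by apply/nbhs_normP; exists r.
  exact: (gen_continuous gi (x := (x : euclid R n))).
apply: (@filterS _ _ (nbhs_filter (x : euclid R n))) => y H; apply: rU => /=.
rewrite [ltLHS]mx_normrE; apply: bigmax_lt => // -[a i] _ /=.
by rewrite !mxE (ord1 a).
Qed.

Lemma euclid_smooth n (w : 'rV[R]_n -> R) x : Cinf w -> @smooth_at R (euclid R n) x w.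
Proof.
move=> cw; exists n, (fun i (y : 'rV[R]_n) => y 0 i), w; split=> //; first by move=> i; exists i.
by apply: near_all => y; congr w; apply/rowP => i; rewrite mxE.
Qed.

Lemma euclid_smooth_at n (f : 'rV[R]_n -> R) x : @smooth_at R (euclid R n) x f ->
  exists2 w : 'rV[R]_n -> R, Cinf w & \forall y \near (x : 'rV[R]_n), f y = w y.
Proof.
move=> [m [s [w [gs cw E]]]].
have /choice[i iP] : forall k, exists i : 'I_n, s k = fun y : 'rV[R]_n => y 0 i.
  by move=> k; case: (gs k) => i ->; exists i.
exists (fun y => w (\row_k y 0 (i k))).
  by apply: Cinf_comp => // k; exact: Cinf_coord.
move/euclid_nbhs: E; apply: (@filterS _ _ (nbhs_filter (x : 'rV[R]_n))) => y ->; congr w; apply/rowP => k.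
by rewrite !mxE iP.
Qed.

End SmoothMaps.

(** * Tangent vectors *)

Section Derivations.
Context (R : realType).
Implicit Types X Y Z : space R.

Definition is_der X (p : X) (D : (X -> R) -> R) : Prop :=
  (forall (a : R) (f g : X -> R), smoothf f -> smoothf g ->
     D (fun x => a * f x + g x) = a * D f + D g) /\
  (forall f g : X -> R, smoothf f -> smoothf g ->
     D (fun x => f x * g x) = f p * D g + g p * D f).

Lemma tangentP X (p : X) (v : tangent p) :
  (forall f, ~ smoothf f -> sublv v f = 0) /\ is_der p (sublv v).
Proof. by have /asboolP := valP v. Qed.

Lemma tangent_eq X (p : X) (v w : tangent p) :
  (forall f, smoothf f -> sublv v f = sublv w f) -> v = w.
Proof.
move=> H; apply: val_inj; apply/funext => f.
have [sf|nsf] := pselect (smoothf f); first exact: H.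
rewrite -[val v]/(sublv v) -[val w]/(sublv w).
by rewrite (proj1 (tangentP v)) // (proj1 (tangentP w)).
Qed.

Lemma tangent_make X (p : X) (D : (X -> R) -> R) : is_der p D ->
  exists v : tangent p, forall f, smoothf f -> sublv v f = D f.
Proof.
move=> [DD DM]; pose D' (f : X -> R) : R^o := if `[< smoothf f >] then D f else 0.
have E f : smoothf f -> D' f = D f by move=> sf; rewrite /D' asboolT.
have H : D' \in der_pred p.
  apply/asboolP; split=> [f nsf|]; first by rewrite /D' asboolF.
  split=> [a f g sf sg|f g sf sg].
    rewrite !E ?DD //= => q; apply: smooth_atD => //.
    by apply: smooth_atM; [exact: smooth_at_cst|exact: sf].
    exact: sg.
  rewrite !E ?DM //= => q; apply: smooth_atM; [exact: sf|exact: sg].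
by exists (Subl H) => f sf; rewrite /= E.
Qed.

(** Extends a tangent vector to germs by choosing a global representative; by [dvE] the choice is
    immaterial. The default 0 occurs only for functions that agree near [p] with no smooth
    function. *)
Definition dv X (p : X) (v : tangent p) (f : X -> R) : R :=
  xget 0 [set r : R | exists2 g : X -> R, smoothf g &
    (\forall q \near (p : X), f q = g q) /\ r = sublv v g].

Section Calculus.
Context (X : space R) (p : X).
Implicit Types (v w : tangent p) (f g : X -> R).

Lemma smoothfM f g : smoothf f -> smoothf g -> smoothf (fun q => f q * g q).
Proof. by move=> sf sg q; apply: smooth_atM; [exact: sf|exact: sg]. Qed.

Lemma smoothfD f g : smoothf f -> smoothf g -> smoothf (fun q => f q + g q).
Proof. by move=> sf sg q; apply: smooth_atD; [exact: sf|exact: sg]. Qed.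

Lemma smoothf_cst (c : R) : smoothf (fun _ : X => c).
Proof. by move=> q; exact: smooth_at_cst. Qed.

Lemma der_cst v c : sublv v (fun _ => c) = 0.
Proof.
have [_ [vD vM]] := tangentP v.
have v1 : sublv v (fun _ => 1) = 0.
  have := vM (fun _ => 1) (fun _ => 1) (@smoothf_cst 1) (@smoothf_cst 1).
  by rewrite !mul1r => /eqP; rewrite -subr_eq0 opprD addrA subrr sub0r oppr_eq0 => /eqP.
have := vD c (fun _ => 1) (fun _ => 0) (@smoothf_cst 1) (@smoothf_cst 0).
have := vD 0 (fun _ => 0) (fun _ => 0) (@smoothf_cst 0) (@smoothf_cst 0).
by rewrite mul0r addr0 mulr1 addr0 v1 mulr0 add0r mul0r add0r => _ ->;
   have := vD (-1) (fun _ => 1) (fun _ => 1) (@smoothf_cst 1) (@smoothf_cst 1);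
   rewrite mulr1 addNr v1 mulr0 addr0.
Qed.

(** The difference of [f] and [g] times a bump supported where they agree is identically zero, while
    the bump is 1 at [p]; the Leibniz rule then gives the claim. *)
Lemma der_local v f g : smoothf f -> smoothf g ->
  (\forall q \near (p : X), f q = g q) -> sublv v f = sublv v g.
Proof.
move=> sf sg E; have [_ [vD vM]] := tangentP v.
have [b [sb b1 b0]] := smooth_bump E.
have bp := nbhs_singleton b1.
pose h q := -1 * g q + f q.
have sh : smoothf h by apply: smoothfD => //; apply: smoothfM => //; exact: smoothf_cst.
have hb : (fun q => h q * b q) = fun _ => 0.
  apply/funext => q; have [fg|nfg] := pselect (f q = g q).
    by rewrite /h fg mulN1r addNr mul0r.
  by rewrite (nbhs_singleton (b0 q nfg)) mulr0.
have := vM h b sh sb; rewrite hb der_cst bp mul1r.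
rewrite {1}/h (nbhs_singleton E) mulN1r addNr mul0r add0r.
rewrite /h vD // mulN1r addrC => /esym/eqP; rewrite subr_eq0 => /eqP //.
Qed.

Lemma dvE v f g : smoothf g -> (\forall q \near (p : X), f q = g q) ->
  dv v f = sublv v g.
Proof.
move=> sg E; rewrite /dv; case: xgetP => [r -> [h sh [E' ->]]|/(_ (sublv v g))[]].
  by apply: der_local => //; apply: filterS2 E E' => q -> ->.
by exists g.
Qed.

Lemma dv_smooth v f : smoothf f -> dv v f = sublv v f.
Proof. by move=> sf; apply: dvE => //; exact: near_all. Qed.

Lemma dv_near v f g : (\forall q \near (p : X), f q = g q) -> dv v f = dv v g.
Proof.
move=> E; rewrite /dv; congr xget; apply/seteqP; split=> r [h sh [E' ->]];
  by exists h => //; split => //; apply: filterS2 E E' => q -> ->.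
Qed.

Lemma dv_cst v c : dv v (fun _ => c) = 0.
Proof. by rewrite dv_smooth ?der_cst //; exact: smoothf_cst. Qed.

Lemma dvD v f g : smooth_at p f -> smooth_at p g ->
  dv v (fun q => f q + g q) = dv v f + dv v g.
Proof.
move=> /smooth_at_global[f' sf Ef] /smooth_at_global[g' sg Eg].
have [_ [vD vM]] := tangentP v.
rewrite (dvE v sf Ef) (dvE v sg Eg) (@dvE _ _ (fun q => 1 * f' q + g' q)).
- by rewrite vD // mul1r.
- by apply: smoothfD => //; apply: smoothfM => //; exact: smoothf_cst.
- by apply: filterS2 Ef Eg => q -> ->; rewrite mul1r.
Qed.

Lemma dvM v f g : smooth_at p f -> smooth_at p g ->
  dv v (fun q => f q * g q) = f p * dv v g + g p * dv v f.
Proof.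
move=> /smooth_at_global[f' sf Ef] /smooth_at_global[g' sg Eg].
have [_ [vD vM]] := tangentP v.
rewrite (dvE v sf Ef) (dvE v sg Eg) (@dvE _ _ (fun q => f' q * g' q)).
- by rewrite vM // (nbhs_singleton Ef) (nbhs_singleton Eg).
- exact: smoothfM.
- by apply: filterS2 Ef Eg => q -> ->.
Qed.

Lemma dvZ v c f : smooth_at p f -> dv v (fun q => c * f q) = c * dv v f.
Proof.
by move=> sf; rewrite dvM ?dv_cst ?mulr0 ?addr0 //; exact: smooth_at_cst.
Qed.

Lemma dvN v f : smooth_at p f -> dv v (fun q => - f q) = - dv v f.
Proof.
move=> sf; rewrite -mulN1r -dvZ //; apply: dv_near; apply: near_all => q.
by rewrite mulN1r.
Qed.

Lemma dvB v f g : smooth_at p f -> smooth_at p g ->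
  dv v (fun q => f q - g q) = dv v f - dv v g.
Proof. by move=> sf sg; rewrite dvD ?dvN //; exact: smooth_atN. Qed.

Lemma dv_sum v (I : Type) (r : seq I) (f : I -> X -> R) :
  (forall i, smooth_at p (f i)) ->
  dv v (fun q => \sum_(i <- r) f i q) = \sum_(i <- r) dv v (f i).
Proof.
move=> sf; elim: r => [|i r IH].
  rewrite big_nil -[RHS](dv_cst v 0); apply: dv_near.
  by apply: near_all => q; rewrite big_nil.
rewrite big_cons -IH -dvD //; last exact: smooth_at_sum.
by apply: dv_near; apply: near_all => q; rewrite big_cons.
Qed.

(** In Hadamard's expansion at [a] the linear factors vanish at [p], so after differentiation only
    the values at [a] of the coefficients survive. *)
Lemma dv_comp v m (u : 'I_m -> X -> R) (w : 'rV[R]_m -> R) :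
  (forall i, smooth_at p (u i)) -> Cinf w ->
  dv v (fun q => w (\row_i u i q)) =
  \sum_i pd i (w : _ -> R^o) (\row_i u i p) * dv v (u i).
Proof.
move=> su cw; set a := \row_i u i p.
have [g [cg gE ga]] := hadamard a cw.
have sg i : smooth_at p (fun q => g i (\row_i u i q)) by exact: smooth_at_comp.
have sua i : smooth_at p (fun q => u i q - u i p).
  by apply: smooth_atB => //; exact: smooth_at_cst.
have -> : dv v (fun q => w (\row_i u i q)) =
   dv v (fun q => w a + \sum_i (u i q - u i p) * g i (\row_i u i q)).
  apply: dv_near; apply: near_all => q; rewrite [LHS]gE; congr (_ + _).
  by apply: eq_bigr => i _; rewrite !mxE.
rewrite dvD ?dv_cst ?add0r; last 2 first.
- exact: smooth_at_cst.
- by apply: smooth_at_sum => i _; exact: smooth_atM.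
rewrite dv_sum => [|i]; last exact: smooth_atM.
apply: eq_bigr => i _; rewrite dvM // subrr mul0r add0r ga; congr (_ * _).
by rewrite dvB ?dv_cst ?subr0 //; exact: smooth_at_cst.
Qed.

Lemma sublv_lin a v w f : sublv (a *: v + w) f = a * sublv v f + sublv w f.
Proof. by []. Qed.

Lemma dv_lin a v w f : dv (a *: v + w) f = a * dv v f + dv w f.
Proof.
have [[g sg E]|H] := pselect (exists2 g, smoothf g & \forall q \near (p : X), f q = g q).
  by rewrite !(dvE _ sg E) sublv_lin.
have N (u : tangent p) : dv u f = 0.
  by rewrite /dv; case: xgetP => // r _ [g sg [E _]]; case: H; exists g.
by rewrite !N mulr0 addr0.
Qed.

Lemma dv0 f : dv (0 : tangent p) f = 0.
Proof. by have := dv_lin (-1) 0 0 f; rewrite scaler0 addr0 mulN1r addNr. Qed.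

Lemma dv_add v w f : dv (v + w) f = dv v f + dv w f.
Proof. by rewrite -[v in LHS]scale1r dv_lin mul1r. Qed.

Lemma dv_scale a v f : dv (a *: v) f = a * dv v f.
Proof. by rewrite -[a *: v]addr0 dv_lin dv0 addr0. Qed.

Lemma dv_opp v f : dv (- v) f = - dv v f.
Proof. by rewrite -scaleN1r dv_scale mulN1r. Qed.

Lemma dv_sumv (I : Type) (r : seq I) (v : I -> tangent p) f :
  dv (\sum_(i <- r) v i) f = \sum_(i <- r) dv (v i) f.
Proof.
by elim: r => [|i r IH]; rewrite ?big_nil ?dv0 // !big_cons dv_add IH.
Qed.

Lemma tangent_gen_eq v w : (forall f, gen f -> dv v f = dv w f) -> v = w.
Proof.
move=> H; apply: tangent_eq => f sf.
have [n [s [u [gs cu E]]]] := sf p.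
rewrite -!dv_smooth // !(dv_near _ E) !dv_comp //; try by move=> i; apply: smoothf_gen.
by apply: eq_bigr => i _; rewrite H.
Qed.
End Calculus.

Lemma der_make X (p : X) (D : (X -> R) -> R) :
  (forall a f g, smoothf f -> smoothf g -> D (fun x => a * f x + g x) = a * D f + D g) ->
  (forall f g, smoothf f -> smoothf g -> D (fun x => f x * g x) = f p * D g + g p * D f) ->
  exists v : tangent p, forall f, smoothf f -> dv v f = D f.
Proof.
move=> DD DM; have [v vE] := @tangent_make X p D (conj DD DM).
by exists v => f sf; rewrite dv_smooth ?vE.
Qed.

Lemma push_at X Y (p : X) (phi : X -> Y) (v : tangent p) : smooth_map_at p phi ->
  exists w : tangent (phi p), forall f, smooth_at (phi p) f -> dv w f = dv v (f \o phi).
Proof.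
move=> sphi.
have sc f : smoothf f -> smooth_at p (f \o phi) by move=> sf; apply: sphi; exact: sf.
have [|f g sf sg|w wE] := @der_make Y (phi p) (fun f => dv v (f \o phi)).
- move=> a f g sf sg; by rewrite -(dvZ v a (sc f sf)) -(dvD v (smooth_atZ a (sc f sf)) (sc g sg)).
- by rewrite -(dvM v (sc f sf) (sc g sg)).
exists w => f /smooth_at_global[g sg E]; rewrite (dv_near w E) wE //.
apply: dv_near; have := smooth_map_at_cvg sphi E.
by apply: (@filterS _ _ (nbhs_filter p)) => q /= ->.
Qed.

(** The proof also shows that the [insubd] in [dmap] does not fall back on its default when [phi] is
    smooth. *)
Lemma dmapE X Y (phi : X -> Y) (p : X) (v : tangent p) f : smooth phi ->
  smooth_at (phi p) f -> dv (dmap phi v) f = dv v (f \o phi).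
Proof.
move=> sphi sf; have sphip := proj1 (smoothP phi) sphi p.
have [w wE] := push_at v sphip.
suff -> : dmap phi v = w by exact: wE.
apply: val_inj; rewrite /dmap insubdK.
  apply/funext => h; case: ifP => [/asboolP sh|/asboolP nsh].
    rewrite -[val w]/(sublv w) -(dv_smooth v (sphi _ sh)) -(dv_smooth w sh) wE //.
    exact: sh.
  by rewrite -[val w]/(sublv w) (proj1 (tangentP w)).
apply/asboolP; have [_ [vD vM]] := tangentP v.
split=> [h nsh|]; first by rewrite asboolF.
split=> [a h k sh sk|h k sh sk].
  rewrite !asboolT //; first exact: vD (sphi _ sh) (sphi _ sk).
  by apply: smoothfD => //; apply: smoothfM => //; exact: smoothf_cst.
rewrite !asboolT //; first exact: vM (sphi _ sh) (sphi _ sk).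
exact: smoothfM.
Qed.

Lemma dmapEs X Y (phi : X -> Y) (p : X) (v : tangent p) f : smooth phi ->
  smoothf f -> dv (dmap phi v) f = dv v (f \o phi).
Proof. by move=> sphi sf; apply: dmapE => //; exact: sf. Qed.

Lemma dv_dmap X Y (phi : X -> Y) (p : X) (v : tangent p) (w : tangent (phi p)) :
  smooth phi -> (forall f, smoothf f -> dv v (f \o phi) = dv w f) -> dmap phi v = w.
Proof.
move=> sphi H; apply: tangent_gen_eq => f gf; have sf := smoothf_gen gf.
by rewrite dmapEs // H.
Qed.

Lemma dmap_lin X Y (phi : X -> Y) (p : X) : smooth phi -> linear (@dmap R X Y phi p).
Proof.
move=> sphi a v w; apply: dv_dmap => // f sf.
by rewrite !dv_lin !dmapEs.
Qed.

Lemma dmap_comp X Y Z (phi : X -> Y) (psi : Y -> Z) (p : X) (v : tangent p) :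
  smooth phi -> smooth psi -> dmap (psi \o phi) v = dmap psi (dmap phi v).
Proof.
move=> sphi spsi; apply: dv_dmap; first exact: smooth_comp.
by move=> f sf; rewrite (dmapEs _ spsi sf) (dmapEs _ sphi (spsi _ sf)).
Qed.

Lemma dmap_id X (p : X) (v : tangent p) : dmap (@id X) v = v.
Proof. by apply: dv_dmap. Qed.

(** A vector that kills every function vanishing near [p] on the subspace descends to it: a function
    on the subspace is differentiated through any extension, and two extensions have the same
    derivative. *)
Lemma tangent_initial (T : Type) Y (i : T -> Y) (p : initial_space i) (v : tangent (i p)) :
  (forall f, smoothf f -> (\forall q \near (p : initial_space i), f (i q) = 0) -> dv v f = 0) ->
  exists z : tangent p, dmap (i : initial_space i -> Y) z = v.
Proof.
move=> H; pose X := initial_space i.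
have ex (f : X -> R) : smoothf f -> exists g : Y -> R, smoothf g /\
   \forall q \near (p : X), f q = g (i q).
  by move=> sf; have [g sg E] := initial_extend (sf p); exists g.
pose ext (f : X -> R) : Y -> R := xget (fun=> 0) [set g | smoothf g /\
   \forall q \near (p : X), f q = g (i q)].
have extP f : smoothf f -> smoothf (ext f) /\ \forall q \near (p : X), f q = ext f (i q).
  by move=> /ex[g gP]; apply: (xgetPex (fun=> 0) (P := [set g | smoothf g /\
   \forall q \near (p : X), f q = g (i q)])); exists g.
have key (f : X -> R) (g : Y -> R) : smoothf g -> smoothf f -> (\forall q \near (p : X), f q = g (i q)) -> dv v (ext f) = dv v g.
  move=> sg /extP[se Ee] E; apply/eqP; rewrite -subr_eq0; apply/eqP.
  rewrite -dvB; [|exact: se|exact: sg]; apply: H.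
    by move=> q; apply: smooth_atB; [exact: se|exact: sg].
  by apply: filterS2 E Ee => q -> <-; rewrite subrr.
have [a f g sf sg|f g sf sg|z zE] := @der_make X p (fun f => dv v (ext f)).
- have [sef Ef] := extP f sf; have [seg Eg] := extP g sg.
  rewrite (@key _ (fun y => a * ext f y + ext g y)).
  + by rewrite dvD ?dvZ //; [exact: sef|apply: smooth_atZ; exact: sef|exact: seg].
  + by apply: smoothfD => //; apply: smoothfM => //; exact: smoothf_cst.
  + by apply: smoothfD => //; apply: smoothfM => //; exact: smoothf_cst.
  + by apply: filterS2 Ef Eg => q -> ->.
- have [sef Ef] := extP f sf; have [seg Eg] := extP g sg.
  rewrite (@key _ (fun y => ext f y * ext g y)).
  + by rewrite dvM ?(nbhs_singleton Ef) ?(nbhs_singleton Eg) //; [exact: sef|exact: seg].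
  + exact: smoothfM.
  + exact: smoothfM.
  + by apply: filterS2 Ef Eg => q -> ->.
exists z; apply: dv_dmap => [|f sf]; first exact: smooth_initial_map.
rewrite zE; last by apply: smooth_initial_map.
apply: key => //; first by apply: smooth_initial_map.
exact: near_all.
Qed.

Lemma dmap_initial_inj (T : Type) Y (i : T -> Y) (p : initial_space i) (v w : tangent p) :
  dmap (i : initial_space i -> Y) v = dmap (i : initial_space i -> Y) w -> v = w.
Proof.
move=> E; apply: tangent_gen_eq => f -[g gg <-].
have si := @smooth_initial_map R T Y i.
have sg := smoothf_gen gg.
by exact: (etrans (esym (dmapEs v si sg)) (etrans (congr1 (fun t => dv t g) E) (dmapEs w si sg))).
Qed.

Lemma tangent_pair X Y (p : X) (q : Y) (v : tangent p) (w : tangent q) :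
  exists z : @tangent R (prod_space X Y) (p, q), [/\ dmap (fst : prod_space X Y -> X) z = v,
    dmap (snd : prod_space X Y -> Y) z = w
    & forall f, @smooth_at R (prod_space X Y) (p, q) f ->
       dv z f = dv v (fun x => f (x, q)) + dv w (fun y => f (p, y))].
Proof.
pose i1 (x : X) : prod_space X Y := (x, q).
pose i2 (y : Y) : prod_space X Y := (p, y).
have s1 : smooth i1 by apply: smooth_pair; [exact: smooth_id|exact: smooth_cst].
have s2 : smooth i2 by apply: smooth_pair; [exact: smooth_cst|exact: smooth_id].
exists (dmap i1 v + dmap i2 w); split.
  apply: dv_dmap => [|f sf]; first exact: smooth_fst.
  have sf1 : smoothf (f \o (fst : prod_space X Y -> X)) by apply: smooth_fst.
  rewrite dv_add (dmapEs _ s1) // (dmapEs _ s2) //.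
  by rewrite -[X in _ + X]/(dv w (fun _ => f p)) dv_cst addr0.
  apply: dv_dmap => [|f sf]; first exact: smooth_snd.
  have sf1 : smoothf (f \o (snd : prod_space X Y -> Y)) by apply: smooth_snd.
  rewrite dv_add (dmapEs _ s1) // (dmapEs _ s2) //.
  by rewrite -[X in X + _]/(dv v (fun _ => f q)) dv_cst add0r.
move=> f sf; rewrite dv_add (dmapE v s1) ?(dmapE w s2) //.
Qed.

Lemma dmap_pair_inj X Y (p : prod_space X Y) (v w : tangent p) :
  dmap (fst : prod_space X Y -> X) v = dmap (fst : prod_space X Y -> X) w ->
  dmap (snd : prod_space X Y -> Y) v = dmap (snd : prod_space X Y -> Y) w -> v = w.
Proof.
move=> E1 E2; apply: tangent_gen_eq => f -[] [g gg <-]; have sg := smoothf_gen gg.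
  have s1 := @smooth_fst R X Y.
  exact: (etrans (esym (dmapEs v s1 sg)) (etrans (congr1 (fun t => dv t g) E1) (dmapEs w s1 sg))).
have s2 := @smooth_snd R X Y.
exact: (etrans (esym (dmapEs v s2 sg)) (etrans (congr1 (fun t => dv t g) E2) (dmapEs w s2 sg))).
Qed.

End Derivations.

(** * Charts, coordinate fields and parametrizations *)

Section Charts.
Context (R : realType).
Implicit Types X Y Z : space R.

Lemma shift_cvg n (a z : 'rV[R]_n) : a + y @[y --> z] --> a + z.
Proof.
move=> U /nbhs_normP[e e0 eU].
suff : \forall y \near z, U (a + y) by [].
apply/nbhs_normP; exists e => // y /= H; apply: eU => /=.
by rewrite opprD addrACA subrr add0r.
Qed.

Lemma derive_translate n (w : 'rV[R]_n -> R^o) (a x v : 'rV[R]_n) :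
  'D_v (fun z => w (a + z) : R^o) x = 'D_v w (a + x).
Proof.
rewrite /derive.
suff -> : (fun h : R => h^-1 *: (((fun z => w (a + z) : R^o) \o shift x) (h *: v) - w (a + x))) =
  (fun h : R => h^-1 *: ((w \o shift (a + x)) (h *: v) - w (a + x))) by [].
by apply/funext => h /=; rewrite addrCA.
Qed.

Lemma near_initial (T : Type) Y (i : T -> Y) (p : initial_space i) (A : set T) :
  (\forall q \near (p : initial_space i), A q) ->
  \forall y \near (i p : Y), forall q, i q = y -> A q.
Proof.
pose X := initial_space i.
move: A; apply: (@nbhs_gen_ind R X).
- move=> U V UV; apply: filterS => y H q /H; exact: UV.
- exact: near_all.
- by move=> U V; apply: filterS2 => y H1 H2 q qy; split; [exact: H1|exact: H2].
- move=> f A [h gh <-] oA Af.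
  have : \forall z \near h (i p), A z by exact: open_nbhs_nbhs.
  move/(gen_continuous gh); apply: (@filterS _ _ (nbhs_filter (i p))) => y Ay q qy.
  by rewrite /= qy.
Qed.

Lemma smooth_at_open_sub X (U : set X) (Y : space R) (phi : sub U -> Y) (psi : X -> Y) (p : sub U) :
  open U -> (forall q : sub U, psi (sval q) = phi q) ->
  smooth_map_at p phi -> smooth_map_at (sval p) psi.
Proof.
move=> oU E sphi f; rewrite E => /sphi sf; have [g sg Eg] := initial_extend sf.
apply: smooth_at_ext (sg (sval p)).
have oUp : \forall y \near (sval p : X), U y by apply: open_nbhs_nbhs; split => //; exact: svalP.
apply: filterS2 oUp (near_initial Eg) => y Uy H.
by rewrite -(H (exist _ y Uy)) //= -(E (exist _ y Uy)).
Qed.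

Lemma smooth_section_at X (e : section (TB X)) p :
  (forall f, smoothf f -> smooth_at p (fun q => dv (e q) f)) <->
  smooth_map_at p (fun q => Tot (e q)).
Proof.
split=> [H|/smooth_map_atP H f sf].
  apply/smooth_map_atP => h [] [f sf ->]; first exact: sf.
  by apply: smooth_at_ext (H f sf); apply: near_all => q; rewrite dv_smooth.
have := H (fun q : tot (TB X) => sublv (tagged q) f); move=> /(_ _)/= K.
have {}K : smooth_at p (fun q => sublv (e q) f) by apply: K; right; exists f.
by apply: smooth_at_ext K; apply: near_all => q; rewrite dv_smooth.
Qed.

Lemma smooth_sectionP X (e : section (TB X)) :
  smooth_section e <-> forall f, smoothf f -> smoothf (fun q => dv (e q) f).
Proof.
split=> [/smoothP H f sf p|H]; first exact: (proj2 (smooth_section_at e p) (H p)).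
by apply/smoothP => p; apply/smooth_section_at => f sf; apply: H.
Qed.

Lemma smooth_tag_TB X : smooth (fun q : tot (TB X) => tag q : X).
Proof.
apply/smoothP => q; apply/smooth_map_atP => f gf.
by apply: (@smoothf_gen R (tot (TB X))); left; exists f => //; exact: smoothf_gen.
Qed.

Lemma smooth_dv X f : smoothf f -> smoothf (fun q : tot (TB X) => dv (tagged q) f).
Proof.
move=> sf q; apply: (@smooth_at_ext R (tot (TB X)) _ (fun q => sublv (tagged q) f)).
  by apply: near_all => r; rewrite dv_smooth.
by apply: (@smoothf_gen R (tot (TB X))); right; exists f.
Qed.

(** Weaker than a chart, as no inverse is demanded: tangent vectors have only to be velocities of
    the parametrization. This suffices for equalizers and passes to products. *)
Definition is_param X (p : X) n (c : 'rV[R]_n -> X) : Prop :=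
  [/\ c 0 = p, @smooth_map_at R (euclid R n) X 0 c
    & forall v : tangent p, exists u : 'rV[R]_n, forall (f : X -> R) (w : 'rV[R]_n -> R),
        smooth_at p f -> Cinf w -> (\forall y \near (0 : 'rV[R]_n), f (c y) = w y) ->
        dv v f = 'D_u (w : _ -> R^o) 0].

(** Coordinates and coordinate fields are global objects, cut off by bumps; only the relations
    between them are local. *)
Definition is_coords X (p : X) n (x : 'I_n -> X -> R) (E : 'I_n -> section (TB X)) : Prop :=
  [/\ forall i, smoothf (x i), forall i, smooth_section (E i),
      \forall q \near (p : X), forall v : tangent q, v = \sum_i dv v (x i) *: E i q,
      \forall q \near (p : X), forall i j, dv (E i q) (x j) = (i == j)%:R
    & exists2 U : set X, nbhs p U & forall q r, U q -> U r ->
        (forall i, x i q = x i r) -> q = r].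

(** [ph] and [ps] extend the chart and its inverse by default values. The fields [E0] differentiate
    along [ps] and are meaningful on [U] only, until a bump makes them global. The frame property is
    the chain rule [dE] in the coordinates [ph]. *)
Lemma manifold_chart X (p : X) : is_manifold X ->
  exists n (x : 'I_n -> X -> R) (E : 'I_n -> section (TB X)) (c : 'rV[R]_n -> X),
    is_coords p x E /\ is_param p c.
Proof.
move=> [_ [_ [n /(_ p)[U [V [phi [oU Up oV [sphi [phiV [psi [spsi [phiK psiK]]]]]]]]]]]].
exists n.
pose ph (q : X) : 'rV[R]_n := if pselect (U q) is left h then phi (exist _ q h) else 0.
pose ps (y : 'rV[R]_n) : X := if pselect (V y) is left h then sval (psi (exist _ y h)) else p.
have phE (q : sub U) : ph (sval q) = phi q.
  case: q => q h; rewrite /ph; case: pselect => [h'|] //=; by congr (phi (exist _ _ _)); exact: Prop_irrelevance.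
have psE (y : sub V) : ps (sval y) = sval (psi y).
  case: y => y h; rewrite /ps; case: pselect => [h'|] //=; by congr (sval (psi (exist _ _ _))); exact: Prop_irrelevance.
have sph q : U q -> @smooth_map_at R X (euclid R n) q ph.
  move=> Uq; apply: (@smooth_at_open_sub X U (euclid R n) phi ph (exist _ q Uq)) => //.
  by move/smoothP: sphi; apply.
have sps y : V y -> @smooth_map_at R (euclid R n) X y ps.
  move=> Vy; apply: (@smooth_at_open_sub (euclid R n) V X (fun y => sval (psi y)) ps (exist _ y Vy)) => //.
  have /smoothP := smooth_comp spsi (@smooth_sval R X U); exact.
have phVq q : U q -> V (ph q).
  by move=> Uq; rewrite -[q]/(sval (exist _ q Uq : sub U)) phE; exact: phiV.
have psUy y : V y -> U (ps y).
  by move=> Vy; rewrite -[y]/(sval (exist _ y Vy : sub V)) psE; exact: svalP.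
have phK q : U q -> ps (ph q) = q.
  move=> Uq; have := psE (exist _ (ph q) (phVq q Uq)) => /= ->.
  by rewrite (psiK (exist _ q Uq)) //= -[q]/(sval (exist _ q Uq : sub U)) phE.
have psK y : V y -> ph (ps y) = y.
  move=> Vy; have := psE (exist _ y Vy) => /= ->.
  by rewrite phE phiK.
have nearU q : U q -> \forall r \near (q : X), U r by move=> Uq; exact: open_nbhs_nbhs.
have nearV y : V y -> \forall z \near (y : 'rV[R]_n), V z.
  by move=> Vy; apply/euclid_nbhs; exact: open_nbhs_nbhs.
have cV (y z : 'rV[R]_n) (A : set 'rV[R]_n) : (\forall t \near (z : 'rV[R]_n), A t) -> \forall t \near (z : euclid R n), A t.
  by move=> H; apply/euclid_nbhs.
have spx i q : U q -> smooth_at q (fun r => ph r 0 i).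
  move=> Uq; apply: (sph q Uq (fun y : 'rV[R]_n => y 0 i)).
  by apply: euclid_smooth; exact: Cinf_coord.
have nearph q (A : set 'rV[R]_n) : U q -> (\forall z \near (ph q : 'rV[R]_n), A z) ->
    \forall r \near (q : X), A (ph r).
  by move=> Uq /euclid_nbhs HA; have := smooth_map_at_cvg (sph q Uq) HA.
have loc q f : U q -> smooth_at q f -> exists2 w : 'rV[R]_n -> R, Cinf w &
    \forall z \near (ph q : 'rV[R]_n), f (ps z) = w z.
  move=> Uq sf; have sfq : @smooth_at R (euclid R n) (ph q) (f \o ps).
    by apply: (sps _ (phVq q Uq)); rewrite phK.
  by have [w cw E] := euclid_smooth_at sfq; exists w.
have rowph q : \row_i (ph q 0 i) = ph q by apply/rowP => i; rewrite mxE.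
have locph q (f : X -> R) w : U q -> (\forall z \near (ph q : 'rV[R]_n), f (ps z) = w z) ->
    \forall r \near (q : X), f r = w (\row_i (ph r 0 i)).
  move=> Uq E; apply: filterS2 (nearU q Uq) (nearph _ _ Uq E) => r Ur H.
  by rewrite rowph -H phK.
have exE q i : U q -> exists t : tangent q, forall f, smoothf f ->
    dv t f = 'D_(delta_mx 0 i) (f \o ps : 'rV[R]_n -> R^o) (ph q).
  move=> Uq; apply: der_make => [a f g sf sg|f g sf sg].
    have [w cw Ew] := loc q f Uq (sf q); have [w' cw' Ew'] := loc q g Uq (sg q).
    rewrite (near_eq_derive _ Ew) (near_eq_derive _ Ew').
    rewrite [LHS](@near_eq_derive _ _ _ _ (fun z => a * w z + w' z)); last first.
      by apply: filterS2 Ew Ew' => z /= -> ->.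
    have dw := Cinf_diff (ph q) cw; have dw' := Cinf_diff (ph q) cw'.
    rewrite deriveD; [|apply: diff_derivable; exact: (differentiableZ a dw)|exact: diff_derivable].
    by congr (_ + _); rewrite deriveZ //; exact: diff_derivable.
  have [w cw Ew] := loc q f Uq (sf q); have [w' cw' Ew'] := loc q g Uq (sg q).
  rewrite (near_eq_derive _ Ew) (near_eq_derive _ Ew').
  rewrite [LHS](@near_eq_derive _ _ _ _ (fun z => w z * w' z)); last first.
    by apply: filterS2 Ew Ew' => z /= -> ->.
  have dw := Cinf_diff (ph q) cw; have dw' := Cinf_diff (ph q) cw'.
  rewrite deriveM; try exact: diff_derivable.
  by rewrite -(nbhs_singleton Ew) -(nbhs_singleton Ew') /= phK.
pose E0 i q : tangent q := xget 0 [set t : tangent q | forall f, smoothf f ->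
    dv t f = 'D_(delta_mx 0 i) (f \o ps : 'rV[R]_n -> R^o) (ph q)].
have E0P i q f : U q -> smooth_at q f ->
    dv (E0 i q) f = 'D_(delta_mx 0 i) (f \o ps : 'rV[R]_n -> R^o) (ph q).
  move=> Uq sf; have [g sg Eg] := smooth_at_global sf.
  rewrite (dv_near _ Eg) (xgetPex 0 (exE q i Uq)) //.
  apply/esym/near_eq_derive.
  have Vq := phVq q Uq.
  have K : \forall r \near (ps (ph q) : X), f r = g r by rewrite phK.
  by have /euclid_nbhs := smooth_map_at_cvg (sps _ Vq) K.
have [b [sb b1 b0]] := smooth_bump (nearU p Up).
pose E i q : tangent q := b q *: E0 i q.
have /choice[x xP] : forall i, exists x : X -> R, smoothf x /\
    \forall q \near (p : X), ph q 0 i = x q.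
  by move=> i; have [x sx Ex] := smooth_at_global (spx i p Up); exists x.
have Ex : \forall q \near (p : X), forall i, ph q 0 i = x i q.
  by apply: (@filter_forall _ _ _ _ (nbhs_filter p)) => i; case: (xP i).
pose c (y : 'rV[R]_n) := ps (ph p + y).
have c0 : c 0 = p by rewrite /c addr0 phK.
have dE q f w (v : tangent q) : U q -> smooth_at q f -> Cinf w ->
    (\forall z \near (ph q : 'rV[R]_n), f (ps z) = w z) ->
    dv v f = \sum_i pd i (w : _ -> R^o) (ph q) * dv v (fun r => ph r 0 i).
  move=> Uq sf cw Ew; rewrite (dv_near v (locph _ _ _ Uq Ew)) dv_comp ?rowph // => i.
  exact: spx.
exists x, E, c; split; split.
- by move=> i; case: (xP i).
- move=> i; apply/smooth_sectionP => f sf q.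
  have [Uq|nUq] := pselect (U q); last first.
    apply: smooth_at_ext (smooth_at_cst q 0).
    by apply: filterS (b0 q nUq) => r br; rewrite /E br scale0r dv0.
  have [w cw Ew] := loc q f Uq (sf q).
  have : smooth_at q (fun r => b r * pd i (w : _ -> R^o) (\row_j (ph r 0 j))).
    apply: smooth_atM; first exact: sb.
    by apply: smooth_at_comp; [move=> j; exact: spx|exact: Cinf_pd].
  apply: smooth_at_ext.
  apply: filterS2 (nearU q Uq) (nearph _ _ Uq (near_join Ew)) => r Ur Er.
  rewrite /E dv_scale E0P //; last exact: sf.
  by rewrite rowph (near_eq_derive _ Er).
- apply: filterS2 (nearU p Up) (filterI b1 (near_join Ex)) => q Uq [bq xq] v.
  apply: tangent_eq => f sf; rewrite -!dv_smooth // dv_sumv.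
  have [w cw Ew] := loc q f Uq (sf q).
  rewrite (dE q f w v Uq (sf q) cw Ew); apply: eq_bigr => i _.
  rewrite dv_scale /E bq scale1r (E0P i q f Uq (sf q)).
  rewrite mulrC (near_eq_derive _ Ew); congr (_ * _).
  by apply: dv_near; apply: filterS xq => r ->.
- apply: filterS2 (nearU p Up) (filterI b1 (near_join Ex)) => q Uq [bq xq] i j.
  have sx : smooth_at q (x j) by case: (xP j) => + _; apply.
  rewrite /E bq scale1r E0P //.
  have xq' : \forall r \near (ps (ph q) : X), forall i, ph r 0 i = x i r by rewrite phK.
  have /euclid_nbhs H := smooth_map_at_cvg (sps _ (phVq q Uq)) xq'.
  have H2 : \forall z \near (ph q : 'rV[R]_n), (x j \o ps) z = z 0 j.
    by apply: filterS2 (nearV _ (phVq q Uq)) H => z Vz /= <-; rewrite psK.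
  by rewrite (near_eq_derive _ H2) derive_coord mxE eqxx eq_sym.
- exists [set q | U q /\ forall i, ph q 0 i = x i q].
    by apply: filterS2 (nearU p Up) Ex => q ? ?; split.
  move=> q r [Uq qx] [Ur rx] H; rewrite -(phK q Uq) -(phK r Ur); congr ps.
  by apply/rowP => i; rewrite qx rx H.
- exact: c0.
- move=> f; rewrite c0 => sf.
  have [w cw Ew] := loc p f Up sf.
  apply: smooth_at_ext (euclid_smooth 0 (Cinf_shift (ph p) cw)).
  apply/euclid_nbhs.
  have : (fun y : 'rV[R]_n => ph p + y) y @[y --> (0 : 'rV[R]_n)] --> (ph p : 'rV[R]_n).
    by rewrite -[X in _ --> X]addr0; exact: shift_cvg.
  by move=> /(_ _ Ew); apply: (@filterS _ _ (nbhs_filter (0 : 'rV[R]_n))) => y /= ->.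
move=> v; exists (\row_i dv v (fun r => ph r 0 i)) => f w sf cw Ew.
pose w' z := w (- ph p + z); have cw' : Cinf w' by exact: Cinf_shift.
have Ew' : \forall z \near (ph p : 'rV[R]_n), f (ps z) = w' z.
  have : (fun z : 'rV[R]_n => - ph p + z) z @[z --> (ph p : 'rV[R]_n)] --> (0 : 'rV[R]_n).
    by rewrite -[X in _ --> X](addNr (ph p)); exact: shift_cvg.
  move=> /(_ _ Ew); apply: (@filterS _ _ (nbhs_filter (ph p : 'rV[R]_n))) => y /=.
  by rewrite /c addNKr => ->.
rewrite (dE p f w' v Up sf cw' Ew') deriveD_dir; last exact: Cinf_diff.
apply: eq_bigr => i _; rewrite mxE mulrC; congr (_ * _).
by rewrite /pd /w' derive_translate addNr.
Qed.

End Charts.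

(** * Tangent spaces of equalizers *)

Section Equalizers.
Context (R : realType).
Implicit Types X Y Z : space R.

Lemma param_smooth X (p : X) n (c : 'rV[R]_n -> X) (f : X -> R) : is_param p c ->
  smooth_at p f -> exists2 w : 'rV[R]_n -> R, Cinf w & \forall y \near (0 : 'rV[R]_n), f (c y) = w y.
Proof.
move=> [c0 sc _] sf; have sf0 : smooth_at (c 0) f by rewrite c0.
exact: euclid_smooth_at (sc _ sf0).
Qed.

Lemma param_near X (p : X) n (c : 'rV[R]_n -> X) (A : set X) : is_param p c ->
  (\forall q \near (p : X), A q) -> \forall y \near (0 : 'rV[R]_n), A (c y).
Proof.
move=> [c0 sc _] HA; have HA0 : \forall q \near (c 0 : X), A q by rewrite c0.
by have /euclid_nbhs := smooth_map_at_cvg sc HA0.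
Qed.

Lemma lsubmx_cvg0 n m : lsubmx y @[y --> (0 : 'rV[R]_(n + m))] --> (0 : 'rV[R]_n).
Proof.
move=> U /nbhs_normP[e e0 eU].
suff : \forall y \near (0 : 'rV[R]_(n + m)), U (lsubmx y) by [].
apply/nbhs_normP; exists e => // y /=; rewrite sub0r normrN => ye; apply: eU.
rewrite /= sub0r normrN [ltLHS]mx_normrE; apply: bigmax_lt => // -[a i] _ /=.
by rewrite mxE; apply: le_lt_trans ye; rewrite (ord1 a) norm_row.
Qed.

Lemma rsubmx_cvg0 n m : rsubmx y @[y --> (0 : 'rV[R]_(n + m))] --> (0 : 'rV[R]_m).
Proof.
move=> U /nbhs_normP[e e0 eU].
suff : \forall y \near (0 : 'rV[R]_(n + m)), U (rsubmx y) by [].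
apply/nbhs_normP; exists e => // y /=; rewrite sub0r normrN => ye; apply: eU.
rewrite /= sub0r normrN [ltLHS]mx_normrE; apply: bigmax_lt => // -[a i] _ /=.
by rewrite mxE; apply: le_lt_trans ye; rewrite (ord1 a) norm_row.
Qed.

(** A tangent vector of the product is the sum of its two parts along the slices through the point,
    and each part is a velocity in one block of the parameters. *)
Lemma param_pair X Y (p : X) (q : Y) n m (c : 'rV[R]_n -> X) (d : 'rV[R]_m -> Y) :
  is_param p c -> is_param q d ->
  @is_param R (prod_space X Y) (p, q) (n + m) (fun y => (c (lsubmx y), d (rsubmx y))).
Proof.
move=> pc pd; have [c0 sc tc] := pc; have [d0 sd td] := pd; split.
- by rewrite !linear0 c0 d0.
- apply: smooth_map_at_pair => f; rewrite linear0 ?c0 ?d0.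
    move=> /(param_smooth pc)[w cw Ew].
    apply: (smooth_at_ext _ (euclid_smooth 0 (_ : Cinf (fun y : 'rV[R]_(n + m) => w (\row_i y 0 (lshift m i)))))).
      apply/euclid_nbhs; have := @lsubmx_cvg0 n m _ Ew.
      apply: (@filterS _ _ (nbhs_filter (0 : 'rV[R]_(n + m)))) => y /= ->.
      by congr w; apply/rowP => i; rewrite !mxE.
    by apply: Cinf_comp => // i; exact: Cinf_coord.
  move=> /(param_smooth pd)[w cw Ew].
  apply: (smooth_at_ext _ (euclid_smooth 0 (_ : Cinf (fun y : 'rV[R]_(n + m) => w (\row_i y 0 (rshift n i)))))).
    apply/euclid_nbhs; have := @rsubmx_cvg0 n m _ Ew.
    apply: (@filterS _ _ (nbhs_filter (0 : 'rV[R]_(n + m)))) => y /= ->.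
    by congr w; apply/rowP => i; rewrite !mxE.
  by apply: Cinf_comp => // i; exact: Cinf_coord.
move=> v.
pose XY := prod_space X Y.
pose i1 (x : X) : XY := (x, q).
pose i2 (y : Y) : XY := (p, y).
have s1 : smooth i1 by apply: smooth_pair; [exact: smooth_id|exact: smooth_cst].
have s2 : smooth i2 by apply: smooth_pair; [exact: smooth_cst|exact: smooth_id].
have sf := @smooth_fst R X Y; have ss := @smooth_snd R X Y.
pose v1 : tangent p := dmap (fst : XY -> X) v.
pose v2 : tangent q := dmap (snd : XY -> Y) v.
have [u1 u1P] := tc v1; have [u2 u2P] := td v2.
have [z [z1 z2 zE]] := tangent_pair v1 v2.
have vE : v = z by apply: dmap_pair_inj; rewrite ?z1 ?z2.
exists (row_mx u1 u2) => f w sfw cw Ew.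
rewrite vE zE //.
have cw1 : Cinf (fun y : 'rV[R]_n => w (row_mx y 0)).
  have -> : (fun y : 'rV[R]_n => w (row_mx y 0)) = fun y => w (\row_i
     (match fintype.split i with inl j => fun y : 'rV[R]_n => y 0 j | inr j => fun _ => 0 end) y).
    apply/funext => y; congr w; apply/rowP => i; rewrite !mxE.
    by case: fintype.splitP => j _ //; rewrite mxE.
  by apply: Cinf_comp => // i; case: fintype.split => j; [exact: Cinf_coord|exact: Cinf_cst].
have cw2 : Cinf (fun y : 'rV[R]_m => w (row_mx 0 y)).
  have -> : (fun y : 'rV[R]_m => w (row_mx 0 y)) = fun y => w (\row_i
     (match fintype.split i with inl j => fun _ => 0 | inr j => fun y : 'rV[R]_m => y 0 j end) y).
    apply/funext => y; congr w; apply/rowP => i; rewrite !mxE.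
    by case: fintype.splitP => j _ //; rewrite mxE.
  by apply: Cinf_comp => // i; case: fintype.split => j; [exact: Cinf_cst|exact: Cinf_coord].
have row0 : row_mx (0 : 'rV[R]_n) (0 : 'rV[R]_m) = 0 by rewrite row_mx0.
have cv1 : row_mx y (0 : 'rV[R]_m) @[y --> (0 : 'rV[R]_n)] --> (0 : 'rV[R]_(n + m)).
  move=> U /nbhs_normP[e e0 eU].
  suff : \forall y \near (0 : 'rV[R]_n), U (row_mx y 0) by [].
  apply/nbhs_normP; exists e => // y /=; rewrite sub0r normrN => ye; apply: eU.
  rewrite /= sub0r normrN [ltLHS]mx_normrE; apply: bigmax_lt => // -[a i] _ /=.
  rewrite mxE; case: fintype.splitP => j _; last by rewrite mxE normr0.
  by apply: le_lt_trans (_ : `|y a j| <= _) ye; rewrite (ord1 a) norm_row.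
have cv2 : row_mx (0 : 'rV[R]_n) y @[y --> (0 : 'rV[R]_m)] --> (0 : 'rV[R]_(n + m)).
  move=> U /nbhs_normP[e e0 eU].
  suff : \forall y \near (0 : 'rV[R]_m), U (row_mx 0 y) by [].
  apply/nbhs_normP; exists e => // y /=; rewrite sub0r normrN => ye; apply: eU.
  rewrite /= sub0r normrN [ltLHS]mx_normrE; apply: bigmax_lt => // -[a i] _ /=.
  rewrite mxE; case: fintype.splitP => j _; first by rewrite mxE normr0.
  by apply: le_lt_trans (_ : `|y a j| <= _) ye; rewrite (ord1 a) norm_row.
rewrite (u1P (f \o i1) (fun y => w (row_mx y 0)) _ cw1); last 2 first.
- exact: (proj1 (smoothP i1) s1 p).
- have := cv1 _ Ew; apply: (@filterS _ _ (nbhs_filter (0 : 'rV[R]_n))) => y /= <-.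
  by rewrite row_mxKl row_mxKr d0.
rewrite (u2P (f \o i2) (fun y => w (row_mx 0 y)) _ cw2); last 2 first.
- exact: (proj1 (smoothP i2) s2 q).
- have := cv2 _ Ew; apply: (@filterS _ _ (nbhs_filter (0 : 'rV[R]_m))) => y /= <-.
  by rewrite row_mxKl row_mxKr c0.
have dw := Cinf_diff 0 cw.
have -> : row_mx u1 u2 = 1 *: row_mx u1 0 + row_mx 0 u2.
  by rewrite scale1r add_row_mx addr0 add0r.
rewrite derive_lin // mul1r; congr (_ + _); rewrite /derive.
  suff -> : (fun h : R => h^-1 *: (((fun y => w (row_mx y 0) : R^o) \o shift 0) (h *: u1) - w (row_mx 0 0))) =
    (fun h : R => h^-1 *: (((w : _ -> R^o) \o shift 0) (h *: row_mx u1 0) - w 0)) by [].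
  by apply/funext => h /=; rewrite !addr0 row0 scale_row_mx scaler0.
suff -> : (fun h : R => h^-1 *: (((fun y => w (row_mx 0 y) : R^o) \o shift 0) (h *: u2) - w (row_mx 0 0))) =
    (fun h : R => h^-1 *: (((w : _ -> R^o) \o shift 0) (h *: row_mx 0 u2) - w 0)) by [].
by apply/funext => h /=; rewrite !addr0 row0 scale_row_mx scaler0.
Qed.

(** Exactly what the target of an equalizer has to provide: functions that separate nearby points,
    with dual vectors at [z]. By [pair_has_coords] this passes to products. *)
Definition has_coords Z (z : Z) : Prop := exists m (x : 'I_m -> Z -> R) (E : 'I_m -> tangent z),
  [/\ forall j, smoothf (x j), forall i j, dv (E i) (x j) = (i == j)%:R
    & exists2 U : set Z, nbhs z U & forall q r, U q -> U r -> (forall j, x j q = x j r) -> q = r].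

Lemma manifold_has_coords Z (z : Z) : is_manifold Z -> has_coords z.
Proof.
move=> mZ; have [m [x [E [_ [[sx _ _ Ed U] _]]]]] := manifold_chart z mZ.
exists m, x, (fun i => E i z); split => //.
exact: nbhs_singleton Ed.
Qed.

Fact split_lshift m n (i : 'I_m) : fintype.split (lshift n i) = inl i.
Proof. exact: (unsplitK (inl i)). Qed.
Fact split_rshift m n (i : 'I_n) : fintype.split (rshift m i) = inr i.
Proof. exact: (unsplitK (inr i)). Qed.

Lemma pair_has_coords X Y (p : X) (q : Y) : has_coords p -> has_coords q ->
  @has_coords (prod_space X Y) (p, q).
Proof.
move=> [m [x [E [sx Ed [U Up Ui]]]]] [n [y [F [sy Fd [V Vq Vi]]]]].
have /choice[z zP] : forall k : 'I_(m + n), exists z : @tangent R (prod_space X Y) (p, q),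
    (forall j, dv z (x j \o fst) = if fintype.split k is inl i then (i == j)%:R else 0) /\
    (forall j, dv z (y j \o snd) = if fintype.split k is inr i then (i == j)%:R else 0).
  move=> k; have [z [z1 z2 _]] := tangent_pair (if fintype.split k is inl i then E i else 0)
     (if fintype.split k is inr i then F i else 0).
  exists z; split=> j.
    rewrite -(dmapEs z (@smooth_fst R X Y) (sx j)) z1; case: (fintype.split k) => i; [exact: Ed|exact: dv0].
  rewrite -(dmapEs z (@smooth_snd R X Y) (sy j)) z2; case: (fintype.split k) => i; [exact: dv0|exact: Fd].
exists (m + n)%N, (fun k => if fintype.split k is inl i then x i \o fst
  else if fintype.split k is inr i then y i \o snd else fun _ => 0), z; split.
- move=> k; case: (fintype.split k) => j; [exact: (@smooth_fst R X Y)|exact: (@smooth_snd R X Y)].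
- move=> k l; have [H1 H2] := zP k; case: (split_ordP l) => j ->; rewrite ?split_lshift ?split_rshift.
    rewrite H1; case: (split_ordP k) => i ->; rewrite ?split_lshift ?split_rshift ?eq_lshift //.
    by rewrite eq_rlshift.
  rewrite H2; case: (split_ordP k) => i ->; rewrite ?split_lshift ?split_rshift ?eq_rshift //.
  by rewrite eq_lrshift.
exists ((fst : prod_space X Y -> X) @^-1` U `&` (snd : prod_space X Y -> Y) @^-1` V).
  by apply: filterI; [exact: (@smooth_continuous R (prod_space X Y) X fst (p, q) (@smooth_fst R X Y) U Up)|exact: (@smooth_continuous R (prod_space X Y) Y snd (p, q) (@smooth_snd R X Y) V Vq)].
move=> [a b] [a' b'] [/= Ua Vb] [/= Ua' Vb'] H; congr (_, _).
  by apply: Ui => // j; have := H (lshift n j); rewrite split_lshift.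
by apply: Vi => // j; have := H (rshift m j); rewrite split_rshift.
Qed.

(** Near [p] the equalizer is the zero set of the differences of the coordinates of [Phi] and [Psi].
    Surjectivity of the difference of the differentials supplies the dual vectors for
    [implicit_zero], which then shows that [v] kills all functions vanishing on the equalizer, so
    that [tangent_initial] applies. *)
Lemma tangent_equalizer X Z (Phi Psi : X -> Z) (p : X) (e : Phi p = Psi p) n (c : 'rV[R]_n -> X) :
  is_param p c -> has_coords (Phi p) -> smooth Phi -> smooth Psi ->
  (forall w : tangent (Phi p), exists v : tangent p, forall f, smoothf f ->
     dv v (f \o Phi) - dv v (f \o Psi) = dv w f) ->
  forall v : tangent p, (forall f, smoothf f -> dv v (f \o Phi) = dv v (f \o Psi)) ->
  exists z : @tangent R (sub [set x | Phi x = Psi x]) (exist _ p e),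
    dmap (fun q : sub [set x | Phi x = Psi x] => sval q) z = v.
Proof.
move=> pc mZ sPhi sPsi surj v veq.
have [m [x [E [sx Edual [U Up Uinj]]]]] := mZ.
have [c0 sc tc] := pc.
apply: tangent_initial => f sf f0.
have fP : \forall q \near (p : X), Phi q = Psi q -> f q = 0.
  have := near_initial f0; apply: filterS => q H eq; exact: (H (exist _ q eq)).
have [w cw Ew] := param_smooth pc (sf p).
pose h j (q : X) := x j (Phi q) - x j (Psi q).
have sh j : smooth_at p (h j) by apply: smooth_atB; [exact: sPhi|exact: sPsi].
have /choice[g gP] : forall j, exists g : 'rV[R]_n -> R, Cinf g /\
    \forall y \near (0 : 'rV[R]_n), h j (c y) = g y.
  by move=> j; have [g cg Eg] := param_smooth pc (sh j); exists g.
have [u uP] := tc v.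
have /choice[b bP] : forall i, exists b : 'rV[R]_n, forall j,
    'D_b (g j : _ -> R^o) 0 = (i == j)%:R.
  move=> i; have [vi viP] := surj (E i); have [b bP] := tc vi.
  exists b => j; have [cg Eg] := gP j.
  rewrite -(bP (h j) (g j) (sh j) cg Eg) dvB; [|exact: sPhi|exact: sPsi].
  by rewrite viP // Edual.
rewrite (uP f w (sf p) cw Ew).
apply: (@implicit_zero R n m g b u w) => // [j|j|j|].
- by case: (gP j).
- by have [_ Eg] := gP j; rewrite -(nbhs_singleton Eg) /h c0 e subrr.
- have [cg Eg] := gP j; rewrite -(uP (h j) (g j) (sh j) cg Eg).
  by rewrite dvB ?veq ?subrr //; [exact: sPhi|exact: sPsi].
have Egs : \forall y \near (0 : 'rV[R]_n), forall j, h j (c y) = g j y.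
  by apply: (@filter_forall _ _ _ _ (nbhs_filter (0 : 'rV[R]_n))) => j; case: (gP j).
have U1 := param_near pc (smooth_continuous sPhi Up).
have U2 : \forall y \near (0 : 'rV[R]_n), U (Psi (c y)).
  by apply: (param_near (A := fun q => U (Psi q)) pc); apply: (smooth_continuous sPsi); rewrite -e.
have fc := param_near pc fP.
apply: filterS2 (filterI Ew Egs) (filterI (filterI U1 U2) fc) => y [<- gy] [[Uy1 Uy2] H] g0.
apply: H; apply: Uinj => // j; apply/eqP; rewrite -subr_eq0; apply/eqP.
by rewrite -[LHS]/(h j (c y)) gy g0.
Qed.

End Equalizers.

(** * Line bundles and connections *)

Section LineBundles.
Context (R : realType).
Implicit Types X Y Z B : space R.

(** Equality on [B] is classically decidable, so dependent pairs are injective in their second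
    component. *)
Lemma Tot_inj B (E : bundle B) (x : B) (u v : E x) : Tot u = Tot v -> u = v.
Proof. by apply: Eqdep_dec.inj_pair2_eq_dec => y z; exact: pselect. Qed.

(** The last clause turns the inverse of the trivialization into a criterion for smoothness of maps
    into the total space. *)
Lemma vb_chart k B (E : bundle B) x0 : is_vector_bundle k E ->
  exists (U : set B) (phi : forall x, E x -> 'rV[R]_k),
    [/\ open U, U x0, forall x, U x -> linear (phi x) /\ bijective (phi x),
     forall q : tot E, U (tag q) ->
       @smooth_map_at R (tot E) (euclid R k) q (fun q => phi _ (tagged q))
     & forall X (p : X) (Q : X -> tot E), U (tag (Q p)) ->
       smooth_map_at p (fun r => tag (Q r) : B) ->
       @smooth_map_at R X (euclid R k) p (fun r => phi _ (tagged (Q r))) ->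
       smooth_map_at p Q].
Proof.
move=> [stag /(_ x0)[U [phi [oU Ux lphi [st [_ [psi [spsi [psiK psiU]]]]]]]]].
exists U, phi; split => //.
- move=> x Ux'; split; first exact: lphi.
  pose y0 (y : 'rV[R]_k) : sub [set y : prod_space B (euclid R k) | U y.1] := exist _ (x, y) Ux'.
  have T (y : 'rV[R]_k) : tag (sval (psi (y0 y))) = x by have := psiK (y0 y) => -[].
  have H y : exists e, phi x e = y /\ forall e', phi x e' = y -> e' = e.
    have := psiK (y0 y); move: (T y); case E1 : (sval (psi (y0 y))) => [z e] /= zx.
    subst z => -[Ey]; exists e; split => // e' Ee'.
    have := psiU (exist _ (existT _ x e') Ux' : sub [set q : tot E | U (tag q)]) (y0 y) _.
    rewrite /= Ee' => /(_ erefl)/(congr1 sval)/=; rewrite E1 => H.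
    by apply/esym; exact: (@Tot_inj B E x).
  have /choice[g gP] := H.
  exists g => y; last by case: (gP y).
  by apply/esym; have [_] := gP (phi x y); apply.
- move=> q Uq.
  have oUt : open [set q : tot E | U (tag q)].
    apply: open_comp oU => r _; exact: smooth_continuous.
  apply: (@smooth_at_open_sub R (tot E) [set q : tot E | U (tag q)] (euclid R k)
    (fun r => phi _ (tagged (sval r))) (fun q => phi _ (tagged q)) (exist _ q Uq)) => //.
  move/smoothP: (smooth_comp st (@smooth_snd R B (euclid R k))); exact.
move=> X p Q UQp sQ1 sQ2.
pose P := [set y : prod_space B (euclid R k) | U y.1].
pose y0 r : prod_space B (euclid R k) := (tag (Q r), phi _ (tagged (Q r))).
have nU : \forall r \near (p : X), U (tag (Q r)).
  by have := smooth_map_at_cvg sQ1; apply; exact: open_nbhs_nbhs.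
(* A total function is needed; away from [U] it takes the value at [p], which does not affect the
   germ. *)
pose y1 r : sub P := if pselect (U (tag (Q r))) is left h then exist _ (y0 r) h
  else exist _ (y0 p) UQp.
have y1E : \forall r \near (p : X), sval (y1 r) = y0 r.
  by apply: filterS nU => r Ur; rewrite /y1; case: pselect.
have sy1 : smooth_map_at p y1.
  apply/(smooth_map_at_initial (i := fun q : {x | P x} => sval q)).
  apply: (smooth_map_at_ext (phi := y0)); last exact: smooth_map_at_pair.
  by apply: filterS y1E => r /= ->.
apply: (smooth_map_at_ext (phi := fun r => sval (psi (y1 r)))).
  apply: filterS2 nU y1E => r Ur Er.
  by rewrite (psiU (exist _ (Q r) Ur : sub [set q : tot E | U (tag q)])).
apply: (@smooth_map_at_comp R X (sub P) (tot E) p y1 (fun y => sval (psi y)) sy1).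
by move/smoothP: (smooth_comp spsi (@smooth_sval R (tot E) [set q : tot E | U (tag q)])); exact.
Qed.

(** The section and its coordinate are global, and only their duality is restricted to [W]. By the
    last clause, a map into [E] is smooth as soon as its base point and its coordinate are; local
    triviality of line bundles is used in this form. *)
Definition is_frame B (E : bundle B) (W : set B) (e : section E) (l : tot E -> R) : Prop :=
  [/\ smooth_section e, smoothf l, forall x, linear (fun v : E x => l (Tot v) : R^o),
      forall x, W x -> l (Tot (e x)) = 1 /\ forall v : E x, v = l (Tot v) *: e x
    & forall X (p : X) (Q : X -> tot E), W (tag (Q p)) ->
       smooth_map_at p (fun r => tag (Q r) : B) -> smooth_at p (l \o Q) ->
       smooth_map_at p Q].

Section Frames.
Context (B : space R) (E : bundle B).

Lemma smooth_tag : is_vector_bundle 1 E -> smooth (fun q : tot E => tag q : B).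
Proof. by case. Qed.

(** Both the unit section of a trivialization and its coordinate are multiplied by the same bump,
    which makes them global. *)
Lemma line_frame x0 : is_vector_bundle 1 E ->
  exists (W : set B) (e : section E) (l : tot E -> R), (\forall x \near (x0 : B), W x) /\ is_frame W e l.
Proof.
move=> vE; have [U [phi [oU Ux0 lphi sphi crit]]] := vb_chart x0 vE.
have stag := smooth_tag vE.
have nU x : U x -> \forall y \near (x : B), U y by move=> Ux; exact: open_nbhs_nbhs.
have [b [sb b1 b0]] := smooth_bump (nU _ Ux0).
pose e1 x : E x := xget 0 [set e | phi x e = const_mx 1].
have e1P x : U x -> phi x (e1 x) = const_mx 1.
  move=> Ux; have [_ [g _ gK]] := lphi x Ux.
  by apply: (xgetPex 0 (P := [set e | phi x e = const_mx 1])); exists (g (const_mx 1)); exact: gK.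
pose e x := b x *: e1 x.
pose l (q : tot E) := b (tag q) * phi _ (tagged q) 0 0.
have bU x : ~ U x -> b x = 0 by move=> /b0/nbhs_singleton.
have phi0 x : U x -> phi x 0 = 0.
  move=> Ux; have [lx _] := lphi x Ux.
  by have := lx (-1) 0 0; rewrite scaler0 addr0 scaleN1r addNr.
have phiZ x (a : R) v : U x -> phi x (a *: v) = a *: phi x v.
  move=> Ux; have [lx _] := lphi x Ux.
  by rewrite -[a *: v]addr0 lx phi0 // addr0.
have sl : smoothf l.
  move=> q; have [Uq|nUq] := pselect (U (tag q)); last first.
    apply: smooth_at_ext (smooth_at_cst q 0).
    have := smooth_continuous stag (b0 _ nUq).
    by apply: (@filterS _ _ (nbhs_filter q)) => r /= br; rewrite /l br mul0r.
  apply: smooth_atM; first exact: stag _ sb q.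
  apply: (sphi q Uq (fun y : 'rV[R]_1 => y 0 0)); apply: euclid_smooth; exact: Cinf_coord.
have se : smooth_section e.
  apply/smoothP => x; have [Ux|nUx] := pselect (U x).
    apply: crit => //.
    apply/smooth_map_atP => f [i ->].
    apply: smooth_at_ext (sb x); apply: filterS (nU x Ux) => y Uy.
    by rewrite /= phiZ // e1P // !mxE mulr1.
  have [V [ps [oV Vx0 lps sps critV]]] := vb_chart x vE.
  apply: critV => //.
  apply/smooth_map_atP => f [i ->].
  apply: smooth_at_ext (smooth_at_cst x 0).
  have nV : \forall y \near (x : B), V y by exact: open_nbhs_nbhs.
  apply: filterS2 (b0 x nUx) nV => y by0 Vy.
  rewrite /= /e by0 scale0r; have [ly _] := lps y Vy.
  by have := ly (-1) 0 0; rewrite scaler0 addr0 scaleN1r addNr => ->; rewrite mxE.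
(* The bump has to be 1 near the point and not just at it, since the smoothness criterion concerns
   germs. *)
exists [set x | (\forall y \near (x : B), b y = 1) /\ U x], e, l; split.
  by apply: filterS2 (near_join b1) (nU _ Ux0).
split => //.
- move=> x a u v; rewrite /l /=.
  have [Ux|nUx] := pselect (U x); last by rewrite bU // !mul0r scaler0 addr0.
  by have [lx _] := lphi x Ux; rewrite lx !mxE mulrDr mulrCA.
- move=> x [/nbhs_singleton bx Ux]; rewrite /l /e /= bx !mul1r scale1r; split.
    by rewrite e1P // mxE.
  move=> v; have [_ [g gK _]] := lphi x Ux; rewrite -[LHS]gK -[RHS]gK; congr g.
  rewrite phiZ // e1P //; apply/rowP => i.
  by rewrite !mxE mul1r mulr1 (ord1 i).
move=> X p Q [bx Ux] sQ1 sQ2; apply: crit => //.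
apply/smooth_map_atP => f [i ->]; rewrite (ord1 i).
apply: smooth_at_ext sQ2.
have := smooth_map_at_cvg sQ1 bx; apply: (@filterS _ _ (nbhs_filter p)) => r /= br.
by rewrite /l br mul1r.
Qed.

Section WithFrame.
Context (W : set B) (e : section E) (l : tot E -> R) (fr : is_frame W e l).

Lemma frame_section : smooth_section e. Proof. by case: fr. Qed.
Lemma frame_coord : smoothf l. Proof. by case: fr. Qed.
Lemma frame_lin x a (u v : E x) : l (Tot (a *: u + v)) = a * l (Tot u) + l (Tot v).
Proof. by have [_ _ H _ _] := fr; exact: H. Qed.
Lemma frame_0 x : l (Tot (0 : E x)) = 0.
Proof. by have := frame_lin (-1) (0 : E x) 0; rewrite scaler0 addr0 mulN1r addNr. Qed.
Lemma frame_D x (u v : E x) : l (Tot (u + v)) = l (Tot u) + l (Tot v).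
Proof. by rewrite -[u in LHS]scale1r frame_lin mul1r. Qed.
Lemma frame_Z x a (u : E x) : l (Tot (a *: u)) = a * l (Tot u).
Proof. by rewrite -[a *: u]addr0 frame_lin frame_0 addr0. Qed.
Lemma frame1 x : W x -> l (Tot (e x)) = 1.
Proof. by move=> Wx; have [_ _ _ H _] := fr; case: (H x Wx). Qed.
Lemma frameE x (v : E x) : W x -> v = l (Tot v) *: e x.
Proof. by move=> Wx; have [_ _ _ H _] := fr; case: (H x Wx). Qed.
Lemma frame_inj x (u v : E x) : W x -> l (Tot u) = l (Tot v) -> u = v.
Proof. by move=> Wx H; rewrite (frameE u Wx) (frameE v Wx) H. Qed.
Lemma frame_neq0 x : W x -> e x != 0.
Proof.
move=> Wx; apply/eqP => H; have := frame1 Wx; rewrite H frame_0 => /esym/eqP.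
by rewrite oner_eq0.
Qed.
Lemma frame_smooth X (p : X) (Q : X -> tot E) : W (tag (Q p)) ->
  smooth_map_at p (fun r => tag (Q r) : B) -> smooth_at p (l \o Q) -> smooth_map_at p Q.
Proof. by have [_ _ _ _ H] := fr; exact: H. Qed.
Lemma frame_coord_at X (p : X) (Q : X -> tot E) : smooth_map_at p Q -> smooth_at p (l \o Q).
Proof. by apply; exact: frame_coord. Qed.
End WithFrame.

Hypothesis vE : is_vector_bundle 1 E.

Lemma line_fiber x : exists2 e : E x, e != 0 & forall v : E x, exists c : R, v = c *: e.
Proof.
have [W [e [l [Wx fr]]]] := line_frame x vE; exists (e x).
  exact: frame_neq0 fr _ (nbhs_singleton Wx).
by move=> v; exists (l (Tot v)); exact: frameE fr _ _ (nbhs_singleton Wx).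
Qed.

Lemma line_smooth_lin X (p : X) (f : X -> B) n (c : 'I_n -> X -> R)
    (Q : 'I_n -> forall r : X, E (f r)) :
  smooth_map_at p f -> (forall i, smooth_at p (c i)) ->
  (forall i, smooth_map_at p (fun r => Tot (Q i r))) ->
  smooth_map_at p (fun r => Tot (\sum_i c i r *: Q i r)).
Proof.
move=> sf sc sQ; have [W [e [l [Wx fr]]]] := line_frame (f p) vE.
apply: (frame_smooth fr) => //=; first exact: nbhs_singleton Wx.
have : smooth_at p (fun r => \sum_i c i r * l (Tot (Q i r))).
  by apply: smooth_at_sum => i _; apply: smooth_atM => //; exact: (frame_coord_at fr (sQ i)).
apply: smooth_at_ext; apply: near_all => r /=.
elim/big_ind2 : _ => [|u a v b Ha Hb|i _]; first by rewrite (frame_0 fr).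
  by rewrite Ha Hb -(frame_D fr).
by rewrite (frame_Z fr).
Qed.

Lemma line_smooth_comb X (p : X) (f : X -> B) (a b : X -> R) (u v : forall r : X, E (f r)) :
  smooth_map_at p f -> smooth_at p a -> smooth_at p b ->
  smooth_map_at p (fun r => Tot (u r)) -> smooth_map_at p (fun r => Tot (v r)) ->
  smooth_map_at p (fun r => Tot (a r *: u r + b r *: v r)).
Proof.
move=> sf sa sb su sv; have [W [e [l [Wx fr]]]] := line_frame (f p) vE.
apply: (frame_smooth fr) => //=; first exact: nbhs_singleton Wx.
have : smooth_at p (fun r => a r * l (Tot (u r)) + b r * l (Tot (v r))).
  by apply: smooth_atD; apply: smooth_atM => //; [exact: (frame_coord_at fr su)|exact: (frame_coord_at fr sv)].
by apply: smooth_at_ext; apply: near_all => r /=; rewrite (frame_D fr) !(frame_Z fr).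
Qed.

Lemma smooth_sectionM (f : B -> R) (e : section E) : smoothf f -> smooth_section e ->
  smooth_section (fun x => f x *: e x).
Proof.
move=> sf /smoothP se; apply/smoothP => x.
have := @line_smooth_comb B x id f (fun _ => 0) e e
  (fun f sf => sf) (sf x) (smooth_at_cst x 0) (se x) (se x).
by apply: smooth_map_at_ext; apply: near_all => y; rewrite scale0r addr0.
Qed.

Lemma smooth_section0 : smooth_section (fun x => 0 : E x).
Proof.
apply/smoothP => x; have [W [e [l [Wx fr]]]] := line_frame x vE.
apply: (frame_smooth fr) => //=; first exact: nbhs_singleton Wx.
by apply: smooth_at_ext (smooth_at_cst x 0); apply: near_all => y /=; rewrite (frame_0 fr).
Qed.

Lemma smooth_section_sum n (e : 'I_n -> section E) : (forall i, smooth_section (e i)) ->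
  smooth_section (fun x => \sum_i e i x).
Proof.
move=> se; apply/smoothP => x.
have := @line_smooth_lin B x id n (fun _ _ => 1) e (fun f sf => sf)
  (fun i => smooth_at_cst x 1) (fun i => proj1 (smoothP _) (se i) x).
by apply: smooth_map_at_ext; apply: near_all => y; congr Tot; apply: eq_bigr => i _; rewrite scale1r.
Qed.
End Frames.

Section Connections.
Context (B : space R) (E : bundle B).
Hypothesis vE : is_vector_bundle 1 E.

(** After multiplication by a bump supported where they agree, the two sections coincide; the
    Leibniz rule removes the bump because its derivative at [x] is zero. *)
Lemma conn_local (D : conn E) x v (e e' : section E) : is_connection D ->
  smooth_section e -> smooth_section e' ->
  (\forall y \near (x : B), e y = e' y) -> D x v e = D x v e'.
Proof.
move=> [_ _ DM _] se se' ee'; have [b [sb b1 b0]] := smooth_bump ee'.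
have E1 : (fun y => b y *: e y) = (fun y => b y *: e' y).
  apply/functional_extensionality_dep => y; have [->//|ne] := pselect (e y = e' y).
  by rewrite (nbhs_singleton (b0 y ne)) !scale0r.
have := DM x v b e sb se; rewrite E1 (DM x v b e' sb se').
have vb : sublv v b = 0.
  by rewrite -dv_smooth // (dv_near v b1) dv_cst.
by rewrite (nbhs_singleton b1) vb !scale0r !addr0 !scale1r.
Qed.

Lemma connM (D : conn E) x v (f : B -> R) (e e' : section E) : is_connection D ->
  smooth_at x f -> smooth_section e -> smooth_section e' ->
  (\forall y \near (x : B), e' y = f y *: e y) ->
  D x v e' = f x *: D x v e + dv v f *: e x.
Proof.
move=> cD /smooth_at_global[g sg Eg] se se' H.
rewrite (@conn_local D x v e' (fun y => g y *: e y)) //.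
- have [_ _ DM _] := cD; rewrite DM // (nbhs_singleton Eg); congr (_ + _ *: _).
  by rewrite (dvE v sg Eg).
- exact: smooth_sectionM.
- by apply: filterS2 H Eg => y -> ->.
Qed.

Lemma connD (D : conn E) x v (e e' : section E) : is_connection D ->
  smooth_section e -> smooth_section e' ->
  D x v (fun y => e y + e' y) = D x v e + D x v e'.
Proof. by move=> [_ DD _ _]; exact: DD. Qed.

Lemma conn_sum (D : conn E) x v n (e : 'I_n -> section E) : is_connection D ->
  (forall i, smooth_section (e i)) ->
  D x v (fun y => \sum_i e i y) = \sum_i D x v (e i).
Proof.
move=> cD; elim: n e => [|n IH] e se.
  have -> : (fun y => \sum_(i < 0) e i y) = (fun y => 0 *: (0 : E y)).
    by apply/functional_extensionality_dep => y; rewrite big_ord0 scale0r.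
  have [_ _ DM _] := cD; rewrite DM; [|exact: smoothf_cst|exact: smooth_section0].
  by rewrite scale0r scaler0 addr0 big_ord0.
have -> : (fun y => \sum_i e i y) = (fun y => e ord0 y + \sum_i e (lift ord0 i) y).
  by apply/functional_extensionality_dep => y; rewrite big_ord_recl.
by rewrite connD // ?IH ?big_ord_recl //; exact: smooth_section_sum.
Qed.

Lemma conn_lin (D : conn E) x (e : section E) : is_connection D -> smooth_section e ->
  linear (fun v => D x v e).
Proof. by move=> [DL _ _ _]; exact: DL. Qed.

End Connections.
End LineBundles.

(** * Partitions and existence of connections *)

Section Partition.
Context (R : realType) (B : space R) (E : bundle B).

(** A locally finite decomposition of the identity of [E] into global functionals times global
    sections: a partition of unity already combined with local frames. *)
Definition is_partition (e : nat -> section E) (l : nat -> tot E -> R) : Prop :=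
  [/\ forall n, smooth_section (e n), forall n, smoothf (l n),
      forall n x, linear (fun v : E x => l n (Tot v) : R^o)
    & forall x, exists N, \forall y \near (x : B),
        (forall m, (N <= m)%N -> forall v : E y, l m (Tot v) = 0) /\
        forall v : E y, v = \sum_(m < N) l m (Tot v) *: e m y].

(* psi_n = b_n prod_(i < n) (1 - b_i) telescopes to a partition of unity, which is
   locally finite because psi_m vanishes where b_n = 1 for n < m. *)
Lemma line_partition : @second_countable (pt B) -> is_vector_bundle 1 E ->
  exists (e : nat -> section E) (l : nat -> tot E -> R), is_partition e l.
Proof.
move=> [U cU [oU bU]] vE.
have stag := smooth_tag vE.
pose T := (section E * (tot E -> R) * (B -> R))%type.
pose P (t : T) := [/\ smooth_section t.1.1, smoothf t.1.2, smoothf t.2,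
  forall x, linear (fun v : E x => t.1.2 (Tot v) : R^o)
  & forall y, t.2 y <> 0 -> forall v : E y, v = t.1.2 (Tot v) *: t.1.1 y].
have /choice[d dP] : forall x : B, exists t : T, P t /\ \forall y \near (x : B), t.2 y = 1.
  move=> x; have [W [e [l [Wx fr]]]] := line_frame x vE.
  have [b [sb b1 b0]] := smooth_bump Wx.
  exists (e, l, b); split => //; have [? ? ? _ _] := fr; split => // y by0 v.
  apply: (frameE fr); apply: contrapT => nW; apply: by0 => /=.
  exact: nbhs_singleton (b0 y nW).
have /countable_injP[f fi] := cU.
pose V x := [set y : B | \forall z \near (y : B), (d x).2 z = 1].
pose idx n x := exists A, [/\ U A, f A = n & A `<=` V x].
pose t0 : T := (fun x => 0, fun _ => 0, fun _ => 0).
have P0 : P t0.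
  split => //=; [exact: smooth_section0|exact: smoothf_cst|exact: smoothf_cst|].
  by move=> x a u v; rewrite scaler0 addr0.
(* The index [n] encodes a set of the countable basis; if no such set lies in some [V x], the
   trivial data [t0] is used. *)
pose t n : T := if xget None [set o | exists2 x, idx n x & o = Some x] is Some x then d x else t0.
have tP n : P (t n).
  by rewrite /t; case: (xget _ _) => [x|//]; case: (dP x).
have cover x : exists n, \forall y \near (x : B), (t n).2 y = 1.
  have Vx : nbhs x (V x) by have [_] := dP x; exact: near_join.
  have [A [UA Ax] AV] := bU x _ Vx.
  exists (f A); rewrite /t; case: xgetP => [z _ [x' [A' [UA' fA AV'] ->]]|/(_ (Some x))[]].
    have AA : A' = A by apply: fi => //; apply/mem_set.
    by apply: AV'; rewrite AA.
  by exists x => //; exists A.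
pose b n := (t n).2.
have sb n : smoothf (b n) by case: (tP n).
pose psi n (x : B) := b n x * \prod_(i < n) (1 - b i x).
have spsi n : smoothf (psi n).
  move=> x; apply: smooth_atM; first exact: sb.
  by apply: smooth_at_prod => i _; apply: smooth_atB; [exact: smooth_at_cst|exact: sb].
have psiS n x : \sum_(m < n) psi m x = 1 - \prod_(i < n) (1 - b i x).
  elim: n => [|n IH]; first by rewrite !big_ord0 subrr.
  by rewrite !big_ord_recr /= IH /psi; ring.
have psi0 n m x : b n x = 1 -> (n < m)%N -> \prod_(i < m) (1 - b i x) = 0.
  by move=> bn nm; rewrite (bigD1 (Ordinal nm)) //= bn subrr mul0r.
exists (fun n => (t n).1.1), (fun n q => psi n (tag q) * (t n).1.2 q); split.
- by move=> n; case: (tP n).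
- move=> n q; apply: smooth_atM; first exact: stag _ (spsi n) q.
  by have [_ s _ _ _] := tP n; exact: s.
- move=> n x a u v /=; have [_ _ _ lin _] := tP n.
  by rewrite lin mulrDr mulrCA.
move=> x; have [n nb] := cover x; exists n.+1; apply: filterS nb => y by1; split.
  by move=> m nm v /=; rewrite /psi (psi0 n m) // mulr0 mul0r.
move=> v; have -> : \sum_(m < n.+1) (psi m (tag (Tot v)) * (t m).1.2 (Tot v)) *: (t m).1.1 y =
    \sum_(m < n.+1) psi m y *: v.
  apply: eq_bigr => m _ /=; rewrite -scalerA.
  have [p0|/eqP p0] := eqVneq (psi m y) 0; first by rewrite p0 !scale0r.
  congr (_ *: _); apply/esym; have [_ _ _ _ H] := tP m; apply: H => b0.
  by apply: p0; rewrite /psi /b b0 mul0r.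
by rewrite -scaler_suml psiS (psi0 n n.+1) // subr0 scale1r.
Qed.

Section Basics.
Context (e : nat -> section E) (l : nat -> tot E -> R) (pa : is_partition e l).

Lemma partition_section n : smooth_section (e n). Proof. by case: pa. Qed.
Lemma partition_coord n : smoothf (l n). Proof. by case: pa. Qed.
Lemma partition_lin n x a (u v : E x) : l n (Tot (a *: u + v)) = a * l n (Tot u) + l n (Tot v).
Proof. by have [_ _ H _] := pa; exact: H. Qed.
Lemma partition_0 n x : l n (Tot (0 : E x)) = 0.
Proof. by have := partition_lin n (-1) (0 : E x) 0; rewrite scaler0 addr0 mulN1r addNr. Qed.
Lemma partition_Z n x a (u : E x) : l n (Tot (a *: u)) = a * l n (Tot u).
Proof. by rewrite -[a *: u]addr0 partition_lin partition_0 addr0. Qed.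
Lemma partition_D n x (u v : E x) : l n (Tot (u + v)) = l n (Tot u) + l n (Tot v).
Proof. by rewrite -[u in LHS]scale1r partition_lin mul1r. Qed.

Definition partition_bound (x : B) (N : nat) : Prop := \forall y \near (x : B),
        (forall m, (N <= m)%N -> forall v : E y, l m (Tot v) = 0) /\
        forall v : E y, v = \sum_(m < N) l m (Tot v) *: e m y.

Lemma partition_boundP x : exists N, partition_bound x N.
Proof. by have [_ _ _] := pa; exact. Qed.

Definition bound_at (x : B) : nat := projT1 (cid (partition_boundP x)).

Lemma bound_atP x : partition_bound x (bound_at x).
Proof. by rewrite /bound_at; case: cid. Qed.

(** Terms beyond either bound vanish. Hence the bound [bound_at x], chosen pointwise and possibly
    jumping with [x], can be replaced by one that is constant near a point. *)
Lemma bound_sum (V : nmodType) x N M (F : nat -> V) : partition_bound x N -> partition_bound x M ->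
  (forall m, (\forall y \near (x : B), forall v : E y, l m (Tot v) = 0) -> F m = 0) ->
  \sum_(m < N) F m = \sum_(m < M) F m.
Proof.
wlog NM : N M / (N <= M)%N.
  move=> H pN pM F0; have [NM|/ltnW MN] := leqP N M; first exact: H.
  by apply/esym; apply: H.
move=> pN pM F0; rewrite -(subnKC NM) big_split_ord /= [X in _ + X]big1 ?addr0 // => i _.
by apply: F0; apply: filterS pN => y [H _] v; apply: H; rewrite leq_addr.
Qed.
End Basics.
End Partition.

Section ConnectionExists.
Context (R : realType) (B : space R) (E : bundle B).

(** The coordinates [l m] of a section are differentiated and multiplied back by the sections [e m].
    The zeroth order term of the Leibniz rule comes from the fact that the partition reproduces each
    section. *)
Lemma connection_exists : is_manifold B -> is_vector_bundle 1 E ->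
  exists D : conn E, is_connection D.
Proof.
move=> [_ [sc _]] vE; have [e [l pa]] := line_partition sc vE.
pose N := bound_at pa.
pose D : conn E := fun x v s => \sum_(m < N x) dv v (fun y => l m (Tot (s y))) *: e m x.
have sl m s x : smooth_section s -> smooth_at x (fun y => l m (Tot (s y))).
  by move=> /smoothP/(_ x); apply; exact: (partition_coord pa).
have DE x v s n : partition_bound e l x n ->
    D x v s = \sum_(m < n) dv v (fun y => l m (Tot (s y))) *: e m x.
  move=> pn; apply: (@bound_sum _ _ _ e l _ x (N x) n (fun m => dv v (fun y => l m (Tot (s y))) *: e m x)).
  - exact: bound_atP.
  - exact: pn.
  move=> m H; have -> : dv v (fun y => l m (Tot (s y))) = dv v (fun _ => 0).
    by apply: dv_near; apply: filterS H => y ->.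
  by rewrite dv_cst scale0r.
exists D; split.
- move=> x s ss a v w; rewrite /D scaler_sumr -big_split /=; apply: eq_bigr => m _.
  by rewrite dv_lin scalerDl scalerA.
- move=> x v s s' ss ss'; rewrite /D -big_split /=; apply: eq_bigr => m _.
  rewrite -scalerDl -dvD; [|exact: sl|exact: sl]; congr (_ *: _); apply: dv_near.
  by apply: near_all => y; rewrite (partition_D pa).
- move=> x v f s sf ss.
  have -> : D x v (fun y => f y *: s y) = \sum_(m < N x)
      (f x *: (dv v (fun y => l m (Tot (s y))) *: e m x) + dv v f *: (l m (Tot (s x)) *: e m x)).
    apply: eq_bigr => m _; rewrite !scalerA -scalerDl; congr (_ *: _).
    rewrite (mulrC (dv v f)) -dvM; [|exact: sf|exact: sl]; apply: dv_near.
    by apply: near_all => y; rewrite (partition_Z pa).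
  rewrite big_split /= -!scaler_sumr dv_smooth //; congr (_ + _ *: _).
  by have [_ H] := nbhs_singleton (bound_atP pa x); rewrite -H.
move=> X s sX ss; apply/smoothP => x.
have pn := bound_atP pa x.
have : smooth_map_at x (fun y => Tot (\sum_(m < N x) dv (X y) (fun z => l m (Tot (s z))) *: e m y)).
  apply: (@line_smooth_lin R B E vE B x id).
  - by move=> f.
  - move=> m; apply: (proj1 (smooth_sectionP X) sX (fun z => l m (Tot (s z)))).
    by move=> y; exact: sl.
  - by move=> m; have /smoothP := partition_section pa m; exact.
apply: smooth_map_at_ext; apply: filterS (near_join pn) => y py.
by rewrite (DE y (X y) s _ py).
Qed.
End ConnectionExists.

Section Linear.
Context (K : pzRingType) (U W : lmodType K) (f : U -> W).
Hypothesis lf : linear f.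
Lemma lin_0 : f 0 = 0.
Proof. by have := lf (-1) 0 0; rewrite scaler0 addr0 scaleN1r addNr. Qed.
Lemma lin_D x y : f (x + y) = f x + f y.
Proof. by rewrite -[x in LHS]scale1r lf scale1r. Qed.
Lemma lin_Z a x : f (a *: x) = a *: f x.
Proof. by rewrite -[a *: x]addr0 lf lin_0 addr0. Qed.
Lemma lin_N x : f (- x) = - f x.
Proof. by rewrite -scaleN1r lin_Z scaleN1r. Qed.
Lemma lin_B x y : f (x - y) = f x - f y.
Proof. by rewrite lin_D lin_N. Qed.
Lemma lin_sum I (r : seq I) (g : I -> U) : f (\sum_(i <- r) g i) = \sum_(i <- r) f (g i).
Proof. by elim/big_rec2: _ => [|i y z _ <-]; rewrite ?lin_0 // lin_D. Qed.
End Linear.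

Lemma near_smooth (R : realType) (X Y : space R) (p : X) (phi : X -> Y) (A : Y -> Prop) :
  smooth_map_at p phi -> (\forall y \near (phi p : Y), A y) -> \forall q \near (p : X), A (phi q).
Proof. by move=> sphi nA; exact: (smooth_map_at_cvg sphi nA). Qed.

Section SmoothAlong.
Context (R : realType) (B : space R) (E : bundle B).
Hypotheses (mB : is_manifold B) (vE : is_vector_bundle 1 E).

(** A connection is only assumed smooth on vector fields; expanding a vector along a map in
    coordinate fields extends this to vectors depending smoothly on a parameter. *)
Lemma conn_smooth_at (D : conn E) (e : section E) (X : space R) (p : X) (P : X -> tot (TB B)) :
  is_connection D -> smooth_section e -> smooth_map_at p P ->
  smooth_map_at p (fun q => Tot (D _ (tagged (P q)) e)).
Proof.
move=> cD se sP; have [n [x [F [c [[sx sF EF _ _] _]]]]] := manifold_chart (tag (P p)) mB.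
have st : smooth_map_at p (fun q => tag (P q) : B).
  by apply: (smooth_map_at_comp sP); move/smoothP: (@smooth_tag_TB R B); exact.
have : smooth_map_at p (fun q => Tot (\sum_i dv (tagged (P q)) (x i) *: D _ (F i (tag (P q))) e)).
  apply: (@line_smooth_lin R B E vE X p (fun q => tag (P q)) n (fun i q => dv (tagged (P q)) (x i))).
  - exact: st.
  - by move=> i; apply: (sP (fun q : tot (TB B) => dv (tagged q) (x i))); exact: smooth_dv.
  - move=> i; have [_ _ _ H] := cD; have /smoothP sD := H (F i) e (sF i) se.
    exact: (smooth_map_at_comp st (sD _)).
apply: smooth_map_at_ext; have := smooth_map_at_cvg st EF.
apply: (@filterS _ _ (nbhs_filter p)) => q /= /(_ (tagged (P q))) H.
rewrite [in RHS]H; congr Tot.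
rewrite (lin_sum (conn_lin cD se (x := tag (P q)))).
by apply: eq_bigr => i _; rewrite (lin_Z (conn_lin cD se (x := tag (P q)))).
Qed.
End SmoothAlong.

(** * Pullback along maps that are isomorphisms of line fibres *)

Section FibreIso.
Context (R : realType) (B B' : space R) (E : bundle B) (E' : bundle B') (f : B -> B').
Context (F : forall x, E x -> E' (f x)).
Hypotheses (vE : is_vector_bundle 1 E) (vE' : is_vector_bundle 1 E').
Hypothesis sF : smooth (fun q : tot E => Tot (F (tagged q))).
Hypotheses (lF : forall x, linear (@F x)) (iF : forall x, injective (@F x)).
Arguments lF : clear implicits.
Arguments iF : clear implicits.

Lemma iso_base_smooth : smooth f.
Proof.
have s0 := smooth_section0 vE.
exact: smooth_comp s0 (smooth_comp sF (smooth_tag vE')).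
Qed.

(** An injective linear map between lines is onto, so the choice in [finv] always finds a
    preimage. *)
Lemma iso_finvP x (v : E' (f x)) : F (finv (@F x) v) = v.
Proof.
have [e en0 eE] := line_fiber vE x; have [e' e'n0 e'E] := line_fiber vE' (f x).
apply: (xgetPex 0 (P := [set u | F u = v])).
have [c ce] := e'E (F e); have [d de] := e'E v.
have c0 : c != 0.
  apply/eqP => c0; move/eqP: en0; apply; apply: iF.
  by rewrite ce c0 scale0r (lin_0 (lF x)).
by exists ((d / c) *: e); rewrite /= (lin_Z (lF x)) ce scalerA divfK.
Qed.

Lemma iso_finv_lin x : linear (finv (@F x)).
Proof. by move=> a u v; apply: iF; rewrite (lF x) !iso_finvP. Qed.

(** The coordinate of [Q] is that of its image divided by the coordinate [c] of the image of the
    frame, and [c] does not vanish because [F] is injective. *)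
Lemma iso_smooth (X : space R) (p : X) (Q : X -> tot E) : smooth_map_at p (fun q => tag (Q q) : B) ->
  smooth_map_at p (fun q => Tot (F (tagged (Q q)))) -> smooth_map_at p Q.
Proof.
move=> s1 s2; have [W [e [l [Wx fr]]]] := line_frame (tag (Q p)) vE.
have [W' [e' [l' [Wx' fr']]]] := line_frame (f (tag (Q p))) vE'.
apply: (frame_smooth fr) => //=; first exact: nbhs_singleton Wx.
pose c q := l' (Tot (F (e (tag (Q q))))).
have sc : smooth_at p c.
  apply: (frame_coord_at fr'); apply: (smooth_map_at_comp (phi := fun q => Tot (e (tag (Q q)))) (psi := fun q : tot E => Tot (F (tagged q)))).
    exact: (smooth_map_at_comp s1 (proj1 (smoothP _) (frame_section fr) _)).
  by move/smoothP: sF; exact.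
have c0 : c p != 0.
  apply/eqP => c0; have := frame_neq0 fr (nbhs_singleton Wx); move/eqP; apply; apply: iF.
  apply: (frame_inj fr' (nbhs_singleton Wx')); rewrite (lin_0 (lF _)) (frame_0 fr').
  exact: c0.
apply: (smooth_at_ext (f := fun q => l' (Tot (F (tagged (Q q)))) * (c q)^-1)); last first.
  by apply: smooth_atM; [exact: (frame_coord_at fr' s2)|exact: smooth_atV].
have WQ : \forall q \near (p : X), W (tag (Q q)) by exact: (near_smooth s1 Wx).
apply: filterS2 (smooth_at_neq0 sc c0) WQ => q cq Wq /=.
by rewrite {1}(frameE fr (tagged (Q q)) Wq) (lin_Z (lF _)) (frame_Z fr') mulfK //; case: (Q q) cq Wq.
Qed.

Lemma pull_section_smooth (e : section E') : smooth_section e -> smooth_section (pull_section F e).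
Proof.
move=> se; apply/smoothP => x; apply: iso_smooth; first by move=> g.
apply: (smooth_map_at_ext (phi := fun y => Tot (e (f y)))).
  by apply: near_all => y /=; rewrite iso_finvP.
by move: x; apply/smoothP; exact: smooth_comp iso_base_smooth se.
Qed.

Lemma pull_frame (W : set B') (e : section E') (l : tot E' -> R) : is_frame W e l ->
  is_frame (f @^-1` W) (pull_section F e) (fun q : tot E => l (Tot (F (tagged q)))).
Proof.
move=> fr; split.
- exact: pull_section_smooth (frame_section fr).
- exact: sF (frame_coord fr).
- by move=> x a u v; rewrite /= (lF x) (frame_lin fr).
- move=> x Wx; split; first by rewrite /= iso_finvP (frame1 fr).
  by move=> v; apply: iF; rewrite (lin_Z (lF x)) iso_finvP -(frameE fr).
move=> X p Q WQ s1 s2; apply: iso_smooth => //.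
by apply: (frame_smooth fr) => //; exact: (smooth_map_at_comp s1 (proj1 (smoothP _) iso_base_smooth _)).
Qed.

Hypotheses (mB' : is_manifold B').

(** A section is expanded in the pulled back sections [e m], whose derivatives are prescribed, and
    the Leibniz rule dictates the rest. That the prescription then holds for every [e'] is the
    Leibniz rule of [nabla] applied to the expansion of [e']. *)
Lemma pull_conn_exists (nabla : conn E') : is_connection nabla -> exists D : conn E,
  is_connection D /\ forall (e' : section E') y (w : tangent y), smooth_section e' ->
          D y w (pull_section F e') = finv (@F y) (nabla (f y) (dmap f w) e').
Proof.
move=> cN; have [_ [sc _]] := mB'; have [e [l pa]] := line_partition sc vE'.
have sf := iso_base_smooth.
pose N x := bound_at pa (f x).
pose co m (s : section E) y := l m (Tot (F (s y))).
pose T x (v : tangent x) (s : section E) m := dv v (co m s) *: pull_section F (e m) x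
  + co m s x *: finv (@F x) (nabla (f x) (dmap f v) (e m)).
pose D : conn E := fun x v s => \sum_(m < N x) T x v s m.
have sl m s x : smooth_section s -> smooth_at x (co m s).
  move=> ss; have := smooth_comp ss sF; move=> /(_ _ (partition_coord pa m)); exact.
have DE x v s n : partition_bound e l (f x) n -> D x v s = \sum_(m < n) T x v s m.
  move=> pn; apply: (@bound_sum _ _ _ e l _ (f x) (N x) n (fun m => T x v s m)).
  - exact: bound_atP.
  - exact: pn.
  move=> m H; rewrite /T; have -> : dv v (co m s) = dv v (fun _ => 0).
    apply: dv_near; have := smooth_continuous sf H.
    by apply: (@filterS _ _ (nbhs_filter x)) => y; apply.
  by rewrite dv_cst /co (nbhs_singleton H) !scale0r addr0.
have linN x (s : section E') : smooth_section s -> linear (fun v : tangent x => nabla (f x) (dmap f v) s).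
  by move=> ss a u v; rewrite (dmap_lin sf) (conn_lin cN ss).
have sumE x (s : section E) : \sum_(m < N x) co m s x *: pull_section F (e m) x = s x.
  apply: iF; rewrite (lin_sum (lF x)).
  have [_ H] := nbhs_singleton (bound_atP pa (f x)); rewrite [RHS](H (F (s x))).
  by apply: eq_bigr => m _; rewrite (lin_Z (lF x)) iso_finvP.
have cD : is_connection D.
  split.
  - move=> x s ss a v w; rewrite /D scaler_sumr -big_split /=; apply: eq_bigr => m _.
    rewrite /T dv_lin (linN x (e m) (partition_section pa m)) iso_finv_lin.
    rewrite scalerDl !scalerDr !scalerA (mulrC _ a) -!addrA; congr (_ + _).
    by rewrite addrCA.
  - move=> x v s s' ss ss'; rewrite /D -big_split /=; apply: eq_bigr => m _.
    have -> : T x v (fun y => s y + s' y) m = (dv v (co m s) + dv v (co m s')) *: pull_section F (e m) x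
       + (co m s x + co m s' x) *: finv (@F x) (nabla (f x) (dmap f v) (e m)).
      rewrite /T -dvD; [|exact: sl|exact: sl]; rewrite {2}/co (lin_D (lF x)) (partition_D pa).
      congr (_ *: _ + _); apply: dv_near.
      by apply: near_all => y; rewrite /co (lin_D (lF y)) (partition_D pa).
    by rewrite /T !scalerDl -!addrA; congr (_ + _); rewrite addrCA.
  - move=> x v g s sg ss.
    have -> : D x v (fun y => g y *: s y) = \sum_(m < N x)
        (g x *: T x v s m + dv v g *: (co m s x *: pull_section F (e m) x)).
      apply: eq_bigr => m _; rewrite /T.
      have -> : co m (fun y => g y *: s y) = fun y => g y * co m s y.
        by apply: boolp.funext => y; rewrite /co (lin_Z (lF y)) (partition_Z pa).
      rewrite dvM; [|exact: sg|exact: sl].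
      rewrite scalerDr scalerDl !scalerA -!addrA; congr (_ + _).
      by rewrite addrC (mulrC (co m s x)).
    by rewrite big_split /= -!scaler_sumr sumE dv_smooth.
  move=> X s sX ss; apply/smoothP => x.
  have pn := bound_atP pa (f x).
  have sDX m : smooth_map_at x (fun y => Tot (finv (@F y) (nabla (f y) (dmap f (X y)) (e m)))).
    apply: iso_smooth; first by move=> g.
    apply: (smooth_map_at_ext (phi := fun y => Tot (nabla (f y) (dmap f (X y)) (e m)))).
      by apply: near_all => y /=; rewrite iso_finvP.
    apply: (conn_smooth_at mB' vE' cN (partition_section pa m) (P := fun y => @Tot R B' (TB B') (f y) (dmap f (X y)))).
    apply/smooth_map_atP => h [] [g sg ->]; first exact: sf.
    have := proj1 (smooth_sectionP X) sX _ (sf _ sg) x.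
    apply: smooth_at_ext; apply: near_all => y /=.
    by rewrite -dv_smooth // dmapEs.
  have : smooth_map_at x (fun y => Tot (\sum_(m < N x + N x)
      (match fintype.split m with inl m => dv (X y) (co m s) | inr m => co m s y end) *:
      match fintype.split m with inl m => pull_section F (e m) y | inr m => finv (@F y) (nabla (f y) (dmap f (X y)) (e m)) end)).
    apply: (@line_smooth_lin R B E vE B x id).
    - by move=> g.
    - move=> m; case: (fintype.split m) => j; last exact: sl.
      by apply: (proj1 (smooth_sectionP X) sX (co j s)) => y; exact: sl.
    - move=> m; case: (fintype.split m) => j; last exact: sDX.
      by have /smoothP := pull_section_smooth (partition_section pa j); exact.
  apply: smooth_map_at_ext; have := smooth_continuous sf (near_join pn).
  apply: (@filterS _ _ (nbhs_filter x)) => y py.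
  rewrite (DE y (X y) s _ py) big_split_ord /= /T big_split /=; congr (Tot (_ + _)); apply: eq_bigr => m _.
    have -> : fintype.split (lshift (N x) m) = inl m by exact: (unsplitK (inl m)).
    by [].
  have -> : fintype.split (rshift (N x) m) = inr m by exact: (unsplitK (inr m)).
  by [].
exists D; split => // s y w ss; apply: iF; rewrite iso_finvP /D (lin_sum (lF y)).
have sls m : smooth_at (f y) (fun z => l m (Tot (s z))).
  by have := ss _ (partition_coord pa m) (f y).
pose s' : section E' := fun z => \sum_(m < N y) l m (Tot (s z)) *: e m z.
rewrite (conn_local (e' := s') (dmap f w) cN ss); last first.
- by have := bound_atP pa (f y); apply: filterS => z [_ H]; rewrite [LHS]H.
- apply: smooth_section_sum => // m.
  by apply: smooth_sectionM => //; [exact: (ss _ (partition_coord pa m))|exact: (partition_section pa)].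
- rewrite /s' conn_sum //.
    apply: eq_bigr => m _; have [_ _ NM _] := cN.
    rewrite NM; [|exact: (ss _ (partition_coord pa m))|exact: (partition_section pa)].
    rewrite /T (lin_D (lF y)) !(lin_Z (lF y)) !iso_finvP addrC.
    have -> : co m (pull_section F s) = fun z => l m (Tot (s (f z))).
      by apply: boolp.funext => z; rewrite /co iso_finvP.
    congr (_ + _ *: _); rewrite -dv_smooth ?dmapEs //; exact: (ss _ (partition_coord pa m)).
  by move=> m; apply: smooth_sectionM => //; [exact: (ss _ (partition_coord pa m))|exact: (partition_section pa)].
Qed.

(** This replaces the choice inside [pull_conn] by a formula: existence makes the chosen value come
    from some connection with the prescribed derivatives, and that connection obeys the Leibniz
    rule. *)
Lemma pull_connE (nabla : conn E') x (v : tangent x) (s : section E) (e' : section E') (c : B -> R) :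
  is_connection nabla -> smooth_section s -> smooth_section e' -> smooth_at x c ->
  (\forall y \near (x : B), s y = c y *: pull_section F e' y) ->
  pull_conn F nabla v s = c x *: finv (@F x) (nabla (f x) (dmap f v) e') + dv v c *: pull_section F e' x.
Proof.
move=> cN ss se sc sE; rewrite /pull_conn.
set P := [set _ | _].
suff : P (xget 0 P).
  case=> D [cD DE ->]; rewrite (connM vE v cD sc (pull_section_smooth se) ss sE).
  by rewrite DE.
have [D [cD DE]] := pull_conn_exists cN.
by apply: (xgetPex 0); exists (D x v s), D.
Qed.
End FibreIso.

(** * Differentials as smooth maps of tangent bundles *)

Section TangentMaps.
Context (R : realType).
Implicit Types X Y Z : space R.

(** The differential on total spaces, where functoriality is a plain equation without transport of
    base points. *)
Definition Tmap X Y (phi : X -> Y) (q : tot (TB X)) : tot (TB Y) :=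
  @Tot R Y (TB Y) (phi (tag q)) (dmap phi (tagged q)).

Lemma Tmap_comp X Y Z (phi : X -> Y) (psi : Y -> Z) q : smooth phi -> smooth psi ->
  Tmap (psi \o phi) q = Tmap psi (Tmap phi q).
Proof. by move=> sphi spsi; rewrite /Tmap /= dmap_comp. Qed.

Lemma Tmap_id X (q : tot (TB X)) : Tmap id q = q.
Proof. by case: q => x v; rewrite /Tmap /= dmap_id. Qed.

(** The derivative of an arbitrary smooth function is, by the chain rule, a smooth combination of
    the derivatives of generators. *)
Lemma smooth_TB_at X Y (p : X) (P : X -> tot (TB Y)) :
  smooth_map_at p (fun q => tag (P q) : Y) ->
  (forall f : Y -> R, gen f -> smooth_at p (fun q => dv (tagged (P q)) f)) -> smooth_map_at p P.
Proof.
move=> st sg; apply/smooth_map_atP => h [] [f sf ->]; first exact: (st _ (sf _)).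
have [n [s [w [gs cw E]]]] := sf (tag (P p)).
have := near_smooth st (near_join E) => nE.
apply: (smooth_at_ext (f := fun q => \sum_i pd i (w : _ -> R^o) (\row_j s j (tag (P q))) * dv (tagged (P q)) (s i))).
  move: nE; apply: filterS => q Eq /=.
  rewrite -dv_smooth // (dv_near _ Eq) dv_comp //.
  by move=> i; exact: smoothf_gen.
apply: smooth_at_sum => i _; apply: smooth_atM; last exact: sg.
apply: (smooth_at_comp (u := fun j q => s j (tag (P q))) (w := pd i (w : _ -> R^o))).
  by move=> j; exact: (st _ (smoothf_gen (gs j) _)).
exact: Cinf_pd.
Qed.

Lemma smooth_at_Tmap X Y Z (p : X) (P : X -> tot (TB Y)) (phi : Y -> Z) : smooth phi ->
  smooth_map_at p P -> smooth_map_at p (fun q => Tmap phi (P q)).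
Proof.
move=> sphi sP; have st : smooth_map_at p (fun q => tag (P q) : Y).
  exact: (smooth_map_at_comp sP (proj1 (smoothP _) (@smooth_tag_TB R Y) _)).
apply: smooth_TB_at; first exact: (smooth_map_at_comp st (proj1 (smoothP _) sphi _)).
move=> f /smoothf_gen sf.
apply: smooth_at_ext (sP _ (smooth_dv (sphi _ sf) _)); apply: near_all => q /=.
by rewrite dmapEs.
Qed.

Lemma smooth_at_TB_initial (T : Type) X Y (i : T -> Y) (p : X) (P : X -> tot (TB (initial_space i))) :
  smooth_map_at p (fun q => Tmap (i : initial_space i -> Y) (P q)) -> smooth_map_at p P.
Proof.
move=> sP; apply: smooth_TB_at.
  apply/(smooth_map_at_initial (i := i)).
  exact: (smooth_map_at_comp sP (proj1 (smoothP _) (@smooth_tag_TB R Y) _)).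
move=> _ [h gh <-]; have sh := smoothf_gen gh.
apply: smooth_at_ext (sP _ (smooth_dv sh _)); apply: near_all => q /=.
by rewrite dmapEs //; exact: smooth_initial_map.
Qed.

Lemma smooth_at_TB_pair X Y Z (p : X) (P : X -> tot (TB (prod_space Y Z))) :
  smooth_map_at p (fun q => Tmap (fst : prod_space Y Z -> Y) (P q)) ->
  smooth_map_at p (fun q => Tmap (snd : prod_space Y Z -> Z) (P q)) -> smooth_map_at p P.
Proof.
move=> s1 s2; apply: smooth_TB_at.
  apply: (smooth_map_at_ext (phi := fun q => (tag (Tmap (fst : prod_space Y Z -> Y) (P q)),
      tag (Tmap (snd : prod_space Y Z -> Z) (P q))) : prod_space Y Z)).
    by apply: near_all => q /=; case: (tag (P q)).
  apply: smooth_map_at_pair.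
    exact: (smooth_map_at_comp s1 (proj1 (smoothP _) (@smooth_tag_TB R Y) _)).
  exact: (smooth_map_at_comp s2 (proj1 (smoothP _) (@smooth_tag_TB R Z) _)).
move=> _ [] [h gh <-]; have sh := smoothf_gen gh.
  apply: smooth_at_ext (s1 _ (smooth_dv sh _)); apply: near_all => q /=.
  by rewrite dmapEs //; exact: smooth_fst.
apply: smooth_at_ext (s2 _ (smooth_dv sh _)); apply: near_all => q /=.
by rewrite dmapEs //; exact: smooth_snd.
Qed.

Lemma smooth_at_TB_lin X Y (p : X) n (f : X -> Y) (c : 'I_n -> X -> R) (E : 'I_n -> forall q, tangent (f q)) :
  smooth_map_at p f -> (forall i, smooth_at p (c i)) ->
  (forall i, smooth_map_at p (fun q => @Tot R Y (TB Y) (f q) (E i q))) ->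
  smooth_map_at p (fun q => @Tot R Y (TB Y) (f q) (\sum_i c i q *: E i q)).
Proof.
move=> sf sc sE; apply: smooth_TB_at => //= g /smoothf_gen sg.
apply: (smooth_at_ext (f := fun q => \sum_i c i q * dv (E i q) g)).
  by apply: near_all => q; rewrite dv_sumv; apply: eq_bigr => i _; rewrite dv_scale.
apply: smooth_at_sum => i _; apply: smooth_atM => //; exact: (sE i _ (smooth_dv sg _)).
Qed.

Lemma vector_extend X (p : X) (v : tangent p) : is_manifold X ->
  exists2 V : section (TB X), smooth_section V & V p = v.
Proof.
move=> mX; have [n [x [E [c [[sx sE Ee _ _] _]]]]] := manifold_chart p mX.
exists (fun q => \sum_i dv v (x i) *: E i q); last by rewrite [RHS](nbhs_singleton Ee).
apply/smoothP => q; apply: (smooth_at_TB_lin (f := id) (c := fun i _ => dv v (x i))) => // [i|i].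
  exact: smooth_at_cst.
by move: q; apply/smoothP; exact: sE.
Qed.
End TangentMaps.

Section SmoothMatrix.
Context (R : realType) (X : space R) (p : X).

Lemma smooth_at_det n (A : X -> 'M[R]_n) : (forall i j, smooth_at p (fun q => A q i j)) ->
  smooth_at p (fun q => \det (A q)).
Proof.
move=> sA; rewrite /determinant; apply: smooth_at_sum => s _; apply: smooth_atM.
  exact: smooth_at_cst.
by apply: smooth_at_prod.
Qed.

(** Cramer's rule: the entries of the inverse are cofactors divided by a determinant that stays
    nonzero near [p]. *)
Lemma smooth_at_invmx n (A : X -> 'M[R]_n) : (forall i j, smooth_at p (fun q => A q i j)) ->
  A p \in unitmx -> (\forall q \near (p : X), A q \in unitmx) /\
  forall i j, smooth_at p (fun q => invmx (A q) i j).
Proof.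
move=> sA; rewrite unitmxE unitfE => d0; have sd := smooth_at_det sA.
have nd := smooth_at_neq0 sd d0; split.
  by apply: filterS nd => q dq; rewrite unitmxE unitfE.
move=> i j; apply: (smooth_at_ext (f := fun q => (\det (A q))^-1 * cofactor (A q) j i)).
  by apply: filterS nd => q dq; rewrite /invmx unitmxE unitfE dq !mxE.
apply: smooth_atM; first exact: smooth_atV.
apply: smooth_atZ; apply: smooth_at_det => a b.
by apply: smooth_at_ext (sA (lift j a) (lift i b)); apply: near_all => q; rewrite !mxE.
Qed.
End SmoothMatrix.

(** * Smooth local splittings of a submersion *)

Section HorizontalLift.
Context (R : realType) (X Y : space R) (phi : X -> Y).
Hypotheses (mX : is_manifold X) (mY : is_manifold Y) (sub_phi : submersion phi).

(** A submersion is only known to be surjective on tangent vectors pointwise. This produces a right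
    inverse of the differential with smooth coefficients [N] in local frames. *)
Lemma horizontal_lift p : exists n (E : 'I_n -> section (TB X)) m (y : 'I_m -> Y -> R) (N : 'I_m -> 'I_n -> X -> R),
  [/\ forall i, smooth_section (E i), forall k, smoothf (y k), forall k i, smooth_at p (N k i),
      \forall q \near (phi p : Y), forall v w : tangent q, (forall k, dv v (y k) = dv w (y k)) -> v = w
    & \forall q \near (p : X), forall (c : 'I_m -> R) l,
        dv (dmap phi (\sum_i (\sum_k c k * N k i q) *: E i q)) (y l) = c l].
Proof.
have [sphi surj] := sub_phi.
have [n [x [E [_ [[sx sE Ee _ _] _]]]]] := manifold_chart p mX.
have [m [y [F [_ [[sy sF Fe Fd _] _]]]]] := manifold_chart (phi p) mY.
pose T q : 'M[R]_(n, m) := \matrix_(i, k) dv (E i q) (y k \o phi).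
have sT i k : smooth_at p (fun q => T q i k).
  apply: smooth_at_ext (proj1 (smooth_sectionP (E i)) (sE i) _ (sphi _ (sy k)) p).
  by apply: near_all => q; rewrite mxE.
have /choice[v vP] : forall k, exists v, dmap phi v = F k (phi p) by move=> k; exact: surj.
(* The rows are the coordinates of lifts at the single point [p]. The constant matrix [S] inverts
   [T] from the left only at [p], but [S *m T q] stays invertible nearby, and correcting by its
   inverse gives the splitting. *)
pose S : 'M[R]_(m, n) := \matrix_(k, i) dv (v k) (x i).
have ST : S *m T p = 1%:M.
  apply/matrixP => k l; rewrite !mxE -(nbhs_singleton Fd) -vP dmapEs //.
  rewrite [v k in RHS](nbhs_singleton Ee) dv_sumv; apply: eq_bigr => i _.
  by rewrite !mxE dv_scale.
have sST k l : smooth_at p (fun q => (S *m T q) k l).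
  apply: (smooth_at_ext (f := fun q => \sum_i S k i * T q i l)).
    by apply: near_all => q; rewrite [RHS]mxE.
  by apply: smooth_at_sum => i _; apply: smooth_atZ.
have UT : S *m T p \in unitmx by rewrite ST unitmx1.
have [nU sI] := smooth_at_invmx sST UT.
exists n, E, m, y, (fun k i q => (invmx (S *m T q) *m S) k i); split => //.
- move=> k i; apply: (smooth_at_ext (f := fun q => \sum_l invmx (S *m T q) k l * S l i)).
    by apply: near_all => q; rewrite [RHS]mxE.
  by apply: smooth_at_sum => l _; apply: smooth_atM => //; exact: smooth_at_cst.
- by apply: filterS Fe => q Fq v' w H; rewrite (Fq v') (Fq w); apply: eq_bigr => k _; rewrite H.
apply: filterS nU => q Uq c l.
rewrite dmapEs // dv_sumv.
rewrite (eq_bigr (fun i => \sum_k c k * ((invmx (S *m T q) *m S) k i * T q i l))); last first.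
  by move=> i _; rewrite dv_scale mulr_suml; apply: eq_bigr => k _; rewrite -mulrA [T q i l]mxE.
rewrite exchange_big /= (eq_bigr (fun k => c k * (k == l)%:R)); last first.
  move=> k _; rewrite -mulr_sumr; congr (_ * _).
  have : (invmx (S *m T q) *m S *m T q) k l = (1%:M : 'M[R]_m) k l by rewrite -mulmxA mulVmx.
  by rewrite !mxE.
rewrite (bigD1 l) //= eqxx mulr1 big1 ?addr0 // => k /negPf ->.
by rewrite mulr0.
Qed.
End HorizontalLift.

(** * Commutators of vector fields *)

Section Commutator.
Context (R : realType) (X : space R) (p : X) (V W : section (TB X)).
Hypotheses (sV : smooth_map_at p (fun q => Tot (V q))) (sW : smooth_map_at p (fun q => Tot (W q))).

(** The fields need to be smooth at [p] only, which is all that is known of the lifted fields on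
    composable pairs. *)
Lemma commutator_exists : exists c : tangent p, forall f, smoothf f ->
  dv c f = dv (V p) (fun q => dv (W q) f) - dv (W p) (fun q => dv (V q) f).
Proof.
have dV f : smoothf f -> smooth_at p (fun q => dv (V q) f) by move=> sf; exact: (proj2 (smooth_section_at V p) sV).
have dW f : smoothf f -> smooth_at p (fun q => dv (W q) f) by move=> sf; exact: (proj2 (smooth_section_at W p) sW).
apply: der_make => [a f g sf sg|f g sf sg];
  have [a1 a2 a3 a4] := And4 (dV f sf) (dV g sg) (dW f sf) (dW g sg); have [a5 a6] := conj (sf p) (sg p).
  have E (U : section (TB X)) : (fun q => dv (U q) (fun x => a * f x + g x)) = fun q => a * dv (U q) f + dv (U q) g.
    by apply: boolp.funext => q; rewrite dvD ?dvZ //; first [exact: sf|exact: sg|exact: (smooth_atZ _ (sf q))].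
  rewrite !E !dvD ?dvZ; try first [assumption | by apply: smooth_atZ].
  by ring.
have E (U : section (TB X)) : (fun q => dv (U q) (fun x => f x * g x)) = fun q => f q * dv (U q) g + g q * dv (U q) f.
  by apply: boolp.funext => q; rewrite dvM; [|exact: sf|exact: sg].
rewrite !E !dvD ?dvM; try first [assumption | by apply: smooth_atM].
by ring.
Qed.

(* If the 1-form [sum A dF] vanishes near [p], so does its differential [sum dA /\ dF]. *)
Lemma closed_zero_form (I : finType) (A F : I -> X -> R) : (forall k, smoothf (F k)) ->
  (forall k, smooth_at p (A k)) ->
  (\forall q \near (p : X), forall v : tangent q, \sum_k A k q * dv v (F k) = 0) ->
  \sum_k (dv (V p) (A k) * dv (W p) (F k) - dv (W p) (A k) * dv (V p) (F k)) = 0.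
Proof.
move=> sF sA H; have [c cE] := commutator_exists.
have dV k : smooth_at p (fun q => dv (V q) (F k)) by exact: (proj2 (smooth_section_at V p) sV).
have dW k : smooth_at p (fun q => dv (W q) (F k)) by exact: (proj2 (smooth_section_at W p) sW).
have z (U U' : section (TB X)) : (forall k, smooth_at p (fun q => dv (U' q) (F k))) ->
    \sum_k (A k p * dv (U p) (fun q => dv (U' q) (F k)) + dv (U' p) (F k) * dv (U p) (A k)) = 0.
  move=> sU; rewrite -[RHS](dv_cst (U p) 0).
  rewrite -(@dv_near R X p (U p) (fun q => \sum_k A k q * dv (U' q) (F k))); last first.
    by apply: filterS H => q; apply.
  rewrite dv_sum; last by move=> k; exact: smooth_atM.
  by apply: eq_bigr => k _; rewrite dvM.
have := congr2 (fun a b => a - b) (z V W dW) (z W V dV); rewrite subr0 -sumrB /=.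
have := nbhs_singleton H c => H0.
move=> E; have := congr2 (fun a b => a - b) E H0; rewrite subr0 -sumrB => {}E.
apply: etrans E; apply: eq_bigr => k _.
by rewrite cE //; ring.
Qed.

(** For smooth fields the operator inside [bracket] is a derivation, so its [insubd] does not fall
    back on 0. *)
Lemma bracketE f : smooth_section V -> smooth_section W -> smoothf f ->
  dv (bracket V W p) f = dv (V p) (fun q => dv (W q) f) - dv (W p) (fun q => dv (V q) f).
Proof.
move=> gV gW sf; have [c cE] := commutator_exists; rewrite -cE //; congr (dv _ f).
apply: val_inj; rewrite /bracket.
have -> : (fun h : X -> R => sublv (V p) (fun q => sublv (W q) h) - sublv (W p) (fun q => sublv (V q) h)) = sublv c.
  apply: boolp.funext => h; have [sh|nh] := pselect (smoothf h); last first.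
    have z (U : section (TB X)) : (fun q => sublv (U q) h) = fun _ => 0.
      by apply: boolp.funext => q; have [-> //] := tangentP (U q).
    by rewrite !z; have [-> //] := tangentP c; rewrite !der_cst subr0.
  have E (U : section (TB X)) : (fun q => sublv (U q) h) = fun q => dv (U q) h.
    by apply: boolp.funext => q; rewrite dv_smooth.
  rewrite -(dv_smooth c sh) cE // !E -!dv_smooth //; exact: (proj1 (smooth_sectionP _)).
by rewrite /insubd valK.
Qed.
End Commutator.

(** * The covariant exterior derivative in a frame *)

Section ExteriorDerivative.
Context (R : realType) (B : space R) (E : bundle B).
Hypotheses (mB : is_manifold B) (vE : is_vector_bundle 1 E).
Context (th : form1 E).
Hypothesis fth : is_form1 th.

Lemma form1_smooth_at (X : space R) (p : X) (P : X -> tot (TB B)) : smooth_map_at p P ->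
  smooth_map_at p (fun q => Tot (th (tagged (P q)))).
Proof.
by have [_ /smoothP s] := fth; move=> sP; exact: (smooth_map_at_comp sP (s _)).
Qed.

Lemma form1_local g W (e : section E) l : is_frame W e l -> (\forall y \near (g : B), W y) ->
  exists n (a X : 'I_n -> B -> R), [/\ forall i, smoothf (a i), forall i, smoothf (X i)
    & \forall y \near (g : B), forall w : tangent y, l (Tot (th w)) = \sum_i a i y * dv w (X i)].
Proof.
move=> fr Wg; have [n [x [F [_ [[sx sF Fe _ _] _]]]]] := manifold_chart g mB.
exists n, (fun i y => l (Tot (th (F i y)))), x; split => //.
  move=> i y; apply: (frame_coord_at fr); apply: (form1_smooth_at (P := fun y => Tot (F i y))).
  by move: y; apply/smoothP; exact: sF.
apply: filterS Fe => y Fy w; have [lth _] := fth.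
rewrite {1}(Fy w) (lin_sum (lth y)) -[RHS]addr0.
elim/big_rec2: _ => [|i u v _ IH]; first by rewrite (frame_0 fr) addr0.
by rewrite (lin_Z (lth y)) (frame_D fr) (frame_Z fr) IH -!addrA mulrC.
Qed.

(** If [th] is [alpha] times [s0] and [al] is the connection form of [D] in the frame [s0], then the
    derivative is [d alpha + al /\ alpha] times [s0]. The right side no longer involves the vector
    fields, so their choice in [dconn] is immaterial. *)
Lemma dconnE (D : conn E) g (s0 : section E) (al : tangent g -> R) n (a X : 'I_n -> B -> R) v w :
  (forall u (s : section E) c, smooth_section s -> smooth_at g c ->
    (\forall y \near (g : B), s y = c y *: s0 y) -> D g u s = (c g * al u + dv u c) *: s0 g) ->
  (forall i, smooth_at g (a i)) -> (forall i, smoothf (X i)) ->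
  (\forall y \near (g : B), forall w : tangent y, th w = (\sum_i a i y * dv w (X i)) *: s0 y) ->
  dconn D th v w =
    (\sum_i (dv v (a i) * dv w (X i) - dv w (a i) * dv v (X i)) +
     (al v * \sum_i a i g * dv w (X i) - al w * \sum_i a i g * dv v (X i))) *: s0 g.
Proof.
move=> HD sa sX Hth; rewrite /dconn; set P := [set _ | _].
suff : P (xget 0 P).
  case=> V [W [sV sW Vg Wg ->]].
  have thS (U : section (TB B)) : smooth_section U -> smooth_section (fun y => th (U y)).
    move=> sU; apply/smoothP => y; apply: (form1_smooth_at (P := fun y => Tot (U y))).
    by move: y; apply/smoothP.
  have cS (U : section (TB B)) : smooth_section U -> smooth_at g (fun y => \sum_i a i y * dv (U y) (X i)).
    move=> sU; apply: smooth_at_sum => i _; apply: smooth_atM => //.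
    exact: (proj1 (smooth_sectionP U) sU).
  have DE u (U : section (TB B)) : smooth_section U ->
      D g u (fun y => th (U y)) = (\sum_i a i g * dv (U g) (X i) * al u +
        \sum_i (a i g * dv u (fun y => dv (U y) (X i)) + dv (U g) (X i) * dv u (a i))) *: s0 g.
    move=> sU; rewrite (HD u _ (fun y => \sum_i a i y * dv (U y) (X i))); last first.
    - by apply: filterS Hth => y; apply.
    - exact: cS.
    - exact: thS.
    rewrite mulr_suml dv_sum; last first.
      move=> i; apply: smooth_atM => //; exact: (proj1 (smooth_sectionP U) sU).
    congr ((_ + _) *: _); apply: eq_bigr => i _; rewrite dvM //.
    exact: (proj1 (smooth_sectionP U) sU).
  rewrite !DE // (nbhs_singleton Hth) -!scalerBl; congr (_ *: _).
  rewrite Vg Wg !mulr_sumr -!sumrB -!big_split /= -!sumrB; apply: eq_bigr => i _.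
  have sVg : smooth_map_at g (fun q => Tot (V q)) by move: (g); apply/smoothP.
  have sWg : smooth_map_at g (fun q => Tot (W q)) by move: (g); apply/smoothP.
  by rewrite bracketE // Vg Wg; ring.
have [V sV Vg] := vector_extend v mB; have [W sW Wg] := vector_extend w mB.
by apply: (xgetPex 0); do 3!eexists; split; [exact: sV|exact: sW| | |].
Qed.
End ExteriorDerivative.

(** * Lie groupoids and line bundle groupoids *)

Arguments vsrc {R G} _ {g} _.
Arguments vtgt {R G} _ {g} _.
Arguments vunt {R G} _ {x} _.
Arguments vinv {R G} _ {g} _.
Arguments vmul {R G} _ {g h} _ _.
Arguments sinv {R G} _ g l.

Section Groupoid.
Context (R : realType) (G : groupoid R).
Hypothesis gG : is_groupoid G.
Implicit Types (g h k : ar G) (x : ob G).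

Lemma src_unt x : src (unt x) = x. Proof. by case: gG => /(_ x)[]. Qed.
Lemma tgt_unt x : tgt (unt x) = x. Proof. by case: gG => /(_ x)[]. Qed.
Lemma src_mul g h : src g = tgt h -> src (mul g h) = src h.
Proof. by move=> e; case: gG => _ [/(_ g h e)[]]. Qed.
Lemma tgt_mul g h : src g = tgt h -> tgt (mul g h) = tgt g.
Proof. by move=> e; case: gG => _ [/(_ g h e)[]]. Qed.
Lemma mul_assoc g h k : src g = tgt h -> src h = tgt k -> mul (mul g h) k = mul g (mul h k).
Proof. by move=> e f; case: gG => _ [_ [/(_ g h k e f)]]. Qed.
Lemma mul_unt g : mul g (unt (src g)) = g.
Proof. by case: gG => _ [_ [_ [/(_ g)[]]]]. Qed.
Lemma unt_mul g : mul (unt (tgt g)) g = g.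
Proof. by case: gG => _ [_ [_ [/(_ g)[]]]]. Qed.
Lemma src_inv g : src (inv g) = tgt g.
Proof. by case: gG => _ [_ [_ [_ [/(_ g)[]]]]]. Qed.
Lemma tgt_inv g : tgt (inv g) = src g.
Proof. by case: gG => _ [_ [_ [_ [/(_ g)[]]]]]. Qed.
Lemma mul_inv g : mul g (inv g) = unt (tgt g).
Proof. by case: gG => _ [_ [_ [_ [_ /(_ g)[]]]]]. Qed.
Lemma inv_mul g : mul (inv g) g = unt (src g).
Proof. by case: gG => _ [_ [_ [_ [_ /(_ g)[]]]]]. Qed.

Lemma mulK g h : src g = tgt h -> mul (mul g h) (inv h) = g.
Proof. by move=> e; rewrite mul_assoc ?tgt_inv // mul_inv -e mul_unt. Qed.
Lemma mulVK g h : src g = tgt h -> mul (inv g) (mul g h) = h.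
Proof. by move=> e; rewrite -mul_assoc ?src_inv // inv_mul e unt_mul. Qed.
Lemma inv_inv g : inv (inv g) = g.
Proof.
by have := mulVK (g := inv g) (h := g); move=> /(_ (src_inv g)); rewrite inv_mul -(tgt_inv g) -(src_inv (inv g)) mul_unt.
Qed.
Lemma inv_unt x : inv (unt x) = unt x.
Proof. by rewrite -[LHS]unt_mul tgt_inv src_unt mul_inv tgt_unt. Qed.
End Groupoid.

Section Zero.
Context (R : realType) (B : space R) (E : bundle B).

Lemma Tot0 (x y : B) : x = y -> Tot (0 : E x) = Tot (0 : E y).
Proof. by move=> ->. Qed.

Lemma Tot_eq0 (x y : B) (u : E x) : Tot u = Tot (0 : E y) -> u = 0.
Proof.
move=> H; have e : x = y by have := congr1 (fun q : tot E => tag q) H.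
by case: _ / e H => /Tot_inj.
Qed.

Lemma fibatE (x : B) (u : E x) : fibat x (Tot u) = u.
Proof. by apply: Tot_inj; apply: (xgetPex 0 (P := [set e | Tot e = Tot u])); exists u. Qed.

Lemma fibatK (x : B) (q : tot E) : tag q = x -> Tot (fibat x q) = q.
Proof. by case: q => y u /= e; case: _ / e; rewrite -/(Tot u) fibatE. Qed.
End Zero.

Section LieGroupoid.
Context (R : realType) (G : groupoid R).
Hypothesis lG : is_lie_groupoid G.

Lemma lie_groupoid : is_groupoid G. Proof. by case: lG. Qed.
Lemma ob_manifold : is_manifold (ob G). Proof. by case: lG => _ []. Qed.
Lemma ar_manifold : is_manifold (ar G). Proof. by case: lG => _ []. Qed.
Lemma src_submersion : submersion (@src R G). Proof. by case: lG => _ _ []. Qed.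
Lemma tgt_submersion : submersion (@tgt R G). Proof. by case: lG => _ _ []. Qed.
Lemma src_smooth : smooth (@src R G). Proof. by case: src_submersion. Qed.
Lemma tgt_smooth : smooth (@tgt R G). Proof. by case: tgt_submersion. Qed.
Lemma unt_smooth : smooth (@unt R G). Proof. by case: lG => _ _ _ []. Qed.
Lemma inv_smooth : smooth (@inv R G). Proof. by case: lG => _ _ _ []. Qed.
Lemma compm_smooth : smooth (@compm R G). Proof. by case: lG. Qed.
Lemma comp1_smooth : smooth (@comp1 R G).
Proof. exact: (smooth_comp (@smooth_sval R _ _) (@smooth_fst R _ _)). Qed.
Lemma comp2_smooth : smooth (@comp2 R G).
Proof. exact: (smooth_comp (@smooth_sval R _ _) (@smooth_snd R _ _)). Qed.
End LieGroupoid.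

Section LineGroupoid.
Context (R : realType) (G : groupoid R) (L : vbg G).
Hypothesis hL : is_line_groupoid L.

Lemma line_lie : is_lie_groupoid G. Proof. by case: hL. Qed.
Lemma line_tot_lie : is_lie_groupoid (tot_groupoid L). Proof. by case: hL. Qed.
Lemma line_vb : is_vector_bundle 1 L. Proof. by case: hL => _ _ []. Qed.
Lemma line_vb0 : is_vector_bundle 1 (vb0 L). Proof. by case: hL => _ _ []. Qed.
Lemma vsrc_lin g : linear (@vsrc R G L g). Proof. by case: hL => _ _ _ []. Qed.
Lemma vtgt_lin g : linear (@vtgt R G L g). Proof. by case: hL => _ _ _ []. Qed.
Lemma vunt_lin g : linear (@vunt R G L g). Proof. by case: hL => _ _ _ []. Qed.
Lemma vinv_lin g : linear (@vinv R G L g). Proof. by case: hL => _ _ _ []. Qed.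
Arguments vsrc_lin : clear implicits.
Arguments vtgt_lin : clear implicits.
Arguments vunt_lin : clear implicits.
Arguments vinv_lin : clear implicits.
Lemma vsrc_smooth : smooth (fun q : tot L => Tot (vsrc L (tagged q))).
Proof. exact: (src_smooth line_tot_lie). Qed.
Lemma vtgt_smooth : smooth (fun q : tot L => Tot (vtgt L (tagged q))).
Proof. exact: (tgt_smooth line_tot_lie). Qed.

Let gT := lie_groupoid line_tot_lie.
Let gG := lie_groupoid line_lie.

Lemma vmul00 g h : src g = tgt h -> vmul L (0 : L g) (0 : L h) = 0.
Proof.
move=> e; have c : vcomposable (0 : L g) (0 : L h).
  by rewrite /vcomposable (lin_0 (vsrc_lin g)) (lin_0 (vtgt_lin h)); exact: Tot0.
have [_ _ _ _ /(_ g h 1 0 0 0 0 e c c)] := hL.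
by rewrite !scaler0 !addr0 scale1r => /eqP; rewrite eq_sym -subr_eq0 addrK => /eqP.
Qed.

(** Over a unit, [vunt] provides a nonzero vector with nonzero source on a line. In general, let [v]
    over [g] have source 0. Then [v] equals [(v 0) 0] with zero vectors over [inv g] and [g]; here
    [v 0] lies over a unit and has source 0, hence vanishes, and a product of zero vectors is
    zero. *)
Lemma vsrc_inj g : injective (@vsrc R G L g).
Proof.
have unit_case x (k : ar G) (v : L k) : k = unt x -> vsrc L v = 0 -> v = 0.
  move=> e; case: _ / (esym e) v => {k e} v sv.
  have [e0 e0n _] := line_fiber line_vb0 x; have [f fn fE] := line_fiber line_vb (unt x).
  have su : Tot (vsrc L (vunt L e0)) = Tot e0 by have := src_unt gT (Tot e0).
  have [c cE] := fE v; have [d dE] := fE (vunt L e0).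
  have dn : d != 0.
    apply: contra_neq e0n => d0; apply: (@Tot_eq0 R _ (vb0 L) x (src (unt x))).
    by rewrite -su dE d0 scale0r (lin_0 (vsrc_lin _)).
  have : vsrc L ((c / d) *: vunt L e0) = 0 by rewrite dE scalerA divfK // -cE.
  rewrite (lin_Z (vsrc_lin _)) => /eqP; rewrite scaler_eq0 mulf_eq0 invr_eq0 (negPf dn) orbF.
  case/orP => /eqP H; first by rewrite cE H scale0r.
  by case/eqP: e0n; apply: (@Tot_eq0 R _ (vb0 L) x (src (unt x))); rewrite -su H.
have ker0 (v : L g) : vsrc L v = 0 -> v = 0.
  move=> sv; pose V : ar (tot_groupoid L) := Tot v.
  pose Z : ar (tot_groupoid L) := Tot (0 : L (inv g)); pose Z' : ar (tot_groupoid L) := Tot (0 : L g).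
  have e1 : src V = tgt Z.
    by rewrite /= sv (lin_0 (vtgt_lin _)); apply: Tot0; rewrite (tgt_inv gG).
  have e2 : src Z = tgt Z'.
    by rewrite /= (lin_0 (vsrc_lin _)) (lin_0 (vtgt_lin _)); apply: Tot0; rewrite (src_inv gG).
  have ZZ : mul Z Z' = unt (src V).
    rewrite /= vmul00 ?(src_inv gG) // sv (lin_0 (vunt_lin _)).
    by apply: Tot0; rewrite (inv_mul gG).
  have VZ : mul V Z = Tot (0 : L (mul g (inv g))).
    rewrite /=; congr Tot; apply: (unit_case (tgt g)); first by rewrite (mul_inv gG).
    have := src_mul gT e1; rewrite /= (lin_0 (vsrc_lin _)); exact: Tot_eq0.
  have := mul_assoc gT e1 e2; rewrite ZZ (mul_unt gT) VZ => H.
  apply: (@Tot_eq0 R _ L g (mul (mul g (inv g)) g)); rewrite -[LHS]H /=.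
  by rewrite vmul00 // (mul_inv gG) (src_unt gG).
move=> u v /eqP; rewrite -subr_eq0 -(lin_B (vsrc_lin g)) => /eqP/ker0/eqP.
by rewrite subr_eq0 => /eqP.
Qed.

Lemma vtgt_inj g : injective (@vtgt R G L g).
Proof.
have ker0 (v : L g) : vtgt L v = 0 -> v = 0.
  move=> tv; pose V : ar (tot_groupoid L) := Tot v.
  have iv : vinv L v = 0.
    apply: vsrc_inj; rewrite (lin_0 (vsrc_lin _)).
    have := src_inv gT V; rewrite /= tv; exact: Tot_eq0.
  have := inv_inv gT V; rewrite /= iv (lin_0 (vinv_lin _)) => /esym; exact: Tot_eq0.
move=> u v /eqP; rewrite -subr_eq0 -(lin_B (vtgt_lin g)) => /eqP/ker0/eqP.
by rewrite subr_eq0 => /eqP.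
Qed.

Lemma sinvK g (l : tot (vb0 L)) : tag l = src g -> Tot (vsrc L (sinv L g l)) = l.
Proof.
case: l => x u /= e; case: _ / (esym e) u => u.
apply: (xgetPex 0 (P := [set y : L g | Tot (vsrc L y) = Tot u])).
exists (finv (@vsrc R G L g) u); congr Tot.
exact: (iso_finvP line_vb line_vb0 vsrc_lin vsrc_inj).
Qed.

End LineGroupoid.
Arguments vsrc_lin {R G L} hL g.
Arguments vtgt_lin {R G L} hL g.
Arguments vunt_lin {R G L} hL g.
Arguments vinv_lin {R G L} hL g.

Section CompositionBundle.
Context (R : realType) (G : groupoid R) (L : vbg G).
Hypothesis hL : is_line_groupoid L.

Lemma Tot_lin (B : space R) (E : bundle B) (x y : B) a (u v : E x) (u' v' : E y) :
  Tot u = Tot u' -> Tot v = Tot v' -> Tot (a *: u + v) = Tot (a *: u' + v').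
Proof.
move=> H; have e : x = y by have := congr1 (fun q : tot E => tag q) H.
by case: _ / e u' v' H => u' v' /Tot_inj-> /Tot_inj->.
Qed.

Lemma span_ofP (K : pzRingType) (W : lmodType K) (P : set W) (x : span_of P) :
  lin_closed P -> P (sublv x).
Proof. by move=> lP; have /asboolP := valP x; exact. Qed.

Lemma span_of_intro (K : pzRingType) (W : lmodType K) (P : set W) (w : W) : P w ->
  exists x : span_of P, sublv x = w.
Proof.
move=> Pw; have H : w \in span_pred P by apply/asboolP => S _; exact.
by exists (Subl H).
Qed.

Lemma comp_bundle_composable (p : comp G) (x : comp_bundle L p) :
  vcomposable (sublv x).1 (sublv x).2.
Proof.
have e : src (comp1 p) = tgt (comp2 p) by case: p x.
apply: (@span_ofP _ _ [set l : (L (comp1 p) * L (comp2 p))%type | vcomposable l.1 l.2]).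
split; rewrite /= /vcomposable.
  by rewrite (lin_0 (vsrc_lin hL _)) (lin_0 (vtgt_lin hL _)); exact: Tot0.
move=> a [u u'] [v v'] /= H H'.
by rewrite (vsrc_lin hL) (vtgt_lin hL); exact: Tot_lin.
Qed.

Lemma comp_bundle_intro (p : comp G) (u : L (comp1 p)) (v : L (comp2 p)) : vcomposable u v ->
  exists x : comp_bundle L p, sublv x = (u, v).
Proof. by move=> c; exact: (@span_of_intro _ _ [set l : (L (comp1 p) * L (comp2 p))%type | vcomposable l.1 l.2] (u, v)). Qed.

Lemma comp_mul_src (p : comp G) (u : L (comp1 p)) (v : L (comp2 p)) : vcomposable u v ->
  Tot (vsrc L (vmul L u v : L (compm p))) = Tot (vsrc L v) /\
  Tot (vtgt L (vmul L u v : L (compm p))) = Tot (vtgt L u).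
Proof.
move=> c; have gT := lie_groupoid (line_tot_lie hL).
by split; [exact: (@src_mul R (tot_groupoid L) gT (Tot u) (Tot v) c)|exact: (@tgt_mul R (tot_groupoid L) gT (Tot u) (Tot v) c)].
Qed.

(** Evaluates the three [finv] hidden in the multiplicativity condition. Each is a genuine preimage
    because a composable pair in [L] can be completed from any one of its factors or from its
    product. *)
Lemma comp_bundle_pull (th : form1 L) (p : comp G) (z : tangent p) (u : L (comp1 p)) :
  Tot (vsrc L u) = Tot (vtgt L (th (comp2 p) (dmap (@comp2 R G) z))) ->
  [/\ sublv (pull1 (@lpr2 R G L) th z) = (u, th (comp2 p) (dmap (@comp2 R G) z)),
      (sublv (pull1 (@lpr1 R G L) th z)).1 = th (comp1 p) (dmap (@comp1 R G) z)
    & Tot (vtgt L (th (compm p) (dmap (@compm R G) z))) = Tot (vtgt L (sublv (pull1 (@lmul R G L) th z)).1)].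
Proof.
move=> su; have e : src (comp1 p) = tgt (comp2 p) by case: p z u su.
have gG := lie_groupoid (line_lie hL).
set x2 := pull1 _ th z; set x1 := pull1 _ th z; set xm := pull1 _ th z; split.
- have [x xE] := comp_bundle_intro su.
  have H : lpr2 x2 = th (comp2 p) (dmap (@comp2 R G) z).
    by apply: (xgetPex 0 (P := [set y : comp_bundle L p | lpr2 y = _])); exists x; rewrite /lpr2 /= xE.
  have c := comp_bundle_composable x2.
  rewrite [LHS]surjective_pairing -/(lpr2 x2) H; congr (_, _).
  by apply: (vsrc_inj hL); apply: Tot_inj; rewrite c -/(lpr2 x2) H su.
- pose t1 := th (comp1 p) (dmap (@comp1 R G) z).
  have [y yE] : exists y : L (comp2 p), Tot (vtgt L y) = Tot (vsrc L t1).
    case: p z {u su x2 xm x1} t1 e => -[g h] /= pe z t1 e.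
    have : forall (x : ob G) (l : vb0 L x), x = tgt h -> exists y : L h, Tot (vtgt L y) = Tot l.
      move=> x l ex; case: _ / (esym ex) l => l; exists (finv (@vtgt R G L h) l); congr Tot.
      exact: (iso_finvP (line_vb hL) (line_vb0 hL) (vtgt_lin hL) (vtgt_inj hL)).
    by apply.
  have [x xE] := comp_bundle_intro (esym yE).
  by apply: (xgetPex 0 (P := [set y : comp_bundle L p | lpr1 y = _])); exists x; rewrite /lpr1 /= xE.
have xmE : lmul xm = th (compm p) (dmap (@compm R G) z).
  pose tm := th (compm p) (dmap (@compm R G) z).
  have em : src (compm p) = src (comp2 p) by exact: (src_mul gG e).
  have s2 : Tot (vsrc L (sinv L (comp2 p) (Tot (vsrc L tm)))) = Tot (vsrc L tm) by exact: (sinvK hL).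
  set v := sinv L (comp2 p) _ in s2.
  have s1 : Tot (vsrc L (sinv L (comp1 p) (Tot (vtgt L v)))) = Tot (vtgt L v) by exact: (sinvK hL).
  have [x xE] := comp_bundle_intro s1.
  apply: (xgetPex 0 (P := [set y : comp_bundle L p | lmul y = _])); exists x; rewrite /lmul /= xE /=.
  apply: (vsrc_inj hL); apply: Tot_inj; have [-> _] := comp_mul_src s1.
  exact: s2.
have [_ H] := comp_mul_src (comp_bundle_composable xm).
by rewrite -xmE.
Qed.

(** Here [u] is the value on the second factor, translated to the fibre over the first. Applying the
    target turns multiplicativity into an additive cocycle identity in a single line. *)
Lemma multiplicativeE (th : form1 L) (p : comp G) (z : tangent p) (u : L (comp1 p)) :
  multiplicative th -> Tot (vsrc L u) = Tot (vtgt L (th (comp2 p) (dmap (@comp2 R G) z))) ->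
  Tot (vtgt L (th (compm p) (dmap (@compm R G) z))) =
  Tot (vtgt L (th (comp1 p) (dmap (@comp1 R G) z) + u)).
Proof.
move=> /(_ p z) M su; have [x2E x1E ->] := comp_bundle_pull su; congr (Tot (vtgt L _)).
move: M x2E x1E; set x2 := pull1 _ th z; set xm := pull1 _ th z; set x1 := pull1 _ th z => M x2E x1E.
have := congr1 (fun x : comp_bundle L p => (sublv x).1) M.
rewrite -[sublv _]/((sublv x2 - sublv xm) + sublv x1) x2E /= x1E => /eqP.
by rewrite addrAC subr_eq0 addrC => /eqP <-.
Qed.

Lemma multiplicative_intro (th : form1 L) :
  (forall (p : comp G) (z : tangent p) (u : L (comp1 p)),
     Tot (vsrc L u) = Tot (vtgt L (th (comp2 p) (dmap (@comp2 R G) z))) ->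
     Tot (vtgt L (th (compm p) (dmap (@compm R G) z))) =
     Tot (vtgt L (th (comp1 p) (dmap (@comp1 R G) z) + u))) -> multiplicative th.
Proof.
move=> H p z; have gG := lie_groupoid (line_lie hL).
have e : src (comp1 p) = tgt (comp2 p) by case: p z.
pose t2 := th (comp2 p) (dmap (@comp2 R G) z).
have su : Tot (vsrc L (sinv L (comp1 p) (Tot (vtgt L t2)))) = Tot (vtgt L t2) by exact: (sinvK hL).
have [x2E x1E xmE] := comp_bundle_pull su; have := H p z _ su.
rewrite xmE; set u := sinv L _ _ in x2E *; move: x2E x1E.
set x2 := pull1 (@lpr2 R G L) th z; set xm := pull1 (@lmul R G L) th z; set x1 := pull1 (@lpr1 R G L) th z => x2E x1E.
have em : tgt (compm p) = tgt (comp1 p) by exact: (tgt_mul gG e).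
move=> /(@Tot_inj R _ (vb0 L))/(vtgt_inj hL) E.
set x := x2 - xm + x1.
have E1 : (sublv x).1 = 0.
  by rewrite -[sublv _]/((sublv x2 - sublv xm) + sublv x1) x2E /= x1E E addrAC [X in X - _]addrC subrr.
have E2 : (sublv x).2 = 0.
  apply: (vtgt_inj hL); rewrite (lin_0 (vtgt_lin hL _)).
  apply: (@Tot_eq0 R _ (vb0 L) (tgt (comp2 p)) (src (comp1 p))); rewrite -(comp_bundle_composable x) E1.
  by rewrite (lin_0 (vsrc_lin hL _)).
by apply: val_inj; rewrite /= [LHS]surjective_pairing E1 E2.
Qed.
End CompositionBundle.

(** * The curvature pairing *)

Section Pairing.
Context (R : realType) (G : groupoid R) (L : vbg G).
Hypothesis hL : is_line_groupoid L.

Let mM := ob_manifold (line_lie hL).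
Let mG := ar_manifold (line_lie hL).
Let vL := line_vb hL.
Let vL0 := line_vb0 hL.

(* For [l] the coordinate of a frame [a] of [L_M], the coordinate in the frame [t^* a]. *)
Definition tcoord (l : tot (vb0 L) -> R) g (u : L g) : R := l (Tot (vtgt L u)).

(* Ratio of the frames [s^* b] and [t^* a], for [l] the coordinate of [a]. *)
Definition frame_ratio (l : tot (vb0 L) -> R) (b : section (vb0 L)) (g : ar G) : R :=
  tcoord l (pull_section (@vsrc R G L) b g).

(** The domain of the frame is hidden so that the same frame can be used at all points near [x], see
    [frame_at_near]. *)
Definition frame_at (x : ob G) (a : section (vb0 L)) (l : tot (vb0 L) -> R) : Prop :=
  exists W, is_frame W a l /\ \forall y \near (x : ob G), W y.

Lemma frame_at_exists x : exists a l, frame_at x a l.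
Proof. by have [W [e [l [Wx fr]]]] := line_frame x vL0; exists e, l, W. Qed.

Section OneFrame.
Context (x : ob G) (a : section (vb0 L)) (l : tot (vb0 L) -> R) (fa : frame_at x a l).

Lemma frame_at_section : smooth_section a.
Proof. by have [W [fr _]] := fa; exact: frame_section fr. Qed.

Lemma frame_at_coord : smoothf l.
Proof. by have [W [fr _]] := fa; exact: frame_coord fr. Qed.

Lemma frame_at_lin y c (u v : vb0 L y) : l (Tot (c *: u + v)) = c * l (Tot u) + l (Tot v).
Proof. by have [W [fr _]] := fa; exact: (frame_lin fr). Qed.

Lemma frame_at_1 : l (Tot (a x)) = 1.
Proof. by have [W [fr /nbhs_singleton Wx]] := fa; exact: (frame1 fr Wx). Qed.

Lemma frame_atE (u : vb0 L x) : u = l (Tot u) *: a x.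
Proof. by have [W [fr /nbhs_singleton Wx]] := fa; exact: (frameE fr _ Wx). Qed.

Lemma frame_at_near : \forall y \near (x : ob G), frame_at y a l.
Proof. by have [W [fr Wx]] := fa; apply: filterS (near_join Wx) => y Wy; exists W. Qed.

Lemma frame_at_0 y : l (Tot (0 : vb0 L y)) = 0.
Proof. by have := frame_at_lin (-1) (0 : vb0 L y) 0; rewrite scaler0 addr0 mulN1r addNr. Qed.

Lemma frame_at_Z y c (u : vb0 L y) : l (Tot (c *: u)) = c * l (Tot u).
Proof. by rewrite -[c *: u]addr0 frame_at_lin frame_at_0 addr0. Qed.

Lemma frame_at_N y (u : vb0 L y) : l (Tot (- u)) = - l (Tot u).
Proof. by rewrite -scaleN1r frame_at_Z mulN1r. Qed.

Lemma tcoord_lin g c (u v : L g) : tcoord l (c *: u + v) = c * tcoord l u + tcoord l v.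
Proof. by rewrite /tcoord (vtgt_lin hL) frame_at_lin. Qed.
Lemma tcoord0 g : tcoord l (0 : L g) = 0.
Proof. by have := tcoord_lin (-1) (0 : L g) 0; rewrite scaler0 addr0 mulN1r addNr. Qed.
Lemma tcoordD g (u v : L g) : tcoord l (u + v) = tcoord l u + tcoord l v.
Proof. by rewrite -[u in LHS]scale1r tcoord_lin mul1r. Qed.
Lemma tcoordZ g c (u : L g) : tcoord l (c *: u) = c * tcoord l u.
Proof. by rewrite -[c *: u]addr0 tcoord_lin tcoord0 addr0. Qed.
Lemma tcoordN g (u : L g) : tcoord l (- u) = - tcoord l u.
Proof. by rewrite -scaleN1r tcoordZ mulN1r. Qed.
Lemma tcoordB g (u v : L g) : tcoord l (u - v) = tcoord l u - tcoord l v.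
Proof. by rewrite tcoordD tcoordN. Qed.
End OneFrame.

Lemma tcoord_inj g a l (u v : L g) : frame_at (tgt g) a l -> tcoord l u = tcoord l v -> u = v.
Proof.
move=> fa H; apply: (vtgt_inj hL).
by rewrite (frame_atE fa (vtgt L u)) (frame_atE fa (vtgt L v)) -!/(tcoord l _) H.
Qed.

Lemma tcoord1 g a l : frame_at (tgt g) a l -> tcoord l (pull_section (@vtgt R G L) a g) = 1.
Proof.
move=> fa; rewrite /tcoord (iso_finvP vL vL0 (vtgt_lin hL) (vtgt_inj hL)).
exact: frame_at_1 fa.
Qed.

Lemma tcoordE g a l (u : L g) : frame_at (tgt g) a l ->
  u = tcoord l u *: pull_section (@vtgt R G L) a g.
Proof.
move=> fa; apply: (tcoord_inj fa).
by rewrite (tcoordZ fa) (tcoord1 fa) mulr1.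
Qed.

Lemma tcoord_src x a l g b lb (u : L g) : frame_at x a l -> frame_at (src g) b lb ->
  tcoord l u = frame_ratio l b g * lb (Tot (vsrc L u)).
Proof.
move=> fa fb; have -> : u = lb (Tot (vsrc L u)) *: pull_section (@vsrc R G L) b g.
  apply: (vsrc_inj hL); rewrite (lin_Z (vsrc_lin hL g)).
  by rewrite (iso_finvP vL vL0 (vsrc_lin hL) (vsrc_inj hL)) -(frame_atE fb).
rewrite (tcoordZ fa) mulrC (lin_Z (vsrc_lin hL g)); congr (_ * _).
rewrite (iso_finvP vL vL0 (vsrc_lin hL) (vsrc_inj hL)).
by rewrite (frame_at_Z fb) (frame_at_1 fb) mulr1.
Qed.

Lemma near_tgt g a l : frame_at (tgt g) a l -> \forall k \near (g : ar G), frame_at (tgt k) a l.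
Proof.
move=> fa; have /smoothP/(_ g) st := tgt_smooth (line_lie hL).
exact: (near_smooth st (frame_at_near fa)).
Qed.

Lemma near_src g a l : frame_at (src g) a l -> \forall k \near (g : ar G), frame_at (src k) a l.
Proof.
move=> fa; have /smoothP/(_ g) st := src_smooth (line_lie hL).
exact: (near_smooth st (frame_at_near fa)).
Qed.

Lemma smooth_tcoord g a l : frame_at (tgt g) a l -> smoothf (fun q : tot L => tcoord l (tagged q)).
Proof. by move=> fa; exact: (vtgt_smooth hL (frame_at_coord fa)). Qed.

Lemma smooth_ratio g a l b lb : frame_at (tgt g) a l -> frame_at (src g) b lb ->
  smoothf (frame_ratio l b).
Proof.
move=> fa fb; have := pull_section_smooth vL vL0 (vsrc_smooth hL) (vsrc_lin hL) (vsrc_inj hL) (frame_at_section fb).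
exact: (fun s => s _ (smooth_tcoord fa)).
Qed.

Lemma ratio_neq0 g a l b lb : frame_at (tgt g) a l -> frame_at (src g) b lb -> frame_ratio l b g != 0.
Proof.
move=> fa fb; apply/eqP => H; have := tcoord1 fa.
by rewrite (tcoord_src _ fa fb) H mul0r => /eqP; rewrite eq_sym oner_eq0.
Qed.

Context (nabla : conn (vb0 L)) (cN : is_connection nabla).

(** The connection 1-form of [nabla] in the frame [a]. *)
Definition conn_coef (a : section (vb0 L)) (l : tot (vb0 L) -> R) x (v : tangent x) : R := l (Tot (nabla v a)).

Lemma conn_coef_lin x0 a l x c (v w : tangent x) : frame_at x0 a l ->
  conn_coef a l (c *: v + w) = c * conn_coef a l v + conn_coef a l w.
Proof.
by move=> fa; rewrite /conn_coef (conn_lin cN (frame_at_section fa)) (frame_at_lin fa).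
Qed.

Lemma pull_tgt_conn g a l v (s : section L) c : frame_at (tgt g) a l -> smooth_section s ->
  smooth_at g c -> (\forall y \near (g : ar G), s y = c y *: pull_section (@vtgt R G L) a y) ->
  pull_conn (@vtgt R G L) nabla v s =
  (c g * conn_coef a l (dmap (@tgt R G) v) + dv v c) *: pull_section (@vtgt R G L) a g.
Proof.
move=> fa ss sc H.
rewrite (pull_connE vL vL0 (vtgt_smooth hL) (vtgt_lin hL) (vtgt_inj hL) mM v cN ss (frame_at_section fa) sc H).
rewrite {1}(frame_atE fa (nabla _ _)) (lin_Z (iso_finv_lin vL vL0 (vtgt_lin hL) (vtgt_inj hL) (x := g))).
by rewrite scalerDl scalerA.
Qed.

Lemma pull_src_conn g b l v (s : section L) c : frame_at (src g) b l -> smooth_section s ->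
  smooth_at g c -> (\forall y \near (g : ar G), s y = c y *: pull_section (@vsrc R G L) b y) ->
  pull_conn (@vsrc R G L) nabla v s =
  (c g * conn_coef b l (dmap (@src R G) v) + dv v c) *: pull_section (@vsrc R G L) b g.
Proof.
move=> fa ss sc H.
rewrite (pull_connE vL vL0 (vsrc_smooth hL) (vsrc_lin hL) (vsrc_inj hL) mM v cN ss (frame_at_section fa) sc H).
rewrite {1}(frame_atE fa (nabla _ _)) (lin_Z (iso_finv_lin vL vL0 (vsrc_lin hL) (vsrc_inj hL) (x := g))).
by rewrite scalerDl scalerA.
Qed.

(** In the frames [s^* b] and [t^* a] the two pulled back connections have the pulled back
    connection forms; changing from one frame to the other contributes the logarithmic derivative of
    their ratio. *)
Lemma etaE g a la b lb (v : tangent g) : frame_at (tgt g) a la -> frame_at (src g) b lb ->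
  eta nabla v = conn_coef b lb (dmap (@src R G) v) - conn_coef a la (dmap (@tgt R G) v)
    - dv v (frame_ratio la b) / frame_ratio la b g.
Proof.
move=> fa fb; set r0 := _ - _ - _; rewrite /eta.
have sr := smooth_ratio fa fb g; have r0n := ratio_neq0 fa fb.
have H : forall e : section L, smooth_section e ->
    pull_conn (@vsrc R G L) nabla v e - pull_conn (@vtgt R G L) nabla v e = r0 *: e g.
  move=> e se; pose c k := tcoord la (e k).
  have sc : smooth_at g c by exact: (se _ (smooth_tcoord fa) g).
  have nt := near_tgt fa.
  have ns := near_src fb.
  have ca : \forall y \near (g : ar G), e y = c y *: pull_section (@vtgt R G L) a y.
    by move: nt; apply: (@filterS _ _ (nbhs_filter g)) => k fk; exact: tcoordE.
  pose d k := c k / frame_ratio la b k.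
  have sd : smooth_at g d by apply: smooth_atM => //; exact: smooth_atV.
  have rE k : frame_at (tgt k) a la -> frame_at (src k) b lb -> frame_ratio la b k != 0 ->
      pull_section (@vsrc R G L) b k = frame_ratio la b k *: pull_section (@vtgt R G L) a k.
    by move=> fk gk rk; exact: tcoordE.
  have cb : \forall y \near (g : ar G), e y = d y *: pull_section (@vsrc R G L) b y.
    have nr := smooth_at_neq0 sr r0n.
    apply: filterS2 (filterI nt ns) (filterI nr ca) => k [fk gk] [rk ->].
    by rewrite (rE k) // scalerA divfK.
  rewrite (pull_tgt_conn _ fa se sc ca) (pull_src_conn _ fb se sd cb) (rE g) //.
  rewrite (nbhs_singleton ca) !scalerA -scalerBl; congr (_ *: _).
  have : dv v c = d g * dv v (frame_ratio la b) + frame_ratio la b g * dv v d.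
    rewrite -dvM //; apply: dv_near; apply: filterS (smooth_at_neq0 sr r0n) => k rk.
    by rewrite divfK.
  by move=> ->; rewrite /r0 /d; field.
set P := [set _ | _].
have : P (xget 0 P) by apply: (xgetPex 0); exists r0.
move=> /(_ _ (pull_section_smooth vL vL0 (vtgt_smooth hL) (vtgt_lin hL) (vtgt_inj hL) (frame_at_section fa))).
rewrite H; last exact: (pull_section_smooth vL vL0 (vtgt_smooth hL) (vtgt_lin hL) (vtgt_inj hL) (frame_at_section fa)).
move=> /(congr1 (tcoord la (g := g))); rewrite !(tcoordZ fa) (tcoord1 fa) !mulr1.
by move=> ->.
Qed.

Context (th : form1 L) (fth : is_form1 th) (ka : form2 (vb0 L)) (fka : is_form2 ka).

Definition local_form g l n (c X : 'I_n -> ar G -> R) : Prop :=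
  [/\ forall i, smoothf (c i), forall i, smoothf (X i)
    & \forall y \near (g : ar G), forall w : tangent y, tcoord l (th w) = \sum_i c i y * dv w (X i)].

Lemma local_form_exists g a l : frame_at (tgt g) a l -> exists n (c X : 'I_n -> ar G -> R), local_form g l c X.
Proof.
move=> [W [fr Wx]].
have fr' := pull_frame vL vL0 (vtgt_smooth hL) (vtgt_lin hL) (vtgt_inj hL) fr.
have Wg := smooth_continuous (tgt_smooth (line_lie hL)) Wx.
exact: (form1_local mG fth fr' Wg).
Qed.

(** The value on [v] and [w] of the exterior derivative of the 1-form with coefficients [c] and
    differentials of [X]. *)
Definition dform n (c X : 'I_n -> ar G -> R) g (v w : tangent g) : R :=
  \sum_i (dv v (c i) * dv w (X i) - dv w (c i) * dv v (X i)).

Lemma dconn_coord g a l n (c X : 'I_n -> ar G -> R) (v w : tangent g) : frame_at (tgt g) a l ->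
  local_form g l c X ->
  tcoord l (dconn (pull_conn (@vtgt R G L) nabla) th v w) = dform c X v w +
    (conn_coef a l (dmap (@tgt R G) v) * tcoord l (th w) - conn_coef a l (dmap (@tgt R G) w) * tcoord l (th v)).
Proof.
move=> fa [sc sX H]; have nt := near_tgt fa.
rewrite (@dconnE R (ar G) L mG th fth _ g (pull_section (@vtgt R G L) a)
  (fun v => conn_coef a l (dmap (@tgt R G) v)) n c X v w) //.
- by rewrite (tcoordZ fa) (tcoord1 fa) mulr1 !(nbhs_singleton H).
- by move=> u s d ss sd Hs; exact: pull_tgt_conn.
- by move=> i; exact: sc.
apply: filterS2 nt H => y fy Hy u.
by rewrite [LHS](tcoordE _ fy) Hy.
Qed.

(** The form behind [MR_ar] before it is wrapped by [mkhom], which is meaningful only once linearity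
    is known. *)
Definition pairing g (p q : MK th g) : L g :=
  dconn (pull_conn (@vtgt R G L) nabla) th p.1 q.1 + partial2 ka p.1 q.1
    + eta nabla q.1 *: p.2 - eta nabla p.1 *: q.2.

Lemma partial2_coord g a l b lb (v w : tangent g) : frame_at (tgt g) a l -> frame_at (src g) b lb ->
  tcoord l (partial2 ka v w) = frame_ratio l b g * lb (Tot (ka (dmap (@src R G) v) (dmap (@src R G) w)))
    - l (Tot (ka (dmap (@tgt R G) v) (dmap (@tgt R G) w))).
Proof.
move=> fa fb; rewrite /partial2 (tcoordB fa) (tcoord_src _ fa fb).
rewrite /pull2 (iso_finvP vL vL0 (vsrc_lin hL) (vsrc_inj hL)).
by rewrite /tcoord (iso_finvP vL vL0 (vtgt_lin hL) (vtgt_inj hL)).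
Qed.

Lemma pairing_coord g a l (p q : MK th g) : frame_at (tgt g) a l ->
  tcoord l (pairing p q) = tcoord l (dconn (pull_conn (@vtgt R G L) nabla) th p.1 q.1)
   + tcoord l (partial2 ka p.1 q.1) + eta nabla q.1 * tcoord l p.2 - eta nabla p.1 * tcoord l q.2.
Proof. by move=> fa; rewrite /pairing (tcoordB fa) !(tcoordD fa) !(tcoordZ fa). Qed.

Lemma ka_linl x (w : tangent x) : linear (fun v : tangent x => ka v w).
Proof.
have [kl _ ks _] := fka; move=> c u v.
by rewrite ks kl opprD -scalerN -!ks.
Qed.

Lemma eta_lin g : linear (eta nabla (g := g) : tangent g -> R^o).
Proof.
move=> c v w; have [a [la fa]] := frame_at_exists (tgt g); have [b [lb fb]] := frame_at_exists (src g).
rewrite !(etaE _ fa fb) (dmap_lin (src_smooth (line_lie hL))) (dmap_lin (tgt_smooth (line_lie hL))).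
rewrite (conn_coef_lin _ _ _ fa) (conn_coef_lin _ _ _ fb) dv_lin.
by rewrite -[c *: (_ - _ - _)]/(c * _); ring.
Qed.

Lemma pairing_anti g (p q : MK th g) : pairing p q = - pairing q p.
Proof.
have [a [la fa]] := frame_at_exists (tgt g); have [b [lb fb]] := frame_at_exists (src g).
have [n [c [X lo]]] := local_form_exists fa.
apply: (tcoord_inj fa); rewrite (tcoordN fa) !(pairing_coord _ _ fa) !(dconn_coord _ _ fa lo).
rewrite !(partial2_coord _ _ fa fb) /dform.
have [_ _ ks _] := fka.
rewrite (ks _ (dmap (@src R G) p.1)) (ks _ (dmap (@tgt R G) p.1)).
rewrite (frame_at_N fb) (frame_at_N fa).
have -> : \sum_i (dv p.1 (c i) * dv q.1 (X i) - dv q.1 (c i) * dv p.1 (X i)) =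
   - \sum_i (dv q.1 (c i) * dv p.1 (X i) - dv p.1 (c i) * dv q.1 (X i)).
  by rewrite -sumrN; apply: eq_bigr => i _; rewrite opprB.
by ring.
Qed.

Lemma pairing_lin g (p : MK th g) : linear (pairing p).
Proof.
move=> d q q'.
have [a [la fa]] := frame_at_exists (tgt g); have [b [lb fb]] := frame_at_exists (src g).
have [n [c [X lo]]] := local_form_exists fa.
apply: (tcoord_inj fa); rewrite (tcoord_lin fa) !(pairing_coord _ _ fa) !(dconn_coord _ _ fa lo).
rewrite !(partial2_coord _ _ fa fb) /=.
have [kl _ _ _] := fka; have [tl _] := fth.
rewrite (dmap_lin (src_smooth (line_lie hL))) (dmap_lin (tgt_smooth (line_lie hL))) !kl.
rewrite (frame_at_lin fa) (frame_at_lin fb) tl !(tcoord_lin fa) (conn_coef_lin _ _ _ fa) (eta_lin).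
rewrite -[d *: eta nabla _]/(d * _).
have -> : dform c X p.1 (d *: q.1 + q'.1) = d * dform c X p.1 q.1 + dform c X p.1 q'.1.
  rewrite /dform mulr_sumr -big_split; apply: eq_bigr => i _ /=.
  by rewrite !dv_lin; ring.
by ring.
Qed.
End Pairing.

(** * Tangent vectors of composable pairs *)

Section TangentGroupoid.
Context (R : realType) (G : groupoid R).
Hypothesis lG : is_lie_groupoid G.

Let mM := ob_manifold lG.
Let mG := ar_manifold lG.

Lemma manifold_param (X : space R) (p : X) : is_manifold X ->
  exists n (c : 'rV[R]_n -> X), is_param p c.
Proof. by move=> mX; have [n [_ [_ [c [_ pc]]]]] := manifold_chart p mX; exists n, c. Qed.

(** An instance of [tangent_equalizer]: the source being a submersion, any tangent vector at the
    common object is the difference of a source and a target, with second component 0. *)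
Lemma comp_tangent_at (p : comp G) (v : tangent (comp1 p)) (w : tangent (comp2 p)) :
  (forall f, smoothf f -> dv v (f \o @src R G) = dv w (f \o @tgt R G)) ->
  exists z : tangent p, dmap (@comp1 R G) z = v /\ dmap (@comp2 R G) z = w.
Proof.
case: p v w => -[g h] /= e v w H.
have [n [c pc]] := manifold_param g mG; have [m [d pd]] := manifold_param h mG.
have [y [y1 y2 yE]] := tangent_pair v w.
have s1 := smooth_comp (@smooth_fst R (ar G) (ar G)) (src_smooth lG).
have s2 := smooth_comp (@smooth_snd R (ar G) (ar G)) (tgt_smooth lG).
have dE (u : @tangent R (prod_space (ar G) (ar G)) (g, h)) f : smoothf f ->
    dv u (f \o (@src R G \o fst)) = dv (dmap (fst : prod_space (ar G) (ar G) -> ar G) u) (f \o @src R G) /\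
    dv u (f \o (@tgt R G \o snd)) = dv (dmap (snd : prod_space (ar G) (ar G) -> ar G) u) (f \o @tgt R G).
  move=> sf; split.
    by rewrite (dmapEs u (@smooth_fst R (ar G) (ar G)) (src_smooth lG sf)).
  by rewrite (dmapEs u (@smooth_snd R (ar G) (ar G)) (tgt_smooth lG sf)).
have [|f sf|z zE] := @tangent_equalizer R (prod_space (ar G) (ar G)) (ob G) (@src R G \o fst) (@tgt R G \o snd) (g, h) e
  _ _ (param_pair pc pd) (manifold_has_coords _ mM) s1 s2 _ y.
- move=> u; have [_ /(_ g u)[u' uE]] := src_submersion lG.
  have [t [t1 t2 _]] := tangent_pair u' (0 : tangent h).
  exists t => f sf; have [-> ->] := dE t f sf; rewrite t1 t2 dv0 subr0.
  by rewrite -(dmapEs u' (src_smooth lG) sf) uE.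
- by have [-> ->] := dE y f sf; rewrite y1 y2; exact: H.
exists z; split.
  rewrite -y1 -zE; exact: (dmap_comp z (@smooth_sval R _ _) (@smooth_fst R (ar G) (ar G))).
rewrite -y2 -zE; exact: (dmap_comp z (@smooth_sval R _ _) (@smooth_snd R (ar G) (ar G))).
Qed.

Lemma comp_tangent_at_inj (p : comp G) (z z' : tangent p) :
  dmap (@comp1 R G) z = dmap (@comp1 R G) z' -> dmap (@comp2 R G) z = dmap (@comp2 R G) z' -> z = z'.
Proof.
move=> H1 H2; apply: dmap_initial_inj; apply: dmap_pair_inj.
  rewrite -!(dmap_comp _ (@smooth_sval R _ _) (@smooth_fst R (ar G) (ar G))); exact: H1.
rewrite -!(dmap_comp _ (@smooth_sval R _ _) (@smooth_snd R (ar G) (ar G))); exact: H2.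
Qed.

Lemma comp_eq (p q : comp G) : comp1 p = comp1 q -> comp2 p = comp2 q -> p = q.
Proof. by case: p q => [[g h] e] [[g' h'] e'] /= E1 E2; apply: eq_exist; congr (_, _). Qed.

Lemma comp_tangent (a b : tot (TB (ar G))) : Tmap (@src R G) a = Tmap (@tgt R G) b ->
  exists z : tot (TB (comp G)), Tmap (@comp1 R G) z = a /\ Tmap (@comp2 R G) z = b.
Proof.
case: a b => [g v] [h w] H.
have e : src g = tgt h by have := congr1 (fun q : tot (TB (ob G)) => tag q) H.
pose p : comp G := exist _ (g, h) e.
have [|z [z1 z2]] := @comp_tangent_at p v w.
  move=> f sf; rewrite -(dmapEs v (src_smooth lG) sf) -(dmapEs w (tgt_smooth lG) sf).
  exact: (congr1 (fun q : tot (TB (ob G)) => dv (tagged q) f) H).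
by exists (@Tot R _ (TB (comp G)) p z); rewrite /Tmap /= z1 z2.
Qed.

Lemma comp_tangent_inj (y z : tot (TB (comp G))) :
  Tmap (@comp1 R G) y = Tmap (@comp1 R G) z -> Tmap (@comp2 R G) y = Tmap (@comp2 R G) z -> y = z.
Proof.
case: y z => [p y] [q z] E1 E2.
have e : p = q.
  apply: comp_eq; first exact: (congr1 (fun q : tot (TB (ar G)) => tag q) E1).
  exact: (congr1 (fun q : tot (TB (ar G)) => tag q) E2).
case: _ / e z E1 E2 => z /Tot_inj E1 /Tot_inj E2; congr existT.
exact: comp_tangent_at_inj.
Qed.

Lemma Tmap_tmul (z : tot (TB (comp G))) g h (v : tangent g) (w : tangent h) :
  Tmap (@comp1 R G) z = @Tot R _ (TB (ar G)) g v -> Tmap (@comp2 R G) z = @Tot R _ (TB (ar G)) h w ->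
  @Tot R _ (TB (ar G)) (mul g h) (tmul v w) = Tmap (@compm R G) z.
Proof.
case: z => [[[g' h'] e] z] E1 E2.
have e1 : g' = g by exact: (congr1 (fun q : tot (TB (ar G)) => tag q) E1).
have e2 : h' = h by exact: (congr1 (fun q : tot (TB (ar G)) => tag q) E2).
case: _ / e1 v E1 => v /Tot_inj E1; case: _ / e2 w E2 => w /Tot_inj E2.
rewrite /tmul; set P := [set _ | _].
have : P (xget 0 P).
  by apply: (xgetPex 0); exists (dmap (@compm R G) z); exists e, z.
case=> e' [z' [z1 z2 <-]]; have ee : e' = e by exact: Prop_irrelevance.
case: _ / (esym ee) z' z1 z2 => z' z1 z2.
have -> // : z' = z by apply: comp_tangent_at_inj; [rewrite z1 -E1|rewrite z2 -E2].
Qed.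

(* Extend the first component by constant coefficients and correct the second one by a
   horizontal lift. *)
Lemma comp_extend (p : comp G) (z : tangent p) : exists Z : section (TB (comp G)),
  smooth_map_at p (fun q => Tot (Z q)) /\ Z p = z.
Proof.
have [V sV V1] := vector_extend (dmap (@comp1 R G) z) mG.
have [W sW W1] := vector_extend (dmap (@comp2 R G) z) mG.
have [n [E [m [y [N [sE sy sN yinj NE]]]]]] := horizontal_lift mG mM (tgt_submersion lG) (comp2 p).
pose u (q : comp G) k := dv (dmap (@src R G) (V (comp1 q))) (y k) - dv (dmap (@tgt R G) (W (comp2 q))) (y k).
have s1 := @comp1_smooth R G; have s2 := @comp2_smooth R G.
have su k : smooth_at p (fun q => u q k).
  have := proj1 (smooth_sectionP V) sV _ (src_smooth lG (sy k)).
  have := proj1 (smooth_sectionP W) sW _ (tgt_smooth lG (sy k)).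
  move=> /s2/(_ p) sw /s1/(_ p) sv; apply: smooth_at_ext (smooth_atB sv sw).
  by apply: near_all => q /=; rewrite /u !dmapEs //; [exact: (tgt_smooth lG)|exact: (src_smooth lG)].
pose W' (q : comp G) : tangent (comp2 q) :=
  W (comp2 q) + \sum_i (\sum_k u q k * N k i (comp2 q)) *: E i (comp2 q).
pose Z (q : comp G) : tangent q := xget 0 [set z | dmap (@comp1 R G) z = V (comp1 q) /\ dmap (@comp2 R G) z = W' q].
have zE f : smoothf f -> dv (dmap (@src R G) (dmap (@comp1 R G) z)) f = dv (dmap (@tgt R G) (dmap (@comp2 R G) z)) f.
  move=> sf; rewrite (dmapEs _ (src_smooth lG) sf) (dmapEs _ (tgt_smooth lG) sf).
  rewrite (dmapEs _ s1 (src_smooth lG sf)) (dmapEs _ s2 (tgt_smooth lG sf)).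
  by apply: dv_near; apply: near_all => q /=; congr f; case: q.
have u0 k : u p k = 0 by rewrite /u V1 W1 zE // subrr.
have W'1 : W' p = dmap (@comp2 R G) z.
  rewrite /W' W1 big1 ?addr0 // => i _; rewrite big1 ?scale0r // => k _.
  by rewrite u0 mul0r.
have Zp : Z p = z.
  rewrite /Z; case: xgetP => [z' _ [E1 E2]|/(_ z)[]]; last by rewrite V1 W'1.
  by apply: comp_tangent_at_inj; rewrite ?E1 ?E2 ?V1 ?W'1.
exists Z; split => //.
have nZ : \forall q \near (p : comp G), dmap (@comp1 R G) (Z q) = V (comp1 q) /\ dmap (@comp2 R G) (Z q) = W' q.
  have n1 : \forall q \near (p : comp G), forall v w : tangent (tgt (comp2 q)), (forall k, dv v (y k) = dv w (y k)) -> v = w.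
    have /smoothP/(_ p) st := smooth_comp s2 (tgt_smooth lG); exact: (near_smooth st yinj).
  have /smoothP/(_ p) st2 := s2; have n2 := near_smooth st2 NE.
  apply: filterS2 n1 n2 => q H1 H2; apply: (xgetPex 0 (P := [set z | dmap (@comp1 R G) z = V (comp1 q) /\ dmap (@comp2 R G) z = W' q])).
  apply: comp_tangent_at => f sf.
  have e : src (comp1 q) = tgt (comp2 q) by case: (q).
  rewrite -(dmapEs _ (src_smooth lG) sf) -(dmapEs _ (tgt_smooth lG) sf).
  have : forall x (v : tangent x), x = tgt (comp2 q) -> (forall k, dv v (y k) = dv (dmap (@tgt R G) (W' q)) (y k)) ->
      dv v f = dv (dmap (@tgt R G) (W' q)) f.
    by move=> x v ex; case: _ / (esym ex) v => v Hv; congr (dv _ f); exact: H1.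
  apply => // k; rewrite /W' (lin_D (dmap_lin (tgt_smooth lG) (p := comp2 q))) dv_add H2 /u.
  by rewrite addrC subrK.
have st1 : smooth_map_at p (fun q => @Tot R _ (TB (ar G)) (comp1 q) (V (comp1 q))).
  by move: (p); apply/smoothP; exact: smooth_comp s1 sV.
have st2 : smooth_map_at p (fun q => @Tot R _ (TB (ar G)) (comp2 q) (W' q)).
  have sc2 : smooth_map_at p (@comp2 R G) by move/smoothP: s2; exact.
  have sE2 i : smooth_map_at p (fun q => @Tot R _ (TB (ar G)) (comp2 q) (E i (comp2 q))).
    by move: (p); apply/smoothP; exact: smooth_comp s2 (sE i).
  have sW2 : smooth_map_at p (fun q => @Tot R _ (TB (ar G)) (comp2 q) (W (comp2 q))).
    by move: (p); apply/smoothP; exact: smooth_comp s2 sW.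
  have := smooth_at_TB_lin (n := n.+1) (c := fun j q => if unlift ord0 j is Some i then \sum_k u q k * N k i (comp2 q) else 1)
    (E := fun j q => if unlift ord0 j is Some i then E i (comp2 q) else W (comp2 q)) sc2.
  move=> H; apply: smooth_map_at_ext; last apply: H.
  - apply: near_all => q; rewrite big_ord_recl unlift_none scale1r /W'.
    by congr (@Tot _ _ (TB (ar G)) _ (_ + _)); apply: eq_bigr => i _; rewrite liftK.
  - move=> j; case: (unlift _ _) => [i|]; last exact: smooth_at_cst.
    by apply: smooth_at_sum => k _; apply: smooth_atM => //; exact: (sc2 _ (sN k i)).
  - by move=> j; case: (unlift _ _).
apply: smooth_at_TB_initial; apply: smooth_at_TB_pair.
  apply: smooth_map_at_ext st1; apply: filterS nZ => q [E1 _].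
  rewrite -Tmap_comp; [by rewrite /Tmap -E1|exact: smooth_initial_map|exact: smooth_fst].
apply: smooth_map_at_ext st2; apply: filterS nZ => q [_ E2].
rewrite -Tmap_comp; [by rewrite /Tmap -E2|exact: smooth_initial_map|exact: smooth_snd].
Qed.
End TangentGroupoid.

(** * Multiplicativity of the curvature pairing *)

Section PairingMul.
Context (R : realType) (G : groupoid R) (L : vbg G).
Hypothesis hL : is_line_groupoid L.
Context (nabla : conn (vb0 L)) (cN : is_connection nabla).
Context (th : form1 L) (fth : is_form1 th) (mth : multiplicative th).
Context (ka : form2 (vb0 L)) (fka : is_form2 ka).
Let lG := line_lie hL.
Let gG := lie_groupoid lG.

Lemma comp_src (p : comp G) : src (comp1 p) = tgt (comp2 p). Proof. by case: p. Qed.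
Lemma compm_src (p : comp G) : src (compm p) = src (comp2 p).
Proof. exact: (src_mul gG (comp_src p)). Qed.
Lemma compm_tgt (p : comp G) : tgt (compm p) = tgt (comp1 p).
Proof. exact: (tgt_mul gG (comp_src p)). Qed.

(** Multiplicativity of [th] in frames: the coordinate on the product is that on the first factor
    plus that on the second, carried over by the frame ratio. *)
Lemma tcoord_mult_form (p : comp G) (z : tangent p) a la b lb :
  frame_at (tgt (comp1 p)) a la -> frame_at (src (comp1 p)) b lb ->
  tcoord la (th (dmap (@compm R G) z)) =
  tcoord la (th (dmap (@comp1 R G) z)) + frame_ratio la b (comp1 p) * tcoord lb (th (dmap (@comp2 R G) z)).
Proof.
move=> fa fb; have e := comp_src p.
set t2 := th (dmap (@comp2 R G) z).
have su : Tot (vsrc L (sinv L (comp1 p) (Tot (vtgt L t2)))) = Tot (vtgt L t2) by exact: (sinvK hL).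
rewrite /tcoord (multiplicativeE hL mth su) -!/(tcoord _ _) (tcoordD hL fa); congr (_ + _).
by rewrite (tcoord_src hL _ fa fb) su.
Qed.

Lemma ka_fam x y (v w : tangent x) (v' w' : tangent y) (l : tot (vb0 L) -> R) : x = y ->
  (forall f, smoothf f -> dv v f = dv v' f) -> (forall f, smoothf f -> dv w f = dv w' f) ->
  l (Tot (ka v w)) = l (Tot (ka v' w')).
Proof.
move=> e; case: _ / e v' w' => v' w' H H'.
have -> : v = v' by apply: tangent_eq => f sf; rewrite -!dv_smooth // H.
by have -> : w = w' by apply: tangent_eq => f sf; rewrite -!dv_smooth // H'.
Qed.

Lemma conn_coef_fam a l x y (v : tangent x) (v' : tangent y) : x = y ->
  (forall f, smoothf f -> dv v f = dv v' f) -> conn_coef nabla a l v = conn_coef nabla a l v'.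
Proof.
move=> e; case: _ / e v' => v' H.
by have -> : v = v' by apply: tangent_eq => f sf; rewrite -!dv_smooth // H.
Qed.

(** Differentiating [tcoord_mult_form] produces an extra term, the differential of the frame ratio
    wedged with [th] on the second factor. It cancels against the terms with [eta], because
    composability puts [th] of the second factor into [l1] and [m1]. The terms with [ka] and the
    connection forms cancel at the middle object. *)
Lemma pairing_mul (p : comp G) (z z' : tangent p)
    (l1 m1 : L (comp1 p)) (l2 m2 : L (comp2 p)) (lm mm : L (compm p)) a la b lb :
  frame_at (tgt (comp1 p)) a la -> frame_at (src (comp1 p)) b lb ->
  Tot (vsrc L l1) = Tot (vtgt L (l2 + th (dmap (@comp2 R G) z))) ->
  Tot (vsrc L m1) = Tot (vtgt L (m2 + th (dmap (@comp2 R G) z'))) ->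
  Tot (vsrc L lm) = Tot (vsrc L l2) -> Tot (vsrc L mm) = Tot (vsrc L m2) ->
  tcoord la (pairing nabla ka ((dmap (@compm R G) z, lm) : MK th (compm p)) (dmap (@compm R G) z', mm)) =
  tcoord la (pairing nabla ka ((dmap (@comp1 R G) z, l1) : MK th (comp1 p)) (dmap (@comp1 R G) z', m1)) +
  frame_ratio la b (comp1 p) *
  tcoord lb (pairing nabla ka ((dmap (@comp2 R G) z, l2) : MK th (comp2 p)) (dmap (@comp2 R G) z', m2)).
Proof.
move=> fa fb cl cm el em.
have e := comp_src p; have [es et] := (compm_src p, compm_tgt p).
have sS := src_smooth lG; have sT := tgt_smooth lG.
have sc1 := @comp1_smooth R G; have sc2 := @comp2_smooth R G; have scm := compm_smooth lG.
have fam : frame_at (tgt (compm p)) a la by rewrite et.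
have fb2 : frame_at (tgt (comp2 p)) b lb by rewrite -e.
have [c [lc fc]] := frame_at_exists hL (src (comp2 p)).
have fcm : frame_at (src (compm p)) c lc by rewrite es.
have [n1 [c1 [X1 lo1]]] := local_form_exists hL fth fa.
have [n2 [c2 [X2 lo2]]] := local_form_exists hL fth fb2.
have [n3 [c3 [X3 lo3]]] := local_form_exists hL fth fam.
have nfa : \forall q \near (p : comp G), frame_at (tgt (comp1 q)) a la.
  by have /smoothP/(_ p) s := sc1; exact: (near_smooth s (near_tgt hL fa)).
have nfb : \forall q \near (p : comp G), frame_at (src (comp1 q)) b lb.
  by have /smoothP/(_ p) s := sc1; exact: (near_smooth s (near_src hL fb)).
have nfc : \forall q \near (p : comp G), frame_at (src (comp2 q)) c lc.
  by have /smoothP/(_ p) s := sc2; exact: (near_smooth s (near_src hL fc)).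
(* Frame ratios form a multiplicative cocycle; hence their logarithmic derivatives, and with them
   [eta], are additive. *)
have ratio_mul q : frame_at (tgt (comp1 q)) a la -> frame_at (src (comp1 q)) b lb ->
    frame_at (src (comp2 q)) c lc -> frame_ratio la c (compm q) = frame_ratio la b (comp1 q) * frame_ratio lb c (comp2 q).
  move=> fa' fb' fc'.
  have fb2' : frame_at (tgt (comp2 q)) b lb by rewrite -comp_src.
  pose u := pull_section (@vsrc R G L) c (comp2 q).
  have s1 : Tot (vsrc L (sinv L (comp1 q) (Tot (vtgt L u)))) = Tot (vtgt L u).
    by apply: (sinvK hL) => /=; rewrite comp_src.
  have [E1 E2] := comp_mul_src hL (p := q) s1.
  have := tcoord_src hL (vmul L (sinv L (comp1 q) (Tot (vtgt L u))) u : L (compm q)) fa'.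
  have fcm' : frame_at (src (compm q)) c lc by rewrite compm_src.
  move=> /(_ c lc fcm'); rewrite E1 /tcoord E2 -/(tcoord la _) (tcoord_src hL _ fa' fb') s1.
  rewrite -/(tcoord lb u) (tcoord_src hL u fb2' fc').
  have -> : lc (Tot (vsrc L u)) = 1.
    rewrite (iso_finvP (line_vb hL) (line_vb0 hL) (vsrc_lin hL) (vsrc_inj hL)).
    exact: frame_at_1 fc'.
  by rewrite !mulr1.
have sr1 := smooth_ratio hL fa fb; have sr2 := smooth_ratio hL fb2 fc; have srm := smooth_ratio hL fam fcm.
have r1n := ratio_neq0 hL fa fb; have r2n := ratio_neq0 hL fb2 fc; have rmE := ratio_mul p fa fb fc.
have drE (y : tangent p) : dv (dmap (@compm R G) y) (frame_ratio la c) / frame_ratio la c (compm p) =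
   dv (dmap (@comp1 R G) y) (frame_ratio la b) / frame_ratio la b (comp1 p) + dv (dmap (@comp2 R G) y) (frame_ratio lb c) / frame_ratio lb c (comp2 p).
  rewrite (dmapEs y scm srm) (dmapEs y sc1 sr1) (dmapEs y sc2 sr2) rmE.
  have -> : dv y (frame_ratio la c \o @compm R G) = dv y (fun q => (frame_ratio la b \o @comp1 R G) q * (frame_ratio lb c \o @comp2 R G) q).
    by apply: dv_near; apply: filterS2 (filterI nfa nfb) nfc => q [fa' fb'] fc'; exact: ratio_mul.
  rewrite dvM; [|exact: (sc1 _ sr1 p)|exact: (sc2 _ sr2 p)].
  by rewrite /=; field; rewrite r1n r2n.
have ccs (y : tangent p) : conn_coef nabla c lc (dmap (@src R G) (dmap (@compm R G) y)) = conn_coef nabla c lc (dmap (@src R G) (dmap (@comp2 R G) y)).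
  apply: conn_coef_fam => // f sf; rewrite (dmapEs _ sS sf) (dmapEs _ sS sf) (dmapEs _ scm (sS _ sf)) (dmapEs _ sc2 (sS _ sf)).
  by apply: dv_near; apply: near_all => q /=; rewrite compm_src.
have cct (y : tangent p) : conn_coef nabla a la (dmap (@tgt R G) (dmap (@compm R G) y)) = conn_coef nabla a la (dmap (@tgt R G) (dmap (@comp1 R G) y)).
  apply: conn_coef_fam => // f sf; rewrite (dmapEs _ sT sf) (dmapEs _ sT sf) (dmapEs _ scm (sT _ sf)) (dmapEs _ sc1 (sT _ sf)).
  by apply: dv_near; apply: near_all => q /=; rewrite compm_tgt.
have ccm (y : tangent p) : conn_coef nabla b lb (dmap (@tgt R G) (dmap (@comp2 R G) y)) = conn_coef nabla b lb (dmap (@src R G) (dmap (@comp1 R G) y)).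
  apply: conn_coef_fam => // f sf; rewrite (dmapEs _ sT sf) (dmapEs _ sS sf) (dmapEs _ sc2 (sT _ sf)) (dmapEs _ sc1 (sS _ sf)).
  by apply: dv_near; apply: near_all => q /=; rewrite comp_src.
have etaD (y : tangent p) : eta nabla (dmap (@compm R G) y) = eta nabla (dmap (@comp1 R G) y) + eta nabla (dmap (@comp2 R G) y).
  rewrite (etaE hL cN _ fam fcm) (etaE hL cN _ fa fb) (etaE hL cN _ fb2 fc) drE ccs cct ccm; ring.
have k1 : lc (Tot (ka (dmap (@src R G) (dmap (@compm R G) z)) (dmap (@src R G) (dmap (@compm R G) z')))) =
     lc (Tot (ka (dmap (@src R G) (dmap (@comp2 R G) z)) (dmap (@src R G) (dmap (@comp2 R G) z')))).
  apply: ka_fam => // f sf; rewrite (dmapEs _ sS sf) (dmapEs _ sS sf) (dmapEs _ scm (sS _ sf)) (dmapEs _ sc2 (sS _ sf));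
  by apply: dv_near; apply: near_all => q /=; rewrite compm_src.
have k2 : la (Tot (ka (dmap (@tgt R G) (dmap (@compm R G) z)) (dmap (@tgt R G) (dmap (@compm R G) z')))) =
     la (Tot (ka (dmap (@tgt R G) (dmap (@comp1 R G) z)) (dmap (@tgt R G) (dmap (@comp1 R G) z')))).
  apply: ka_fam => // f sf; rewrite (dmapEs _ sT sf) (dmapEs _ sT sf) (dmapEs _ scm (sT _ sf)) (dmapEs _ sc1 (sT _ sf));
  by apply: dv_near; apply: near_all => q /=; rewrite compm_tgt.
have k3 : lb (Tot (ka (dmap (@tgt R G) (dmap (@comp2 R G) z)) (dmap (@tgt R G) (dmap (@comp2 R G) z')))) =
     lb (Tot (ka (dmap (@src R G) (dmap (@comp1 R G) z)) (dmap (@src R G) (dmap (@comp1 R G) z')))).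
  apply: ka_fam => // f sf; rewrite (dmapEs _ sT sf) (dmapEs _ sS sf) (dmapEs _ sc2 (sT _ sf)) (dmapEs _ sc1 (sS _ sf));
  by apply: dv_near; apply: near_all => q /=; rewrite comp_src.
have tl1 (u : L (comp1 p)) (v : L (comp2 p)) (y : tangent p) : Tot (vsrc L u) = Tot (vtgt L (v + th (dmap (@comp2 R G) y))) ->
    tcoord la u = frame_ratio la b (comp1 p) * (tcoord lb v + tcoord lb (th (dmap (@comp2 R G) y))).
  by move=> E; rewrite (tcoord_src hL _ fa fb) E -(tcoordD hL fb2).
have tlm (u : L (compm p)) (v : L (comp2 p)) : Tot (vsrc L u) = Tot (vsrc L v) ->
    tcoord la u = frame_ratio la b (comp1 p) * tcoord lb v.
  by move=> E; rewrite (tcoord_src hL _ fam fcm) (tcoord_src hL v fb2 fc) E rmE mulrA.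
have tm (y : tangent p) := tcoord_mult_form y fa fb.
(* Near [p] the local expression of [th] on the product minus those on the factors is a 1-form that
   vanishes identically on composable pairs. [closed_zero_form] differentiates this relation, and
   [comp_extend] provides the fields extending [z] and [z']. *)
have dE : dform c3 X3 (dmap (@compm R G) z) (dmap (@compm R G) z') =
   dform c1 X1 (dmap (@comp1 R G) z) (dmap (@comp1 R G) z') +
   (frame_ratio la b (comp1 p) * dform c2 X2 (dmap (@comp2 R G) z) (dmap (@comp2 R G) z') +
    (dv (dmap (@comp1 R G) z) (frame_ratio la b) * tcoord lb (th (dmap (@comp2 R G) z')) -
     dv (dmap (@comp1 R G) z') (frame_ratio la b) * tcoord lb (th (dmap (@comp2 R G) z)))).
  have [sc3 sX3 H3] := lo3; have [sc1' sX1 H1] := lo1; have [sc2' sX2 H2] := lo2.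
  have [Z [sZ Zp]] := comp_extend lG z; have [Z' [sZ' Z'p]] := comp_extend lG z'.
  pose A (i : ('I_n3 + ('I_n1 + 'I_n2))%type) (q : comp G) : R := match i with
    | inl i => c3 i (compm q) | inr (inl i) => - c1 i (comp1 q) | inr (inr i) => - (frame_ratio la b (comp1 q) * c2 i (comp2 q)) end.
  pose F (i : ('I_n3 + ('I_n1 + 'I_n2))%type) (q : comp G) : R := match i with
    | inl i => X3 i (compm q) | inr (inl i) => X1 i (comp1 q) | inr (inr i) => X2 i (comp2 q) end.
  have sF i : smoothf (F i) by case: i => [i|[i|i]]; [exact: (scm _ (sX3 i))|exact: (sc1 _ (sX1 i))|exact: (sc2 _ (sX2 i))].
  have sA i : smooth_at p (A i).
    case: i => [i|[i|i]]; first exact: (scm _ (sc3 i)).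
      by apply: smooth_atN; exact: (sc1 _ (sc1' i)).
    by apply: smooth_atN; apply: smooth_atM; [exact: (sc1 _ sr1)|exact: (sc2 _ (sc2' i))].
  have := @closed_zero_form R (comp G) p Z Z' sZ sZ' _ A F sF sA; rewrite Zp Z'p => H.
  have n1' : \forall q \near (p : comp G), forall w : tangent (comp1 q), tcoord la (th w) = \sum_i c1 i (comp1 q) * dv w (X1 i).
    by have /smoothP/(_ p) s := sc1; exact: (near_smooth s H1).
  have n2' : \forall q \near (p : comp G), forall w : tangent (comp2 q), tcoord lb (th w) = \sum_i c2 i (comp2 q) * dv w (X2 i).
    by have /smoothP/(_ p) s := sc2; exact: (near_smooth s H2).
  have n3' : \forall q \near (p : comp G), forall w : tangent (compm q), tcoord la (th w) = \sum_i c3 i (compm q) * dv w (X3 i).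
    by have /smoothP/(_ p) s := scm; exact: (near_smooth s H3).
  have {H} : \sum_k (dv z (A k) * dv z' (F k) - dv z' (A k) * dv z (F k)) = 0.
    apply: H; apply: filterS2 (filterI nfa nfb) (filterI n1' (filterI n2' n3')) => q [fa' fb'] [E1 [E2 E3]] v.
    have fE m (C Y : 'I_m -> ar G -> R) (phi : comp G -> ar G) : smooth phi -> (forall i, smoothf (Y i)) ->
        \sum_i C i (phi q) * dv (dmap phi v) (Y i) = \sum_i C i (phi q) * dv v (Y i \o phi).
      by move=> sphi sY; apply: eq_bigr => i _; rewrite (dmapEs v sphi (sY i)).
    have := tcoord_mult_form v fa' fb'; rewrite E1 E2 E3 !fE // => M.
    rewrite big_sumType [\sum_(i : 'I_n1 + 'I_n2) _]big_sumType /= (eq_bigr (fun i => c3 i (compm q) * dv v (X3 i \o @compm R G))) // M.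
    rewrite [X in _ + (X + _)](eq_bigr (fun i => - (c1 i (comp1 q) * dv v (X1 i \o @comp1 R G)))); last by move=> i _; rewrite mulNr.
    rewrite [X in _ + (_ + X)](eq_bigr (fun i => - (frame_ratio la b (comp1 q) * (c2 i (comp2 q) * dv v (X2 i \o @comp2 R G))))); last first.
      by move=> i _; rewrite mulNr mulrA.
    by rewrite !sumrN -mulr_sumr; ring.
  rewrite big_sumType [\sum_(i : 'I_n1 + 'I_n2) _]big_sumType /=.
  rewrite [X in X + _](_ : _ = dform c3 X3 (dmap (@compm R G) z) (dmap (@compm R G) z')); last first.
    apply: eq_bigr => i _.
    by rewrite !(dmapEs _ scm (sX3 i)) !(dmapEs _ scm (sc3 i)).
  rewrite [X in _ + (X + _)](_ : _ = - dform c1 X1 (dmap (@comp1 R G) z) (dmap (@comp1 R G) z')); last first.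
    rewrite /dform -sumrN; apply: eq_bigr => i _.
    rewrite !(dmapEs _ sc1 (sX1 i)) !(dmapEs _ sc1 (sc1' i)) !dvN; [|exact: (sc1 _ (sc1' i) p)|exact: (sc1 _ (sc1' i) p)].
    by rewrite /comp /=; ring.
  rewrite [X in _ + (_ + X)](_ : _ = - (frame_ratio la b (comp1 p) * dform c2 X2 (dmap (@comp2 R G) z) (dmap (@comp2 R G) z') +
    (dv (dmap (@comp1 R G) z) (frame_ratio la b) * tcoord lb (th (dmap (@comp2 R G) z')) -
     dv (dmap (@comp1 R G) z') (frame_ratio la b) * tcoord lb (th (dmap (@comp2 R G) z))))); last first.
    rewrite !(nbhs_singleton H2) /dform !mulr_sumr -sumrB -big_split -sumrN; apply: eq_bigr => i _ /=.
    rewrite !(dmapEs _ sc2 (sX2 i)) !(dmapEs _ sc2 (sc2' i)) !(dmapEs _ sc1 sr1) !dvN ?dvM;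
      try first [exact: (sc1 _ sr1 p)|exact: (sc2 _ (sc2' i) p)|apply: smooth_atM; [exact: (sc1 _ sr1 p)|exact: (sc2 _ (sc2' i) p)]].
    by rewrite /comp /=; ring.
  by move=> /eqP; rewrite -opprD subr_eq0 => /eqP.
rewrite !(pairing_coord hL nabla ka _ _ fa) (pairing_coord hL nabla ka _ _ fam) (pairing_coord hL nabla ka _ _ fb2) /=.
rewrite (dconn_coord hL cN fth _ _ fam lo3) (dconn_coord hL cN fth _ _ fa lo1) (dconn_coord hL cN fth _ _ fb2 lo2).
rewrite (partial2_coord hL ka _ _ fam fcm) (partial2_coord hL ka _ _ fa fb) (partial2_coord hL ka _ _ fb2 fc).
rewrite k1 k2 k3 !etaD dE !cct !ccm !tm rmE (tl1 _ _ _ cl) (tl1 _ _ _ cm) (tlm _ _ el) (tlm _ _ em).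
rewrite (etaE hL cN (dmap (@comp1 R G) z) fa fb) (etaE hL cN (dmap (@comp1 R G) z') fa fb).
by field.
Qed.
End PairingMul.

(** * The tangent groupoid and the Morita kernel *)

Section TangentMul.
Context (R : realType) (G : groupoid R).
Hypothesis lG : is_lie_groupoid G.
Let gG := lie_groupoid lG.
Implicit Types a b c : tot (TB (ar G)).

Let sS := src_smooth lG.
Let sT := tgt_smooth lG.
Let sU := unt_smooth lG.
Let sI := inv_smooth lG.
Let sM := compm_smooth lG.
Let s1 := @comp1_smooth R G.
Let s2 := @comp2_smooth R G.

(* A relation between points of total spaces: the groupoid laws then hold without
   transport along equalities of base points. *)
Definition tangent_mul a b c : Prop := exists z : tot (TB (comp G)),
  [/\ Tmap (@comp1 R G) z = a, Tmap (@comp2 R G) z = b & Tmap (@compm R G) z = c].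

Definition TZ (X : space R) (x : X) : tot (TB X) := @Tot R X (TB X) x 0.

Lemma tangent_mul_exists a b : Tmap (@src R G) a = Tmap (@tgt R G) b -> exists c, tangent_mul a b c.
Proof. by move=> /(comp_tangent lG)[z [z1 z2]]; exists (Tmap (@compm R G) z), z. Qed.

Lemma tangent_mul_fun a b c c' : tangent_mul a b c -> tangent_mul a b c' -> c = c'.
Proof.
move=> [z [z1 z2 <-]] [z' [z1' z2' <-]]; congr (Tmap _ _).
by apply: comp_tangent_inj; rewrite ?z1 ?z2 ?z1' ?z2'.
Qed.

Lemma comp_map (X : space R) (u v : X -> ar G) : smooth u -> smooth v ->
  (forall x, src (u x) = tgt (v x)) -> exists phi : X -> comp G,
  [/\ smooth phi, forall x, comp1 (phi x) = u x & forall x, comp2 (phi x) = v x].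
Proof.
move=> su sv E; exists (fun x => exist _ (u x, v x) (E x)); split => //.
apply/(@smooth_initial R _ X (prod_space (ar G) (ar G)) (fun q : {x | [set p | src p.1 = tgt p.2] x} => sval q)).
exact: smooth_pair.
Qed.

(** An identity between arrows depending smoothly on a parameter is differentiated; the unit and
    inverse laws of the tangent groupoid all arise in this way. *)
Lemma tangent_mul_map (X : space R) (u v w : X -> ar G) (x : tot (TB X)) : smooth u -> smooth v ->
  (forall y, src (u y) = tgt (v y)) -> (forall y, mul (u y) (v y) = w y) ->
  tangent_mul (Tmap u x) (Tmap v x) (Tmap w x).
Proof.
move=> su sv E M; have [phi [sphi p1 p2]] := comp_map su sv E.
exists (Tmap phi x); split; rewrite -Tmap_comp //; congr (Tmap _ x); apply: boolp.funext => y /=.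
- exact: p1.
- exact: p2.
- by rewrite -M -p1 -p2.
Qed.

Lemma tangent_mul_src a b c : tangent_mul a b c ->
  [/\ Tmap (@src R G) a = Tmap (@tgt R G) b, Tmap (@src R G) c = Tmap (@src R G) b
    & Tmap (@tgt R G) c = Tmap (@tgt R G) a].
Proof.
move=> [z [<- <- <-]]; split; rewrite -!Tmap_comp //; congr (Tmap _ z); apply: boolp.funext => q /=.
- exact: comp_src.
- by case: q => -[g h] /= e; exact: (src_mul gG e).
- by case: q => -[g h] /= e; exact: (tgt_mul gG e).
Qed.

Lemma tangent_mul_tag a b c : tangent_mul a b c -> src (tag a) = tgt (tag b) /\ tag c = mul (tag a) (tag b).
Proof. by move=> [[[[g h] e] z] [<- <- <-]]. Qed.

Lemma tangent_mul_unitr a : tangent_mul a (Tmap (@unt R G \o @src R G) a) a.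
Proof.
rewrite -{1 3}(Tmap_id a); apply: tangent_mul_map => [||y|y]; [exact: smooth_id|exact: smooth_comp| |].
  by rewrite /= (tgt_unt gG).
by rewrite /= (mul_unt gG).
Qed.

Lemma tangent_mul_unitl a : tangent_mul (Tmap (@unt R G \o @tgt R G) a) a a.
Proof.
rewrite -{2 3}(Tmap_id a); apply: tangent_mul_map => [||y|y]; [exact: smooth_comp|exact: smooth_id| |].
  by rewrite /= (src_unt gG).
by rewrite /= (unt_mul gG).
Qed.

Lemma tangent_mul_invr a : tangent_mul a (Tmap (@inv R G) a) (Tmap (@unt R G \o @tgt R G) a).
Proof.
rewrite -{1}(Tmap_id a); apply: tangent_mul_map => [||y|y] //.
  by rewrite /= (tgt_inv gG).
by rewrite /= (mul_inv gG).
Qed.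

Lemma tangent_mul_cancelr a b c : tangent_mul a b c -> tangent_mul c (Tmap (@inv R G) b) a.
Proof.
move=> [z [<- <- <-]]; rewrite -Tmap_comp //; apply: tangent_mul_map => //.
- exact: smooth_comp.
- by case=> -[g h] e /=; rewrite (tgt_inv gG); exact: (src_mul gG e).
- by case=> -[g h] e /=; exact: (mulK gG e).
Qed.

Lemma tangent_mul_cancell a b c : tangent_mul a b c -> tangent_mul (Tmap (@inv R G) a) c b.
Proof.
move=> [z [<- <- <-]]; rewrite -Tmap_comp //; apply: tangent_mul_map => //.
- exact: smooth_comp.
- by case=> -[g h] e /=; rewrite (src_inv gG); apply/esym; exact: (tgt_mul gG e).
- by case=> -[g h] e /=; exact: (mulVK gG e).
Qed.

Lemma Tot_TB_lin (x y : ar G) k (u v : tangent x) (u' v' : tangent y) :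
  @Tot R _ (TB (ar G)) x u = @Tot R _ (TB (ar G)) y u' -> @Tot R _ (TB (ar G)) x v = @Tot R _ (TB (ar G)) y v' ->
  @Tot R _ (TB (ar G)) x (k *: u + v) = @Tot R _ (TB (ar G)) y (k *: u' + v').
Proof. exact: Tot_lin. Qed.

Lemma tangent_mul_lin g h k s (u v : tangent g) (u' v' : tangent h) (w x : tangent k) :
  tangent_mul (@Tot R _ (TB (ar G)) g u) (@Tot R _ (TB (ar G)) h u') (@Tot R _ (TB (ar G)) k w) ->
  tangent_mul (@Tot R _ (TB (ar G)) g v) (@Tot R _ (TB (ar G)) h v') (@Tot R _ (TB (ar G)) k x) ->
  tangent_mul (@Tot R _ (TB (ar G)) g (s *: u + v)) (@Tot R _ (TB (ar G)) h (s *: u' + v'))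
    (@Tot R _ (TB (ar G)) k (s *: w + x)).
Proof.
move=> [[p z] [z1 z2 z3]] [[q y] [y1 y2 y3]].
have pq : p = q.
  apply: comp_eq; [have := etrans z1 _|have := etrans z2 _].
    by have := congr1 (fun q : tot (TB (ar G)) => tag q) z1; have := congr1 (fun q : tot (TB (ar G)) => tag q) y1 => /= -> ->.
  by have := congr1 (fun q : tot (TB (ar G)) => tag q) z2; have := congr1 (fun q : tot (TB (ar G)) => tag q) y2 => /= -> ->.
case: _ / pq y y1 y2 y3 => y y1 y2 y3.
exists (@Tot R _ (TB (comp G)) p (s *: z + y)); split; rewrite /Tmap /=.
- by rewrite (dmap_lin s1); exact: (Tot_TB_lin s z1 y1).
- by rewrite (dmap_lin s2); exact: (Tot_TB_lin s z2 y2).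
- by rewrite (dmap_lin sM); exact: (Tot_TB_lin s z3 y3).
Qed.

Lemma tangent_mul_tmul g h (v : tangent g) (w : tangent h) c :
  tangent_mul (@Tot R _ (TB (ar G)) g v) (@Tot R _ (TB (ar G)) h w) c ->
  c = @Tot R _ (TB (ar G)) (mul g h) (tmul v w).
Proof. by move=> [z [z1 z2 <-]]; rewrite (Tmap_tmul z1 z2). Qed.
End TangentMul.

Lemma sum_Tot_eq (R : realType) (B : space R) (E E' : bundle B) (x y : B)
    (u : sum_bundle E E' x) (v : sum_bundle E E' y) :
  Tot u.1 = Tot v.1 -> Tot u.2 = Tot v.2 -> Tot u = Tot v.
Proof.
case: u v => [u1 u2] [v1 v2] /= H; have e : x = y by exact: (congr1 (fun q : tot E => tag q) H).
by case: _ / e v1 v2 H => v1 v2 /Tot_inj -> /Tot_inj ->.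
Qed.

(** * The groupoid structure of the Morita kernel *)

Section MKMul.
Context (R : realType) (G : groupoid R) (L : vbg G).
Hypothesis hL : is_line_groupoid L.
Context (th : form1 L) (fth : is_form1 th) (mth : multiplicative th).
Let lG := line_lie hL.
Let gG := lie_groupoid lG.
Let lL := line_tot_lie hL.
Let gL := lie_groupoid lL.

Let sS := src_smooth lG.
Let sT := tgt_smooth lG.
Let sU := unt_smooth lG.
Let sI := inv_smooth lG.

Lemma th_Tot g h (v : tangent g) (w : tangent h) :
  @Tot R _ (TB (ar G)) g v = @Tot R _ (TB (ar G)) h w -> Tot (th v) = Tot (th w).
Proof. by move=> H; have := congr1 (fun q : tot (TB (ar G)) => Tot (th (tagged q))) H. Qed.

Lemma frame_Tot x y a l (u : vb0 L x) (v : vb0 L y) : x = y -> frame_at x a l ->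
  l (Tot u) = l (Tot v) -> Tot u = Tot v.
Proof.
move=> e; case: _ / e v => v fa H; congr Tot.
by rewrite (frame_atE fa u) (frame_atE fa v) H.
Qed.

Lemma unt_ratio (x : ob G) (a : section (vb0 L)) l : frame_at x a l -> frame_ratio l a (unt x) = 1.
Proof.
move=> fa; have ft : frame_at (tgt (unt x)) a l by rewrite (tgt_unt gG).
have fs : frame_at (src (unt x)) a l by rewrite (src_unt gG).
have := tcoord_src hL (vunt L (a x)) ft fs; rewrite /tcoord.
have -> : Tot (vtgt L (vunt L (a x))) = Tot (a x) by exact: (tgt_unt gL (Tot (a x))).
have -> : Tot (vsrc L (vunt L (a x))) = Tot (a x) by exact: (src_unt gL (Tot (a x))).
by rewrite (frame_at_1 fa) mulr1.
Qed.

Lemma inv_ratio (g : ar G) (a : section (vb0 L)) l (b : section (vb0 L)) lb : frame_at (tgt g) a l -> frame_at (src g) b lb ->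
  frame_ratio lb a (inv g) = (frame_ratio l b g)^-1.
Proof.
move=> fa fb.
have fa' : frame_at (src (inv g)) a l by rewrite (src_inv gG).
have fb' : frame_at (tgt (inv g)) b lb by rewrite (tgt_inv gG).
pose y := pull_section (@vtgt R G L) a g.
have ty : l (Tot (vtgt L y)) = 1.
  by rewrite (iso_finvP (line_vb hL) (line_vb0 hL) (vtgt_lin hL) (vtgt_inj hL)) (frame_at_1 fa).
have r0 := ratio_neq0 hL fa fb.
have := tcoord_src hL (vinv L y) fb' fa'; rewrite /tcoord.
have -> : Tot (vtgt L (vinv L y)) = Tot (vsrc L y) by exact: (tgt_inv gL (Tot y)).
have -> : Tot (vsrc L (vinv L y)) = Tot (vtgt L y) by exact: (src_inv gL (Tot y)).
have := tcoord_src hL y fa fb; rewrite /tcoord ty mulr1 => E <-.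
by apply: (mulfI r0); rewrite -E divff.
Qed.

Lemma tcoord_mul (p : comp G) (u : L (compm p)) (v : L (comp2 p)) a la b lb :
  frame_at (tgt (comp1 p)) a la -> frame_at (src (comp1 p)) b lb ->
  Tot (vsrc L u) = Tot (vsrc L v) -> tcoord la u = frame_ratio la b (comp1 p) * tcoord lb v.
Proof.
move=> fa fb E; have es := comp_src p.
have s1 : Tot (vsrc L (sinv L (comp1 p) (Tot (vtgt L v)))) = Tot (vtgt L v) by exact: (sinvK hL).
have [E1 E2] := comp_mul_src hL s1.
have -> : u = vmul L (sinv L (comp1 p) (Tot (vtgt L v))) v :> L (compm p).
  by apply: (vsrc_inj hL); apply: Tot_inj; rewrite E1.
by rewrite /tcoord E2 -/(tcoord la _) (tcoord_src hL _ fa fb) s1.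
Qed.

(** A unit is its own square and the frame ratio at a unit is 1, so by multiplicativity the value of
    [th] equals twice itself. *)
Lemma th_unt x (v : tangent x) : th (dmap (@unt R G) v) = 0.
Proof.
have [a [l fa]] := frame_at_exists hL x.
have ft : frame_at (tgt (unt x)) a l by rewrite (tgt_unt gG).
have fs : frame_at (src (unt x)) a l by rewrite (src_unt gG).
have [phi [sphi p1 p2]] := comp_map (G := G) sU sU (fun y => etrans (src_unt gG y) (esym (tgt_unt gG y))).
pose z := dmap phi v; pose q := @Tot R _ (TB (ob G)) x v.
have E (u : comp G -> ar G) (su : smooth u) : (forall y, u (phi y) = unt y) ->
    @Tot R _ (TB (ar G)) _ (dmap u z) = @Tot R _ (TB (ar G)) _ (dmap (@unt R G) v).
  move=> H; rewrite -[LHS]/(Tmap u (Tmap phi q)) -Tmap_comp //.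
  by rewrite -[RHS]/(Tmap (@unt R G) q); congr (Tmap _ q); apply: boolp.funext => y /=.
have E1 := th_Tot (E _ (@comp1_smooth R G) p1).
have E2 := th_Tot (E _ (@comp2_smooth R G) p2).
have Em : Tot (th (dmap (@compm R G) z)) = Tot (th (dmap (@unt R G) v)).
  apply: th_Tot; apply: (E _ (compm_smooth lG)) => y.
  rewrite /compm -/(comp1 _) -/(comp2 _) p1 p2 -{2}(src_unt gG y); exact: (mul_unt gG).
have fa1 : frame_at (tgt (comp1 (phi x))) a l by rewrite p1.
have fb1 : frame_at (src (comp1 (phi x))) a l by rewrite p1.
have tc g h (u : L g) (w : L h) : Tot u = Tot w -> tcoord l u = tcoord l w.
  by move=> H; have := congr1 (fun q : tot L => tcoord l (tagged q)) H.
have := tcoord_mult_form hL mth z fa1 fb1; rewrite (tc _ _ _ _ E1) (tc _ _ _ _ E2) (tc _ _ _ _ Em) p1 (unt_ratio fa) mul1r.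
move=> H; apply: (tcoord_inj hL ft); rewrite (tcoord0 hL fa).
by apply/eqP; rewrite -(addrK (tcoord l (th (dmap (@unt R G) v))) (tcoord l (th (dmap (@unt R G) v)))) -H subrr.
Qed.

Let TK := tot_groupoid (MK th).
Implicit Types P Q S : ar TK.

Definition MKv P : tot (TB (ar G)) := @Tot R _ (TB (ar G)) (tag P) (tagged P).1.
Definition MKl P : tot L := Tot (tagged P).2.
Definition MKt P : tot (vb0 L) := Tot (vtgt L ((tagged P).2 + th (tagged P).1)).
Definition MKs P : tot (vb0 L) := Tot (vsrc L (tagged P).2).

Lemma MK_eq P Q : MKv P = MKv Q -> MKl P = MKl Q -> P = Q.
Proof. by case: P Q => [g p] [h q]; exact: (@sum_Tot_eq R _ (TB (ar G)) L). Qed.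

Lemma MK_srcE P Q : src P = src Q <-> Tmap (@src R G) (MKv P) = Tmap (@src R G) (MKv Q) /\ MKs P = MKs Q.
Proof.
split=> [H|[H1 H2]]; last exact: (@sum_Tot_eq R _ (TB (ob G)) (vb0 L)).
split; first exact: (congr1 (fun q : ob TK => @Tot R _ (TB (ob G)) (tag q) (tagged q).1) H).
exact: (congr1 (fun q : ob TK => Tot (tagged q).2) H).
Qed.

Lemma MK_tgtE P Q : tgt P = tgt Q <-> Tmap (@tgt R G) (MKv P) = Tmap (@tgt R G) (MKv Q) /\ MKt P = MKt Q.
Proof.
split=> [H|[H1 H2]]; last exact: (@sum_Tot_eq R _ (TB (ob G)) (vb0 L)).
split; first exact: (congr1 (fun q : ob TK => @Tot R _ (TB (ob G)) (tag q) (tagged q).1) H).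
exact: (congr1 (fun q : ob TK => Tot (tagged q).2) H).
Qed.

Lemma MK_src_tgtE P Q : src P = tgt Q <-> Tmap (@src R G) (MKv P) = Tmap (@tgt R G) (MKv Q) /\ MKs P = MKt Q.
Proof.
split=> [H|[H1 H2]]; last exact: (@sum_Tot_eq R _ (TB (ob G)) (vb0 L)).
split; first exact: (congr1 (fun q : ob TK => @Tot R _ (TB (ob G)) (tag q) (tagged q).1) H).
exact: (congr1 (fun q : ob TK => Tot (tagged q).2) H).
Qed.

(** Multiplication as a relation on total spaces, for the same reason as [tangent_mul]; the middle
    clause is composability in the line component. *)
Definition mk_mul P Q S : Prop :=
  [/\ tangent_mul (MKv P) (MKv Q) (MKv S), MKs P = MKt Q & MKs S = MKs Q].

Lemma mk_mul_coord P Q S a la b lb : mk_mul P Q S ->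
  frame_at (tgt (tag P)) a la -> frame_at (src (tag P)) b lb ->
  [/\ tcoord la (th (tagged S).1) = tcoord la (th (tagged P).1) + frame_ratio la b (tag P) * tcoord lb (th (tagged Q).1),
      tcoord la (tagged P).2 = frame_ratio la b (tag P) * (tcoord lb (tagged Q).2 + tcoord lb (th (tagged Q).1))
    & tcoord la (tagged S).2 = frame_ratio la b (tag P) * tcoord lb (tagged Q).2].
Proof.
case: P Q S => [g [p l]] [h [q m]] [k [r n]] [[[pp z] [z1 z2 z3]] c1 c2] fa fb.
have e1 : comp1 pp = g by exact: (congr1 (fun q : tot (TB (ar G)) => tag q) z1).
have e2 : comp2 pp = h by exact: (congr1 (fun q : tot (TB (ar G)) => tag q) z2).
have e3 : compm pp = k by exact: (congr1 (fun q : tot (TB (ar G)) => tag q) z3).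
case: _ / e1 p l z1 c1 fa fb => p l z1 c1 fa fb.
case: _ / e2 q m z2 c1 c2 => q m z2 c1 c2; case: _ / e3 r n z3 c2 => r n z3 c2.
have {}z1 := Tot_inj z1; have {}z2 := Tot_inj z2; have {}z3 := Tot_inj z3.
rewrite /= in z1 z2 z3 fa fb *; rewrite -z1 -z2 -z3.
have fb2 : frame_at (tgt (comp2 pp)) b lb by rewrite -comp_src.
split; first exact: (tcoord_mult_form hL mth z fa fb).
  by rewrite (tcoord_src hL l fa fb) [Tot (vsrc L l)]c1 /= -(tcoordD hL fb2) z2.
exact: (tcoord_mul fa fb c2).
Qed.

(** Only the target in the line component needs an argument: it contains [th], and the contributions
    of the two factors add up by multiplicativity. *)
Lemma mk_mul_ends P Q S : mk_mul P Q S -> [/\ src P = tgt Q, src S = src Q & tgt S = tgt P].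
Proof.
move=> m; have [tm c1 c2] := m; have [E1 E2 E3] := tangent_mul_src lG tm.
have [e1 e2] := tangent_mul_tag tm; rewrite /= in e1 e2.
split; [by apply/MK_src_tgtE|by apply/MK_srcE|apply/MK_tgtE; split => //].
have [a [la fa]] := frame_at_exists hL (tgt (tag P)).
have [b [lb fb]] := frame_at_exists hL (src (tag P)).
have et : tgt (tag S) = tgt (tag P) by rewrite e2; exact: (tgt_mul gG e1).
have fs : frame_at (tgt (tag S)) a la by rewrite et.
have [H1 H2 H3] := mk_mul_coord m fa fb.
apply: (frame_Tot et fs); rewrite -!/(tcoord la _) !(tcoordD hL fa) H1 H2 H3; ring.
Qed.

Lemma mk_mul_fun P Q S S' : mk_mul P Q S -> mk_mul P Q S' -> S = S'.
Proof.
move=> [t1 _ s1] [t2 _ s2]; have tE := tangent_mul_fun t1 t2; apply: MK_eq => //.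
have e : tag S = tag S' by exact: (congr1 (fun q : tot (TB (ar G)) => tag q) tE).
rewrite /MKl; move: s1 s2; case: S S' {t1 t2 tE} e => [k [r n]] [k' [r' n']] /= e.
case: _ / e r' n' => r' n'; rewrite /MKs /= => <- /Tot_inj/(vsrc_inj hL) -> //.
Qed.

Lemma mk_mul_mul P Q : src P = tgt Q -> mk_mul P Q (mul P Q).
Proof.
move=> /MK_src_tgtE[H1 H2]; have [c tm] := tangent_mul_exists lG H1.
have [e1 e2] := tangent_mul_tag tm; rewrite /= in e1.
have cE : c = MKv (mul P Q) .
  have H := @tangent_mul_tmul R G (tag P) (tag Q) (tagged P).1 (tagged Q).1 c tm.
  rewrite H; reflexivity.
split; [by rewrite -cE|exact: H2|].
by rewrite /MKs /= (sinvK hL) //= (src_mul gG e1).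
Qed.

Lemma mk_mulE P Q S : mk_mul P Q S -> S = mul P Q.
Proof. by move=> m; have [/mk_mul_mul m' _ _] := mk_mul_ends m; exact: mk_mul_fun m m'. Qed.

Lemma MK_src_unt (A : ob TK) : src (unt A) = A.
Proof.
case: A => x [v l]; apply: (@sum_Tot_eq R _ (TB (ob G)) (vb0 L)) => /=.
  rewrite -[LHS]/(Tmap (@src R G) (Tmap (@unt R G) (@Tot R _ (TB (ob G)) x v))) -Tmap_comp //.
  rewrite -[RHS]Tmap_id; congr (Tmap _ _); apply: boolp.funext => y /=; exact: (src_unt gG).
exact: (src_unt gL (Tot l)).
Qed.

Lemma MK_tgt_unt (A : ob TK) : tgt (unt A) = A.
Proof.
case: A => x [v l]; apply: (@sum_Tot_eq R _ (TB (ob G)) (vb0 L)) => /=.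
  rewrite -[LHS]/(Tmap (@tgt R G) (Tmap (@unt R G) (@Tot R _ (TB (ob G)) x v))) -Tmap_comp //.
  rewrite -[RHS]Tmap_id; congr (Tmap _ _); apply: boolp.funext => y /=; exact: (tgt_unt gG).
by rewrite th_unt addr0; exact: (tgt_unt gL (Tot l)).
Qed.

Lemma mk_mul_unitr P : mk_mul P (unt (src P)) P.
Proof.
have /MK_src_tgtE[_ E] := esym (MK_tgt_unt (src P)).
have /MK_srcE[_ E'] := MK_src_unt (src P).
split; [|exact: E|exact: (esym E')].
have -> : MKv (unt (src P)) = Tmap (@unt R G) (Tmap (@src R G) (MKv P)) by [].
rewrite -Tmap_comp //.
exact: tangent_mul_unitr.
Qed.

Lemma mk_mul_unitl P : mk_mul (unt (tgt P)) P P.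
Proof.
split => //; last by have /MK_src_tgtE[_ ->] := MK_src_unt (tgt P).
have -> : MKv (unt (tgt P)) = Tmap (@unt R G) (Tmap (@tgt R G) (MKv P)) by [].
rewrite -Tmap_comp //.
exact: tangent_mul_unitl.
Qed.

Lemma MKv_inv P : MKv (inv P) = Tmap (@inv R G) (MKv P). Proof. by []. Qed.

Lemma MKs_inv P : MKs (inv P) = MKt P.
Proof. by rewrite /MKs /= (sinvK hL) //= (src_inv gG). Qed.

(** The product of a vector with its inverse is a unit vector, on which [th] vanishes. This
    determines [th] on the inverse, and the line component of the target then collapses to the
    source. *)
Lemma MKt_inv P : MKt (inv P) = MKs P.
Proof.
have tm := tangent_mul_invr lG (MKv P).
have [a [la fa]] := frame_at_exists hL (tgt (tag P)); have [b [lb fb]] := frame_at_exists hL (src (tag P)).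
have fa' : frame_at (src (inv (tag P))) a la by rewrite (src_inv gG).
have fb' : frame_at (tgt (inv (tag P))) b lb by rewrite (tgt_inv gG).
have r0 := ratio_neq0 hL fa fb.
(* The line component is chosen solely to make [Q] composable with [inv P]; only the values of [th]
   are extracted from this product. *)
pose Q : ar TK := @Tot R _ (MK th) (tag P) ((tagged P).1, sinv L (tag P) (Tot (vtgt L ((tagged (inv P)).2 + th (tagged (inv P)).1)))).
pose S : ar TK := @Tot R _ (MK th) (unt (tgt (tag P))) (dmap (@unt R G \o @tgt R G) (tagged P).1,
   sinv L (unt (tgt (tag P))) (Tot (vsrc L (tagged (inv P)).2))).
have m : mk_mul Q (inv P) S.
  split => //; rewrite /MKs /MKt /= (sinvK hL) //=; first by rewrite (tgt_inv gG).
  by rewrite (src_unt gG) (src_inv gG).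
have [H1 _ _] := mk_mul_coord m fa fb; rewrite /= in H1.
have sUT := smooth_comp sT sU.
have th0 : th (dmap (@unt R G \o @tgt R G) (tagged P).1) = 0.
  by rewrite dmap_comp // th_unt.
rewrite th0 (tcoord0 hL fa) in H1.
apply: (frame_Tot _ fb'); first by rewrite /= (tgt_inv gG).
rewrite -/(tcoord lb _) /= (tcoordD hL fb') (tcoord_src hL _ fb' fa') (sinvK hL) /= ?(src_inv gG) //.
rewrite (inv_ratio fa fb) -/(tcoord la _) (tcoordD hL fa).
have := tcoord_src hL (tagged P).2 fa fb => E; rewrite E mulrDr mulKf // -addrA.
rewrite -[RHS]addr0; congr (_ + _); apply: (mulfI r0).
by rewrite mulr0 mulrDr mulVKf.
Qed.

Lemma MK_src_inv P : src (inv P) = tgt P.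
Proof.
apply/MK_src_tgtE; split; last exact: MKs_inv.
rewrite MKv_inv -Tmap_comp //; congr (Tmap _ _); apply: boolp.funext => g /=; exact: (src_inv gG).
Qed.

Lemma MK_tgt_inv P : tgt (inv P) = src P.
Proof.
apply/esym; apply/MK_src_tgtE; split; last by rewrite MKt_inv.
rewrite MKv_inv -Tmap_comp //; congr (Tmap _ _); apply: boolp.funext => g /=; exact/esym/(tgt_inv gG).
Qed.

Lemma mk_mul_cancelr P Q S : mk_mul P Q S -> mk_mul S (inv Q) P.
Proof.
move=> [tm c1 c2]; split; first exact: (tangent_mul_cancelr lG tm).
  by rewrite MKt_inv.
by rewrite MKs_inv.
Qed.

Lemma mk_mul_cancell P Q S : mk_mul P Q S -> mk_mul (inv P) S Q.
Proof.
move=> m; have [tm c1 c2] := m; have [_ _ /MK_tgtE[_ E]] := mk_mul_ends m.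
split; first exact: (tangent_mul_cancell lG tm).
  by rewrite MKs_inv E.
by rewrite c2.
Qed.

Lemma mk_mul_invr P : mk_mul P (inv P) (unt (tgt P)).
Proof. exact: mk_mul_cancelr (mk_mul_unitl P). Qed.

Lemma MK_inv_inv P : inv (inv P) = P.
Proof.
have m := mk_mul_cancell (mk_mul_cancell (mk_mul_unitr P)).
apply: mk_mul_fun m; rewrite -MK_tgt_inv -MK_src_inv; exact: mk_mul_unitr.
Qed.
End MKMul.

Lemma homP (K : comPzRingType) (U W : lmodType K) (f : hom U W) : linear (sublv f).
Proof. by have /asboolP := valP f. Qed.

Lemma mkhomE (K : comPzRingType) (U W : lmodType K) (f : U -> W) : linear f -> sublv (mkhom f) = f.
Proof.
move=> lf; rewrite /mkhom -[sublv _]/(val _) insubdK //; exact/asboolP.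
Qed.

Lemma hom_eq (K : comPzRingType) (U W : lmodType K) (f g : hom U W) : (forall u, sublv f u = sublv g u) -> f = g.
Proof. by move=> H; apply: val_inj; apply: boolp.funext. Qed.

(** * The core and the kernels of source and target *)

Section Kernels.
Context (R : realType) (G : groupoid R) (L : vbg G).
Hypothesis hL : is_line_groupoid L.
Context (th : form1 L) (fth : is_form1 th) (mth : multiplicative th).
Let lG := line_lie hL.
Let gG := lie_groupoid lG.
Let V := MK th.
Let TK := tot_groupoid V.

Lemma MK_vsrc_lin g : linear (@vsrc R G V g).
Proof. by move=> c p q; congr (_, _); [exact: dmap_lin (src_smooth lG) _ _ _|exact: vsrc_lin hL _ _ _ _]. Qed.

Lemma MK_vtgt_lin g : linear (@vtgt R G V g).
Proof.
move=> c p q; congr (_, _); first exact: dmap_lin (tgt_smooth lG) _ _ _.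
have [tl _] := fth; rewrite /= tl -(vtgt_lin hL) scalerDr; congr (vtgt L _).
by rewrite -!addrA; congr (_ + _); rewrite addrCA.
Qed.

Lemma MK_vunt_lin x : linear (@vunt R G V x).
Proof. by move=> c p q; congr (_, _); [exact: dmap_lin (unt_smooth lG) _ _ _|exact: vunt_lin hL _ _ _ _]. Qed.

Lemma MK_vinv_lin g : linear (@vinv R G V g).
Proof.
move=> c p q; congr (_, _); first exact: dmap_lin (inv_smooth lG) _ _ _.
apply: (vsrc_inj hL); apply: Tot_inj; rewrite (sinvK hL) /=; last by rewrite (src_inv gG).
rewrite (vsrc_lin hL).
have := MK_vtgt_lin c p q => /(congr1 snd) /= ->.
by apply: Tot_lin; rewrite (sinvK hL) //= (src_inv gG).
Qed.

Lemma mk_mul_lin g h k c (p p' : V g) (q q' : V h) (r r' : V k) :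
  mk_mul (Tot p : ar TK) (Tot q : ar TK) (Tot r : ar TK) -> mk_mul (Tot p' : ar TK) (Tot q' : ar TK) (Tot r' : ar TK) ->
  mk_mul (Tot (c *: p + p') : ar TK) (Tot (c *: q + q') : ar TK) (Tot (c *: r + r') : ar TK).
Proof.
move=> [t1 t2 t3] [t1' t2' t3']; split.
- exact: tangent_mul_lin t1 t1'.
- rewrite /MKs /MKt /= (vsrc_lin hL).
  have := MK_vtgt_lin c q q' => /(congr1 snd) /= ->; exact: Tot_lin.
- by rewrite /MKs /= !(vsrc_lin hL); exact: Tot_lin.
Qed.

Lemma MK_zero_src g : src (Tot (0 : V g) : ar TK) = Tot (0 : vb0 V (src g)).
Proof. by rewrite /= -[Tot _]/(Tot (vsrc V (0 : V g))) (lin_0 (MK_vsrc_lin (g := g))). Qed.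

Lemma MK_zero_tgt g : tgt (Tot (0 : V g) : ar TK) = Tot (0 : vb0 V (tgt g)).
Proof. by rewrite /= -[Tot _]/(Tot (vtgt V (0 : V g))) (lin_0 (MK_vtgt_lin (g := g))). Qed.

Lemma MK_zero_inv g : inv (Tot (0 : V g) : ar TK) = Tot (0 : V (inv g)).
Proof. by rewrite /= -[Tot _]/(Tot (vinv V (0 : V g))) (lin_0 (MK_vinv_lin (g := g))). Qed.

Lemma core_src0 x (c : core V x) : vsrc V (sublv c) = 0.
Proof.
apply: (@span_ofP _ _ [set v : V (unt x) | vsrc V v = 0]); split => [|a u v Hu Hv] /=.
  exact: (lin_0 (MK_vsrc_lin (g := unt x))).
by rewrite -[LHS]/(vsrc V (a *: u + v)) MK_vsrc_lin [vsrc V u]Hu [vsrc V v]Hv scaler0 addr0.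
Qed.

Lemma core_intro x (v : V (unt x)) : vsrc V v = 0 -> exists c : core V x, sublv c = v.
Proof. exact: (@span_of_intro _ _ [set v : V (unt x) | vsrc V v = 0]). Qed.

(** The vector on which the source of a dual element is evaluated. These vectors are exactly the
    kernel of the target, just as the right shifts are the kernel of the source, so the ends of a
    dual element record its restrictions to the two kernels. *)
Definition left_shift g (c : core V (src g)) : V g :=
  fibat g (Tot (vmul V (0 : V g) (vinv V (sublv c)))).

Definition right_shift g (c : core V (tgt g)) : V g :=
  fibat g (Tot (vmul V (sublv c) (0 : V g))).

Lemma left_shift_mul g (c : core V (src g)) :
  mk_mul (Tot (0 : V g) : ar TK) (inv (Tot (sublv c) : ar TK)) (Tot (left_shift c) : ar TK).
Proof.
rewrite /left_shift fibatK /=; last by rewrite (inv_unt gG) (mul_unt gG).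
apply: (@mk_mul_mul R G L hL th (Tot (0 : V g)) (inv (Tot (sublv c) : ar TK))).
rewrite (MK_tgt_inv hL mth) MK_zero_src /= -[RHS]/(Tot (vsrc V (sublv c))) core_src0.
by apply: (@Tot0 R (ob G) (vb0 V)); rewrite (src_unt gG).
Qed.

Lemma right_shift_mul g (c : core V (tgt g)) :
  mk_mul (Tot (sublv c) : ar TK) (Tot (0 : V g) : ar TK) (Tot (right_shift c) : ar TK).
Proof.
rewrite /right_shift fibatK /=; last by rewrite (unt_mul gG).
apply: (@mk_mul_mul R G L hL th (Tot (sublv c)) (Tot (0 : V g))).
rewrite MK_zero_tgt /= -[LHS]/(Tot (vsrc V (sublv c))) core_src0.
by apply: (@Tot0 R (ob G) (vb0 V)); rewrite (src_unt gG).
Qed.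

Lemma left_shift_lin g : linear (@left_shift g).
Proof.
move=> a c c'; apply: Tot_inj.
apply: (mk_mul_fun hL (left_shift_mul (a *: c + c'))).
have := mk_mul_lin a (left_shift_mul c) (left_shift_mul c').
rewrite scaler0 addr0 => H.
have E : inv (Tot (sublv (a *: c + c')) : ar TK) = Tot (a *: vinv V (sublv c) + vinv V (sublv c')).
  exact: (congr1 (@Tot R _ V _) (MK_vinv_lin a (sublv c) (sublv c'))).
by rewrite E; exact: H.
Qed.

Lemma right_shift_lin g : linear (@right_shift g).
Proof.
move=> a c c'; apply: Tot_inj.
apply: (mk_mul_fun hL (right_shift_mul (a *: c + c'))).
have := mk_mul_lin a (right_shift_mul c) (right_shift_mul c').
by rewrite scaler0 addr0.
Qed.

Lemma left_shift_tgt g (c : core V (src g)) : vtgt V (left_shift c) = 0.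
Proof.
have [_ _ H] := mk_mul_ends hL mth (left_shift_mul c).
by apply: (@Tot_eq0 R _ (vb0 V) (tgt g) (tgt g)); rewrite -[LHS]/(tgt (Tot (left_shift c) : ar TK)) H MK_zero_tgt.
Qed.

Lemma right_shift_src g (c : core V (tgt g)) : vsrc V (right_shift c) = 0.
Proof.
have [_ H _] := mk_mul_ends hL mth (right_shift_mul c).
by apply: (@Tot_eq0 R _ (vb0 V) (src g) (src g)); rewrite -[LHS]/(src (Tot (right_shift c) : ar TK)) H MK_zero_src.
Qed.

(** The core element is the inverse of the zero vector over [inv g] times [q]; it has source 0
    because [q] has target 0. *)
Lemma left_shift_surj g (q : V g) : vtgt V q = 0 -> exists c, left_shift c = q.
Proof.
move=> tq; pose Z : ar TK := Tot (0 : V (inv g)).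
have e : src Z = tgt (Tot q : ar TK).
  by rewrite MK_zero_src /= -[RHS]/(Tot (vtgt V q)) tq; apply: (@Tot0 R (ob G) (vb0 V)); rewrite (src_inv gG).
have m := mk_mul_mul hL e; set S := mul Z _ in m.
have tS : tag S = unt (src g) by exact: (inv_mul gG).
have cK : Tot (fibat (E := V) (unt (src g)) (inv S)) = inv S by rewrite fibatK //= (inv_mul gG) (inv_unt gG).
have s0 : vsrc V (fibat (E := V) (unt (src g)) (inv S)) = 0.
  apply: (@Tot_eq0 R _ (vb0 V) _ (tgt (inv g))).
  have [_ _ tSE] := mk_mul_ends hL mth m.
  by rewrite -[LHS]/(src (Tot (fibat (E := V) (unt (src g)) (inv S)) : ar TK)) cK (MK_src_inv hL) tSE MK_zero_tgt.
have [c cE] := core_intro s0; exists c; apply: Tot_inj.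
apply: (mk_mul_fun hL (left_shift_mul c)).
rewrite cE cK (MK_inv_inv hL mth).
have := mk_mul_cancell hL mth m.
rewrite MK_zero_inv; have -> // : Tot (0 : V (inv (inv g))) = Tot (0 : V g) by apply: (@Tot0 R (ar G) V); rewrite (inv_inv gG).
Qed.

Lemma right_shift_surj g (q : V g) : vsrc V q = 0 -> exists c, right_shift c = q.
Proof.
move=> sq; pose Z : ar TK := Tot (0 : V (inv g)).
have e : src (Tot q : ar TK) = tgt Z.
  by rewrite MK_zero_tgt /= -[LHS]/(Tot (vsrc V q)) sq; apply: (@Tot0 R (ob G) (vb0 V)); rewrite (tgt_inv gG).
have m := mk_mul_mul hL e; set S := mul _ Z in m.
have cK : Tot (fibat (E := V) (unt (tgt g)) S) = S by rewrite fibatK //= (mul_inv gG).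
have s0 : vsrc V (fibat (E := V) (unt (tgt g)) S) = 0.
  apply: (@Tot_eq0 R _ (vb0 V) _ (src (inv g))).
  have [_ sSE _] := mk_mul_ends hL mth m.
  by rewrite -[LHS]/(src (Tot (fibat (E := V) (unt (tgt g)) S) : ar TK)) cK sSE MK_zero_src.
have [c cE] := core_intro s0; exists c; apply: Tot_inj.
apply: (mk_mul_fun hL (right_shift_mul c)).
rewrite cE cK; have := mk_mul_cancelr hL mth m.
rewrite MK_zero_inv; have -> // : Tot (0 : V (inv (inv g))) = Tot (0 : V g) by apply: (@Tot0 R (ar G) V); rewrite (inv_inv gG).
Qed.

Lemma dual_srcE g (psi : dual L V g) (c : core V (src g)) :
  sublv (vsrc (dual L V) psi) c = - vsrc L (sublv psi (left_shift c)).
Proof.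
rewrite /= /dual_src mkhomE // => a u v.
rewrite -!/(left_shift _) left_shift_lin homP (vsrc_lin hL) opprD scalerN //.
Qed.

Lemma dual_tgtE g (psi : dual L V g) (c : core V (tgt g)) :
  sublv (vtgt (dual L V) psi) c = vtgt L (sublv psi (right_shift c)).
Proof.
rewrite /= /dual_tgt mkhomE // => a u v.
by rewrite -!/(right_shift _) right_shift_lin homP (vtgt_lin hL).
Qed.
End Kernels.

(** * The Morita curvature as a VBG morphism *)

Lemma sublv_hom_lin (K : comPzRingType) (U W : lmodType K) (f g : hom U W) a u :
  sublv (a *: f + g) u = a *: sublv f u + sublv g u.
Proof. by []. Qed.

Section CurvatureMorphism.
Context (R : realType) (G : groupoid R) (L : vbg G).
Hypothesis hL : is_line_groupoid L.
Context (nabla : conn (vb0 L)) (cN : is_connection nabla).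
Context (th : form1 L) (fth : is_form1 th) (mth : multiplicative th).
Context (ka : form2 (vb0 L)) (fka : is_form2 ka).
Let lG := line_lie hL.
Let gG := lie_groupoid lG.
Let lL := line_tot_lie hL.
Let gL := lie_groupoid lL.
Let V := MK th.
Let TK := tot_groupoid V.
Let Om g (p q : V g) : L g := pairing nabla ka p q.

Lemma pairing_Tot g h (p p' : V g) (q q' : V h) : Tot p = Tot q -> Tot p' = Tot q' ->
  Tot (Om p p') = Tot (Om q q').
Proof.
move=> H; have e : g = h by exact: (congr1 (fun q : tot V => tag q) H).
by case: _ / e q q' H => q q' /Tot_inj -> /Tot_inj ->.
Qed.

(** [pairing_mul] moved to the relation [mk_mul]: two factorizations over the same pair of arrows
    come from tangent vectors at the same composable pair. *)
Lemma pairing_mk_mul g h k (p p' : V g) (q q' : V h) (r r' : V k) a la b lb :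
  mk_mul (Tot p : ar TK) (Tot q : ar TK) (Tot r : ar TK) ->
  mk_mul (Tot p' : ar TK) (Tot q' : ar TK) (Tot r' : ar TK) ->
  frame_at (tgt g) a la -> frame_at (src g) b lb ->
  tcoord la (Om r r') = tcoord la (Om p p') + frame_ratio la b g * tcoord lb (Om q q').
Proof.
move=> [[[P z] [z1 z2 z3]] c1 c2] [[[P' z'] [z1' z2' z3']] c1' c2'].
have PP : P = P'.
  apply: comp_eq.
    exact: (etrans (congr1 (fun q : tot (TB (ar G)) => tag q) z1) (esym (congr1 (fun q : tot (TB (ar G)) => tag q) z1'))).
  exact: (etrans (congr1 (fun q : tot (TB (ar G)) => tag q) z2) (esym (congr1 (fun q : tot (TB (ar G)) => tag q) z2'))).
case: _ / PP z' z1' z2' z3' => z' z1' z2' z3'.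
have e1 : comp1 P = g by exact: (congr1 (fun q : tot (TB (ar G)) => tag q) z1).
have e2 : comp2 P = h by exact: (congr1 (fun q : tot (TB (ar G)) => tag q) z2).
have e3 : compm P = k by exact: (congr1 (fun q : tot (TB (ar G)) => tag q) z3).
case: _ / e1 p p' z1 z1' c1 c1' => p p' z1 z1' c1 c1'.
case: _ / e2 q q' z2 z2' c1 c1' c2 c2' => q q' z2 z2' c1 c1' c2 c2'.
case: _ / e3 r r' z3 z3' c2 c2' => r r' z3 z3' c2 c2' fa fb.
have {}z1 := Tot_inj z1; have {}z2 := Tot_inj z2; have {}z3 := Tot_inj z3.
have {}z1' := Tot_inj z1'; have {}z2' := Tot_inj z2'; have {}z3' := Tot_inj z3'.
case: p q r p' q' r' z1 z2 z3 z1' z2' z3' c1 c2 c1' c2' => [p l] [q m] [r n] [p' l'] [q' m'] [r' n'] /=.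
rewrite /MKs /MKt /= => <- <- <- <- <- <- c1 c2 c1' c2'.
exact: (@pairing_mul R G L hL nabla cN th fth mth ka P z z' l l' m m' n n' a la b lb fa fb c1 c1' c2 c2').
Qed.

Lemma Om_lin g (p : V g) : linear (Om p).
Proof. exact: (pairing_lin hL cN fth fka p). Qed.

Lemma Om_anti g (p q : V g) : Om p q = - Om q p.
Proof. exact: (pairing_anti hL cN fth fka). Qed.

Lemma Om_linl g (q : V g) : linear (fun p => Om p q).
Proof. by move=> a u v; rewrite Om_anti Om_lin opprD -scalerN -!Om_anti. Qed.

Lemma MR_arE g (p q : V g) : sublv (MR_ar nabla ka p) q = Om p q.
Proof. by rewrite /MR_ar mkhomE //; exact: Om_lin. Qed.

(** Write [p] as [p] times the unit at its source, and the left shift as zero times an inverted core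
    element. Multiplicativity leaves only the pairing of the second factors. *)
Lemma Om_left_shift g (p : V g) (c : core V (src g)) (k : V (unt (src g))) :
  Tot k = inv (Tot (sublv c) : ar TK) ->
  Tot (vsrc L (Om p (left_shift c))) = Tot (vtgt L (Om (vunt V (vsrc V p)) k)).
Proof.
move=> kE; have m := left_shift_mul hL mth c.
have [a [la fa]] := frame_at_exists hL (tgt g); have [b [lb fb]] := frame_at_exists hL (src g).
have m1 : mk_mul (Tot (0 : V g) : ar TK) (Tot k : ar TK) (Tot (left_shift c) : ar TK) by rewrite kE.
have := pairing_mk_mul (mk_mul_unitr hL mth (Tot p : ar TK)) m1 fa fb.
rewrite (lin_0 (Om_lin p)) (tcoord0 hL fa) add0r (tcoord_src hL _ fa fb).
move=> /(mulfI (ratio_neq0 hL fa fb)) H.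
by apply: (frame_Tot _ fb); [rewrite (tgt_unt gG)|exact: H].
Qed.

Lemma Om_right_shift g (p : V g) (c : core V (tgt g)) :
  Tot (vtgt L (Om p (right_shift c))) = Tot (vtgt L (Om (vunt V (vtgt V p)) (sublv c))).
Proof.
have m := right_shift_mul hL fth c.
have [a [la fa]] := frame_at_exists hL (tgt g).
have fa1 : frame_at (tgt (unt (tgt g))) a la by rewrite (tgt_unt gG).
have fa2 : frame_at (src (unt (tgt g))) a la by rewrite (src_unt gG).
have := pairing_mk_mul (mk_mul_unitl hL (Tot p : ar TK)) m fa1 fa2.
rewrite (lin_0 (Om_lin p)) (tcoord0 hL fa) mulr0 addr0 => H.
by apply: (frame_Tot _ fa); [rewrite (tgt_unt gG)|exact: H].
Qed.

(** Unit vectors are idempotent and the frame ratio at a unit is 1, so the pairing equals twice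
    itself. *)
Lemma Om_unt x (A B : vb0 V x) : Om (vunt V A) (vunt V B) = 0.
Proof.
have mu (D : vb0 V x) : mk_mul (Tot (vunt V D) : ar TK) (Tot (vunt V D) : ar TK) (Tot (vunt V D) : ar TK).
  have := mk_mul_unitr hL mth (Tot (vunt V D) : ar TK).
  have -> // : unt (src (Tot (vunt V D) : ar TK)) = Tot (vunt V D).
  exact: (congr1 (@unt R TK) (MK_src_unt hL (Tot D : ob TK))).
have [a [la fa]] := frame_at_exists hL x.
have fa1 : frame_at (tgt (unt x)) a la by rewrite (tgt_unt gG).
have fa2 : frame_at (src (unt x)) a la by rewrite (src_unt gG).
have := pairing_mk_mul (mu A) (mu B) fa1 fa2; rewrite (unt_ratio hL fa) mul1r => H.
apply: (tcoord_inj hL fa1); rewrite (tcoord0 hL fa).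
by apply/eqP; rewrite -(addrK (tcoord la (Om (vunt V A) (vunt V B))) (tcoord la (Om (vunt V A) (vunt V B)))) -H subrr.
Qed.

(** A unit vector is its own square, and a core element times its inverse is a unit vector; the two
    pairings therefore add up to the one of units, which is 0. This explains the sign in the source
    of the dual. *)
Lemma Om_core_inv x (A : vb0 V x) (c : core V x) (k : V (unt x)) : Tot k = inv (Tot (sublv c) : ar TK) ->
  Om (vunt V A) (sublv c) = - Om (vunt V A) k.
Proof.
move=> kE.
have mu : mk_mul (Tot (vunt V A) : ar TK) (Tot (vunt V A) : ar TK) (Tot (vunt V A) : ar TK).
  have := mk_mul_unitr hL mth (Tot (vunt V A) : ar TK).
  have -> // : unt (src (Tot (vunt V A) : ar TK)) = Tot (vunt V A).
  exact: (congr1 (@unt R TK) (MK_src_unt hL (Tot A : ob TK))).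
have m := mk_mul_invr hL mth (Tot (sublv c) : ar TK); rewrite -kE in m.
have [a [la fa]] := frame_at_exists hL x.
have fa1 : frame_at (tgt (unt x)) a la by rewrite (tgt_unt gG).
have fa2 : frame_at (src (unt x)) a la by rewrite (src_unt gG).
have e : tgt (Tot (sublv c) : ar TK) = Tot (fibat (E := vb0 V) x (tgt (Tot (sublv c) : ar TK))).
  by rewrite fibatK //= (tgt_unt gG).
rewrite e in m.
have := pairing_mk_mul mu m fa1 fa2; rewrite (unt_ratio hL fa) mul1r Om_unt (tcoord0 hL fa) => H.
apply: (tcoord_inj hL fa1); rewrite (tcoordN hL fa); apply/eqP.
by rewrite -addr_eq0 -H.
Qed.

Lemma core_inv_exists x (c : core V x) : exists k : V (unt x), Tot k = inv (Tot (sublv c) : ar TK).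
Proof. by exists (fibat (unt x) (inv (Tot (sublv c) : ar TK))); rewrite fibatK //= (inv_unt gG). Qed.

Lemma Tot_opp (B : space R) (E : bundle B) (x y : B) (u : E x) (v : E y) : Tot u = Tot v -> Tot (- u) = Tot (- v).
Proof.
move=> H; have e : x = y by exact: (congr1 (fun q : tot E => tag q) H).
by case: _ / e v H => v /Tot_inj ->.
Qed.

Lemma fibat_hom x y (psi : vb0 (dual L V) y) (c : core V x) (d : core V y) : y = x -> Tot c = Tot d ->
  Tot (sublv (fibat (E := vb0 (dual L V)) x (Tot psi)) c) = Tot (sublv psi d).
Proof. by move=> e; case: _ / e c d => c d /Tot_inj ->; rewrite fibatE. Qed.

(** The definition goes through the source of a dual element over [src (unt x)]. Moving to the base
    point [x] and cancelling the two signs gives a formula shared by the source and the target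
    computations. *)
Lemma MR_obE x (A : vb0 V x) (c : core V x) :
  sublv (MR_ob nabla ka A) c = fibat x (Tot (vtgt L (Om (vunt V A) (sublv c)))).
Proof.
apply: Tot_inj; rewrite fibatK; last by rewrite /= (tgt_unt gG).
have e : src (unt x) = x by rewrite (src_unt gG).
pose d : core V (src (unt x)) := fibat (src (unt x)) (Tot c).
have dc : Tot d = Tot c by rewrite fibatK.
have -> : Tot (sublv (MR_ob nabla ka A) c) = Tot (sublv (vsrc (dual L V) (MR_ar nabla ka (vunt V A))) d).
  exact: fibat_hom e (esym dc).
rewrite (dual_srcE hL fth mth) MR_arE.
have [k kE] := core_inv_exists c; have [k' kE'] := core_inv_exists d.
have sd : Tot (sublv d) = Tot (sublv c).
  exact: (congr1 (fun q : tot (core V) => Tot (sublv (tagged q))) dc).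
rewrite (Om_core_inv A kE) (lin_N (vtgt_lin hL _)); apply: Tot_opp.
rewrite (Om_left_shift _ kE').
have E1 : Tot (vunt V (vsrc V (vunt V A))) = Tot (vunt V A).
  exact: (congr1 (@unt R TK) (MK_src_unt hL (Tot A : ob TK))).
have E2 : Tot k' = Tot k by rewrite kE' kE; exact: (congr1 (@inv R TK) sd).
exact: (congr1 (fun q : tot L => Tot (vtgt L (tagged q))) (pairing_Tot E1 E2)).
Qed.

Lemma MR_src g (p : V g) : vsrc (dual L V) (MR_ar nabla ka p) = MR_ob nabla ka (vsrc V p).
Proof.
apply: hom_eq => c; rewrite (dual_srcE hL fth mth) MR_arE MR_obE.
have [k kE] := core_inv_exists c.
apply: Tot_inj; rewrite fibatK; last by rewrite /= (tgt_unt gG).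
rewrite (Om_core_inv _ kE) (lin_N (vtgt_lin hL _)); apply: Tot_opp.
exact: Om_left_shift.
Qed.

Lemma MR_tgt g (p : V g) : vtgt (dual L V) (MR_ar nabla ka p) = MR_ob nabla ka (vtgt V p).
Proof.
apply: hom_eq => c; rewrite (dual_tgtE hL fth) MR_arE MR_obE.
apply: Tot_inj; rewrite fibatK; last by rewrite /= (tgt_unt gG).
exact: Om_right_shift.
Qed.

Lemma pr_coreE x (v : V (unt x)) (B : vb0 V x) : Tot B = src (Tot v : ar TK) ->
  sublv (pr_core v) = v - vunt V B.
Proof.
move=> BE; rewrite /pr_core.
have -> : fibat (E := V) (unt x) (Tot (vunt V (vsrc V v))) = vunt V B.
  apply: Tot_inj; rewrite fibatK /=; last by rewrite (src_unt gG).
  by rewrite -[LHS]/(unt (src (Tot v : ar TK))) -BE.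
rewrite -[sublv _]/(val _) insubdK //; apply/asboolP => S _; apply => /=.
rewrite -[LHS]/(vsrc V (v - vunt V B)) (lin_B (MK_vsrc_lin hL (th := th) (g := unt x))).
apply/eqP; rewrite subr_eq0; apply/eqP; apply: (@Tot_inj R (ob G) (vb0 V)).
exact: (etrans (esym BE) (esym (MK_src_unt hL (Tot B : ob TK)))).
Qed.

Lemma MR_unt x (A : vb0 V x) : MR_ar nabla ka (vunt V A) = vunt (dual L V) (MR_ob nabla ka A).
Proof.
have src0 (v : V (unt x)) : exists B : vb0 V x, Tot B = src (Tot v : ar TK).
  by exists (fibat x (src (Tot v : ar TK))); rewrite fibatK //= (src_unt gG).
have E : (fun v : V (unt x) => vunt L (sublv (MR_ob nabla ka A) (pr_core v))) = Om (vunt V A).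
  apply: boolp.funext => v; have [B BE] := src0 v.
  apply: (vtgt_inj hL); apply: Tot_inj.
  rewrite -[LHS]/(tgt (unt (Tot (sublv (MR_ob nabla ka A) (pr_core v)) : ob (tot_groupoid L)))) (tgt_unt gL).
  rewrite MR_obE fibatK; last by rewrite /= (tgt_unt gG).
  by rewrite (pr_coreE BE) (lin_B (Om_lin _)) Om_unt subr0.
apply: hom_eq => v; rewrite MR_arE /= /dual_unt.
by rewrite E mkhomE //; exact: Om_lin.
Qed.

(** Since the source is fibrewise onto, choose [w] over [h] with the source of [u]; then [v] is [u]
    times the inverse of [w]. *)
Lemma MK_decompose g h (u : V (mul g h)) : src g = tgt h -> exists (v : V g) (w : V h),
  mk_mul (Tot v : ar TK) (Tot w : ar TK) (Tot u : ar TK).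
Proof.
move=> e; have es : src (mul g h) = src h by exact: (src_mul gG e).
have [w wE] : exists w : V h, src (Tot w : ar TK) = src (Tot u : ar TK).
  pose B : vb0 V (src h) := fibat (src h) (src (Tot u : ar TK)).
  have BE : Tot B = src (Tot u : ar TK) by rewrite fibatK.
  have [_ /(_ h B.1)[v vE]] := src_submersion lG.
  exists (v, sinv L h (Tot B.2)); rewrite -BE; apply: sum_Tot_eq => /=; first by rewrite vE.
  by rewrite (sinvK hL).
have e2 : src (Tot u : ar TK) = tgt (inv (Tot w : ar TK)) by rewrite (MK_tgt_inv hL mth).
have m := mk_mul_mul hL e2; set S := mul (Tot u : ar TK) _ in m.
have SE : Tot (fibat (E := V) g S) = S by rewrite fibatK //=; exact: (mulK gG e).
exists (fibat g S), w; rewrite SE.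
by have := mk_mul_cancelr hL mth m; rewrite (MK_inv_inv hL mth).
Qed.

(** The product of dual elements is computed from some factorization of [u]. By multiplicativity of
    the pairing every factorization yields the same value, and one exists by [MK_decompose]. *)
Lemma MR_mul g h (p : V g) (q : V h) : vcomposable p q ->
  MR_ar nabla ka (vmul V p q) = vmul (dual L V) (MR_ar nabla ka p) (MR_ar nabla ka q).
Proof.
move=> c; have m := mk_mul_mul hL (c : src (Tot p : ar TK) = tgt (Tot q : ar TK)).
have e : src g = tgt h by exact: (congr1 (fun q : tot (vb0 V) => tag q) c).
have es : src (mul g h) = src h by exact: (src_mul gG e).
have et : tgt (mul g h) = tgt g by exact: (tgt_mul gG e).
apply: hom_eq => u; rewrite MR_arE /= /dual_mul.
set f := (fun u0 : V (mul g h) => _); have -> : f = Om (vmul V p q); last first.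
  by rewrite mkhomE //; exact: Om_lin.
apply: boolp.funext => {}u; rewrite /f; set P := [set _ | _].
have key (v : V g) (w : V h) : mk_mul (Tot v : ar TK) (Tot w : ar TK) (Tot u : ar TK) ->
    sinv L (mul g h) (Tot (fibat (src h) (Tot (act (inv h) (Tot (vsrc L (sublv (MR_ar nabla ka p) v)))))
                    + vsrc L (sublv (MR_ar nabla ka q) w))) = Om (vmul V p q) u.
  move=> m'; rewrite !MR_arE; apply: (vsrc_inj hL); apply: Tot_inj; rewrite (sinvK hL); last exact: (esym es).
  have [a [la fa]] := frame_at_exists hL (tgt g); have [b [lb fb]] := frame_at_exists hL (src g).
  have fb2 : frame_at (tgt h) b lb by rewrite -e.
  have [d [ld fd]] := frame_at_exists hL (src h).
  have r1 := ratio_neq0 hL fa fb; have r2 := ratio_neq0 hL fb2 fd.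
  have [nu nuE] : exists nu : L h, Tot (vtgt L nu) = Tot (vsrc L (Om p v)).
    exists (finv (@vtgt R G L h) (fibat (tgt h) (Tot (vsrc L (Om p v))))).
    by rewrite (iso_finvP (line_vb hL) (line_vb0 hL) (vtgt_lin hL) (vtgt_inj hL)) fibatK.
  have actE : Tot (fibat (src h) (Tot (act (inv h) (Tot (vsrc L (Om p v)))))) = Tot (vsrc L nu).
    rewrite fibatK /=; last by rewrite (tgt_inv gG).
    rewrite -nuE /act; have -> : sinv L (inv h) (Tot (vtgt L nu)) = vinv L nu.
      apply: (vsrc_inj hL); apply: Tot_inj; rewrite (sinvK hL) /= ?(src_inv gG) //.
      exact/esym/(src_inv gL (Tot nu)).
    exact: (tgt_inv gL (Tot nu)).
  set ac := fibat _ _ in actE *; have {}actE := Tot_inj actE; rewrite actE.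
  apply: (frame_Tot _ fd) => //.
  have H : tcoord la (Om (vmul V p q) u) = tcoord la (Om p v) + frame_ratio la b g * tcoord lb (Om q w).
    exact: (pairing_mk_mul m m' fa fb).
  pose pp : comp G := exist _ (g, h) e.
  have lamE : Tot (vsrc L (sinv L h (Tot (vsrc L (Om (vmul V p q) u))))) = Tot (vsrc L (Om (vmul V p q) u)) by exact: (sinvK hL).
  have H2 : tcoord la (Om (vmul V p q) u) = frame_ratio la b g * tcoord lb (sinv L h (Tot (vsrc L (Om (vmul V p q) u)))).
    exact: (@tcoord_mul R G L hL pp (Om (vmul V p q) u) _ a la b lb fa fb (esym lamE)).
  rewrite H2 (tcoord_src hL _ fb2 fd) lamE in H.
  rewrite (tcoord_src hL (Om p v) fa fb) -nuE -/(tcoord lb nu) (tcoord_src hL nu fb2 fd) (tcoord_src hL (Om q w) fb2 fd) in H.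
  move: H; rewrite -!mulrDr => /(mulfI r1)/(mulfI r2) ->.
  by have := frame_at_lin fd 1 (vsrc L nu) (vsrc L (Om q w)); rewrite scale1r mul1r.
have : P (xget 0 P).
  have [v [w m']] := MK_decompose u e.
  apply: (xgetPex 0); eexists; exists v, w; split; last by [].
    by have [H _ _] := mk_mul_ends hL mth m'.
  by have := mk_mulE hL mth m' => /Tot_inj <-.
case=> v [w [cv uE ->]]; apply: key.
by rewrite -uE; exact: (mk_mul_mul hL (cv : src (Tot v : ar TK) = tgt (Tot w : ar TK))).
Qed.

Lemma MR_ar_lin g : linear (@MR_ar R G L nabla th ka g).
Proof.
by move=> a p q; apply: hom_eq => u; rewrite sublv_hom_lin !MR_arE Om_linl.
Qed.

Lemma MR_ob_lin x : linear (@MR_ob R G L nabla th ka x).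
Proof.
move=> a p q.
have HA := fun u => MR_obE (a *: p + q) u.
have HB := fun u => MR_obE p u.
have HC := fun u => MR_obE q u.
have gen (w : V (unt x)) (u : core V x) : w = a *: (vunt V p : V (unt x)) + vunt V q ->
  fibat x (Tot (vtgt L (Om w (sublv u)))) =
  a *: fibat x (Tot (vtgt L (Om (vunt V p) (sublv u)))) + fibat x (Tot (vtgt L (Om (vunt V q) (sublv u)))).
  move=> ->; apply: Tot_inj.
  rewrite fibatK; last by rewrite /= (tgt_unt gG).
  rewrite Om_linl (vtgt_lin hL).
  by apply: Tot_lin; rewrite fibatK //= (tgt_unt gG).
apply: hom_eq => u.
refine (etrans (HA u) _).
refine (etrans (gen _ u (MK_vunt_lin hL a p q)) _).
rewrite -HB -HC.
reflexivity.
Qed.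
End CurvatureMorphism.

Section SumBundle.
Context (R : realType) (B : space R) (E E' : bundle B) (X : space R) (p : X).

Lemma smooth_sum_at (Q : X -> tot (sum_bundle E E')) :
  smooth_map_at p (fun q => Tot (tagged (Q q)).1) -> smooth_map_at p (fun q => Tot (tagged (Q q)).2) ->
  smooth_map_at p Q.
Proof.
move=> s1 s2; apply/smooth_map_atP => _ [] [f tf ->].
  exact: (s1 _ (smoothf_gen (X := tot E) tf _)).
exact: (s2 _ (smoothf_gen (X := tot E') tf _)).
Qed.

Lemma smooth_sum_at1 (Q : X -> tot (sum_bundle E E')) :
  smooth_map_at p Q -> smooth_map_at p (fun q => Tot (tagged (Q q)).1).
Proof.
move=> s; apply/smooth_map_atP => f gf; apply: (s (fun q : tot (sum_bundle E E') => f (Tot (tagged q).1))).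
by apply: (@smoothf_gen R (tot (sum_bundle E E'))); left; exists f.
Qed.

Lemma smooth_sum_at2 (Q : X -> tot (sum_bundle E E')) :
  smooth_map_at p Q -> smooth_map_at p (fun q => Tot (tagged (Q q)).2).
Proof.
move=> s; apply/smooth_map_atP => f gf; apply: (s (fun q : tot (sum_bundle E E') => f (Tot (tagged q).2))).
by apply: (@smoothf_gen R (tot (sum_bundle E E'))); right; exists f.
Qed.
End SumBundle.

(** * Smoothness of the Morita curvature *)

Section CurvatureSmooth.
Context (R : realType) (G : groupoid R) (L : vbg G).
Hypothesis hL : is_line_groupoid L.
Context (nabla : conn (vb0 L)) (cN : is_connection nabla).
Context (th : form1 L) (fth : is_form1 th) (mth : multiplicative th).
Context (ka : form2 (vb0 L)) (fka : is_form2 ka).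
Let lG := line_lie hL.
Let gG := lie_groupoid lG.
Let lL := line_tot_lie hL.
Let V := MK th.

Lemma MK_tag_smooth : smooth (fun q : tot V => tag q : ar G).
Proof.
apply/smoothP => q; have s := smooth_sum_at1 (fun f (sf : smooth_at (q : tot V) f) => sf : smooth_at q (f \o id)).
exact: (smooth_map_at_comp s (proj1 (smoothP _) (@smooth_tag_TB R (ar G)) _)).
Qed.

Lemma MK0_tag_smooth : smooth (fun q : tot (vb0 V) => tag q : ob G).
Proof.
apply/smoothP => q; have s := smooth_sum_at1 (fun f (sf : smooth_at (q : tot (vb0 V)) f) => sf : smooth_at q (f \o id)).
exact: (smooth_map_at_comp s (proj1 (smoothP _) (@smooth_tag_TB R (ob G)) _)).
Qed.

(** Frames and local form chosen at [f p] remain valid at nearby points, so the coordinate of the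
    pairing is given there by one and the same visibly smooth expression [D]. *)
Lemma smooth_pairing_at (X : space R) (p : X) (f : X -> ar G) (u w : forall x, V (f x)) :
  smooth_map_at p (fun q => Tot (u q) : tot V) -> smooth_map_at p (fun q => Tot (w q) : tot V) ->
  smooth_map_at p (fun q => Tot (pairing nabla ka (u q) (w q))).
Proof.
move=> su sw.
have sf : smooth_map_at p f by exact: (smooth_map_at_comp su (proj1 (smoothP _) MK_tag_smooth _)).
have su1 := smooth_sum_at1 su; have su2 := smooth_sum_at2 su.
have sw1 := smooth_sum_at1 sw; have sw2 := smooth_sum_at2 sw.
have [a [la fa]] := frame_at_exists hL (tgt (f p)); have [b [lb fb]] := frame_at_exists hL (src (f p)).
have [n [c [Y lo]]] := local_form_exists hL fth fa.
have [W [fr Wx]] := fa.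
have fr' := pull_frame (line_vb hL) (line_vb0 hL) (vtgt_smooth hL) (vtgt_lin hL) (vtgt_inj hL) fr.
apply: (frame_smooth fr') => /=; [exact: nbhs_singleton Wx|exact: sf|].
have [sc sY Hlo] := lo.
have sdv (v : forall x, tangent (f x)) g : smooth_map_at p (fun q => @Tot R _ (TB (ar G)) (f q) (v q)) -> smoothf g ->
    smooth_at p (fun q => dv (v q) g) by move=> sv sg; exact: (sv _ (smooth_dv sg _)).
have sT (v : forall x, tangent (f x)) : smooth_map_at p (fun q => @Tot R _ (TB (ar G)) (f q) (v q)) ->
    smooth_map_at p (fun q => @Tot R _ (TB (ob G)) (tgt (f q)) (dmap (@tgt R G) (v q))).
  by move=> sv; exact: (smooth_at_Tmap (tgt_smooth lG) sv).
have sS (v : forall x, tangent (f x)) : smooth_map_at p (fun q => @Tot R _ (TB (ar G)) (f q) (v q)) ->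
    smooth_map_at p (fun q => @Tot R _ (TB (ob G)) (src (f q)) (dmap (@src R G) (v q))).
  by move=> sv; exact: (smooth_at_Tmap (src_smooth lG) sv).
have sct (v : forall x, tangent (f x)) : smooth_map_at p (fun q => @Tot R _ (TB (ar G)) (f q) (v q)) ->
    smooth_at p (fun q => conn_coef nabla a la (dmap (@tgt R G) (v q))).
  move=> sv; have := conn_smooth_at (ob_manifold lG) (line_vb0 hL) cN (frame_at_section fa) (sT _ sv).
  by move=> /(_ la (frame_at_coord fa _)).
have scs (v : forall x, tangent (f x)) : smooth_map_at p (fun q => @Tot R _ (TB (ar G)) (f q) (v q)) ->
    smooth_at p (fun q => conn_coef nabla b lb (dmap (@src R G) (v q))).
  move=> sv; have := conn_smooth_at (ob_manifold lG) (line_vb0 hL) cN (frame_at_section fb) (sS _ sv).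
  by move=> /(_ lb (frame_at_coord fb _)).
have sth (v : forall x, tangent (f x)) : smooth_map_at p (fun q => @Tot R _ (TB (ar G)) (f q) (v q)) ->
    smooth_at p (fun q => tcoord la (th (v q))).
  by move=> sv; have := form1_smooth_at fth sv; move=> /(_ _ (smooth_tcoord hL fa _)).
have stc (l : forall x, L (f x)) : smooth_map_at p (fun q => Tot (l q)) -> smooth_at p (fun q => tcoord la (l q)).
  by move=> sl; exact: (sl _ (smooth_tcoord hL fa _)).
have sr : smooth_at p (fun q => frame_ratio la b (f q)) by exact: (sf _ (smooth_ratio hL fa fb _)).
have r0 := ratio_neq0 hL fa fb.
have seta (v : forall x, tangent (f x)) : smooth_map_at p (fun q => @Tot R _ (TB (ar G)) (f q) (v q)) ->
    smooth_at p (fun q => conn_coef nabla b lb (dmap (@src R G) (v q)) - conn_coef nabla a la (dmap (@tgt R G) (v q))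
      - dv (v q) (frame_ratio la b) / frame_ratio la b (f q)).
  move=> sv; apply: smooth_atB; first by apply: smooth_atB; [exact: scs|exact: sct].
  apply: smooth_atM; last exact: smooth_atV.
  by apply: sdv => //; exact: (smooth_ratio hL fa fb).
have [_ _ _ /smoothP sk] := fka.
have skt : smooth_at p (fun q => la (Tot (ka (dmap (@tgt R G) (u q).1) (dmap (@tgt R G) (w q).1)))).
  have s := @smooth_sum_at R (ob G) (TB (ob G)) (TB (ob G)) X p
     (fun q => @Tot R _ (sum_bundle (TB (ob G)) (TB (ob G))) (tgt (f q)) (dmap (@tgt R G) (u q).1, dmap (@tgt R G) (w q).1))
     (sT _ su1) (sT _ sw1).
  exact: (smooth_map_at_comp s (sk _) (frame_at_coord fa _)).
have sks : smooth_at p (fun q => lb (Tot (ka (dmap (@src R G) (u q).1) (dmap (@src R G) (w q).1)))).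
  have s := @smooth_sum_at R (ob G) (TB (ob G)) (TB (ob G)) X p
     (fun q => @Tot R _ (sum_bundle (TB (ob G)) (TB (ob G))) (src (f q)) (dmap (@src R G) (u q).1, dmap (@src R G) (w q).1))
     (sS _ su1) (sS _ sw1).
  exact: (smooth_map_at_comp s (sk _) (frame_at_coord fb _)).
pose D q := (\sum_i (dv (u q).1 (c i) * dv (w q).1 (Y i) - dv (w q).1 (c i) * dv (u q).1 (Y i)) +
    (conn_coef nabla a la (dmap (@tgt R G) (u q).1) * tcoord la (th (w q).1) -
     conn_coef nabla a la (dmap (@tgt R G) (w q).1) * tcoord la (th (u q).1))) +
   (frame_ratio la b (f q) * lb (Tot (ka (dmap (@src R G) (u q).1) (dmap (@src R G) (w q).1))) -
     la (Tot (ka (dmap (@tgt R G) (u q).1) (dmap (@tgt R G) (w q).1)))) +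
   (conn_coef nabla b lb (dmap (@src R G) (w q).1) - conn_coef nabla a la (dmap (@tgt R G) (w q).1)
      - dv (w q).1 (frame_ratio la b) / frame_ratio la b (f q)) * tcoord la (u q).2 -
   (conn_coef nabla b lb (dmap (@src R G) (u q).1) - conn_coef nabla a la (dmap (@tgt R G) (u q).1)
      - dv (u q).1 (frame_ratio la b) / frame_ratio la b (f q)) * tcoord la (w q).2.
apply: (smooth_at_ext (f := D)).
  have nlo : \forall k \near (f p : ar G), local_form th k la c Y by apply: filterS (near_join Hlo) => k Hk; split.
  have nt := near_smooth sf (near_tgt hL fa); have ns := near_smooth sf (near_src hL fb).
  apply: filterS2 (filterI nt ns) (near_smooth sf nlo) => q [ft fs] lq.
  rewrite -[RHS]/(tcoord la (pairing nabla ka (u q) (w q))) (pairing_coord hL nabla ka _ _ ft).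
  by rewrite (dconn_coord hL cN fth _ _ ft lq) (partial2_coord hL ka _ _ ft fs) !(etaE hL cN _ ft fs).
apply: smooth_atB; last by apply: smooth_atM; [exact: seta|exact: stc].
apply: smooth_atD; last by apply: smooth_atM; [exact: seta|exact: stc].
apply: smooth_atD; last by apply: smooth_atB => //; exact: smooth_atM.
apply: smooth_atD; last by apply: smooth_atB; apply: smooth_atM; [exact: sct|exact: sth|exact: sct|exact: sth].
by apply: smooth_at_sum => i _; apply: smooth_atB; apply: smooth_atM; exact: sdv.
Qed.

Lemma MR_ar_smooth : smooth (fun q : tot V => Tot (MR_ar nabla ka (tagged q)) : tot (dual L V)).
Proof.
apply/smoothP => q; apply/smooth_map_atP => h [] [].
  by move=> f sf ->; exact: (MK_tag_smooth sf).
move=> X [l [sX sl ->]].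
have s : smooth_map_at q (fun q : tot V => Tot (pairing nabla ka (tagged q) (X (tag q)))).
  apply: (@smooth_pairing_at (tot V) q (fun q => tag q) (fun q => tagged q) (fun q => X (tag q))).
    by move=> f; case: q => ? ?; apply: smooth_at_ext; apply: near_all => -[].
  by move: q; apply/smoothP; exact: smooth_comp MK_tag_smooth sX.
apply: smooth_at_ext (s _ (sl _)); apply: near_all => r /=.
by rewrite -(MR_arE hL cN fth fka).
Qed.

Lemma MR_ob_smooth : smooth (fun q : tot (vb0 V) => Tot (MR_ob nabla ka (tagged q)) : tot (vb0 (dual L V))).
Proof.
apply/smoothP => q; apply/smooth_map_atP => h [] [].
  by move=> f sf ->; exact: (MK0_tag_smooth sf).
move=> X [l [sX sl ->]].
have sid : smooth_map_at q (fun r : tot (vb0 V) => r) by move=> f.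
have s1 := smooth_sum_at1 sid; have s2 := smooth_sum_at2 sid.
have stag : smooth_map_at q (fun r : tot (vb0 V) => tag r : ob G) by move/smoothP: MK0_tag_smooth; exact.
have su : smooth_map_at q (fun r : tot (vb0 V) => Tot (vunt V (tagged r)) : tot V).
  apply: smooth_sum_at => /=; first exact: (smooth_at_Tmap (unt_smooth lG) s1).
  exact: (smooth_map_at_comp s2 (proj1 (smoothP _) (unt_smooth lL) _)).
have sw : smooth_map_at q (fun r : tot (vb0 V) => Tot (sublv (X (tag r))) : tot V).
  apply/smooth_map_atP => h' gh; apply: (stag (fun x => h' (Tot (sublv (X x))))).
  apply: (sX (fun c : tot (core V) => h' (Tot (sublv (tagged c))))).
  by apply: (@smoothf_gen R (tot (core V))); exists h'.
have s := @smooth_pairing_at (tot (vb0 V)) q (fun r => unt (tag r)) (fun r => vunt V (tagged r)) (fun r => sublv (X (tag r))) su sw.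
have s' := smooth_map_at_comp s (proj1 (smoothP _) (vtgt_smooth hL) _).
apply: smooth_at_ext (s' _ (sl _)); apply: near_all => r /=.
rewrite (MR_obE hL cN fth mth fka) fibatK //=; by rewrite (tgt_unt gG).
Qed.

Lemma MR_vbg_morphism : is_vbg_morphism (MR nabla th ka).
Proof.
split; last first.
- exact: (MR_ob_lin hL cN fth mth fka).
- exact: (MR_ar_lin hL cN fth fka).
- split.
  + by split; [exact: MR_ar_smooth|exact: MR_ob_smooth].
  + case=> g p; split; [exact: (congr1 (@Tot R _ _ _) (MR_src hL cN fth mth fka p))|exact: (congr1 (@Tot R _ _ _) (MR_tgt hL cN fth mth fka p))].
  + by case=> x A; exact: (congr1 (@Tot R _ _ _) (MR_unt hL cN fth mth fka A)).
  + case=> g p [h q] c; exact: (congr1 (@Tot R _ _ _) (MR_mul hL cN fth mth fka c)).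
by split; [split; exact: smooth_id| | |].
Qed.
End CurvatureSmooth.

(** * Nondegeneracy and the Morita condition *)

Section LinearAlgebra.
Context (K : fieldType) (U : lmodType K) (N : nat) (r : U -> 'rV[K]_N) (r' : 'rV[K]_N -> U).
Hypotheses (rK : cancel r r') (r'K : cancel r' r) (lr : linear r) (lr' : linear r').
Arguments lr : clear implicits.
Arguments lr' : clear implicits.

Definition map_matrix m (phi : U -> 'rV[K]_m) : 'M[K]_(N, m) := \matrix_(i < N) phi (r' (delta_mx 0 i)).

Lemma map_matrixE m (phi : U -> 'rV[K]_m) x : linear phi -> phi (r' x) = x *m map_matrix phi.
Proof.
move=> lphi; rewrite {1}(row_sum_delta x) (lin_sum lr') (lin_sum lphi) mulmx_sum_row.
by apply: eq_bigr => i _; rewrite (lin_Z lr') (lin_Z lphi) rowK.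
Qed.

Lemma kernel_matrixE m (phi : U -> 'rV[K]_m) u : linear phi -> phi u = 0 ->
  exists y, u = r' (y *m kermx (map_matrix phi)).
Proof.
move=> lphi pu; have : (r u <= kermx (map_matrix phi))%MS.
  by apply/sub_kermxP; rewrite -map_matrixE // rK.
by move=> /submxP[y yE]; exists y; rewrite -yE rK.
Qed.

Lemma kernel_matrixP m (phi : U -> 'rV[K]_m) y : linear phi -> phi (r' (y *m kermx (map_matrix phi))) = 0.
Proof. by move=> lphi; rewrite map_matrixE // -mulmxA mulmx_ker mulmx0. Qed.

Definition functional_matrix (f : U -> K) : 'cV[K]_N := \col_i f (r' (delta_mx 0 i)).

Lemma functional_matrixE (f : U -> K) x : linear (f : U -> K^o) -> f (r' x) = (x *m functional_matrix f) 0 0.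
Proof.
move=> lf; rewrite {1}(row_sum_delta x) (lin_sum lr') (lin_sum lf) !mxE.
by apply: eq_bigr => i _; rewrite (lin_Z lr') (lin_Z lf) mxE.
Qed.

(** A vector outside the sum of the two kernels has a nonzero coordinate in the cokernel of that
    sum, and this coordinate is the functional. *)
Lemma separate m1 m2 (phi1 : U -> 'rV[K]_m1) (phi2 : U -> 'rV[K]_m2) d : linear phi1 -> linear phi2 ->
  ~ (exists p q, [/\ phi1 p = 0, phi2 q = 0 & d = p + q]) ->
  exists f : U -> K, [/\ linear (f : U -> K^o), forall p, phi1 p = 0 -> f p = 0, forall q, phi2 q = 0 -> f q = 0 & f d != 0].
Proof.
move=> l1 l2 H; pose S := (kermx (map_matrix phi1) + kermx (map_matrix phi2))%MS.
have nS : ~~ (r d <= S)%MS.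
  apply/negP => /sub_addsmxP[[y1 y2] /= E]; apply: H.
  exists (r' (y1 *m kermx (map_matrix phi1))), (r' (y2 *m kermx (map_matrix phi2))).
  by split; [exact: kernel_matrixP|exact: kernel_matrixP|rewrite -(lin_D lr') -E rK].
have [j jn] : exists j, (r d *m cokermx S) 0 j != 0.
  apply/existsP; rewrite -negb_forall; apply: contra nS => /forallP H0.
  by rewrite submxE; apply/eqP/rowP => j; rewrite [RHS]mxE; apply/eqP; exact: H0.
exists (fun u => (r u *m cokermx S) 0 j); split => //.
- by move=> c u v; rewrite lr mulmxDl -scalemxAl !mxE.
- move=> p /(kernel_matrixE l1)[y ->]; rewrite r'K.
  have : (y *m kermx (map_matrix phi1) <= S)%MS by apply: submx_trans (submxMl _ _) (addsmxSl _ _).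
  by rewrite submxE => /eqP ->; rewrite mxE.
move=> p /(kernel_matrixE l2)[y ->]; rewrite r'K.
have : (y *m kermx (map_matrix phi2) <= S)%MS by apply: submx_trans (submxMl _ _) (addsmxSr _ _).
by rewrite submxE => /eqP ->; rewrite mxE.
Qed.

(** The Fredholm alternative: [f] lies in the row space of the matrix of [w] restricted to the two
    kernels as soon as the cokernel of that matrix kills it. Constraints with values in ['rV_0] are
    void. *)
Lemma bilinear_solve m1 m2 (phi1 : U -> 'rV[K]_m1) (phi2 : U -> 'rV[K]_m2) (w : U -> U -> K) (f : U -> K) :
  linear phi1 -> linear phi2 -> (forall u, linear (w u : U -> K^o)) -> (forall v, linear (w^~ v : U -> K^o)) ->
  linear (f : U -> K^o) ->
  (forall d, phi2 d = 0 -> (forall i, phi1 i = 0 -> w i d = 0) -> f d = 0) ->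
  exists2 i, phi1 i = 0 & forall d, phi2 d = 0 -> w i d = f d.
Proof.
move=> l1 l2 lw lw' lf H.
have tr11 (A : 'M[K]_1) : A^T = A by apply/matrixP => i j; rewrite !ord1 mxE.
pose M : 'M[K]_N := \matrix_(i, j) w (r' (delta_mx 0 i)) (r' (delta_mx 0 j)).
have wE x y : w (r' x) (r' y) = (x *m M *m y^T) 0 0.
  have E1 : functional_matrix (w (r' x)) = M^T *m x^T.
    apply/colP => j; rewrite !mxE {1}(row_sum_delta x) (lin_sum lr') (lin_sum (lw' _)).
    by apply: eq_bigr => i _; rewrite (lin_Z lr') (lin_Z (lw' _)) !mxE mulrC.
  rewrite (functional_matrixE _ (lw _)) E1.
  by rewrite -[in RHS](tr11 (x *m M *m y^T)) !trmx_mul trmxK.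
pose J1 := kermx (map_matrix phi1); pose J2 := kermx (map_matrix phi2).
pose F := functional_matrix f; pose A := J1 *m M *m J2^T.
have : ((J2 *m F)^T <= A)%MS.
  rewrite submxE; apply/eqP/rowP => j; rewrite [RHS]mxE.
  pose c := (col j (cokermx A))^T; pose d := r' (c *m J2).
  have /(_ _ _)-/(_ d) := H.
  have pd : phi2 d = 0 by exact: kernel_matrixP.
  move=> /(_ pd) fd.
  have : f d = 0.
    apply: fd => i /(kernel_matrixE l1)[y ->]; rewrite wE trmx_mul trmxK.
    have -> : y *m J1 *m M *m (J2^T *m col j (cokermx A)) = y *m (A *m col j (cokermx A)) by rewrite /A !mulmxA.
    by rewrite colE (mulmxA A) mulmx_coker mul0mx mulmx0 mxE.
  rewrite /d (functional_matrixE _ lf) -/F => E.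
  have -> : ((J2 *m F)^T *m cokermx A) 0 j = (col j ((J2 *m F)^T *m cokermx A)) 0 0 by rewrite [RHS]mxE.
  rewrite colE -mulmxA -colE -[RHS]E -[in LHS](tr11 (_ *m _)).
  by rewrite trmx_mul trmxK mulmxA.
move=> /submxP[y yE]; exists (r' (y *m J1)); first exact: kernel_matrixP.
move=> d /(kernel_matrixE l2)[e ->]; rewrite wE -/J2 trmx_mul.
have -> : y *m J1 *m M *m (J2^T *m e^T) = (y *m A) *m e^T by rewrite /A !mulmxA.
rewrite -yE -trmx_mul [LHS]mxE (functional_matrixE _ lf) mulmxA //.
Qed.
End LinearAlgebra.

(** * Frames of the Morita kernel and the pointwise nondegeneracy condition *)

Section Nondegeneracy.
Context (R : realType) (G : groupoid R) (L : vbg G).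
Hypothesis hL : is_line_groupoid L.
Context (nabla : conn (vb0 L)) (cN : is_connection nabla).
Context (th : form1 L) (fth : is_form1 th) (mth : multiplicative th).
Context (ka : form2 (vb0 L)) (fka : is_form2 ka).
Let lG := line_lie hL.
Let gG := lie_groupoid lG.
Let V := MK th.
Let Om g (p q : V g) : L g := pairing nabla ka p q.
Let OmL g (p : V g) : linear (Om p) := pairing_lin hL cN fth fka p.
Let OmLl g (q : V g) : linear (fun p => Om p q) := Om_linl hL cN fth fka q.
Let OmA g (p q : V g) : Om p q = - Om q p := pairing_anti hL cN fth fka p q.

Lemma smooth_section_zero_TB (X : space R) : smooth_section (fun x => 0 : TB X x).
Proof.
apply/smooth_sectionP => f sf x; apply: smooth_at_ext (smooth_at_cst x 0).
by apply: near_all => y; rewrite dv0.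
Qed.

(** Index 0 carries the line direction, the lifted indices carry coordinate fields. *)
Lemma MK_frame g0 : exists N (B : 'I_N -> section V) (co : 'I_N -> tot V -> R),
  [/\ forall i, smooth_section (B i), forall i, smoothf (co i),
      forall i g, linear (fun v : V g => co i (Tot v) : R^o),
      \forall g \near (g0 : ar G), forall v : V g, v = \sum_i co i (Tot v) *: B i g
    & forall i j, co i (Tot (B j g0)) = (i == j)%:R].
Proof.
have [a [la fa]] := frame_at_exists hL (tgt g0).
have [n [x [E [_ [[sx sE Ee Ed _] _]]]]] := manifold_chart g0 (ar_manifold lG).
pose e := pull_section (@vtgt R G L) a.
have se : smooth_section e by exact: (pull_section_smooth (line_vb hL) (line_vb0 hL) (vtgt_smooth hL) (vtgt_lin hL) (vtgt_inj hL) (frame_at_section fa)).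
pose B (j : 'I_n.+1) : section V := fun g => if unlift ord0 j is Some i then (E i g, 0) else (0, e g).
pose co (j : 'I_n.+1) (q : tot V) : R := if unlift ord0 j is Some i then dv (tagged q).1 (x i) else tcoord la (tagged q).2.
have sid (q : tot V) : smooth_map_at q (fun r : tot V => r) by move=> f.
exists n.+1, B, co; split.
- move=> j; rewrite /B; apply/smoothP => g; case: (unlift _ _) => [i|]; apply: smooth_sum_at => /=.
  + by move: g; apply/smoothP; exact: sE.
  + by move: g; apply/smoothP; exact: (smooth_section0 (line_vb hL)).
  + by move: g; apply/smoothP; exact: smooth_section_zero_TB.
  + by move: g; apply/smoothP; exact: se.
- move=> j q; rewrite /co; case: (unlift _ _) => [i|].
    exact: (smooth_sum_at1 (sid q) (smooth_dv (sx i) _)).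
  exact: (smooth_sum_at2 (sid q) (smooth_tcoord hL fa _)).
- move=> j g c u v; rewrite /co /=; case: (unlift _ _) => [i|]; first by rewrite dv_lin.
  by rewrite (tcoord_lin hL fa).
- apply: filterS2 Ee (near_tgt hL fa) => g Eg ft [v l].
  rewrite big_ord_recl /B /co unlift_none /=.
  rewrite (eq_bigr (fun i => (dv v (x i) *: E i g, 0))); last first.
    by move=> i _; rewrite liftK; congr (_, _); rewrite scaler0.
  have sE2 : forall (I : Type) (s : seq I) (F : I -> tangent g), \sum_(i <- s) ((F i, 0) : V g) = (\sum_(i <- s) F i, 0).
    by move=> I s F; elim/big_rec2: _ => [//|i y1 y2 _ ->]; congr (_, _); rewrite addr0.
  rewrite sE2 -(Eg v); congr (_, _).
    by rewrite -[RHS]/(tcoord la l *: (0 : tangent g) + v) scaler0 add0r.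
  by rewrite -[RHS]/(tcoord la l *: e g + 0) addr0; exact: tcoordE.
move=> i j; rewrite /co /B; case: (unliftP ord0 i) => [i'|] ->; case: (unliftP ord0 j) => [j'|] ->.
- rewrite (inj_eq (@lift_inj _ _)) /= (nbhs_singleton Ed) eq_sym //.
- by rewrite dv0.
- by rewrite /= (tcoord0 hL fa).
- by rewrite /= (tcoord1 hL fa).
Qed.

Lemma MK0_coframe x0 : exists m (k : 'I_m -> tot (vb0 V) -> R),
  [/\ forall i, smoothf (k i), forall i x, linear (fun A : vb0 V x => k i (Tot A) : R^o)
    & \forall x \near (x0 : ob G), forall A B : vb0 V x, (forall i, k i (Tot A) = k i (Tot B)) -> A = B].
Proof.
have [a [la fa]] := frame_at_exists hL x0.
have [n [y [E [_ [[sy sE Ee Ed _] _]]]]] := manifold_chart x0 (ob_manifold lG).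
pose k (j : 'I_n.+1) (q : tot (vb0 V)) : R := if unlift ord0 j is Some i then dv (tagged q).1 (y i) else la (Tot (tagged q).2).
have sid (q : tot (vb0 V)) : smooth_map_at q (fun r : tot (vb0 V) => r) by move=> f.
exists n.+1, k; split.
- move=> j q; rewrite /k; case: (unlift _ _) => [i|].
    exact: (smooth_sum_at1 (sid q) (smooth_dv (sy i) _)).
  exact: (smooth_sum_at2 (sid q) (frame_at_coord fa _)).
- move=> j g c u v; rewrite /k /=; case: (unlift _ _) => [i|]; first by rewrite dv_lin.
  by rewrite (frame_at_lin fa).
apply: filterS2 Ee (frame_at_near fa) => x Ex fx [v l] [w m] H.
congr (_, _); last first.
  by have := H ord0; rewrite /k unlift_none /= => E0; rewrite (frame_atE fx l) (frame_atE fx m) E0.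
rewrite (Ex v) (Ex w); apply: eq_bigr => i _; congr (_ *: _).
by have := H (lift ord0 i); rewrite /k liftK.
Qed.

Lemma MK_src_surj g (A : vb0 V (src g)) : exists b : V g, vsrc V b = A.
Proof.
have [_ /(_ g A.1)[v vE]] := src_submersion lG.
exists (v, finv (@vsrc R G L g) A.2); rewrite [RHS]surjective_pairing -vE; congr (_, _).
exact: (iso_finvP (line_vb hL) (line_vb0 hL) (vsrc_lin hL) (vsrc_inj hL)).
Qed.

Lemma MK_tgt_surj g (A : vb0 V (tgt g)) : exists b : V g, vtgt V b = A.
Proof.
have [_ /(_ g A.1)[v vE]] := tgt_submersion lG.
exists (v, finv (@vtgt R G L g) A.2 - th v); rewrite [RHS]surjective_pairing -vE; congr (_, _).
rewrite /= subrK; exact: (iso_finvP (line_vb hL) (line_vb0 hL) (vtgt_lin hL) (vtgt_inj hL)).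
Qed.

(** A vector with target 0 is a left shift, and the pairing with a left shift depends on [p] only
    through its source. *)
Lemma pairing_ker g (p q : V g) : vsrc V p = 0 -> vtgt V q = 0 -> Om p q = 0.
Proof.
move=> sp /(left_shift_surj hL fth mth)[c <-]; have [k kE] := core_inv_exists hL c.
apply: (vsrc_inj hL); apply: Tot_inj.
have := Om_left_shift hL cN fth mth fka p kE; rewrite sp (lin_0 (MK_vunt_lin hL (th := th) (x := src g))) => ->.
rewrite [pairing nabla ka _ k](lin_0 (OmLl k)) (lin_0 (vtgt_lin hL _)) (lin_0 (vsrc_lin hL _)).
by apply: Tot0; rewrite (tgt_unt gG).
Qed.

Definition isotropy g (i : V g) : Prop := vsrc V i = 0 /\ vtgt V i = 0.

(** Nondegeneracy on the side of the quotient is stated without forming it, as membership in the sum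
    of the two kernels. *)
Definition contact_nondegenerate g : Prop :=
  (forall i : V g, isotropy i -> (forall q, Om i q = 0) -> i = 0) /\
  (forall d : V g, (forall i, isotropy i -> Om i d = 0) ->
     exists p q : V g, [/\ vsrc V p = 0, vtgt V q = 0 & d = p + q]).

Section Pointwise.
Context (g : ar G).

Lemma MK_coordinates : exists N (r : V g -> 'rV[R]_N) (r' : 'rV[R]_N -> V g),
  [/\ cancel r r', cancel r' r, linear r & linear r'].
Proof.
have [N [B [co [_ _ lco /nbhs_singleton Be Bd]]]] := MK_frame g.
exists N, (fun v => \row_i co i (Tot v)), (fun x => \sum_i x 0 i *: B i g); split.
- by move=> v; rewrite [RHS]Be; apply: eq_bigr => i _; rewrite mxE.
- move=> x; apply/rowP => j; rewrite mxE (lin_sum (lco j g)) (bigD1 j) //= big1 ?addr0.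
    by rewrite (lin_Z (lco j g)) Bd eqxx; exact: mulr1.
  by move=> i ij; rewrite (lin_Z (lco j g)) Bd eq_sym (negPf ij); exact: mulr0.
- by move=> c u v; apply/rowP => i; rewrite !mxE; exact: lco.
by move=> c x y; rewrite scaler_sumr -big_split; apply: eq_bigr => i _; rewrite !mxE scalerDl scalerA.
Qed.

Lemma src_functionals : exists m (phi : V g -> 'rV[R]_m), linear phi /\ forall v, phi v = 0 <-> vsrc V v = 0.
Proof.
have [m [k [_ lk /nbhs_singleton ki]]] := MK0_coframe (src g).
exists m, (fun v => \row_i k i (Tot (vsrc V v))); split=> [c u v|v].
  by apply/rowP => i; rewrite !mxE -lk; congr (k i (Tot _)); exact: MK_vsrc_lin.
split=> [/rowP H|->]; last by apply/rowP => i; rewrite !mxE (lin_0 (lk i (src g))).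
by apply: ki => i; have := H i; rewrite !mxE => ->; rewrite (lin_0 (lk i (src g))).
Qed.

Lemma tgt_functionals : exists m (phi : V g -> 'rV[R]_m), linear phi /\ forall v, phi v = 0 <-> vtgt V v = 0.
Proof.
have [m [k [_ lk /nbhs_singleton ki]]] := MK0_coframe (tgt g).
exists m, (fun v => \row_i k i (Tot (vtgt V v))); split=> [c u v|v].
  by apply/rowP => i; rewrite !mxE -lk; congr (k i (Tot _)); exact: (MK_vtgt_lin hL fth).
split=> [/rowP H|->]; last by apply/rowP => i; rewrite !mxE (lin_0 (lk i (tgt g))).
by apply: ki => i; have := H i; rewrite !mxE => ->; rewrite (lin_0 (lk i (tgt g))).
Qed.

Lemma isotropy_functionals : exists m (phi : V g -> 'rV[R]_m), linear phi /\ forall v, phi v = 0 <-> isotropy v.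
Proof.
have [m1 [p1 [l1 E1]]] := src_functionals; have [m2 [p2 [l2 E2]]] := tgt_functionals.
exists (m1 + m2)%N, (fun v => row_mx (p1 v) (p2 v)); split=> [c u v|v].
  by rewrite l1 l2 scale_row_mx add_row_mx.
split=> [|[/E1 -> /E2 ->]]; last by rewrite row_mx0.
by rewrite -row_mx0 => /eq_row_mx[/E1 ? /E2].
Qed.

(** The second half of nondegeneracy read dually: a vector annihilated by all isotropic ones is a
    sum from the two kernels, and [chi] vanishes there, so the solvability criterion is met. *)
Lemma annihilator_solve (chi : V g -> L g) : contact_nondegenerate g -> linear chi ->
  (forall p, vsrc V p = 0 -> chi p = 0) -> (forall q, vtgt V q = 0 -> chi q = 0) ->
  exists2 i, isotropy i & forall v, Om i v = chi v.
Proof.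
move=> [_ Q2] lchi cs ct.
have [N [r [r' [rK r'K lr lr']]]] := MK_coordinates.
have [m [phi [lphi phiE]]] := isotropy_functionals.
have [a [la fa]] := frame_at_exists hL (tgt g).
have lt c (u v : L g) := tcoord_lin hL fa c u v.
have [||||||i Ii iE] := @bilinear_solve R (V g) N r r' rK lr' m 0 phi (fun _ => 0) (fun u v => tcoord la (Om u v)) (fun v => tcoord la (chi v)).
- exact: lphi.
- by move=> c u v; rewrite scaler0 addr0.
- by move=> u c v w; rewrite OmL lt.
- by move=> v c u w; rewrite OmLl lt.
- by move=> c u v; rewrite lchi lt.
- move=> d _ H; have [|p [q [sp tq ->]]] := Q2 d.
    move=> j /phiE/H Hj; apply: (tcoord_inj hL fa); rewrite Hj (tcoord0 hL fa) //.
  by rewrite (lin_D lchi) cs // ct // addr0 (tcoord0 hL fa).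
exists i; first exact/phiE.
by move=> v; apply: (tcoord_inj hL fa); exact: iE.
Qed.

(** The first half of nondegeneracy read dually: no nonzero isotropic vector is killed by all
    pairings, so every functional on the isotropic vectors is a pairing. *)
Lemma isotropy_solve a la (f : V g -> R) : frame_at (tgt g) a la -> contact_nondegenerate g -> linear (f : V g -> R^o) ->
  exists b, forall i, isotropy i -> tcoord la (Om b i) = f i.
Proof.
move=> fa [Q1 _] lf.
have [N [r [r' [rK r'K lr lr']]]] := MK_coordinates.
have [m [phi [lphi phiE]]] := isotropy_functionals.
have lt c (u v : L g) := tcoord_lin hL fa c u v.
have [||||||b _ bE] := @bilinear_solve R (V g) N r r' rK lr' 0 m (fun _ => 0) phi (fun u v => tcoord la (Om u v)) f.
- by move=> c u v; rewrite scaler0 addr0.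
- exact: lphi.
- by move=> u c v w; rewrite OmL lt.
- by move=> v c u w; rewrite OmLl lt.
- exact: lf.
- move=> d /phiE Id H; rewrite (Q1 d Id) ?(lin_0 lf) // => q.
  by rewrite OmA; apply: (tcoord_inj hL fa); rewrite (tcoordN hL fa) H // (tcoord0 hL fa) oppr0.
by exists b => i /phiE; exact: bE.
Qed.

Lemma separate_kernels (d : V g) : ~ (exists p q : V g, [/\ vsrc V p = 0, vtgt V q = 0 & d = p + q]) ->
  exists chi : V g -> L g, [/\ linear chi, forall p, vsrc V p = 0 -> chi p = 0,
    forall q, vtgt V q = 0 -> chi q = 0 & chi d <> 0].
Proof.
move=> H; have [N [r [r' [rK r'K lr lr']]]] := MK_coordinates.
have [m1 [p1 [l1 E1]]] := src_functionals; have [m2 [p2 [l2 E2]]] := tgt_functionals.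
have [|f [lf f1 f2 fd]] := @separate R (V g) N r r' rK r'K lr lr' m1 m2 p1 p2 d l1 l2.
  by move=> [p [q [/E1 sp /E2 tq dE]]]; apply: H; exists p, q.
have [a [la fa]] := frame_at_exists hL (tgt g).
exists (fun v => f v *: pull_section (@vtgt R G L) a g); split.
- by move=> c u v; rewrite lf scalerDl scalerA.
- by move=> p /E1/f1 ->; rewrite scale0r.
- by move=> p /E2/f2 ->; rewrite scale0r.
move=> /(congr1 (tcoord la (g := g))); rewrite (tcoordZ hL fa) (tcoord1 hL fa) (tcoord0 hL fa) mulr1.
exact/eqP.
Qed.
End Pointwise.
End Nondegeneracy.

Lemma lin_sub (K : pzRingType) (U W : lmodType K) (f g : U -> W) : linear f -> linear g -> linear (fun v => f v - g v).
Proof. by move=> lf lg c u v; rewrite lf lg scalerBr opprD addrACA. Qed.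

Lemma smooth_at_row_mx (R : realType) (X : space R) (p : X) a b (u : X -> 'rV[R]_a) (v : X -> 'rV[R]_b) j :
  (forall j, smooth_at p (fun y => u y 0 j)) -> (forall j, smooth_at p (fun y => v y 0 j)) ->
  smooth_at p (fun y => row_mx (u y) (v y) 0 j).
Proof.
move=> su sv; rewrite -(splitK j); case: (fintype.split j) => k.
  by apply: smooth_at_ext (su k); apply: near_all => y; rewrite row_mxEl.
by apply: smooth_at_ext (sv k); apply: near_all => y; rewrite row_mxEr.
Qed.

Lemma smooth_at_row (R : realType) (X : space R) (p : X) n (f : 'I_n -> X -> R) j :
  (forall j, smooth_at p (f j)) -> smooth_at p (fun y => (\row_j f j y) 0 j).
Proof. by move=> sf; apply: smooth_at_ext (sf j); apply: near_all => y; rewrite mxE. Qed.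

(** * Nondegeneracy and full faithfulness *)

Section FullyFaithful.
Context (R : realType) (G : groupoid R) (L : vbg G).
Hypothesis hL : is_line_groupoid L.
Context (nabla : conn (vb0 L)) (cN : is_connection nabla).
Context (th : form1 L) (fth : is_form1 th) (mth : multiplicative th).
Context (ka : form2 (vb0 L)) (fka : is_form2 ka).
Let lG := line_lie hL.
Let V := MK th.
Let Om g (p q : V g) : L g := pairing nabla ka p q.
Let OmL g (p : V g) : linear (Om p) := pairing_lin hL cN fth fka p.
Let OmLl g (q : V g) : linear (fun p => Om p q) := Om_linl hL cN fth fka q.
Let OmA g (p q : V g) : Om p q = - Om q p := pairing_anti hL cN fth fka p q.
Let sl g : linear (@vsrc R G V g) := MK_vsrc_lin hL (th := th) (g := g).
Let tl g : linear (@vtgt R G V g) := MK_vtgt_lin hL fth (g := g).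
Let MRo0 x : MR_ob nabla ka (0 : vb0 V x) = 0 := lin_0 (MR_ob_lin hL cN fth mth fka (x := x)).

Let Phi (q : tot V) : prod_space (tot (dual L V)) (prod_space (tot (vb0 V)) (tot (vb0 V))) :=
  (Tot (MR_ar nabla ka (tagged q)), (Tot (vsrc V (tagged q)), Tot (vtgt V (tagged q)))).
Let P : set (prod_space (tot (dual L V)) (prod_space (tot (vb0 V)) (tot (vb0 V)))) :=
  [set y | Tot (vsrc (dual L V) (tagged y.1)) = Tot (MR_ob nabla ka (tagged y.2.1)) /\
           Tot (vtgt (dual L V) (tagged y.1)) = Tot (MR_ob nabla ka (tagged y.2.2))].

Lemma curvature_in_graph q : P (Phi q).
Proof. by case: q => g p; split; congr Tot; [exact: (MR_src hL cN fth mth fka)|exact: (MR_tgt hL cN fth mth fka)]. Qed.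

Lemma curvature_graph_eq g (psi : dual L V g) (a0 : vb0 V (src g)) (a1 : vb0 V (tgt g)) q :
  Phi q = (Tot psi, (Tot a0, Tot a1)) ->
  exists b : V g, [/\ q = Tot b, MR_ar nabla ka b = psi, vsrc V b = a0 & vtgt V b = a1].
Proof.
case: q => h b E.
have E1 : Tot (MR_ar nabla ka b) = Tot psi by exact: (congr1 fst E).
have E2 : Tot (vsrc V b) = Tot a0 by exact: (congr1 (fun y => y.2.1) E).
have E3 : Tot (vtgt V b) = Tot a1 by exact: (congr1 (fun y => y.2.2) E).
have eh : h = g by exact: (congr1 (fun q : tot (dual L V) => tag q) E1).
case: _ / (esym eh) b E1 E2 E3 {E} => b E1 E2 E3; exists b; split => //.
- exact: (@Tot_inj R _ (dual L V) _ _ _ E1).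
- exact: (@Tot_inj R _ (vb0 V) _ _ _ E2).
exact: (@Tot_inj R _ (vb0 V) _ _ _ E3).
Qed.

(** An isotropic vector in the radical has the same image as 0, so injectivity kills it. For the
    other half, a functional vanishing on both kernels but not at [d] is a dual element with both
    ends 0; its preimage is isotropic and pairs nontrivially with [d]. *)
Lemma fully_faithful_nondegenerate g : fully_faithful (tot_gmap (MR nabla th ka)) -> contact_nondegenerate nabla th ka g.
Proof.
move=> [_ [_ [psi [_ [psi1 psi2]]]]].
have inj (p q : tot V) : Phi p = Phi q -> p = q.
  move=> E; pose y : sub P := exist _ (Phi p) (curvature_in_graph p).
  by rewrite -(psi2 p y erefl); apply: psi2; rewrite /= E.
split=> [i [si ti] H|d H].
  apply: (@Tot_inj R _ V); apply: inj.
  have E : MR_ar nabla ka i = MR_ar nabla ka (0 : V g).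
    by apply: hom_eq => v; rewrite !(MR_arE hL cN fth fka) [pairing _ _ i v]H [RHS](lin_0 (OmLl v)).
  change ((Tot (MR_ar nabla ka i), (Tot (vsrc V i), Tot (vtgt V i))) =
    (Tot (MR_ar nabla ka (0 : V g)), (Tot (vsrc V (0 : V g)), Tot (vtgt V (0 : V g))))).
  by rewrite E si ti (lin_0 (@sl g)) (lin_0 (@tl g)).
apply: contrapT => /(separate_kernels hL fth)[chi [lchi cs ct cd]]; apply: cd.
pose psi0 : dual L V g := mkhom chi.
have yP : P (Tot psi0, (Tot (0 : vb0 V (src g)), Tot (0 : vb0 V (tgt g)))).
  have E0 : vsrc (dual L V) psi0 = 0.
    apply: hom_eq => c; rewrite (dual_srcE hL fth mth) mkhomE // ct; last exact: (left_shift_tgt hL fth mth).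
    by rewrite (lin_0 (vsrc_lin hL _)) oppr0.
  have E1 : vtgt (dual L V) psi0 = 0.
    apply: hom_eq => c; rewrite (dual_tgtE hL fth) mkhomE // cs; last exact: (right_shift_src hL fth mth).
    by rewrite (lin_0 (vtgt_lin hL _)).
  split.
    change (Tot (vsrc (dual L V) psi0) = Tot (MR_ob nabla ka (0 : vb0 V (src g)))).
    by rewrite E0 MRo0.
  change (Tot (vtgt (dual L V) psi0) = Tot (MR_ob nabla ka (0 : vb0 V (tgt g)))).
  by rewrite E1 MRo0.
have [b [_ E1 E2 E3]] := curvature_graph_eq (psi1 (exist _ _ yP)).
have <- : sublv psi0 d = chi d by rewrite mkhomE.
by rewrite -E1 (MR_arE hL cN fth fka); exact: H.
Qed.

Lemma nondegenerate_inj g (b b' : V g) : contact_nondegenerate nabla th ka g ->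
  vsrc V b = vsrc V b' -> vtgt V b = vtgt V b' -> (forall v, Om b v = Om b' v) -> b = b'.
Proof.
move=> [Q1 _] s t H; apply/eqP; rewrite -subr_eq0; apply/eqP; apply: Q1.
  by split; rewrite ?(lin_B (@sl g)) ?(lin_B (@tl g)) ?s ?t subrr.
by move=> q; rewrite -/(Om _ _) (lin_B (OmLl q)) H subrr.
Qed.

(** The source of a dual element records precisely its restriction to the kernel of the target. *)
Lemma dual_src_vanish g (psi : dual L V g) (b0 q : V g) : vsrc (dual L V) psi = MR_ob nabla ka (vsrc V b0) ->
  vtgt V q = 0 -> sublv psi q = Om b0 q.
Proof.
rewrite -(MR_src hL cN fth mth fka) => H /(left_shift_surj hL fth mth)[c <-].
apply: (vsrc_inj hL); apply: oppr_inj; rewrite -(dual_srcE hL fth mth) H.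
by rewrite (dual_srcE hL fth mth) (MR_arE hL cN fth fka).
Qed.

Lemma dual_tgt_vanish g (psi : dual L V g) (b0 q : V g) : vtgt (dual L V) psi = MR_ob nabla ka (vtgt V b0) ->
  vsrc V q = 0 -> sublv psi q = Om b0 q.
Proof.
rewrite -(MR_tgt hL cN fth mth fka) => H /(right_shift_surj hL fth mth)[c <-].
apply: (vtgt_inj hL); rewrite -(dual_tgtE hL fth) H.
by rewrite (dual_tgtE hL fth) (MR_arE hL cN fth fka).
Qed.

(** Lift [a0] and [a1] separately to [b0] and [b1]. On isotropic vectors both pair as [psi] does, so
    their difference is annihilated and splits as [p + q]. The vector [b0 + p], equal to [b1 - q],
    has both ends right and pairs as [psi] does on both kernels; the remaining discrepancy is the
    pairing with an isotropic vector. *)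
Lemma nondegenerate_lift g (psi : dual L V g) (a0 : vb0 V (src g)) (a1 : vb0 V (tgt g)) :
  contact_nondegenerate nabla th ka g ->
  vsrc (dual L V) psi = MR_ob nabla ka a0 -> vtgt (dual L V) psi = MR_ob nabla ka a1 ->
  exists b : V g, [/\ vsrc V b = a0, vtgt V b = a1 & forall v, Om b v = sublv psi v].
Proof.
move=> Q; have [b0 <-] := MK_src_surj hL a0; have [b1 <-] := MK_tgt_surj hL a1 => E0 E1.
have [_ Q2] := Q.
have [|p [q [sp tq dE]]] := Q2 (b1 - b0).
  move=> i [si ti]; rewrite -/(Om _ _) (lin_B (OmL i)) !(OmA i).
  by rewrite -(dual_src_vanish E0 ti) -(dual_tgt_vanish E1 si) subrr.
pose b := b0 + p; have bE : b = b1 - q.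
  by rewrite /b; apply/eqP; rewrite eq_sym subr_eq -addrA -dE addrC subrK.
pose chi v := sublv psi v - Om b v.
have lchi : linear chi.
  exact: (lin_sub (homP psi) (OmL b)).
have [||i [si ti] iE] := annihilator_solve hL cN fth fka Q lchi.
- move=> v sv; rewrite /chi (dual_tgt_vanish E1 sv) bE (lin_B (OmLl v)) (OmA q).
  by rewrite [Om v q](pairing_ker hL cN fth mth fka sv tq) oppr0 subr0 subrr.
- move=> v tv; rewrite /chi (dual_src_vanish E0 tv) /b (lin_D (OmLl v)).
  by rewrite [Om p v](pairing_ker hL cN fth mth fka sp tv) addr0 subrr.
exists (b + i); split.
- by rewrite (lin_D (@sl g)) si addr0 (lin_D (@sl g)) sp addr0.
- by rewrite (lin_D (@tl g)) ti addr0 bE (lin_B (@tl g)) tq subr0.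
move=> v; rewrite (lin_D (OmLl v)) [Om i v]iE /chi addrC subrK //.
Qed.

Lemma MK_vsrc_smooth : smooth (fun q : tot V => Tot (vsrc V (tagged q)) : tot (vb0 V)).
Proof.
apply/smoothP => q; have sid : smooth_map_at q (fun r : tot V => r) by move=> f.
apply: smooth_sum_at; first exact: (smooth_at_Tmap (src_smooth lG) (smooth_sum_at1 sid)).
exact: (smooth_map_at_comp (smooth_sum_at2 sid) (proj1 (smoothP _) (vsrc_smooth hL) _)).
Qed.

Lemma MK_vtgt_smooth : smooth (fun q : tot V => Tot (vtgt V (tagged q)) : tot (vb0 V)).
Proof.
apply/smoothP => q; have sid : smooth_map_at q (fun r : tot V => r) by move=> f.
have s1 := smooth_sum_at1 sid; have s2 := smooth_sum_at2 sid.
apply: smooth_sum_at; first exact: (smooth_at_Tmap (tgt_smooth lG) s1).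
have st : smooth_map_at q (fun r : tot V => tag r : ar G) by move/smoothP: (@MK_tag_smooth R G L th); exact.
have := line_smooth_comb (line_vb hL) st (smooth_at_cst q 1) (smooth_at_cst q 1) s2 (form1_smooth_at fth s1).
move=> s; have := smooth_map_at_comp s (proj1 (smoothP _) (vtgt_smooth hL) _).
by apply: smooth_map_at_ext; apply: near_all => r /=; rewrite !scale1r.
Qed.

Lemma MK_smooth_lin (X : space R) (p : X) n (f : X -> ar G) (c : 'I_n -> X -> R) (Q : 'I_n -> forall x, V (f x)) :
  smooth_map_at p f -> (forall i, smooth_at p (c i)) -> (forall i, smooth_map_at p (fun x => Tot (Q i x) : tot V)) ->
  smooth_map_at p (fun x => Tot (\sum_i c i x *: Q i x) : tot V).
Proof.
move=> sf sc sQ; apply: smooth_sum_at.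
  apply: smooth_map_at_ext (smooth_at_TB_lin sf sc (fun i => smooth_sum_at1 (sQ i))).
  apply: near_all => x; congr (@Tot _ _ (TB (ar G)) _ _) => /=.
  by elim/big_rec2: _ => [//|i u v _ ->].
apply: smooth_map_at_ext (line_smooth_lin (line_vb hL) sf sc (fun i => smooth_sum_at2 (sQ i))).
apply: near_all => x; congr Tot => /=.
by elim/big_rec2: _ => [//|i u v _ ->].
Qed.

Lemma dual_tag_smooth : smooth (fun q : tot (dual L V) => tag q : ar G).
Proof.
apply/smoothP => q; apply/smooth_map_atP => f gf.
by apply: (@smoothf_gen R (tot (dual L V))); left; exists f => //; exact: smoothf_gen.
Qed.

Lemma dual0_tag_smooth : smooth (fun q : tot (vb0 (dual L V)) => tag q : ob G).
Proof.
apply/smoothP => q; apply/smooth_map_atP => f gf.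
by apply: (@smoothf_gen R (tot (vb0 (dual L V)))); left; exists f => //; exact: smoothf_gen.
Qed.

Lemma dual_eval_smooth (e : section V) (h : tot L -> R) : smooth_section e -> smoothf h ->
  smoothf (fun q : tot (dual L V) => h (Tot (sublv (tagged q) (e (tag q))))).
Proof. by move=> se sh; apply: (@smoothf_gen R (tot (dual L V))); right; exists e, h; split. Qed.

(* The inverse is smooth because [b] is found from [psi], [a0], [a1] by solving the linear
   system [Omega b = psi, s b = a0, t b = a1], of full column rank. *)
Lemma nondegenerate_fully_faithful : (forall g, contact_nondegenerate nabla th ka g) ->
  fully_faithful (tot_gmap (MR nabla th ka)).
Proof.
move=> Q; split.
  apply: smooth_pair; first exact: (MR_ar_smooth hL cN fth fka).
  by apply: smooth_pair; [exact: MK_vsrc_smooth|exact: MK_vtgt_smooth].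
split; first exact: curvature_in_graph.
have ex (y : sub P) : exists q : tot V, Phi q = sval y.
  case: y => -[[g psi] [[x0 a0] [x1 a1]]] [E0 E1].
  change (Tot (vsrc (dual L V) psi) = Tot (MR_ob nabla ka a0)) in E0.
  change (Tot (vtgt (dual L V) psi) = Tot (MR_ob nabla ka a1)) in E1.
  suff : exists q : tot V, Phi q = (Tot psi, (Tot a0, Tot a1)) by exact.
  have e0 : src g = x0 by exact: (congr1 (fun q : tot (vb0 (dual L V)) => tag q) E0).
  have e1 : tgt g = x1 by exact: (congr1 (fun q : tot (vb0 (dual L V)) => tag q) E1).
  case: _ / e0 a0 E0 => a0 E0; move: (@Tot_inj R _ (vb0 (dual L V)) _ _ _ E0) => {}E0.
  case: _ / e1 a1 E1 => a1 E1; move: (@Tot_inj R _ (vb0 (dual L V)) _ _ _ E1) => {}E1.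
  have [b [s t H]] := nondegenerate_lift (Q g) E0 E1.
  exists (Tot b); have E : MR_ar nabla ka b = psi by apply: hom_eq => v; rewrite (MR_arE hL cN fth fka) -H.
  change ((Tot (MR_ar nabla ka b), (Tot (vsrc V b), Tot (vtgt V b))) = (Tot psi, (Tot a0, Tot a1))).
  by rewrite E s t.
have [psi psiE] := boolp.choice ex.
exists psi; split; last first.
  split=> // -[g p] y yE; have := psiE y; rewrite yE => /curvature_graph_eq[b [-> E1 E2 E3]].
  congr existT; apply: (nondegenerate_inj (Q g)) => // v.
  by rewrite -[LHS](MR_arE hL cN fth fka) E1 (MR_arE hL cN fth fka).
apply/smoothP => y0.
pose ga (y : sub P) : ar G := tag (sval y).1.
have gaE y : tag (psi y) = ga y by rewrite /ga -psiE.
have s1 := @smooth_fst R (tot (dual L V)) (prod_space (tot (vb0 V)) (tot (vb0 V))).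
have s2 := @smooth_snd R (tot (dual L V)) (prod_space (tot (vb0 V)) (tot (vb0 V))).
have sv := @smooth_sval R _ P.
have sga : smooth ga by exact: smooth_comp (smooth_comp sv s1) dual_tag_smooth.
have [N [B [co [sB sco lco Be Bd]]]] := MK_frame hL th (ga y0).
have [m [k [sk lk ki]]] := MK0_coframe hL th (src (ga y0)).
have [m' [k' [sk' lk' ki']]] := MK0_coframe hL th (tgt (ga y0)).
have [a [la fa]] := frame_at_exists hL (tgt (ga y0)).
(* The left side of the linear system for [b], in coordinates: its pairings with a frame, then its
   source, then its target. *)
pose T g (v : V g) : 'rV[R]_(N + (m + m')) := row_mx (\row_j tcoord la (Om v (B j g)))
  (row_mx (\row_j k j (Tot (vsrc V v))) (\row_j k' j (Tot (vtgt V v)))).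
have lT g : linear (@T g).
  move=> c u v; rewrite /T !scale_row_mx !add_row_mx; congr row_mx; first last.
    by congr row_mx; apply/rowP => j; rewrite !mxE; [rewrite sl lk|rewrite tl lk'].
  by apply/rowP => j; rewrite !mxE OmLl (tcoord_lin hL fa).
pose A g : 'M[R]_(N, N + (m + m')) := \matrix_i T _ (B i g).
have sA : forall i j, smooth_at (ga y0) (fun g => A g i j).
  move=> i j; have sBi l : smooth_map_at (ga y0) (fun g => Tot (B l g) : tot V) by move/smoothP: (sB l); exact.
  have -> : (fun g => A g i j) = fun g => T _ (B i g) 0 j by apply: boolp.funext => g; rewrite mxE.
  apply: smooth_at_row_mx => [j1|j2].
    apply: smooth_at_row => j3; have s := smooth_pairing_at hL cN fth fka (sBi i) (sBi j3).
    exact: s _ (smooth_tcoord hL fa _).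
  apply: smooth_at_row_mx => [j3|j3]; apply: smooth_at_row => j4.
    have s := smooth_map_at_comp (sBi i) (proj1 (smoothP _) MK_vsrc_smooth _).
    exact: s _ (sk j4 _).
  have s := smooth_map_at_comp (sBi i) (proj1 (smoothP _) MK_vtgt_smooth _).
  exact: s _ (sk' j4 _).
have free : row_free (A (ga y0)).
  rewrite -kermx_eq0; apply/eqP/row_matrixP => i; rewrite row0.
  set x := row i _; have xA : x *m A (ga y0) = 0 by rewrite /x -row_mul mulmx_ker row0.
  pose b := \sum_i x 0 i *: B i (ga y0).
  have Tb : T _ b = 0.
    transitivity (x *m A (ga y0)) => //; rewrite /b (lin_sum (lT (ga y0))) mulmx_sum_row.
    by apply: eq_bigr => l _; rewrite (lin_Z (lT (ga y0))) rowK.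
  have b0 : b = 0.
    move: Tb; rewrite /T -row_mx0 => /eq_row_mx[/rowP H1]; rewrite -row_mx0 => /eq_row_mx[/rowP H2 /rowP H3].
    have [Q1 _] := Q (ga y0); apply: Q1.
      split; [apply: (nbhs_singleton ki) => l|apply: (nbhs_singleton ki') => l].
        by have := H2 l; rewrite !mxE => ->; rewrite (lin_0 (lk l _)).
      by have := H3 l; rewrite !mxE => ->; rewrite (lin_0 (lk' l _)).
    move=> q; rewrite -/(Om _ _) (nbhs_singleton Be q) (lin_sum (OmL b)) big1 // => l _.
    rewrite (lin_Z (OmL b)); have -> : Om b (B l (ga y0)) = 0; last by rewrite scaler0.
    by apply: (tcoord_inj hL fa); have := H1 l; rewrite !mxE => ->; rewrite (tcoord0 hL fa).
  apply/rowP => l; rewrite [RHS]mxE.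
  have : co l (Tot b) = x 0 l.
    rewrite /b (lin_sum (lco l (ga y0))) (bigD1 l) //= big1 ?addr0.
      by rewrite (lin_Z (lco l (ga y0))) Bd eqxx; exact: mulr1.
    by move=> j jl; rewrite (lin_Z (lco l (ga y0))) Bd eq_sym (negPf jl); exact: mulr0.
  by rewrite b0 (lin_0 (lco l (ga y0))) => <-.
(* The right inverse [S] found at one point is kept constant; [A g *m S] stays invertible nearby,
   and its inverse varies smoothly. *)
have [S AS] := row_freeP free.
have sAS i j : smooth_at (ga y0) (fun g => (A g *m S) i j).
  apply: (smooth_at_ext (f := fun g => \sum_l A g i l * S l j)).
    by apply: near_all => g; rewrite [RHS]mxE.
  by apply: smooth_at_sum => l _; apply: smooth_atM => //; exact: smooth_at_cst.
have U0 : A (ga y0) *m S \in unitmx by rewrite AS unitmx1.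
have [nU sI] := smooth_at_invmx sAS U0.
pose tau (y : sub P) : 'rV[R]_(N + (m + m')) :=
  row_mx (\row_j tcoord la (sublv (tagged (sval y).1) (B j (tag (sval y).1))))
  (row_mx (\row_j k j (sval y).2.1) (\row_j k' j (sval y).2.2)).
have tauE y : tau y = T _ (tagged (psi y)).
  rewrite /tau -psiE /T /=; congr row_mx; first by apply/rowP => j; rewrite !mxE (MR_arE hL cN fth fka).
have stau j : smooth_at y0 (fun y => tau y 0 j).
  apply: smooth_at_row_mx => [j1|j2].
    apply: smooth_at_row => j3.
    exact: (smooth_comp sv s1 (dual_eval_smooth (sB j3) (smooth_tcoord hL fa)) y0).
  apply: smooth_at_row_mx => [j3|j3]; apply: smooth_at_row => j4.
    exact: (smooth_comp (smooth_comp sv s2) (@smooth_fst R _ _) (sk j4) y0).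
  exact: (smooth_comp (smooth_comp sv s2) (@smooth_snd R _ _) (sk' j4) y0).
have sga0 : smooth_map_at y0 ga by move/smoothP: sga; exact.
pose c i (y : sub P) : R := (tau y *m (S *m invmx (A (ga y) *m S))) 0 i.
have sc i : smooth_at y0 (c i).
  apply: (smooth_at_ext (f := fun y => \sum_j tau y 0 j * \sum_l S j l * invmx (A (ga y) *m S) l i)).
    by apply: near_all => y; rewrite /c [RHS]mxE; apply: eq_bigr => j _; congr (_ * _); rewrite [RHS]mxE.
  apply: smooth_at_sum => j _; apply: smooth_atM => //; apply: smooth_at_sum => l _.
  by apply: smooth_atZ; exact: (sga0 _ (sI l i)).
have sB0 i : smooth_map_at y0 (fun y => Tot (B i (ga y)) : tot V).
  exact: (smooth_map_at_comp sga0 (proj1 (smoothP _) (sB i) _)).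
apply: smooth_map_at_ext (MK_smooth_lin sga0 sc sB0).
apply: filterS2 (near_smooth sga0 Be) (near_smooth sga0 nU) => y Bey Uy.
have [b bE] : exists b : V (ga y), psi y = Tot b.
  by move: (gaE y); case: (psi y) => g b; case: _ /; exists b.
have tE : tau y = T _ b by rewrite tauE bE.
rewrite bE; congr Tot; rewrite [RHS]Bey; apply: eq_bigr => i _; congr (_ *: _).
have yE : tau y = (\row_i co i (Tot b)) *m A (ga y).
  rewrite tE {1}(Bey b) (lin_sum (lT (ga y))) mulmx_sum_row; apply: eq_bigr => l _.
  by rewrite (lin_Z (lT (ga y))) rowK mxE.
by rewrite /c yE mulmxA -(mulmxA _ (A (ga y)) S) mulmxK // mxE.
Qed.
End FullyFaithful.

(** * Gluing functionals and projecting to kernels *)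

Section LinearExtension.
Context (K : fieldType) (U : lmodType K) (N : nat) (r : U -> 'rV[K]_N) (r' : 'rV[K]_N -> U).
Hypotheses (rK : cancel r r') (lr : linear r) (lr' : linear r').

Lemma factor_functional m (phi : U -> 'rV[K]_m) (h : U -> K) : linear phi -> linear (h : U -> K^o) ->
  (forall v, phi v = 0 -> h v = 0) -> exists b : 'I_m -> K, forall v, h v = \sum_i phi v 0 i * b i.
Proof.
move=> lphi lh H; pose A := map_matrix r' phi; pose F := functional_matrix r' h.
have : (F^T <= A^T)%MS.
  rewrite submxE; apply/eqP/rowP => j; rewrite [RHS]mxE.
  pose c := (col j (cokermx A^T))^T.
  have cA : c *m A = 0.
    by apply: trmx_inj; rewrite trmx_mul trmxK colE mulmxA mulmx_coker mul0mx trmx0.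
  have := H (r' c); rewrite (map_matrixE lr' _ lphi) => /(_ cA).
  rewrite (functional_matrixE lr' _ lh) -/F => E.
  have -> : (F^T *m cokermx A^T) 0 j = (col j (F^T *m cokermx A^T)) 0 0 by rewrite [RHS]mxE.
  rewrite colE -mulmxA -colE -[RHS]E.
  have tr11 (B : 'M[K]_1) : B 0 0 = B^T 0 0 by rewrite mxE.
  by rewrite tr11 trmx_mul trmxK.
move=> /submxP[y yE]; exists (fun i => y 0 i) => v.
have FE : F = A *m y^T by apply: trmx_inj; rewrite trmx_mul trmxK.
rewrite -(rK v) (functional_matrixE lr' _ lh) -/F FE mulmxA -(map_matrixE lr' _ lphi) mxE.
by apply: eq_bigr => i _; rewrite [in LHS]mxE.
Qed.

(** A functional vanishing where both maps do is a combination of their coordinates; the part with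
    the coordinates of [phi2] is the one wanted. *)
Lemma glue_functional m1 m2 (phi1 : U -> 'rV[K]_m1) (phi2 : U -> 'rV[K]_m2) (h : U -> K) :
  linear phi1 -> linear phi2 -> linear (h : U -> K^o) -> (forall v, phi1 v = 0 -> phi2 v = 0 -> h v = 0) ->
  exists d : U -> K, [/\ linear (d : U -> K^o), forall v, phi1 v = 0 -> d v = h v & forall v, phi2 v = 0 -> d v = 0].
Proof.
move=> l1 l2 lh H; have [||b hE] := @factor_functional _ (fun v => row_mx (phi1 v) (phi2 v)) h _ lh.
- by move=> c u v; rewrite l1 l2 scale_row_mx add_row_mx.
- by move=> v; rewrite -row_mx0 => /eq_row_mx[? ?]; exact: H.
exists (fun v => \sum_j phi2 v 0 j * b (rshift m1 j)); split.
- move=> c u v; rewrite scaler_sumr -big_split; apply: eq_bigr => j _.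
  by rewrite l2 !mxE mulrDl -mulrA.
- move=> v v0; rewrite hE big_split_ord /= [X in X + _]big1 ?add0r => [|i _].
    by apply: eq_bigr => j _; rewrite row_mxEr.
  by rewrite row_mxEl v0 mxE mul0r.
by move=> v v0; apply: big1 => j _; rewrite v0 mxE mul0r.
Qed.

(** The projection is the identity minus [A] times its pseudo-inverse. *)
Lemma kernel_projection m (phi : U -> 'rV[K]_m) : linear phi -> cancel r' r ->
  exists pi : U -> U, [/\ linear pi, forall v, phi (pi v) = 0 & forall v, phi v = 0 -> pi v = v].
Proof.
move=> lphi r'K; pose A := map_matrix r' phi; pose P := 1%:M - A *m pinvmx A.
exists (fun v => r' (r v *m P)); split.
- by move=> c u v; rewrite lr mulmxDl -scalemxAl lr'.
- move=> v; rewrite (map_matrixE lr' _ lphi) -/A -mulmxA /P mulmxBl mul1mx mulmxKpV ?submx_refl //.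
  by rewrite subrr mulmx0.
move=> v v0; have rA : r v *m A = 0 by rewrite -(map_matrixE lr' _ lphi) rK.
by rewrite /P mulmxBr mulmx1 mulmxA rA mul0mx subr0 rK.
Qed.
End LinearExtension.

Lemma lin_mulr (R : comRingType) (c p1 p2 p3 d : R) : p1 = c * p2 + p3 -> p1 * d = c * (p2 * d) + p3 * d.
Proof. by move=> ->; ring. Qed.

Lemma sval_eq (X : Type) (P : X -> Prop) (a b : {x | P x}) : sval a = sval b -> a = b.
Proof. by case: a b => [a Pa] [b Pb] /= E; exact: eq_exist. Qed.

(** * Tangent vectors of line bundles *)

Section FibreTangents.
Context (R : realType).

Lemma push_to (X Y : space R) (p : X) (phi : X -> Y) y (v : tangent p) : smooth_map_at p phi -> phi p = y ->
  exists w : tangent y, forall f, smooth_at y f -> dv w f = dv v (f \o phi).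
Proof. by move=> s <-; exact: push_at. Qed.

Lemma line_derivation : exists d : @tangent R (euclid R 1) 0, dv d (fun t : 'rV[R]_1 => t 0 0) = 1.
Proof.
have sm f : smoothf (f : euclid R 1 -> R) -> exists2 w : 'rV[R]_1 -> R, Cinf w & \forall y \near (0 : 'rV[R]_1), f y = w y.
  by move=> sf; exact: euclid_smooth_at (sf 0).
have [|f g sf sg|d dE] := @der_make R (euclid R 1) 0 (fun f => 'D_(delta_mx 0 0) (f : 'rV[R]_1 -> R^o) 0).
- move=> a f g sf sg; have [w cw Ew] := sm f sf; have [w' cw' Ew'] := sm g sg.
  rewrite (near_eq_derive _ Ew) (near_eq_derive _ Ew').
  rewrite [LHS](@near_eq_derive _ _ _ _ (fun z => a * w z + w' z)); last first.
    by apply: filterS2 Ew Ew' => z /= -> ->.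
  have dw := Cinf_diff 0 cw; have dw' := Cinf_diff 0 cw'.
  rewrite deriveD; [|apply: diff_derivable; exact: (differentiableZ a dw)|exact: diff_derivable].
  by congr (_ + _); rewrite deriveZ //; exact: diff_derivable.
- have [w cw Ew] := sm f sf; have [w' cw' Ew'] := sm g sg.
  rewrite (near_eq_derive _ Ew) (near_eq_derive _ Ew').
  rewrite [LHS](@near_eq_derive _ _ _ _ (fun z => w z * w' z)); last first.
    by apply: filterS2 Ew Ew' => z /= -> ->.
  have dw := Cinf_diff 0 cw; have dw' := Cinf_diff 0 cw'.
  rewrite deriveM; try exact: diff_derivable.
  by rewrite -(nbhs_singleton Ew) -(nbhs_singleton Ew').
exists d; rewrite dE; first by rewrite derive_coord mxE eqxx.
by apply: (@smoothf_gen R (euclid R 1)); exists 0.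
Qed.

(** A frame identifies the total space near [q0] with a product of the base and a line, and a
    tangent vector of a product is determined by its two components. *)
Lemma line_tangent_eq (B : space R) (E : bundle B) W e l (q0 : tot E) (z z' : tangent q0) :
  is_vector_bundle 1 E -> is_frame W e l -> (\forall x \near (tag q0 : B), W x) ->
  (forall f : B -> R, smoothf f -> dv z (fun q => f (tag q)) = dv z' (fun q => f (tag q))) ->
  dv z l = dv z' l -> z = z'.
Proof.
move=> vE fr Wq H0 H1; have st := smooth_tag vE.
pose j (q : tot E) : prod_space B (euclid R 1) := (tag q : B, (\row_i l q) : 'rV[R]_1).
pose k (y : prod_space B (euclid R 1)) : tot E := Tot (y.2 0 0 *: e y.1).
have sj : smooth j.
  apply: smooth_pair => //; apply/smoothP => q; apply/smooth_map_atP => _ [i ->].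
  apply: smooth_at_ext (frame_coord fr q).
  by apply: near_all => r; rewrite /= mxE.
have sk : smooth_map_at (j q0) k.
  apply: (frame_smooth fr) => /=; first exact: nbhs_singleton Wq.
    by move: (j q0); apply/smoothP; exact: smooth_fst.
  apply: (smooth_at_ext (f := fun y : prod_space B (euclid R 1) => y.2 0 0 * l (Tot (e y.1)))).
    by apply: near_all => y; rewrite /k /= (frame_Z fr).
  apply: smooth_atM.
    apply: (@smooth_snd R B (euclid R 1) (fun t : 'rV[R]_1 => t 0 0)).
    by apply: (@smoothf_gen R (euclid R 1)); exists 0.
  apply: (smooth_comp (@smooth_fst R B (euclid R 1)) (frame_section fr) (frame_coord fr)).
have jk : \forall q \near q0, k (j q) = q.
  have /smoothP/(_ q0) st0 := st; apply: filterS (near_smooth st0 Wq) => -[x v] /= Wx.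
  by rewrite /k /= mxE -(frameE fr v Wx).
have E0 : dmap j z = dmap j z'.
  apply: dmap_pair_inj.
    rewrite -!(dmap_comp _ sj (@smooth_fst R B (euclid R 1))).
    apply: (@tangent_gen_eq R B) => f gf; have sf := smoothf_gen gf.
    by rewrite !(dmapEs _ st sf); exact: H0.
  rewrite -!(dmap_comp _ sj (@smooth_snd R B (euclid R 1))).
  have s2 : smooth ((snd : prod_space B (euclid R 1) -> euclid R 1) \o j) by exact: smooth_comp sj (@smooth_snd R _ _).
  apply: tangent_gen_eq => f gf; have sf := smoothf_gen gf; rewrite !(dmapEs _ s2 sf).
  case: gf => i ->; rewrite (ord1 i).
  have E1 (y : tangent q0) : dv y ((fun x : 'rV[R]_1 => x 0 0) \o ((snd : prod_space B (euclid R 1) -> euclid R 1) \o j)) = dv y l.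
    by apply: dv_near; apply: near_all => q /=; rewrite mxE.
  by rewrite !E1.
apply: tangent_gen_eq => h gh.
have sh : smooth_at (j q0) (h \o k) by apply: sk; exact: (smoothf_gen gh).
have E2 (y : tangent q0) : dv y h = dv (dmap j y) (h \o k).
  by rewrite (dmapE _ sj sh); apply: dv_near; apply: filterS jk => q /= ->.
by rewrite !E2 E0.
Qed.
End FibreTangents.

(** * Nondegeneracy and essential surjectivity *)

Section EssentiallySurjective.
Context (R : realType) (G : groupoid R) (L : vbg G).
Hypothesis hL : is_line_groupoid L.
Context (nabla : conn (vb0 L)) (cN : is_connection nabla).
Context (th : form1 L) (fth : is_form1 th) (mth : multiplicative th).
Context (ka : form2 (vb0 L)) (fka : is_form2 ka).
Let lG := line_lie hL.
Let gG := lie_groupoid lG.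
Let lL := line_tot_lie hL.
Let V := MK th.
Let TK := tot_groupoid V.
Let Om g (p q : V g) : L g := pairing nabla ka p q.
Let OmL g (p : V g) : linear (Om p) := pairing_lin hL cN fth fka p.
Let sl g : linear (@vsrc R G V g) := MK_vsrc_lin hL (th := th) (g := g).
Let tl g : linear (@vtgt R G V g) := MK_vtgt_lin hL fth (g := g).

Lemma right_shift_inj g (c c' : core V (tgt g)) : right_shift c = right_shift c' -> c = c'.
Proof.
move=> E; have m := mk_mul_cancelr hL mth (right_shift_mul hL fth c).
have m' := mk_mul_cancelr hL mth (right_shift_mul hL fth c'); rewrite E in m.
by apply: val_inj; apply: (@Tot_inj R _ V); exact: (mk_mul_fun hL m m').
Qed.

(** The target prescribes [psi] on the kernel of the source, while its source must be that of some
    pairing with [b]. The two demands meet on isotropic vectors, where [isotropy_solve] provides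
    [b]. The remaining difference is extended by 0 over the kernel of the target, so that the source
    is unchanged. *)
Lemma dual_surj g (chi : vb0 (dual L V) (tgt g)) : contact_nondegenerate nabla th ka g ->
  exists (psi : dual L V g) (a0 : vb0 V (src g)),
    vsrc (dual L V) psi = MR_ob nabla ka a0 /\ vtgt (dual L V) psi = chi.
Proof.
move=> Q; have [a [la fa]] := frame_at_exists hL (tgt g).
have [N [r [r' [rK r'K lr lr']]]] := MK_coordinates hL th g.
have [m1 [p1 [l1 E1]]] := src_functionals hL th g.
have [m2 [p2 [l2 E2]]] := tgt_functionals hL fth g.
have [pi [lpi pi0 piK]] := kernel_projection rK lr lr' l1 r'K.
have /boolp.choice[C CE] : forall v, exists c : core V (tgt g), right_shift c = pi v.
  by move=> v; apply: (right_shift_surj hL fth mth); apply/E1.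
have lC : linear C.
  move=> c u v; apply: right_shift_inj; rewrite CE lpi -!CE.
  by rewrite (right_shift_lin hL fth).
pose f1 v := la (Tot (sublv chi (C v))).
have lf1 : linear (f1 : V g -> R^o).
  by move=> c u v; rewrite /f1 lC homP (frame_at_lin fa).
have [b bE] := isotropy_solve hL cN fth fka fa Q lf1.
pose h v := f1 v - tcoord la (Om b v).
have lh : linear (h : V g -> R^o).
  move=> c u v; rewrite /h lf1 OmL (tcoord_lin hL fa) opprD addrACA -mulrBr //.
have [|d [ld d1 d2]] := glue_functional rK lr' l1 l2 lh.
  by move=> v /E1 sv /E2 tv; rewrite /h bE ?subrr.
pose f v : L g := Om b v + d v *: pull_section (@vtgt R G L) a g.
have lf : linear f.
  have ld' c u v : d (c *: u + v) = c * d u + d v by exact: ld.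
  move=> c u v; rewrite /f OmL ld' scalerDl -scalerA [c *: (Om b u + d u *: _)]scalerDr; exact: addrACA.
have fE v : sublv (mkhom f : dual L V g) v = f v by rewrite mkhomE.
exists (mkhom f : dual L V g), (vsrc V b); split.
  rewrite -(MR_src hL cN fth mth fka); apply: hom_eq => c.
  rewrite !(dual_srcE hL fth mth) fE (MR_arE hL cN fth fka); congr (- vsrc L _).
  by rewrite /f d2 ?scale0r ?addr0 //; apply/E2; exact: (left_shift_tgt hL fth mth).
apply: hom_eq => c; rewrite (dual_tgtE hL fth) fE.
have s0 : vsrc V (right_shift c) = 0 by exact: (right_shift_src hL fth mth).
rewrite (frame_atE fa (vtgt L _)) [RHS](frame_atE fa); congr (_ *: _).
rewrite -/(tcoord la _) /f (tcoordD hL fa) (tcoordZ hL fa) (tcoord1 hL fa) mulr1 d1; last exact/E1.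
rewrite /h addrC subrK /f1; congr (la (Tot (sublv chi _))).
by apply: right_shift_inj; rewrite CE piK //; exact/E1.
Qed.

Lemma core_sublv_smooth (X : section (core V)) : smooth_section X <-> smooth (fun x => Tot (sublv (X x)) : tot V).
Proof.
split=> [sX|/smoothP sX]; apply/smoothP => x; apply/smooth_map_atP => h.
  move=> gh; apply: (sX (fun c : tot (core V) => h (Tot (sublv (tagged c))))).
  by apply: (@smoothf_gen R (tot (core V))); exists h.
by case=> f gf ->; apply: (sX x f); exact: (smoothf_gen (X := tot V) gf).
Qed.

(** The tangent component is the differential of multiplication on the pair of a core vector and 0.
    Smoothness into the tangent bundle of composable pairs is tested through the two projections. *)
Lemma right_shift_smooth (X : section (core V)) : smooth_section X ->
  smooth_section (fun g : ar G => right_shift (X (tgt g)) : V g).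
Proof.
move=> /core_sublv_smooth sX.
have m g := right_shift_mul hL fth (X (tgt g)).
have /boolp.choice[z zE] : forall g : ar G, exists z : tot (TB (comp G)),
    [/\ Tmap (@comp1 R G) z = MKv (Tot (sublv (X (tgt g))) : ar TK), Tmap (@comp2 R G) z = TZ g
      & Tmap (@compm R G) z = MKv (Tot (right_shift (X (tgt g))) : ar TK)].
  by move=> g; have [[z zE] _ _] := m g; exists z.
apply/smoothP => g; apply: smooth_sum_at.
  have -> : (fun q : ar G => @Tot R _ (TB (ar G)) q (tagged (Tot (right_shift (X (tgt q))) : tot V)).1) = (fun q => Tmap (@compm R G) (z q)).
    by apply: boolp.funext => q; have [_ _ ->] := zE q.
  apply: smooth_at_Tmap; first exact: (compm_smooth lG).
  apply: smooth_at_TB_initial; apply: smooth_at_TB_pair.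
    have -> : (fun q => Tmap (fst : prod_space (ar G) (ar G) -> ar G) (Tmap (fun y : comp G => sval y : prod_space (ar G) (ar G)) (z q)))
      = (fun q => @Tot R _ (TB (ar G)) _ (sublv (X (tgt q))).1).
      apply: boolp.funext => q; have [E _ _] := zE q; refine (etrans _ E).
      by rewrite -Tmap_comp; [|exact: smooth_sval|exact: smooth_fst].
    have s : smooth_map_at g (fun q => Tot (sublv (X (tgt q))) : tot V).
      by move: g; apply/smoothP; exact: smooth_comp (tgt_smooth lG) sX.
    exact: smooth_sum_at1 s.
  have -> : (fun q => Tmap (snd : prod_space (ar G) (ar G) -> ar G) (Tmap (fun y : comp G => sval y : prod_space (ar G) (ar G)) (z q))) = (fun q => TZ q).
    apply: boolp.funext => q; have [_ <- _] := zE q.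
    by rewrite -Tmap_comp; [|exact: smooth_sval|exact: smooth_snd].
  by move: g; apply/smoothP; exact: smooth_section_zero_TB.
have -> : (fun q : ar G => Tot (tagged (Tot (right_shift (X (tgt q))) : tot V)).2) = (fun q => Tot (0 : L q)).
  apply: boolp.funext => q; congr Tot; apply: (vsrc_inj hL).
  have := right_shift_src hL fth mth (X (tgt q)) => /(congr1 snd) /= ->.
  by rewrite (lin_0 (vsrc_lin hL _)).
by move: g; apply/smoothP; exact: (smooth_section0 (line_vb hL)).
Qed.

Lemma dual_tgt_smooth : smooth (fun q : tot (dual L V) => Tot (vtgt (dual L V) (tagged q)) : tot (vb0 (dual L V))).
Proof.
apply/smoothP => q; apply/smooth_map_atP => h [] [].
  by move=> f sf ->; exact: (smooth_comp (@dual_tag_smooth R G L th) (tgt_smooth lG) sf q).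
move=> X [l [sX sl' ->]].
have s := dual_eval_smooth (right_shift_smooth sX) (fun y => vtgt_smooth hL sl' y).
apply: smooth_at_ext (s q); apply: near_all => r.
by rewrite -[RHS]/(l (Tot (sublv (vtgt (dual L V) (tagged r)) (X (tgt (tag r)))))) (dual_tgtE hL fth).
Qed.

Lemma dual0_eval_smooth (X : section (core V)) : smooth_section X ->
  smooth (fun q : tot (vb0 (dual L V)) => Tot (sublv (tagged q) (X (tag q))) : tot (vb0 L)).
Proof.
move=> sX; apply/smoothP => q; apply/smooth_map_atP => l gl.
by apply: (@smoothf_gen R (tot (vb0 (dual L V)))); right; exists X, l; split => //; exact: smoothf_gen.
Qed.

Lemma MK_vunt_smooth : smooth (fun q : tot (vb0 V) => Tot (vunt V (tagged q)) : tot V).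
Proof.
apply/smoothP => q; have sid : smooth_map_at q (fun r : tot (vb0 V) => r) by move=> f.
have s1 := smooth_sum_at1 sid; have s2 := smooth_sum_at2 sid.
apply: smooth_sum_at => /=; first exact: (smooth_at_Tmap (unt_smooth lG) s1).
exact: (smooth_map_at_comp s2 (proj1 (smoothP _) (unt_smooth lL) _)).
Qed.

(** A frame of the Morita kernel along the units is projected to the core; projecting the expansion
    of a core vector reproduces it. The result need not be linearly independent. *)
Lemma core_frame x0 : exists N (X : 'I_N -> section (core V)) (co : 'I_N -> tot V -> R),
  [/\ forall i, smooth_section (X i), forall i, smoothf (co i), forall i x, linear (fun c : core V x => co i (Tot (sublv c)) : R^o)
    & \forall x \near (x0 : ob G), forall c : core V x, c = \sum_i co i (Tot (sublv c)) *: X i x].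
Proof.
have [N [B [co [sB sco lco Be _]]]] := MK_frame hL th (unt x0).
pose D x (v : V (unt x)) : vb0 V x := fibat x (src (Tot v : ar TK)).
have DE x (v : V (unt x)) : Tot (D x v) = src (Tot v : ar TK) by rewrite /D fibatK //= (src_unt gG).
have lD x : linear (D x).
  move=> c u v; apply: (@Tot_inj R _ (vb0 V)); rewrite DE.
  transitivity (Tot (c *: vsrc V u + vsrc V v)); first by rewrite -sl.
  by apply/esym; apply: Tot_lin; rewrite DE.
have prE x (v : V (unt x)) := @pr_coreE R G L hL th x v _ (DE x v).
exists N, (fun i x => pr_core (B i (unt x))), co; split => [i||i x c v w|]; [|exact: sco|exact: (lco i (unt x))|].
- apply/core_sublv_smooth/smoothP => x.
  have s1 : smooth_map_at x (fun y : ob G => Tot (B i (unt y)) : tot V).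
    by move: x; apply/smoothP; exact: smooth_comp (unt_smooth lG) (sB i).
  have s2 : smooth_map_at x (fun y : ob G => Tot (vunt V (D y (B i (unt y)))) : tot V).
    have s := smooth_map_at_comp (smooth_map_at_comp s1 (proj1 (smoothP _) (MK_vsrc_smooth hL (th := th)) _)) (proj1 (smoothP _) MK_vunt_smooth _).
    apply: smooth_map_at_ext s; apply: near_all => y.
    by rewrite -[RHS]/(unt (Tot (D y (B i (unt y))) : ob TK)) DE.
  have su : smooth_map_at x (fun y : ob G => unt y) by have /smoothP := unt_smooth lG; exact.
  have := @MK_smooth_lin R G L hL th (ob G) x 2 (fun y => unt y) (fun j _ => if j == 0 then 1 else -1)
    (fun j y => if j == 0 then B i (unt y) else vunt V (D y (B i (unt y)))) su.
  move=> H; refine (smooth_map_at_ext _ (H _ _)) => [|j|j]; [|by case: (j == 0); exact: smooth_at_cst|by case: (j == 0)].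
  apply: near_all => y; congr Tot.
  by rewrite !big_ord_recl big_ord0 /= scale1r scaleN1r addr0 prE.
have := near_smooth (proj1 (smoothP _) (unt_smooth lG) x0) Be.
apply: filterS => x Bx c; apply: val_inj => /=.
have -> : sublv (\sum_i co i (Tot (sublv c)) *: pr_core (B i (unt x))) = \sum_i co i (Tot (sublv c)) *: sublv (pr_core (B i (unt x))).
  by elim/big_rec2: _ => // i u v _ <-.
under eq_bigr => i _ do rewrite prE scalerBr -(lin_Z (MK_vunt_lin hL (th := th) (x := x))) -(lin_Z (lD x)).
rewrite sumrB -Bx -(lin_sum (MK_vunt_lin hL (th := th) (x := x))) -(lin_sum (lD x)) -Bx.
have -> : D x (sublv c) = 0.
  apply: (@Tot_inj R _ (vb0 V)); rewrite DE.
  transitivity (Tot (0 : vb0 V (src (unt x)))); first exact: (congr1 (fun A => Tot A) (core_src0 hL c)).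
  by apply: (@Tot0 R (ob G) (vb0 V)); rewrite (src_unt gG).
by rewrite (lin_0 (MK_vunt_lin hL (th := th) (x := x))) subr0.
Qed.

Lemma dual0_tangent_eq (q : tot (vb0 (dual L V))) a la (u u' : tangent q) : frame_at (tag q) a la ->
  (forall f : ob G -> R, smoothf f -> dv u (fun r => f (tag r)) = dv u' (fun r => f (tag r))) ->
  (forall X : section (core V), smooth_section X ->
     dv u (fun r => la (Tot (sublv (tagged r) (X (tag r))))) = dv u' (fun r => la (Tot (sublv (tagged r) (X (tag r)))))) ->
  u = u'.
Proof.
move=> [W [fr Wq]] H0 H1; apply: tangent_gen_eq => h [] [].
  by move=> f sf ->; exact: H0.
move=> X [l [sX sl' ->]]; have sE := dual0_eval_smooth sX.
pose E (r : tot (vb0 (dual L V))) : tot (vb0 L) := Tot (sublv (tagged r) (X (tag r))).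
have EE (y : tangent q) f : smoothf f -> dv y (fun r => f (E r)) = dv (dmap E y) f by move=> sf; rewrite (dmapEs _ sE sf).
refine (etrans (EE u l sl') (etrans _ (esym (EE u' l sl')))); congr (dv _ l).
apply: (line_tangent_eq (line_vb0 hL) fr) => // [f sf|].
  have sf' : smoothf (fun r : tot (vb0 L) => f (tag r)) by exact: (smooth_tag (line_vb0 hL) sf).
  by refine (etrans (esym (EE u _ sf')) (etrans _ (EE u' _ sf'))); exact: H0.
by refine (etrans (esym (EE u _ (frame_coord fr))) (etrans _ (EE u' _ (frame_coord fr)))); exact: H1.
Qed.

Lemma dual0_vertical (q : tot (vb0 (dual L V))) a la (u : tangent q) : frame_at (tag q) a la ->
  (forall f : ob G -> R, smoothf f -> dv u (fun r => f (tag r)) = 0) ->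
  exists chi : vb0 (dual L V) (tag q), forall X : section (core V), smooth_section X ->
    dv u (fun r => la (Tot (sublv (tagged r) (X (tag r))))) = la (Tot (sublv chi (X (tag q)))).
Proof.
move=> fa H0; have [N [Y [co [sY sco lco Yn]]]] := core_frame (tag q).
pose y i (r : tot (vb0 (dual L V))) : R := la (Tot (sublv (tagged r) (Y i (tag r)))).
have sy i : smoothf (y i) by exact: (dual0_eval_smooth (sY i) (frame_at_coord fa)).
pose chi (c : core V (tag q)) : vb0 L (tag q) := (\sum_i co i (Tot (sublv c)) * dv u (y i)) *: a (tag q).
have lchi : linear chi.
  move=> c v w; rewrite /chi scalerA -scalerDl; congr (_ *: _).
  rewrite mulr_sumr -big_split; apply: eq_bigr => i _.
  exact: lin_mulr (lco i (tag q) c v w).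
exists (mkhom chi) => X sX; rewrite mkhomE //.
rewrite (frame_at_Z fa) (frame_at_1 fa) mulr1.
have sc i : smoothf (fun x : ob G => co i (Tot (sublv (X x)))).
  by have /core_sublv_smooth s := sX; exact: s _ (sco i).
have sc' i : smoothf (fun r : tot (vb0 (dual L V)) => co i (Tot (sublv (X (tag r))))).
  exact: (@dual0_tag_smooth R G L th _ (sc i)).
transitivity (dv u (fun r => \sum_i co i (Tot (sublv (X (tag r)))) * y i r)).
  apply: dv_near; apply: filterS (near_smooth (proj1 (smoothP _) (@dual0_tag_smooth R G L th) q) Yn) => r Yr.
  rewrite {1}(Yr (X (tag r))).
  have l1 : linear (fun c : core V (tag r) => la (Tot (sublv (tagged r) c)) : R^o).
    by move=> c v w; rewrite homP (frame_at_lin fa).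
  by rewrite (lin_sum l1); apply: eq_bigr => i _; rewrite (lin_Z l1).
rewrite dv_sum => [|i]; last by apply: smooth_atM; [exact: sc'|exact: sy].
apply: eq_bigr => i _; rewrite dvM; [|exact: sc'|exact: sy].
by rewrite (H0 _ (sc i)) mulr0 addr0.
Qed.

Let S : set (prod_space (tot (dual L V)) (tot (vb0 V))) :=
  [set q | Tot (vsrc (dual L V) (tagged q.1)) = Tot (MR_ob nabla ka (tagged q.2))].
Let T (q : sub S) : tot (vb0 (dual L V)) := Tot (vtgt (dual L V) (tagged (sval q).1)).

Lemma comma_tgt_smooth : smooth T.
Proof. exact: smooth_comp (smooth_comp (@smooth_sval R _ S) (@smooth_fst R _ _)) dual_tgt_smooth. Qed.

Lemma dual_src_lin g : linear (@vsrc R G (dual L V) g).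
Proof.
move=> c p q; apply: hom_eq => d.
rewrite [RHS]sublv_hom_lin !(dual_srcE hL fth mth) sublv_hom_lin (vsrc_lin hL).
by rewrite opprD scalerN.
Qed.

Lemma dual_tgt_lin g : linear (@vtgt R G (dual L V) g).
Proof.
move=> c p q; apply: hom_eq => d.
by rewrite [RHS]sublv_hom_lin !(dual_tgtE hL fth) sublv_hom_lin (vtgt_lin hL).
Qed.

(** [psi] differs from the pairing with [b0] by a functional vanishing on the kernel of the target,
    hence a combination of coordinates of the target. Keeping the coefficients [be] and those of
    [b0] constant extends both parts to nearby arrows, and the source condition persists. *)
Lemma comma_section g (psi : dual L V g) (a0 : vb0 V (src g)) : vsrc (dual L V) psi = MR_ob nabla ka a0 ->
  exists eps : ar G -> sub S, [/\ smooth_map_at g eps, sval (eps g) = (Tot psi, Tot a0)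
    & forall h, tag (sval (eps h)).1 = h].
Proof.
have [b0 <-] := MK_src_surj hL a0 => E0.
have [N [B [co [sB sco lco Be _]]]] := MK_frame hL th g.
have [m [k [sk lk ki]]] := MK0_coframe hL th (tgt g).
have [a [la fa]] := frame_at_exists hL (tgt g).
have [M [r [r' [rK r'K lr lr']]]] := MK_coordinates hL th g.
pose b h : V h := \sum_i co i (Tot b0) *: B i h.
have bE : b g = b0 by rewrite [RHS](nbhs_singleton Be).
pose e := pull_section (@vtgt R G L) a.
pose phi (v : V g) := \row_i k i (Tot (vtgt V v)).
have lphi : linear phi by move=> c u v; apply/rowP => i; rewrite !mxE tl lk.
pose h (v : V g) := tcoord la (sublv psi v - Om b0 v).
have lh : linear (h : V g -> R^o).
  by move=> c u v; rewrite /h (lin_sub (homP psi) (OmL b0)) (tcoord_lin hL fa).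
have [|be hE] := factor_functional rK lr' lphi lh.
  move=> v v0; rewrite /h (dual_src_vanish hL cN fth mth fka E0) ?subrr ?(tcoord0 hL fa) //.
  by apply: (nbhs_singleton ki) => i; have := congr1 (fun x : 'rV[R]_m => x 0 i) v0; rewrite !mxE => ->; rewrite (lin_0 (lk i (tgt g))).
pose chi y (v : V y) : L y := (\sum_i k i (Tot (vtgt V v)) * be i) *: e y.
have lchi y : linear (chi y).
  move=> c u v; rewrite /chi scalerA -scalerDl; congr (_ *: _).
  rewrite mulr_sumr -big_split; apply: eq_bigr => i _; apply: lin_mulr.
  by rewrite tl lk.
pose psi1 y : dual L V y := MR_ar nabla ka (b y) + mkhom (chi y).
have psi1E y v : sublv (psi1 y) v = Om (b y) v + chi y v.
  by rewrite -[LHS]/(sublv (MR_ar nabla ka (b y)) v + sublv (mkhom (chi y)) v) (MR_arE hL cN fth fka) mkhomE.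
have Seps y : S (Tot (psi1 y), Tot (vsrc V (b y))).
  have E1 : vsrc (dual L V) (psi1 y) = MR_ob nabla ka (vsrc V (b y)).
    rewrite (lin_D (@dual_src_lin y)) (MR_src hL cN fth mth fka).
    suff -> : vsrc (dual L V) (mkhom (chi y) : dual L V y) = 0 by rewrite addr0.
    apply: hom_eq => c; rewrite (dual_srcE hL fth mth) mkhomE // /chi (left_shift_tgt hL fth mth).
    rewrite big1 ?scale0r ?(lin_0 (vsrc_lin hL _)) ?oppr0 // => i _.
    by rewrite (lin_0 (lk i (tgt y))) mul0r.
  exact: (congr1 (fun A => Tot A) E1).
exists (fun y => exist _ (Tot (psi1 y), Tot (vsrc V (b y))) (Seps y)); split => //.
  apply/(@smooth_map_at_initial R _ (ar G) (prod_space (tot (dual L V)) (tot (vb0 V))) (fun q : {x | S x} => sval q)).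
  have sb : smooth_map_at g (fun y => Tot (b y) : tot V).
    apply: (@MK_smooth_lin R G L hL th _ g N id) => [//|i|i]; first exact: smooth_at_cst.
    by move: (sB i) => /smoothP; exact.
  apply: smooth_map_at_pair; last exact: (smooth_map_at_comp sb (proj1 (smoothP _) (MK_vsrc_smooth hL (th := th)) _)).
  apply/smooth_map_atP => f [] [].
    by move=> f' sf' ->; exact: sf'.
  move=> X [l [/smoothP sX sl' ->]].
  have se : smooth_section e by exact: (pull_section_smooth (line_vb hL) (line_vb0 hL) (vtgt_smooth hL) (vtgt_lin hL) (vtgt_inj hL) (frame_at_section fa)).
  have sO := smooth_pairing_at hL cN fth fka sb (sX g).
  have sc : smooth_at g (fun y => \sum_i k i (Tot (vtgt V (X y))) * be i).
    apply: smooth_at_sum => i _; apply: smooth_atM; last exact: smooth_at_cst.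
    have s := smooth_map_at_comp (sX g) (proj1 (smoothP _) (MK_vtgt_smooth hL fth) _).
    exact: (s _ (sk i _)).
  have sid : smooth_map_at g (fun y : ar G => y) by [].
  have s := line_smooth_comb (line_vb hL) sid (smooth_at_cst g 1) sc sO (proj1 (smoothP _) se g).
  apply: smooth_at_ext (s _ (sl' _)); apply: near_all => y.
  transitivity (l (Tot (sublv (psi1 y) (X y)))) => //.
  by rewrite psi1E /= scale1r.
congr (_, _); congr Tot; last by rewrite bE.
apply: hom_eq => v; rewrite psi1E /chi bE; apply: (tcoord_inj hL fa).
rewrite (tcoordD hL fa) (tcoordZ hL fa) (tcoord1 hL fa) mulr1.
have -> : \sum_i k i (Tot (vtgt V v)) * be i = h v.
  by rewrite hE; apply: eq_bigr => i _; rewrite mxE.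
by rewrite /h (tcoordB hL fa (sublv psi v) (Om b0 v)) [LHS]addrC subrK.
Qed.

(** The condition relating [psi] and [a0] is linear in each fibre, so the affine line through a
    solution in the direction of another stays in the space. *)
Lemma comma_line g (psi psi' : dual L V g) (a0 a0' : vb0 V (src g)) :
  vsrc (dual L V) psi = MR_ob nabla ka a0 -> vsrc (dual L V) psi' = MR_ob nabla ka a0' ->
  exists ga : euclid R 1 -> sub S, @smooth_map_at R (euclid R 1) (sub S) 0 ga /\
    forall t : 'rV[R]_1, sval (ga t) = (Tot (psi + t 0 0 *: psi'), Tot (a0 + t 0 0 *: a0')).
Proof.
move=> E E'.
have Sga (t : 'rV[R]_1) : S (Tot (psi + t 0 0 *: psi'), Tot (a0 + t 0 0 *: a0')).
  have E1 : vsrc (dual L V) (psi + t 0 0 *: psi') = MR_ob nabla ka (a0 + t 0 0 *: a0').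
    rewrite addrC dual_src_lin E E' addrC.
    by rewrite [in RHS]addrC (MR_ob_lin hL cN fth mth fka) addrC.
  exact: (congr1 (fun A => Tot A) E1).
exists (fun t => exist _ _ (Sga t)); split => //.
apply/(@smooth_map_at_initial R _ (euclid R 1) (prod_space (tot (dual L V)) (tot (vb0 V))) (fun q : {x | S x} => sval q)).
have st : @smooth_at R (euclid R 1) 0 (fun t : 'rV[R]_1 => t 0 0).
  by apply: (@smoothf_gen R (euclid R 1)); exists 0.
have cst (Y : space R) (y : Y) : @smooth_map_at R (euclid R 1) Y 0 (fun _ => y) by move=> f _; exact: smooth_at_cst.
apply: smooth_map_at_pair.
  apply/smooth_map_atP => f [] [].
    by move=> f' sf' ->; exact: (smooth_at_cst _ (f' g)).
  move=> X [l [sX sl' ->]].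
  have s := line_smooth_comb (line_vb hL) (cst _ g) (smooth_at_cst _ 1) st (cst _ (Tot (sublv psi (X g)))) (cst _ (Tot (sublv psi' (X g)))).
  apply: smooth_at_ext (s _ (sl' _)); apply: near_all => t.
  by rewrite /= scale1r.
apply: smooth_sum_at.
  have := @smooth_at_TB_lin R (euclid R 1) (ob G) 0 2 (fun _ => src g) (fun j (t : 'rV[R]_1) => if j == 0 then 1 else t 0 0)
    (fun j t => if j == 0 then a0.1 else a0'.1) (cst _ _).
  move=> H; refine (smooth_map_at_ext _ (H _ _)) => [|j|j]; last by exact: cst.
    by apply: near_all => t; congr (@Tot _ _ (TB (ob G)) _ _); rewrite !big_ord_recl big_ord0 /= scale1r addr0.
  by case: (j == 0); [exact: smooth_at_cst|exact: st].
have s := line_smooth_comb (line_vb0 hL) (cst _ (src g)) (smooth_at_cst _ 1) st (cst _ (Tot a0.2)) (cst _ (Tot a0'.2)).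
by apply: smooth_map_at_ext s; apply: near_all => t; rewrite scale1r.
Qed.

(** A tangent vector [w] is split in two. Its base component lifts through the target submersion of
    [G] and then along [comma_section]. The vertical remainder is a fibre element [chi], reached by
    [dual_surj] and the velocity of [comma_line]. *)
Lemma nondegenerate_essentially_surjective : (forall g, contact_nondegenerate nabla th ka g) ->
  essentially_surjective (tot_gmap (MR nabla th ka)).
Proof.
move=> Q; split.
  move=> [x chi].
  have [g gE] : exists g : ar G, tgt g = x by exists (unt x); exact: (tgt_unt gG).
  case: _ / gE chi => chi; have [psi [a0 [E0 E1]]] := dual_surj chi (Q g).
  have SE : S (Tot psi, Tot a0) by exact: (congr1 (fun A => Tot A) E0).
  by exists (exist _ _ SE); exact: (congr1 (fun A => Tot A) E1).
have sT := comma_tgt_smooth; split; first exact: sT.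
move=> p w.
have [g [psi [a0 [E0 pE]]]] : exists g (psi : dual L V g) (a0 : vb0 V (src g)),
    vsrc (dual L V) psi = MR_ob nabla ka a0 /\ sval p = (Tot psi, Tot a0).
  case: p w => -[[g psi] [x a0]] E w.
  have ex : src g = x by exact: (congr1 (fun q : tot (vb0 (dual L V)) => tag q) E).
  suff : exists g' (psi' : dual L V g') (a0' : vb0 V (src g')), vsrc (dual L V) psi' = MR_ob nabla ka a0' /\
    ((Tot psi, Tot a0) : prod_space (tot (dual L V)) (tot (vb0 V))) = (Tot psi', Tot a0') by exact.
  have E' : Tot (vsrc (dual L V) psi) = Tot (MR_ob nabla ka a0) by exact: E.
  case: _ / ex a0 E' {E w} => a0 E'; exists g, psi, a0; split => //.
  exact: (@Tot_inj R _ (vb0 (dual L V)) _ _ _ E').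
have SE : S (Tot psi, Tot a0) by exact: (congr1 (fun A => Tot A) E0).
pose p' : sub S := exist _ _ SE; have pp : p' = p by exact: sval_eq.
case: _ / pp w {pE} => w.
have [eps [seps epsg epst]] := comma_section E0.
have pe : eps g = p' by exact: sval_eq.
have [v vE] : exists v : tangent g, forall f : ob G -> R, smoothf f ->
    dv v (f \o @tgt R G) = dv (w : tangent (T p')) (fun q => f (tag q)).
  have [w' w'E] := push_to (w : tangent (T p')) (proj1 (smoothP _) (@dual0_tag_smooth R G L th) _) (erefl (tgt g)).
  have [_ /(_ g w')[v vw]] := tgt_submersion lG; exists v => f sf.
  by rewrite -(dmapEs _ (tgt_smooth lG) sf) vw w'E //; exact: sf.
have [v1 v1E] := push_to v seps pe.
have [a [la fa]] := frame_at_exists hL (tgt g).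
have H0 f : smoothf f -> dv ((w : tangent (T p')) - dmap T v1) (fun r : tot (vb0 (dual L V)) => f (tag r)) = 0.
  move=> sf; have sf' : smoothf (fun q : tot (vb0 (dual L V)) => f (tag q)) by exact: (@dual0_tag_smooth R G L th _ sf).
  rewrite dv_add dv_opp (dmapEs _ sT sf') v1E; last exact: (sT _ sf').
  rewrite -(vE _ sf) (@dv_near R _ g v _ (f \o @tgt R G)) ?subrr //.
  by apply: near_all => y /=; rewrite epst.
have [chi chiE] := @dual0_vertical (T p') a la _ fa H0.
have [psi' [a0' [E0' E1']]] := dual_surj (chi : vb0 (dual L V) (tgt g)) (Q g).
have [ga [sga gaE]] := comma_line E0 E0'.
have ga0 : ga 0 = p'.
  by apply: sval_eq; rewrite gaE mxE !scale0r !addr0.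
have [d d1] := line_derivation R.
have [v2 v2E] := push_to d sga ga0.
exists (v1 + v2); rewrite -[dmap _ _]/(dmap T (v1 + v2)) (lin_D (dmap_lin sT (p := p'))).
suff -> : dmap T v2 = w - dmap T v1 by rewrite addrC subrK.
have TgaE t : T (ga t) = Tot (vtgt (dual L V) psi + t 0 0 *: chi).
  have E2 : vtgt (dual L V) (psi + t 0 0 *: psi') = vtgt (dual L V) psi + t 0 0 *: chi.
    by rewrite addrC dual_tgt_lin E1' addrC.
  by rewrite /T gaE; exact: (congr1 (fun A => Tot A) E2).
apply: (@dual0_tangent_eq (T p') a la _ _ fa) => [f sf|X sX].
  have sf' : smoothf (fun q : tot (vb0 (dual L V)) => f (tag q)) by exact: (@dual0_tag_smooth R G L th _ sf).
  rewrite H0 // (dmapEs _ sT sf') v2E; last exact: (sT _ sf').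
  rewrite (@dv_near R _ _ d _ (fun _ => f (tgt g))) ?dv_cst //.
  by apply: near_all => t; transitivity (f (tag (T (ga t)))) => //; rewrite TgaE.
have sf' := dual0_eval_smooth sX (frame_at_coord fa).
rewrite chiE // (dmapEs _ sT sf') v2E; last exact: (sT _ sf').
pose c := la (Tot (sublv (vtgt (dual L V) psi) (X (tgt g)))); pose c' := la (Tot (sublv chi (X (tgt g)))).
rewrite (@dv_near R _ _ d _ (fun t : 'rV[R]_1 => c + c' * t 0 0)); last first.
  apply: near_all => t; transitivity (la (Tot (sublv (tagged (T (ga t))) (X (tag (T (ga t))))))) => //.
  transitivity (la (Tot (t 0 0 *: sublv chi (X (tgt g)) + sublv (vtgt (dual L V) psi) (X (tgt g))))).
    by rewrite TgaE; congr (la (Tot _)); exact: addrC.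
  by rewrite (frame_at_lin fa) addrC mulrC.
have st : @smooth_at R (euclid R 1) 0 (fun t : 'rV[R]_1 => t 0 0).
  by apply: (@smoothf_gen R (euclid R 1)); exists 0.
by rewrite dvD ?dv_cst ?dvZ ?d1 ?add0r ?mulr1 //; [exact: smooth_at_cst|exact: smooth_atZ].
Qed.
End EssentiallySurjective.

(** * Invariance under VB Morita maps *)

Section Translation.
Context (R : realType) (G : groupoid R) (L : vbg G).
Hypothesis hL : is_line_groupoid L.
Context (nabla : conn (vb0 L)) (cN : is_connection nabla).
Context (th : form1 L) (fth : is_form1 th) (mth : multiplicative th).
Context (ka : form2 (vb0 L)) (fka : is_form2 ka).
Let lG := line_lie hL.
Let gG := lie_groupoid lG.
Let V := MK th.
Let TK := tot_groupoid V.
Let Om g (p q : V g) : L g := pairing nabla ka p q.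
Let OmLl g (q : V g) : linear (fun p => Om p q) := Om_linl hL cN fth fka q.

Lemma Tot_at (B : space R) (E : bundle B) (q : tot E) x : tag q = x -> exists v : E x, q = Tot v.
Proof. by case: q => y v /= e; case: _ / e; exists v. Qed.

Lemma Tot_tgt_eq0 g x (p : V g) : tgt (Tot p : ar TK) = Tot (0 : vb0 V x) -> vtgt V p = 0.
Proof. exact: (@Tot_eq0 R _ (vb0 V) (tgt g) x). Qed.

Lemma Tot_src_eq0 g x (p : V g) : src (Tot p : ar TK) = Tot (0 : vb0 V x) -> vsrc V p = 0.
Proof. exact: (@Tot_eq0 R _ (vb0 V) (src g) x). Qed.

Lemma Tot_tgt0 g (p : V g) : vtgt V p = 0 -> tgt (Tot p : ar TK) = Tot (0 : vb0 V (tgt g)).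
Proof. by move=> E; exact: (congr1 (fun A => Tot A) E). Qed.

Lemma Tot_src0 g (p : V g) : vsrc V p = 0 -> src (Tot p : ar TK) = Tot (0 : vb0 V (src g)).
Proof. by move=> E; exact: (congr1 (fun A => Tot A) E). Qed.

Lemma MK_zero_inv_inv k : inv (Tot (0 : V (inv k)) : ar TK) = Tot (0 : V k).
Proof. by rewrite (MK_zero_inv hL fth); apply: (@Tot0 R _ V); exact: (inv_inv gG). Qed.

Lemma mk_mul_zero g k : src g = tgt k -> mk_mul (Tot (0 : V g) : ar TK) (Tot (0 : V k) : ar TK) (Tot (0 : V (mul g k)) : ar TK).
Proof.
move=> e; have s : src (Tot (0 : V g) : ar TK) = tgt (Tot (0 : V k) : ar TK).
  by rewrite (MK_zero_src hL) (MK_zero_tgt hL fth); apply: (@Tot0 R _ (vb0 V)).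
have m := mk_mul_mul hL s.
have [p pE] := Tot_at (erefl (tag (mul (Tot (0 : V g) : ar TK) (Tot (0 : V k) : ar TK)))).
have {}m : mk_mul (Tot (0 : V g) : ar TK) (Tot (0 : V k) : ar TK) (Tot (p : V (mul g k)) : ar TK) by rewrite -pE.
by have := mk_mul_lin hL fth (-1) m m; rewrite !scaler0 !addr0 scaleN1r addNr.
Qed.

(** Right multiplication by the zero vector over [k] carries isotropic vectors to isotropic vectors
    and is undone by the zero vector over [inv k]. By multiplicativity it preserves pairings, since
    zero contributes nothing. *)
Lemma nondegenerate_mulr g k : src g = tgt k -> contact_nondegenerate nabla th ka g ->
  contact_nondegenerate nabla th ka (mul g k).
Proof.
move=> e [Q1 Q2]; have [a [la fa]] := frame_at_exists hL (tgt g); have [b [lb fb]] := frame_at_exists hL (src g).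
have shift (i : V g) (j : V (mul g k)) (d : V g) (d' : V k) (u : V (mul g k)) : mk_mul (Tot i : ar TK) (Tot (0 : V k) : ar TK) (Tot j : ar TK) ->
    mk_mul (Tot d : ar TK) (Tot d' : ar TK) (Tot u : ar TK) -> tcoord la (Om j u) = tcoord la (Om i d).
  move=> m m'; rewrite (pairing_mk_mul hL cN fth mth ka m m' fa fb).
  by rewrite [pairing nabla ka 0 d'](lin_0 (OmLl d')) (tcoord0 hL fb) mulr0 addr0.
split=> [j [sj tj] H|u H].
  have s : src (Tot j : ar TK) = tgt (Tot (0 : V (inv k)) : ar TK).
    rewrite (Tot_src0 sj) (MK_zero_tgt hL fth); apply: (@Tot0 R _ (vb0 V)).
    by rewrite (src_mul gG e) (tgt_inv gG).
  have m := mk_mul_mul hL s.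
  have [|i iE] := @Tot_at (ar G) V (mul (Tot j : ar TK) (Tot (0 : V (inv k)) : ar TK)) g; first exact: (mulK gG e).
  rewrite iE in m; have := mk_mul_cancelr hL mth m; rewrite MK_zero_inv_inv => {}m.
  have [E1 E2 E3] := mk_mul_ends hL mth m.
  have i0 : i = 0.
    apply: Q1; first split.
    - by move: E1; rewrite (MK_zero_tgt hL fth) => /Tot_src_eq0.
    - by apply: Tot_tgt_eq0; rewrite -E3; exact: Tot_tgt0.
    move=> d; have [d' dE] := MK_tgt_surj hL (fibat (tgt k) (src (Tot d : ar TK)) : vb0 V (tgt k)).
    have s' : src (Tot d : ar TK) = tgt (Tot d' : ar TK).
      by rewrite -[RHS]/(Tot (vtgt V d')) dE fibatK.
    have m' := mk_mul_mul hL s'.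
    have [u uE] := @Tot_at (ar G) V (mul (Tot d : ar TK) (Tot d' : ar TK)) (mul g k) (erefl _).
    rewrite uE in m'; apply: (tcoord_inj hL fa); rewrite -[pairing _ _ _ _]/(Om i d) -(shift _ _ _ _ _ m m').
    by rewrite [Om j u]H !(tcoord0 hL fa).
  rewrite i0 in m.
  by apply: (@Tot_inj R _ V); exact: (mk_mul_fun hL m (mk_mul_zero e)).
have [d [d' m]] := MK_decompose hL mth u e.
have [|p [q [sp tq dE]]] := Q2 d.
  move=> i [si ti].
  have s : src (Tot i : ar TK) = tgt (Tot (0 : V k) : ar TK).
    by rewrite (Tot_src0 si) (MK_zero_tgt hL fth); apply: (@Tot0 R _ (vb0 V)).
  have mi := mk_mul_mul hL s.
  have [j jE] := @Tot_at (ar G) V (mul (Tot i : ar TK) (Tot (0 : V k) : ar TK)) (mul g k) (erefl _).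
  rewrite jE in mi; apply: (tcoord_inj hL fa); rewrite -[pairing _ _ _ _]/(Om i d) -(shift _ _ _ _ _ mi m) (tcoord0 hL fa).
  have [E1 E2 E3] := mk_mul_ends hL mth mi.
  rewrite [Om j u]H ?(tcoord0 hL fa) //; split.
    by move: E2; rewrite (MK_zero_src hL) => /Tot_src_eq0.
  by apply: Tot_tgt_eq0; rewrite E3; exact: Tot_tgt0.
have s : src (Tot p : ar TK) = tgt (Tot (0 : V k) : ar TK).
  by rewrite (Tot_src0 sp) (MK_zero_tgt hL fth); apply: (@Tot0 R _ (vb0 V)).
have mp := mk_mul_mul hL s.
have [j jE] := @Tot_at (ar G) V (mul (Tot p : ar TK) (Tot (0 : V k) : ar TK)) (mul g k) (erefl _).
rewrite jE in mp; have := mk_mul_lin hL fth (-1) mp m; rewrite scaler0 add0r !scaleN1r dE addKr => mq.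
have [_ E1 _] := mk_mul_ends hL mth mp; have [_ _ E2] := mk_mul_ends hL mth mq.
exists j, (- j + u); split; last by rewrite addrA subrr add0r.
  by move: E1; rewrite (MK_zero_src hL) => /Tot_src_eq0.
by apply: Tot_tgt_eq0; rewrite E2; exact: Tot_tgt0.
Qed.

(** The mirror image; pairings now change by the nonvanishing factor [frame_ratio la b k]. *)
Lemma nondegenerate_mull g k : src k = tgt g -> contact_nondegenerate nabla th ka g ->
  contact_nondegenerate nabla th ka (mul k g).
Proof.
move=> e [Q1 Q2]; have [a [la fa]] := frame_at_exists hL (tgt k); have [b [lb fb]] := frame_at_exists hL (src k).
have fg : frame_at (tgt g) b lb by rewrite -e.
have r0 := ratio_neq0 hL fa fb.
have shift (i : V g) (j : V (mul k g)) (d : V g) (d' : V k) (u : V (mul k g)) : mk_mul (Tot (0 : V k) : ar TK) (Tot i : ar TK) (Tot j : ar TK) ->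
    mk_mul (Tot d' : ar TK) (Tot d : ar TK) (Tot u : ar TK) -> tcoord la (Om j u) = frame_ratio la b k * tcoord lb (Om i d).
  move=> m m'; rewrite (pairing_mk_mul hL cN fth mth ka m m' fa fb).
  by rewrite [pairing nabla ka 0 d'](lin_0 (OmLl d')) (tcoord0 hL fa) add0r.
split=> [j [sj tj] H|u H].
  have s : src (Tot (0 : V (inv k)) : ar TK) = tgt (Tot j : ar TK).
    rewrite (Tot_tgt0 tj) (MK_zero_src hL); apply: (@Tot0 R _ (vb0 V)).
    by rewrite (tgt_mul gG e) (src_inv gG).
  have m := mk_mul_mul hL s.
  have [|i iE] := @Tot_at (ar G) V (mul (Tot (0 : V (inv k)) : ar TK) (Tot j : ar TK)) g; first exact: (mulVK gG e).
  rewrite iE in m; have := mk_mul_cancell hL mth m; rewrite MK_zero_inv_inv => {}m.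
  have [E1 E2 E3] := mk_mul_ends hL mth m.
  have i0 : i = 0.
    apply: Q1; first split.
    - by apply: Tot_src_eq0; rewrite -E2; exact: Tot_src0.
    - by move: E1; rewrite (MK_zero_src hL) => /esym/Tot_tgt_eq0.
    move=> d; have [d' dE] := MK_src_surj hL (fibat (src k) (tgt (Tot d : ar TK)) : vb0 V (src k)).
    have s' : src (Tot d' : ar TK) = tgt (Tot d : ar TK).
      by rewrite -[LHS]/(Tot (vsrc V d')) dE fibatK.
    have m' := mk_mul_mul hL s'.
    have [u uE] := @Tot_at (ar G) V (mul (Tot d' : ar TK) (Tot d : ar TK)) (mul k g) (erefl _).
    rewrite uE in m'; apply: (tcoord_inj hL fg); apply: (mulfI r0).
    rewrite -[pairing _ _ _ _]/(Om i d) -(shift _ _ _ _ _ m m').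
    by rewrite [Om j u]H (tcoord0 hL fg) mulr0 (tcoord0 hL fa).
  rewrite i0 in m.
  by apply: (@Tot_inj R _ V); exact: (mk_mul_fun hL m (mk_mul_zero e)).
have [d' [d m]] := MK_decompose hL mth u e.
have [|p [q [sp tq dE]]] := Q2 d.
  move=> i [si ti].
  have s : src (Tot (0 : V k) : ar TK) = tgt (Tot i : ar TK).
    by rewrite (Tot_tgt0 ti) (MK_zero_src hL); apply: (@Tot0 R _ (vb0 V)).
  have mi := mk_mul_mul hL s.
  have [j jE] := @Tot_at (ar G) V (mul (Tot (0 : V k) : ar TK) (Tot i : ar TK)) (mul k g) (erefl _).
  rewrite jE in mi; apply: (tcoord_inj hL fg); apply: (mulfI r0).
  rewrite -[pairing _ _ _ _]/(Om i d) -(shift _ _ _ _ _ mi m) (tcoord0 hL fg) mulr0.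
  have [E1 E2 E3] := mk_mul_ends hL mth mi.
  rewrite [Om j u]H ?(tcoord0 hL fa) //; split.
    by apply: Tot_src_eq0; rewrite E2; exact: Tot_src0.
  by move: E3; rewrite (MK_zero_tgt hL fth) => /Tot_tgt_eq0.
have s : src (Tot (0 : V k) : ar TK) = tgt (Tot q : ar TK).
  by rewrite (Tot_tgt0 tq) (MK_zero_src hL); apply: (@Tot0 R _ (vb0 V)).
have mq := mk_mul_mul hL s.
have [j jE] := @Tot_at (ar G) V (mul (Tot (0 : V k) : ar TK) (Tot q : ar TK)) (mul k g) (erefl _).
rewrite jE in mq; have := mk_mul_lin hL fth (-1) mq m; rewrite scaler0 add0r !scaleN1r dE [p + q]addrC addKr => mp.
have [_ _ E1] := mk_mul_ends hL mth mq; have [_ E2 _] := mk_mul_ends hL mth mp.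
exists (- j + u), j; split; last by rewrite addrAC addNr add0r.
  by apply: Tot_src_eq0; rewrite E2; exact: Tot_src0.
by move: E1; rewrite (MK_zero_tgt hL fth) => /Tot_tgt_eq0.
Qed.
End Translation.

(** * Consequences of the Morita condition on the base groupoids *)

Section MoritaBase.
Context (R : realType) (H G : groupoid R) (L' : vbg H) (L : vbg G).
Hypotheses (hL' : is_line_groupoid L') (hL : is_line_groupoid L).
Context (F : vbmap L' L) (hF : is_vb_morita F).
Let f := ar_map (base F).
Let f0 := ob_map (base F).
Let lG := line_lie hL.
Let gG := lie_groupoid lG.
Let lH := line_lie hL'.

Lemma vb_base_lie : is_lie_morphism (base F). Proof. by case: hF => -[]. Qed.
Lemma vb_tot_lie : is_lie_morphism (tot_gmap F). Proof. by case: hF => -[]. Qed.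
Lemma vmap_lin h : linear (@vmap _ _ _ _ _ F h). Proof. by case: hF => -[_ _ ? _] _. Qed.
Lemma vmap0_lin x : linear (@vmap0 _ _ _ _ _ F x). Proof. by case: hF => -[_ _ _ ?] _. Qed.
Lemma base_smooth : smooth f. Proof. by case: vb_base_lie => -[]. Qed.
Lemma base0_smooth : smooth f0. Proof. by case: vb_base_lie => -[]. Qed.
Lemma base_src h : src (f h) = f0 (src h). Proof. by case: vb_base_lie => _ /(_ h)[]. Qed.
Lemma base_tgt h : tgt (f h) = f0 (tgt h). Proof. by case: vb_base_lie => _ /(_ h)[]. Qed.
Lemma base_mul h k : src h = tgt k -> f (mul h k) = mul (f h) (f k). Proof. by case: vb_base_lie => _ _ _; exact. Qed.
Lemma vmap_smooth : smooth (fun q : tot L' => Tot (vmap F (tagged q))). Proof. by case: vb_tot_lie => -[]. Qed.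
Lemma vmap0_smooth : smooth (fun q : tot (vb0 L') => Tot (vmap0 F (tagged q))). Proof. by case: vb_tot_lie => -[]. Qed.
Lemma vmap_src h (u : L' h) : Tot (vsrc L (vmap F u)) = Tot (vmap0 F (vsrc L' u)).
Proof. by case: vb_tot_lie => _ /(_ (Tot u))[]. Qed.
Lemma vmap_tgt h (u : L' h) : Tot (vtgt L (vmap F u)) = Tot (vmap0 F (vtgt L' u)).
Proof. by case: vb_tot_lie => _ /(_ (Tot u))[]. Qed.

Let W : set (prod_space (tot L) (prod_space (tot (vb0 L')) (tot (vb0 L')))) :=
  [set q | src (q.1 : ar (tot_groupoid L)) = ob_map (tot_gmap F) q.2.1 /\ tgt (q.1 : ar (tot_groupoid L)) = ob_map (tot_gmap F) q.2.2].

Lemma zero_graph g x y : src g = f0 x -> tgt g = f0 y ->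
  W (Tot (0 : L g), (Tot (0 : vb0 L' x), Tot (0 : vb0 L' y))).
Proof.
move=> e0 e1; split => /=.
  by rewrite (lin_0 (vsrc_lin hL g)) (lin_0 (@vmap0_lin x)); apply: Tot0.
by rewrite (lin_0 (vtgt_lin hL g)) (lin_0 (@vmap0_lin y)); apply: Tot0.
Qed.

(** If [F] kills [v], full faithfulness gives an arrow of the total groupoid with source [v] and
    target 0. The target being injective on fibres, this arrow is a zero vector, and so is its
    source. *)
Lemma vmap0_inj x : injective (@vmap0 _ _ _ _ _ F x).
Proof.
suff ker v : vmap0 F v = 0 -> v = 0 :> vb0 L' x.
  by move=> u v /eqP; rewrite -subr_eq0 -(lin_B (@vmap0_lin x)) => /eqP/ker/eqP; rewrite subr_eq0 => /eqP.
move=> v0; have [_ [_ [_ [_ [psi [_ [psi1 _]]]]] _]] := hF.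
have Wv : W (Tot (0 : L (unt (f0 x))), (Tot v, Tot (0 : vb0 L' x))).
  have [E0 E1] := @zero_graph (unt (f0 x)) x x (src_unt gG _) (tgt_unt gG _).
  by split => //; rewrite E0 /= v0 (lin_0 (@vmap0_lin x)).
have := psi1 (exist _ _ Wv); case: (psi _) => h u E.
have E2 : Tot (vsrc L' u) = Tot v by exact: (congr1 (fun y => y.2.1) E).
have E3 : Tot (vtgt L' u) = Tot (0 : vb0 L' x) by exact: (congr1 (fun y => y.2.2) E).
have u0 : u = 0 by apply: (vtgt_inj hL'); rewrite (lin_0 (vtgt_lin hL' h)); exact: Tot_eq0 E3.
by apply: (@Tot_eq0 R _ (vb0 L') x (src h)); rewrite -E2 u0 (lin_0 (vsrc_lin hL' h)).
Qed.

Lemma vmap_inj h : injective (@vmap _ _ _ _ _ F h).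
Proof.
move=> u v E; apply: (vsrc_inj hL'); apply: (@vmap0_inj (src h)); apply: Tot_inj.
by rewrite -!vmap_src E.
Qed.

(** Essential surjectivity of the total groupoids, applied to a zero vector and projected to the
    base. *)
Lemma base_surj x : exists k y, src k = f0 y /\ tgt k = x.
Proof.
have [_ [_ _ [/(_ (Tot (0 : vb0 L x)))[[[[k u] [y v]] E] Ex] _]]] := hF.
exists k, y; split; first exact: (congr1 (fun q : tot (vb0 L) => tag q) E).
exact: (congr1 (fun q : tot (vb0 L) => tag q) Ex).
Qed.

Lemma base_lift g x y : src g = f0 x -> tgt g = f0 y -> exists h, [/\ f h = g, src h = x & tgt h = y].
Proof.
move=> e0 e1; have [_ [_ [_ [_ [psi [_ [psi1 _]]]]] _]] := hF.
have := psi1 (exist _ _ (zero_graph e0 e1)); case: (psi _) => h u E; exists h; split.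
- exact: (congr1 (fun q => tag q.1) E).
- exact: (congr1 (fun q => tag q.2.1) E).
exact: (congr1 (fun q => tag q.2.2) E).
Qed.

Let X := prod_space (ar G) (prod_space (ob H) (ob H)).
Let Phi (y : X) : prod_space (ob G) (ob G) := (src y.1, tgt y.1).
Let Psi (y : X) : prod_space (ob G) (ob G) := (f0 y.2.1, f0 y.2.2).
Let E := sub [set y | Phi y = Psi y].

Lemma base_graph h : Phi (f h, (src h, tgt h)) = Psi (f h, (src h, tgt h)).
Proof. by rewrite /Phi /Psi /= base_src base_tgt. Qed.

(** Embed the base by zero sections, apply the smooth inverse that full faithfulness gives on total
    spaces, and project. *)
Lemma base_inverse : exists K : E -> ar H, [/\ smooth K,
  forall y, (f (K y), (src (K y), tgt (K y))) = sval y :> X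
  & forall h (y : E), sval y = (f h, (src h, tgt h)) -> K y = h].
Proof.
have [_ [_ [_ [_ [psi [spsi [psi1 psi2]]]]] _]] := hF.
have WE (y : E) : W (Tot (0 : L (sval y).1), (Tot (0 : vb0 L' (sval y).2.1), Tot (0 : vb0 L' (sval y).2.2))).
  by case: y => -[g [x x']] /= e; apply: zero_graph; [exact: (congr1 fst e)|exact: (congr1 snd e)].
pose Z (y : E) : sub W := exist _ _ (WE y).
have sZ : smooth Z.
  apply/(@smooth_initial R _ E (prod_space (tot L) (prod_space (tot (vb0 L')) (tot (vb0 L')))) (fun q : {x | W x} => sval q)).
  have s0 := @smooth_sval R X [set y | Phi y = Psi y].
  have s2 := smooth_comp s0 (@smooth_snd R (ar G) (prod_space (ob H) (ob H))).
  apply: smooth_pair; first exact: (smooth_comp (smooth_comp s0 (@smooth_fst R (ar G) (prod_space (ob H) (ob H)))) (smooth_section0 (line_vb hL))).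
  apply: smooth_pair.
    exact: (smooth_comp (smooth_comp s2 (@smooth_fst R (ob H) (ob H))) (smooth_section0 (line_vb0 hL'))).
  exact: (smooth_comp (smooth_comp s2 (@smooth_snd R (ob H) (ob H))) (smooth_section0 (line_vb0 hL'))).
exists (fun y => tag (psi (Z y))); split.
- exact: smooth_comp (smooth_comp sZ spsi) (smooth_tag (line_vb hL')).
- move=> y; have := psi1 (Z y); case: (psi _) => h u /= Eq.
  rewrite [RHS]surjective_pairing [X in _ = (_, X)]surjective_pairing.
  congr (_, (_, _)); [exact: (congr1 (fun q => tag q.1) Eq)|exact: (congr1 (fun q => tag q.2.1) Eq)|exact: (congr1 (fun q => tag q.2.2) Eq)].
move=> h y yE; have -> // : psi (Z y) = Tot (0 : L' h).
apply: psi2; rewrite /Z /= yE /= (lin_0 (@vmap_lin h)) (lin_0 (vsrc_lin hL' h)) (lin_0 (vtgt_lin hL' h)) //.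
Qed.

(** The map to the graph has the smooth left inverse [K], so a vector is determined by its image in
    the graph, and there by its components. *)
Lemma base_tangent_inj h (z : tangent h) : dmap f z = 0 -> dmap (@src R H) z = 0 -> dmap (@tgt R H) z = 0 -> z = 0.
Proof.
move=> z0 zs zt; have [K [sK K1 K2]] := base_inverse.
pose gr (k : ar H) : E := exist _ (f k, (src k, tgt k)) (base_graph k).
have sp : smooth (fun k : ar H => (f k, (src k, tgt k)) : X).
  by apply: smooth_pair; [exact: base_smooth|apply: smooth_pair; [exact: (src_smooth lH)|exact: (tgt_smooth lH)]].
have sg : smooth gr by apply/(@smooth_initial R _ (ar H) X (fun q : {x | Phi x = Psi x} => sval q)).
have g0 : dmap gr z = 0.
  apply: dmap_initial_inj; rewrite -(dmap_comp _ sg (@smooth_sval R X _)) (lin_0 (dmap_lin (@smooth_sval R X _) (p := gr h))).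
  apply: dmap_pair_inj.
    rewrite -(dmap_comp _ sp (@smooth_fst R _ _)) (lin_0 (dmap_lin (@smooth_fst R _ _) (p := _))).
    exact: z0.
  rewrite -(dmap_comp _ sp (@smooth_snd R _ _)) (lin_0 (dmap_lin (@smooth_snd R _ _) (p := _))).
  have s2 : smooth (fun k : ar H => (src k, tgt k) : prod_space (ob H) (ob H)).
    by apply: smooth_pair; [exact: (src_smooth lH)|exact: (tgt_smooth lH)].
  apply: dmap_pair_inj.
    rewrite -(dmap_comp _ s2 (@smooth_fst R _ _)) (lin_0 (dmap_lin (@smooth_fst R _ _) (p := _))).
    exact: zs.
  rewrite -(dmap_comp _ s2 (@smooth_snd R _ _)) (lin_0 (dmap_lin (@smooth_snd R _ _) (p := _))).
  exact: zt.
apply: tangent_gen_eq => phi gphi; have sphi := smoothf_gen gphi.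
have -> : dv z phi = dv (dmap gr z) (phi \o K).
  rewrite (dmapEs _ sg (sK _ sphi)); apply: dv_near; apply: near_all => k /=.
  by rewrite (K2 k).
by rewrite g0 !dv0.
Qed.

(** Push [w] along the zero section, lift it by the submersion in the essential surjectivity of [F],
    and project the lift to the base. *)
Lemma base_submersion (k : ar G) (y : ob H) (w : tangent (tgt k)) : src k = f0 y ->
  exists (v : tangent k) (a : tangent y), (forall phi, smoothf phi -> dv v (phi \o @src R G) = dv a (phi \o f0)) /\
    (forall phi, smoothf phi -> dv v (phi \o @tgt R G) = dv w phi).
Proof.
move=> e; have [_ [_ _ [_ [sT subm]]]] := hF.
pose Wes : set (prod_space (tot L) (tot (vb0 L'))) :=
  [set q | src (q.1 : ar (tot_groupoid L)) = ob_map (tot_gmap F) q.2].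
have pW : Wes (Tot (0 : L k), Tot (0 : vb0 L' y)).
  by rewrite /Wes /= (lin_0 (vsrc_lin hL k)) (lin_0 (@vmap0_lin y)); apply: Tot0.
pose p : sub Wes := exist _ _ pW; have p0 : Tot (0 : vb0 L (tgt k)) = Tot (vtgt L (0 : L k)).
  by rewrite (lin_0 (vtgt_lin hL k)).
have [w' w'E] := push_to w (proj1 (smoothP _) (smooth_section0 (line_vb0 hL)) _) p0.
have [z zE] := subm p w'.
have s1 : smooth (fun q : sub Wes => tag (sval q).1 : ar G).
  exact: smooth_comp (smooth_comp (@smooth_sval R _ Wes) (@smooth_fst R _ _)) (smooth_tag (line_vb hL)).
have s2 : smooth (fun q : sub Wes => tag (sval q).2 : ob H).
  exact: smooth_comp (smooth_comp (@smooth_sval R _ Wes) (@smooth_snd R _ _)) (smooth_tag (line_vb0 hL')).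
have [v vE] := push_to z (proj1 (smoothP _) s1 p) (erefl k).
have [a aE] := push_to z (proj1 (smoothP _) s2 p) (erefl y).
exists v, a; split => phi sphi.
  rewrite vE ?aE; [|exact: (base0_smooth sphi)|exact: (src_smooth lG sphi)].
  apply: dv_near; apply: near_all => -[[[k' u] [y' u']] E'] /=; congr phi.
  exact: (congr1 (fun q : tot (vb0 L) => tag q) E').
rewrite vE; last exact: (tgt_smooth lG sphi).
have st : smoothf (fun q : tot (vb0 L) => phi (tag q)) by exact: (smooth_tag (line_vb0 hL) sphi).
transitivity (dv w' (fun q : tot (vb0 L) => phi (tag q))); last by rewrite w'E //; exact: st.
by rewrite -zE; exact: (esym (dmapEs z sT st)).
Qed.

(** The previous statement carried over by inversion of arrows. *)
Lemma base_submersion_src (k : ar G) (y : ob H) (w : tangent (src k)) : tgt k = f0 y ->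
  exists (v : tangent k) (b : tangent y), (forall phi, smoothf phi -> dv v (phi \o @tgt R G) = dv b (phi \o f0)) /\
    (forall phi, smoothf phi -> dv v (phi \o @src R G) = dv w phi).
Proof.
move=> e; have [w' w'E] := push_to w (fun g (sg : smooth_at _ g) => sg : smooth_at _ (g \o id)) (esym (tgt_inv gG k)).
have [|v [b [v0 v1]]] := @base_submersion (inv k) y w'; first by rewrite (src_inv gG).
have [v' v'E] := push_to v (proj1 (smoothP _) (inv_smooth lG) _) (inv_inv gG k).
exists v', b; split => phi sphi.
  rewrite v'E; last exact: (tgt_smooth lG sphi).
  by rewrite -v0 //; apply: dv_near; apply: near_all => g /=; rewrite (tgt_inv gG).
rewrite v'E; last exact: (src_smooth lG sphi).
rewrite -w'E; last exact: sphi.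
by rewrite -v1 //; apply: dv_near; apply: near_all => g /=; rewrite (src_inv gG).
Qed.

(* The transversality needed to describe T_hH as a fibre product comes from the submersion
   above and its mirror image. *)
Lemma base_tangent_lift h (v : tangent (f h)) (a : tangent (src h)) (b : tangent (tgt h)) :
  (forall phi, smoothf phi -> dv v (phi \o @src R G) = dv a (phi \o f0)) ->
  (forall phi, smoothf phi -> dv v (phi \o @tgt R G) = dv b (phi \o f0)) ->
  exists z : tangent h, [/\ dmap f z = v, dmap (@src R H) z = a & dmap (@tgt R H) z = b].
Proof.
move=> va vb; pose p : X := (f h, (src h, tgt h)).
have [n [c pc]] := manifold_param (f h) (ar_manifold lG).
have [m [d pd]] := manifold_param (src h) (ob_manifold lH).
have [m' [d' pd']] := manifold_param (tgt h) (ob_manifold lH).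
have pX := param_pair pc (param_pair pd pd').
have sPhi : smooth Phi by apply: smooth_pair; [exact: smooth_comp (@smooth_fst R _ _) (src_smooth lG)|exact: smooth_comp (@smooth_fst R _ _) (tgt_smooth lG)].
have s2 := @smooth_snd R (ar G) (prod_space (ob H) (ob H)).
have sPsi : smooth Psi.
  apply: smooth_pair; first exact: smooth_comp (smooth_comp s2 (@smooth_fst R _ _)) base0_smooth.
  exact: smooth_comp (smooth_comp s2 (@smooth_snd R _ _)) base0_smooth.
have cZ : @has_coords R (prod_space (ob G) (ob G)) (Phi p).
  by apply: pair_has_coords; apply: manifold_has_coords; exact: (ob_manifold lG).
have pair (u : tangent (f h)) (x : tangent (src h)) (y : tangent (tgt h)) : exists r : @tangent R X p,
    [/\ forall phi, smoothf phi -> dv r (phi \o fst) = dv u phi,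
        forall phi, smoothf phi -> dv r (fun q => phi q.2.1) = dv x phi
      & forall phi, smoothf phi -> dv r (fun q => phi q.2.2) = dv y phi].
  have [r1 [r1a r1b _]] := tangent_pair x y; have [r [ra rb _]] := tangent_pair u r1.
  exists r; split=> phi sphi.
  - by rewrite -ra; exact: (esym (dmapEs r (@smooth_fst R _ _) sphi)).
  - rewrite -r1a -rb; have E1 := dmapEs (dmap (snd : X -> _) r) (@smooth_fst R (ob H) (ob H)) sphi.
    exact: (esym (etrans E1 (dmapEs r s2 (@smooth_fst R (ob H) (ob H) _ sphi)))).
  rewrite -r1b -rb; have E1 := dmapEs (dmap (snd : X -> _) r) (@smooth_snd R (ob H) (ob H)) sphi.
  exact: (esym (etrans E1 (dmapEs r s2 (@smooth_snd R (ob H) (ob H) _ sphi)))).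
have cmp (r : @tangent R X p) (w : tangent (Phi p)) :
    (forall phi, smoothf phi -> dv r (fun q : X => phi (src q.1)) - dv r (fun q : X => phi (f0 q.2.1)) = dv (dmap (fst : prod_space (ob G) (ob G) -> ob G) w) phi) ->
    (forall phi, smoothf phi -> dv r (fun q : X => phi (tgt q.1)) - dv r (fun q : X => phi (f0 q.2.2)) = dv (dmap (snd : prod_space (ob G) (ob G) -> ob G) w) phi) ->
    forall phi, smoothf phi -> dv r (phi \o Phi) - dv r (phi \o Psi) = dv w phi.
  move=> H1 H2; have [r' r'E] := push_to r (proj1 (smoothP _) sPsi p) (esym (base_graph h)).
  suff wE : dmap Phi r - r' = w.
    by move=> phi sphi; rewrite -wE dv_add dv_opp (dmapEs _ sPhi sphi) r'E //; exact: sphi.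
  have sf := @smooth_fst R (ob G) (ob G); have ss := @smooth_snd R (ob G) (ob G).
  apply: dmap_pair_inj; apply: tangent_gen_eq => phi gphi; have sphi := smoothf_gen gphi.
    rewrite -H1 // (dmapEs _ sf sphi) dv_add dv_opp (dmapEs _ sPhi (sf _ sphi)) r'E //; exact: (sf _ sphi).
  rewrite -H2 // (dmapEs _ ss sphi) dv_add dv_opp (dmapEs _ sPhi (ss _ sphi)) r'E //; exact: (ss _ sphi).
have [r [r1 r2 r3]] := pair v a b.
have [K [sK K1 K2]] := base_inverse.
have sSM phi : smoothf phi -> smoothf (phi \o @src R G) by move=> s; exact: (src_smooth lG s).
have sTM phi : smoothf phi -> smoothf (phi \o @tgt R G) by move=> s; exact: (tgt_smooth lG s).
have sFM phi : smoothf phi -> smoothf (phi \o f0) by move=> s; exact: (base0_smooth s).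
have [|phi sphi|z0 z0E] := tangent_equalizer (base_graph h) pX cZ sPhi sPsi _ (v := r).
(* The triple of [v' + v''], [a'] and [b'] realizes [w]: [v'] gives its target component and is
   balanced by [a'] at the source, [v''] gives its source component and is balanced by [b'] at the
   target. *)
- move=> w; have [v' [a' [v'0 v'1]]] := base_submersion (dmap (snd : prod_space (ob G) (ob G) -> ob G) w : tangent (tgt (f h))) (base_src h).
  have [v'' [b' [v''1 v''0]]] := base_submersion_src (dmap (fst : prod_space (ob G) (ob G) -> ob G) w : tangent (src (f h))) (base_tgt h).
  have [q [q1 q2 q3]] := pair (v' + v'') a' b'; exists q; apply: cmp => phi sphi.
    by rewrite [X in X - _](q1 _ (sSM _ sphi)) (q2 _ (sFM _ sphi)) dv_add v'0 // v''0 // addrC addKr.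
  by rewrite [X in X - _](q1 _ (sTM _ sphi)) (q3 _ (sFM _ sphi)) dv_add v'1 // v''1 // addrK.
- apply/eqP; rewrite -subr_eq0; apply/eqP; rewrite -[RHS](@dv0 R _ (Phi p) phi); move: phi sphi; apply: cmp => phi sphi.
    rewrite (lin_0 (dmap_lin (@smooth_fst R _ _) (p := Phi p))) dv0 [X in X - _](r1 _ (sSM _ sphi)) (r2 _ (sFM _ sphi)) va //.
    by rewrite subrr.
  rewrite (lin_0 (dmap_lin (@smooth_snd R _ _) (p := Phi p))) dv0 [X in X - _](r1 _ (sTM _ sphi)) (r3 _ (sFM _ sphi)) vb //.
  by rewrite subrr.
pose y0 : E := exist _ (f h, (src h, tgt h)) (base_graph h).
have Ky : K y0 = h by exact: K2.
have [z zE] := push_to (z0 : tangent y0) (proj1 (smoothP _) sK _) Ky.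
have zK (Y : space R) (psi : ar H -> Y) (psi' : X -> Y) phi : smooth psi -> smooth psi' -> (forall y : E, psi (K y) = psi' (sval y)) -> smoothf phi ->
    dv z (phi \o psi) = dv r (phi \o psi').
  move=> s s' EK sphi; rewrite zE; last exact: (s _ sphi).
  rewrite -z0E; refine (esym (etrans (dmapEs z0 (@smooth_sval R X _) (s' _ sphi)) _)); apply: dv_near; apply: near_all => y /=.
  by rewrite EK.
exists z; split.
- apply: dv_dmap => [|phi sphi]; first exact: base_smooth.
  rewrite (zK _ f fst phi (base_smooth) (@smooth_fst R _ _)) // => [|y]; first exact: r1.
  by rewrite -(K1 y).
- apply: dv_dmap => [|phi sphi]; first exact: (src_smooth lH).
  have s : smooth (fun q : X => q.2.1) by exact: smooth_comp s2 (@smooth_fst R _ _).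
  rewrite (zK _ _ (fun q => q.2.1) phi (src_smooth lH) s) // => [|y]; first exact: r2.
  by rewrite -(K1 y).
apply: dv_dmap => [|phi sphi]; first exact: (tgt_smooth lH).
have s : smooth (fun q : X => q.2.2) by exact: smooth_comp s2 (@smooth_snd R _ _).
rewrite (zK _ _ (fun q => q.2.2) phi (tgt_smooth lH) s) // => [|y]; first exact: r3.
by rewrite -(K1 y).
Qed.
End MoritaBase.

(** * The pairing on isotropic vectors *)

Section IsotropyPairing.
Context (R : realType) (G : groupoid R) (L : vbg G).
Hypothesis hL : is_line_groupoid L.
Context (nabla : conn (vb0 L)) (cN : is_connection nabla).
Context (th : form1 L) (fth : is_form1 th).
Context (ka : form2 (vb0 L)) (fka : is_form2 ka).

Lemma isotropyE g (p : MK th g) : isotropy p <->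
  [/\ dmap (@src R G) p.1 = 0, dmap (@tgt R G) p.1 = 0, p.2 = 0 & th p.1 = 0].
Proof.
split=> [[sp tp]|[s1 t1 p2 t2]].
  have p2 : p.2 = 0.
    by apply: (vsrc_inj hL); rewrite (lin_0 (vsrc_lin hL g)); exact: (congr1 snd sp).
  split=> //; [exact: (congr1 fst sp)|exact: (congr1 fst tp)|].
  apply: (vtgt_inj hL); rewrite (lin_0 (vtgt_lin hL g)).
  by have := congr1 snd tp; rewrite /= p2 add0r.
split; first by rewrite [LHS]surjective_pairing /= s1 p2 (lin_0 (vsrc_lin hL g)).
by rewrite [LHS]surjective_pairing /= t1 p2 t2 addr0 (lin_0 (vtgt_lin hL g)).
Qed.

(* Neither the connection nor [ka] enters, because ds and dt kill isotropic elements. *)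
Lemma isotropy_pairing_coord g (p q : MK th g) a la b lb n (c X : 'I_n -> ar G -> R) :
  frame_at (tgt g) a la -> frame_at (src g) b lb -> local_form th g la c X -> isotropy p ->
  tcoord la (pairing nabla ka p q) =
  dform c X p.1 q.1 + dv p.1 (frame_ratio la b) / frame_ratio la b g * tcoord la q.2.
Proof.
move=> fa fb lo /isotropyE[sp tp p2 tp1].
rewrite (pairing_coord hL nabla ka p q fa) (dconn_coord hL cN fth _ _ fa lo).
rewrite (partial2_coord hL ka _ _ fa fb) (etaE hL cN p.1 fa fb) sp tp p2 tp1.
have ca0 : conn_coef nabla a la (0 : tangent (tgt g)) = 0.
  by have := conn_coef_lin cN (-1) (0 : tangent (tgt g)) 0 fa; rewrite scaler0 addr0 mulN1r addNr.
have cb0 : conn_coef nabla b lb (0 : tangent (src g)) = 0.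
  by have := conn_coef_lin cN (-1) (0 : tangent (src g)) 0 fb; rewrite scaler0 addr0 mulN1r addNr.
rewrite ca0 cb0 (tcoord0 hL fa) (lin_0 (ka_linl fka _)) (lin_0 (ka_linl fka _)).
by rewrite (frame_at_0 fa) (frame_at_0 fb); ring.
Qed.
End IsotropyPairing.

(** * Comparison of the pairings along a VB Morita map *)

Section Comparison.
Context (R : realType) (H G : groupoid R) (L' : vbg H) (L : vbg G).
Hypotheses (hL' : is_line_groupoid L') (hL : is_line_groupoid L).
Context (F : vbmap L' L) (hF : is_vb_morita F).
Context (th : form1 L) (fth : is_form1 th) (mth : multiplicative th).
Let f := ar_map (base F).
Let f0 := ob_map (base F).
Let lG := line_lie hL.
Let lH := line_lie hL'.
Let gH := lie_groupoid lH.
Let vl := vmap_lin hF.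
Let v0l := vmap0_lin hF.
Let vi := vmap_inj hL' hL hF.
Let v0i := vmap0_inj hL' hL hF.
Let th' : form1 L' := pull1 (@vmap _ _ _ _ _ F) th.

Lemma pull_form1E h (z : tangent h) : vmap F (th' z) = th (dmap f z).
Proof. exact: (iso_finvP (line_vb hL') (line_vb hL) vl vi). Qed.

Lemma pull_form1 : is_form1 th'.
Proof.
have [tl _] := fth; split.
  move=> h c v w; apply: (@vi h).
  by rewrite vl !pull_form1E (dmap_lin (base_smooth hF)) tl.
apply/smoothP => q; apply: (iso_smooth (line_vb hL') (line_vb hL) (vmap_smooth hF) vl vi) => /=.
  by move: q; apply/smoothP; exact: smooth_tag_TB.
have sid : smooth_map_at q (fun r : tot (TB (ar H)) => r) by move=> g.
apply: smooth_map_at_ext (form1_smooth_at fth (smooth_at_Tmap (base_smooth hF) sid)).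
by apply: near_all => r; rewrite /= pull_form1E.
Qed.

Lemma vmap0_Tot_inj x y (u : vb0 L' x) (v : vb0 L' y) : x = y -> Tot (vmap0 F u) = Tot (vmap0 F v) -> Tot u = Tot v.
Proof. by move=> e; case: _ / e v => v /Tot_inj/v0i ->. Qed.

Lemma vmap0_Tot x y (u : vb0 L' x) (v : vb0 L' y) : Tot u = Tot v -> Tot (vmap0 F u) = Tot (vmap0 F v).
Proof. by move=> E; exact: (congr1 (fun q : tot (vb0 L') => Tot (vmap0 F (tagged q))) E). Qed.

(** The identity is tested after applying [F], which is injective on fibres; it becomes
    multiplicativity of [th] at the image [c] of the composable pair. *)
Lemma pull_multiplicative : multiplicative th'.
Proof.
apply: (multiplicative_intro hL') => p z u su.
have e := comp_src p.
pose c (q : comp H) : comp G := exist _ (f (comp1 q), f (comp2 q))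
  (etrans (base_src hF _) (etrans (congr1 f0 (comp_src q)) (esym (base_tgt hF _)))).
have s1 : smooth (@comp1 R H) by exact: comp1_smooth.
have s2 : smooth (@comp2 R H) by exact: comp2_smooth.
have sm := compm_smooth lH.
have sf := base_smooth hF.
have sc : smooth c.
  apply/(@smooth_initial R _ (comp H) (prod_space (ar G) (ar G)) (fun q : {x | [set p | src p.1 = tgt p.2] x} => sval q)).
  by apply: smooth_pair; [exact: smooth_comp s1 sf|exact: smooth_comp s2 sf].
pose Z : tot (TB (comp H)) := @Tot R _ (TB (comp H)) p z.
have thT (a b : tot (TB (ar G))) : a = b -> Tot (th (tagged a)) = Tot (th (tagged b)) by move=> ->.
have E1 : Tmap f (Tmap (@comp1 R H) Z) = Tmap (@comp1 R G) (Tmap c Z).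
  by rewrite -!Tmap_comp //; exact: comp1_smooth.
have E2 : Tmap f (Tmap (@comp2 R H) Z) = Tmap (@comp2 R G) (Tmap c Z).
  by rewrite -!Tmap_comp //; exact: comp2_smooth.
have Em : Tmap f (Tmap (@compm R H) Z) = Tmap (@compm R G) (Tmap c Z).
  rewrite -!Tmap_comp //; last exact: compm_smooth lG.
  by congr (Tmap _ Z); apply: boolp.funext => q; exact: (base_mul hF (comp_src q)).
apply: vmap0_Tot_inj; first exact: (tgt_mul gH e).
rewrite -!(vmap_tgt hF) (lin_D (@vl _)) !pull_form1E.
have tgtT g k (x : L g) (y : L k) : Tot x = Tot y -> Tot (vtgt L x) = Tot (vtgt L y).
  by move=> E; exact: (congr1 (fun q : tot L => Tot (vtgt L (tagged q))) E).
have su' : Tot (vsrc L (vmap F u : L (comp1 (c p)))) = Tot (vtgt L (th (dmap (@comp2 R G) (dmap c z)))).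
  rewrite (vmap_src hF) (vmap0_Tot su) -(vmap_tgt hF) pull_form1E; apply: tgtT; exact: (thT _ _ E2).
refine (etrans (tgtT _ _ _ _ (thT _ _ Em)) (etrans (multiplicativeE hL mth su') _)).
have E1' : th (dmap f (dmap (@comp1 R H) z)) = th (dmap (@comp1 R G) (dmap c z)).
  by apply: (@Tot_inj R _ L); exact: (thT _ _ E1).
by rewrite E1'.
Qed.

Lemma pull_form2 (ka : form2 (vb0 L)) : is_form2 ka -> is_form2 (pull2 (@vmap0 _ _ _ _ _ F) ka).
Proof.
move=> [kl k0 ks sk]; have lf x := iso_finv_lin (line_vb0 hL') (line_vb0 hL) v0l v0i (x := x).
have sf0 := base0_smooth hF.
split.
- by move=> x v c w w'; rewrite /pull2 (dmap_lin sf0) kl lf.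
- by move=> x v; rewrite /pull2 k0 (lin_0 (lf x)).
- by move=> x v w; rewrite /pull2 ks (lin_N (lf x)).
apply/smoothP => q; apply: (iso_smooth (line_vb0 hL') (line_vb0 hL) (vmap0_smooth hF) v0l v0i) => /=.
  have sid : smooth_map_at q (fun r : tot (sum_bundle (TB (ob H)) (TB (ob H))) => r) by move=> g.
  exact: (smooth_map_at_comp (smooth_sum_at1 sid) (proj1 (smoothP _) (@smooth_tag_TB R (ob H)) _)).
have sid : smooth_map_at q (fun r : tot (sum_bundle (TB (ob H)) (TB (ob H))) => r) by move=> g.
have s : smooth_map_at q (fun r : tot (sum_bundle (TB (ob H)) (TB (ob H))) =>
    @Tot R (ob G) (sum_bundle (TB (ob G)) (TB (ob G))) (f0 (tag r)) (dmap f0 (tagged r).1, dmap f0 (tagged r).2)).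
  apply: smooth_sum_at; first exact: (smooth_at_Tmap sf0 (smooth_sum_at1 sid)).
  exact: (smooth_at_Tmap sf0 (smooth_sum_at2 sid)).
apply: smooth_map_at_ext (smooth_map_at_comp s (proj1 (smoothP _) sk _)); apply: near_all => r.
by rewrite /= /pull2 (iso_finvP (line_vb0 hL') (line_vb0 hL) v0l v0i).
Qed.

Let pcoord (la : tot (vb0 L) -> R) : tot (vb0 L') -> R := fun q => la (Tot (vmap0 F (tagged q))).
Let psec (a : section (vb0 L)) : section (vb0 L') := pull_section (@vmap0 _ _ _ _ _ F) a.

Lemma pull_frame_at x a la : frame_at (f0 x) a la -> frame_at x (psec a) (pcoord la).
Proof.
move=> [W [fr Wx]]; exists (f0 @^-1` W); split.
  exact: (pull_frame (line_vb0 hL') (line_vb0 hL) (vmap0_smooth hF) v0l v0i fr).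
exact: (near_smooth (proj1 (smoothP _) (base0_smooth hF) x) Wx).
Qed.

Lemma pull_tcoord la h (u : L' h) : tcoord (pcoord la) u = tcoord la (vmap F u).
Proof. by rewrite /tcoord /pcoord -[RHS]/(la (Tot _)) (vmap_tgt hF). Qed.

(** [F] intertwines the structure maps, so pulling back both frames does not change their ratio; the
    logarithmic derivatives therefore agree. *)
Lemma pull_ratio la b h : frame_ratio (pcoord la) (psec b) h = frame_ratio la b (f h).
Proof.
rewrite /frame_ratio pull_tcoord; congr tcoord; apply: (vsrc_inj hL); apply: Tot_inj; rewrite (vmap_src hF).
rewrite (iso_finvP (line_vb hL) (line_vb0 hL) (vsrc_lin hL) (vsrc_inj hL)).
rewrite (iso_finvP (line_vb hL') (line_vb0 hL') (vsrc_lin hL') (vsrc_inj hL')).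
by rewrite (iso_finvP (line_vb0 hL') (line_vb0 hL) v0l v0i) -/(f h) (base_src hF).
Qed.

Lemma pull_local_form h la n (c X : 'I_n -> ar G -> R) : local_form th (f h) la c X ->
  local_form th' h (pcoord la) (fun i => c i \o f) (fun i => X i \o f).
Proof.
move=> [sc sX E]; have sf := base_smooth hF; split; [by move=> i; exact: (sf _ (sc i))|by move=> i; exact: (sf _ (sX i))|].
apply: filterS (near_smooth (proj1 (smoothP _) sf h) E) => k Ek z.
rewrite pull_tcoord pull_form1E Ek; apply: eq_bigr => i _.
by rewrite (dmapEs _ sf (sX i)).
Qed.

Context (nabla : conn (vb0 L)) (cN : is_connection nabla) (ka : form2 (vb0 L)) (fka : is_form2 ka).
Context (nabla' : conn (vb0 L')) (cN' : is_connection nabla') (kb : form2 (vb0 L')) (fkb : is_form2 kb).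
Let V := MK th.
Let V' := MK th'.
Let Om g (p q : V g) : L g := pairing nabla ka p q.
Let Om' h (p q : V' h) : L' h := pairing nabla' kb p q.
Let OmL g (p : V g) : linear (Om p) := pairing_lin hL cN fth fka p.
Let OmA g (p q : V g) : Om p q = - Om q p := pairing_anti hL cN fth fka p q.
Let J h (p : V' h) : V (f h) := (dmap f p.1, vmap F p.2).
Let sf := base_smooth hF.

Lemma pull_dsrc0 h (z : tangent h) : dmap (@src R H) z = 0 -> dmap (@src R G) (dmap f z) = 0.
Proof.
move=> z0; apply: tangent_gen_eq => phi gphi; have sphi := smoothf_gen gphi.
rewrite (dmapEs _ (src_smooth lG) sphi) (dmapEs _ sf (src_smooth lG sphi)) dv0.
transitivity (dv (dmap (@src R H) z) (phi \o f0)); last by rewrite z0 dv0.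
rewrite (dmapEs _ (src_smooth lH) (base0_smooth hF sphi)); apply: dv_near; apply: near_all => k /=.
by rewrite (base_src hF).
Qed.

Lemma pull_dtgt0 h (z : tangent h) : dmap (@tgt R H) z = 0 -> dmap (@tgt R G) (dmap f z) = 0.
Proof.
move=> z0; apply: tangent_gen_eq => phi gphi; have sphi := smoothf_gen gphi.
rewrite (dmapEs _ (tgt_smooth lG) sphi) (dmapEs _ sf (tgt_smooth lG sphi)) dv0.
transitivity (dv (dmap (@tgt R H) z) (phi \o f0)); last by rewrite z0 dv0.
rewrite (dmapEs _ (tgt_smooth lH) (base0_smooth hF sphi)); apply: dv_near; apply: near_all => k /=.
by rewrite (base_tgt hF).
Qed.

Lemma pull_vsrc0 h (p : V' h) : vsrc V' p = 0 -> vsrc V (J p) = 0.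
Proof.
move=> sp; rewrite [LHS]surjective_pairing; congr (_, _); first by apply: pull_dsrc0; exact: (congr1 fst sp).
have p2 : p.2 = 0 by apply: (vsrc_inj hL'); rewrite (lin_0 (vsrc_lin hL' h)); exact: (congr1 snd sp).
by rewrite /= p2 (lin_0 (@vl h)) (lin_0 (vsrc_lin hL _)).
Qed.

Lemma pull_vtgt0 h (p : V' h) : vtgt V' p = 0 -> vtgt V (J p) = 0.
Proof.
move=> tp; rewrite [LHS]surjective_pairing; congr (_, _); first by apply: pull_dtgt0; exact: (congr1 fst tp).
have p2 : p.2 + th' p.1 = 0 by apply: (vtgt_inj hL'); rewrite (lin_0 (vtgt_lin hL' h)); exact: (congr1 snd tp).
by rewrite /= -pull_form1E -(lin_D (@vl h)) p2 (lin_0 (@vl h)) (lin_0 (vtgt_lin hL _)).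
Qed.

Lemma pull_isotropy h (i : V' h) : isotropy i -> isotropy (J i).
Proof. by move=> [si ti]; split; [exact: pull_vsrc0|exact: pull_vtgt0]. Qed.

(** An isotropic vector is killed by the differentials of both ends, so it lifts through the fibre
    product description with both object components 0. *)
Lemma pull_isotropy_surj h (i : V (f h)) : isotropy i -> exists2 j : V' h, isotropy j & J j = i.
Proof.
move=> /(isotropyE hL)[s0 t0 i2 t1].
have [phi sphi|phi sphi|z [zE zs zt]] := base_tangent_lift hL' hL hF (v := i.1) (a := 0 : tangent (src h)) (b := 0 : tangent (tgt h)).
- by rewrite -(dmapEs _ (src_smooth lG) sphi) s0 !dv0.
- by rewrite -(dmapEs _ (tgt_smooth lG) sphi) t0 !dv0.
exists (z, 0); last by rewrite /J /= [dmap f z]zE (lin_0 (@vl h)) -i2 -surjective_pairing.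
apply/(isotropyE hL'); split => //=; apply: (@vi h).
by rewrite pull_form1E [dmap f z]zE t1 (lin_0 (@vl h)).
Qed.

Lemma pull_isotropy_inj h (i : V' h) : isotropy i -> J i = 0 -> i = 0.
Proof.
move=> /(isotropyE hL')[s0 t0 i2 t1] Ji; rewrite [LHS]surjective_pairing i2; congr (_, _).
by apply: (base_tangent_inj hL' hL hF) => //; exact: (congr1 fst Ji).
Qed.

(** For an isotropic first argument both sides are given by [isotropy_pairing_coord], whose
    ingredients, the local form of [th] and the frame ratio, are natural under pullback. For general
    arguments the unrelated connections and 2-forms would enter. *)
Lemma pull_pairing h (i q : V' h) : isotropy i -> Om (J i) (J q) = vmap F (Om' i q).
Proof.
move=> Ii; have [a [la fa]] := frame_at_exists hL (tgt (f h)); have [b [lb fb]] := frame_at_exists hL (src (f h)).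
have fa' : frame_at (tgt h) (psec a) (pcoord la) by apply: pull_frame_at; rewrite -[f0 _](base_tgt hF).
have fb' : frame_at (src h) (psec b) (pcoord lb) by apply: pull_frame_at; rewrite -[f0 _](base_src hF).
have [n [c [X lo]]] := local_form_exists hL fth fa.
apply: (tcoord_inj hL fa); rewrite -pull_tcoord.
rewrite (isotropy_pairing_coord hL cN fth fka _ fa fb lo (pull_isotropy Ii)).
rewrite (isotropy_pairing_coord hL' cN' pull_form1 fkb _ fa' fb' (pull_local_form lo) Ii).
rewrite pull_tcoord; congr (_ + _ * _).
  have [sc sX _] := lo.
  by apply: eq_bigr => k _; rewrite !(dmapEs _ sf (sc k)) !(dmapEs _ sf (sX k)).
have sr := smooth_ratio hL fa fb.
rewrite (dmapEs _ sf sr) pull_ratio; congr (_ / _).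
by apply: dv_near; apply: near_all => k /=; rewrite pull_ratio.
Qed.

(** Transversality in two moves: subtracting [q], which has target 0, brings the source into the
    image of the base map; subtracting [p], which has source 0, does so for the target. What is left
    lifts to [H]. *)
Lemma pull_complement h (d : V (f h)) : exists (d' : V' h) (p q : V (f h)),
  [/\ vsrc V p = 0, vtgt V q = 0 & d = J d' + p + q].
Proof.
have [v1 [a [v1s v1t]]] := base_submersion hL' hL hF (dmap (@tgt R G) d.1) (base_src hF h).
have [v2 [b [v2t v2s]]] := base_submersion_src hL' hL hF (dmap (@src R G) v1) (base_tgt hF h).
have [phi sphi|phi sphi|z [zE _ _]] := base_tangent_lift hL' hL hF (v := v2) (a := a) (b := b).
- by rewrite v2s // (dmapEs _ (src_smooth lG) sphi) v1s.
- exact: v2t.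
pose q : V (f h) := (d.1 - v1, - th (d.1 - v1)).
pose p : V (f h) := (v1 - v2, 0).
exists (z, finv (@vmap _ _ _ _ _ F h) (d.2 - q.2)), p, q; split.
- congr (_, _) => /=; last by rewrite (lin_0 (vsrc_lin hL _)).
  apply: tangent_gen_eq => phi gphi; have sphi := smoothf_gen gphi.
  by rewrite (dmapEs _ (src_smooth lG) sphi) dv_add dv_opp v2s // (dmapEs _ (src_smooth lG) sphi) subrr dv0.
- congr (_, _) => /=; last by rewrite addNr (lin_0 (vtgt_lin hL _)).
  apply: tangent_gen_eq => phi gphi; have sphi := smoothf_gen gphi.
  by rewrite (dmapEs _ (tgt_smooth lG) sphi) dv_add dv_opp v1t // (dmapEs _ (tgt_smooth lG) sphi) subrr dv0.
rewrite [LHS]surjective_pairing [RHS]surjective_pairing; congr (_, _).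
  by rewrite -[RHS]/(dmap f z + (v1 - v2) + (d.1 - v1)) [dmap f z]zE [v2 + _]addrC subrK addrC subrK.
by rewrite -[RHS]/(vmap F (finv (@vmap _ _ _ _ _ F h) (d.2 - q.2)) + 0 + q.2) (iso_finvP (line_vb hL') (line_vb hL) vl vi) addr0 subrK.
Qed.

(** The vector [q.1] lifts to [H] with the source of [d'] and target 0. Subtracting this lift from
    [d'] leaves a vector with source 0. *)
Lemma pull_kernels h (d' : V' h) (p q : V (f h)) : vsrc V p = 0 -> vtgt V q = 0 -> J d' = p + q ->
  exists p' q' : V' h, [/\ vsrc V' p' = 0, vtgt V' q' = 0 & d' = p' + q'].
Proof.
move=> sp tq JE.
have p2 : p.2 = 0 by apply: (vsrc_inj hL); rewrite (lin_0 (vsrc_lin hL _)); exact: (congr1 snd sp).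
have q2 : q.2 = - th q.1.
  apply/eqP; rewrite -addr_eq0; apply/eqP; apply: (vtgt_inj hL); rewrite (lin_0 (vtgt_lin hL _)).
  exact: (congr1 snd tq).
have d1 : dmap f d'.1 = p.1 + q.1 by exact: (congr1 fst JE).
have d2 : vmap F d'.2 = - th q.1 by rewrite -q2 -[q.2]add0r -p2; exact: (congr1 snd JE).
have [phi sphi|phi sphi|z [zE zs zt]] := base_tangent_lift hL' hL hF (v := q.1) (a := dmap (@src R H) d'.1) (b := 0 : tangent (tgt h)).
- rewrite (dmapEs _ (src_smooth lH) (base0_smooth hF sphi)).
  transitivity (dv (dmap f d'.1) (phi \o @src R G)).
    rewrite d1 dv_add -[dv p.1 _](dmapEs _ (src_smooth lG) sphi).
    by have -> : dmap (@src R G) p.1 = 0 by [exact: (congr1 fst sp)]; rewrite dv0 add0r.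
  rewrite (dmapEs _ sf (src_smooth lG sphi)); apply: dv_near; apply: near_all => k /=.
  by rewrite (base_src hF).
- rewrite -(dmapEs _ (tgt_smooth lG) sphi).
  by have -> : dmap (@tgt R G) q.1 = 0 by [exact: (congr1 fst tq)]; rewrite !dv0.
exists (d'.1 - z, 0), (z, d'.2); split.
- congr (_, _) => /=; last by rewrite (lin_0 (vsrc_lin hL' _)).
  by rewrite (lin_B (dmap_lin (src_smooth lH) (p := h))) zs subrr.
- congr (_, _) => //=; rewrite -[RHS](lin_0 (vtgt_lin hL' _)); congr (vtgt L' _); apply: (@vi h).
  by rewrite (lin_D (@vl h)) pull_form1E d2 [dmap f z]zE addNr (lin_0 (@vl h)).
by rewrite [LHS]surjective_pairing; congr (_, _); rewrite /= ?subrK ?add0r.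
Qed.

Lemma pull_lin h : linear (@J h).
Proof. by move=> c u v; congr (_, _); rewrite /= ?(dmap_lin sf) // vl. Qed.

Lemma pairing_isotropy_ker g (i p q : V g) : isotropy i -> vsrc V p = 0 -> vtgt V q = 0 -> Om i (p + q) = 0.
Proof.
move=> [si ti] sp tq; rewrite (lin_D (OmL i)) (OmA i p).
by rewrite [Om p i](pairing_ker hL cN fth mth fka) // [Om i q](pairing_ker hL cN fth mth fka) // oppr0 addr0.
Qed.

Lemma nondegenerate_pull h : contact_nondegenerate nabla th ka (f h) <-> contact_nondegenerate nabla' th' kb h.
Proof.
split=> -[Q1 Q2]; split.
- move=> i Ii H0; apply: (pull_isotropy_inj Ii); apply: (Q1 _ (pull_isotropy Ii)) => d.
  have [d' [p [q [sp tq ->]]]] := pull_complement d.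
  rewrite -[LHS]/(Om (J i) (J d' + p + q)) -addrA (lin_D (OmL _)) (pairing_isotropy_ker (pull_isotropy Ii) sp tq) addr0.
  by rewrite (pull_pairing _ Ii) [Om' _ _]H0 (lin_0 (@vl h)).
- move=> d' H0; have [|p [q [sp tq dE]]] := Q2 (J d'); last exact: pull_kernels sp tq dE.
  move=> i /pull_isotropy_surj[j Ij <-].
  by rewrite [LHS](pull_pairing _ Ij) [Om' _ _]H0 // (lin_0 (@vl h)).
- move=> i /pull_isotropy_surj[j Ij <-] H0.
  suff -> : j = 0 by exact: (lin_0 (@pull_lin h)).
  apply: (Q1 _ Ij) => q; apply: (@vi h); rewrite (lin_0 (@vl h)) -[pairing _ _ _ _]/(Om' j q) -(pull_pairing _ Ij).
  exact: H0.
move=> d H0; have [d' [p [q [sp tq dE]]]] := pull_complement d.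
have [|p' [q' [sp' tq' d'E]]] := Q2 d'.
  move=> i Ii; apply: (@vi h); rewrite (lin_0 (@vl h)) -[pairing _ _ _ _]/(Om' i d') -(pull_pairing _ Ii).
  rewrite -[RHS](H0 _ (pull_isotropy Ii)) -[RHS]/(Om (J i) d) dE -addrA (lin_D (OmL _)).
  by rewrite (pairing_isotropy_ker (pull_isotropy Ii) sp tq) addr0.
have lK := @pull_lin h.
exists (J p' + p), (J q' + q); split.
- by rewrite (lin_D (MK_vsrc_lin hL (th := th) (g := f h))) sp pull_vsrc0 // addr0.
- by rewrite (lin_D (MK_vtgt_lin hL fth (g := f h))) tq pull_vtgt0 // addr0.
by rewrite dE d'E (lin_D lK) -!addrA; congr (_ + _); rewrite addrCA.
Qed.
End Comparison.

Lemma curvature_moritaE (R : realType) (G : groupoid R) (L : vbg G) (hL : is_line_groupoid L)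
  (nabla : conn (vb0 L)) (th : form1 L) (ka : form2 (vb0 L)) :
  is_connection nabla -> is_form1 th -> multiplicative th -> is_form2 ka ->
  is_vb_morita (MR nabla th ka) <-> forall g, contact_nondegenerate nabla th ka g.
Proof.
move=> cN fth mth fka; split=> [[_ [_ ff _]] g|Q].
  exact: (fully_faithful_nondegenerate hL cN fth mth fka _ ff).
have m := MR_vbg_morphism hL cN fth mth fka; split=> //; split.
- by case: m.
- exact: (nondegenerate_fully_faithful hL cN fth mth fka Q).
exact: (nondegenerate_essentially_surjective hL cN fth mth fka Q).
Qed.

Theorem theorem5p24 (R : realType) (H G : groupoid R)
  (L' : vbg H) (L : vbg G)
  (hL' : is_line_groupoid L') (hL : is_line_groupoid L)
  (F : vbmap L' L) (hF : is_vb_morita F)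
  (theta : form1 L) (htheta : is_form1 theta) (hmult : multiplicative theta)
  (kappa : form2 (vb0 L)) (hkappa : is_form2 kappa) :
  is_shifted_contact (pull1 (@vmap _ _ _ _ _ F) theta)
                     (pull2 (@vmap0 _ _ _ _ _ F) kappa)
  <-> is_shifted_contact theta kappa.
Proof.
have gG := lie_groupoid (line_lie hL).
have f1 := pull_form1 hL' hL hF htheta.
have m1 := pull_multiplicative hL' hL hF hmult.
have f2 := pull_form2 hL' hL hF hkappa.
split=> -[_ _ _ [nab [cn]]]; last first.
  move=> /(curvature_moritaE hL cn htheta hmult hkappa) Q; split=> //.
  (* Any connection serves here, as [nondegenerate_pull] compares arbitrary connections on the two
     sides. *)
  have [nab' cn'] := connection_exists (ob_manifold (line_lie hL')) (line_vb0 hL').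
  exists nab'; split=> //; apply/(curvature_moritaE hL' cn' f1 m1 f2) => h.
  by apply/(nondegenerate_pull hL' hL hF htheta hmult cn hkappa cn' f2).
move=> /(curvature_moritaE hL' cn f1 m1 f2) Q; split=> //.
have [nab' cn'] := connection_exists (ob_manifold (line_lie hL)) (line_vb0 hL).
exists nab'; split=> //; apply/(curvature_moritaE hL cn' htheta hmult hkappa) => g.
have [k0 [y0 [s0 t0]]] := base_surj hF (src g).
have [k1 [y1 [s1 t1]]] := base_surj hF (tgt g).
have e1 : src (inv k1) = tgt g by rewrite (src_inv gG).
have e0 : src (mul (inv k1) g) = tgt k0 by rewrite (src_mul gG e1).
(* Both ends of [g'] lie in the image of the base map, so [base_lift] makes it the image of an arrow
   of [H]. *)
pose g' := mul (mul (inv k1) g) k0.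
have [||h [hE _ _]] := base_lift hL hF (g := g') (x := y0) (y := y1).
- by rewrite (src_mul gG e0).
- by rewrite (tgt_mul gG e0) (tgt_mul gG e1) (tgt_inv gG).
have Qg' : contact_nondegenerate nab' theta kappa g'.
  by rewrite -hE; apply/(nondegenerate_pull hL' hL hF htheta hmult cn' hkappa cn f2).
have e2 : src g' = tgt (inv k0) by rewrite (src_mul gG e0) (tgt_inv gG).
have := nondegenerate_mulr hL cn' htheta hmult hkappa e2 Qg'; rewrite (mulK gG e0) => Q1.
have e3 : src k1 = tgt (mul (inv k1) g) by rewrite (tgt_mul gG e1) (tgt_inv gG).
have := nondegenerate_mull hL cn' htheta hmult hkappa e3 Q1.
by have := mulVK gG e1; rewrite (inv_inv gG) => ->.
Qed.
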